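(* Let $X=(X_t)_{t\ge0}$ be a time homogeneous continuous time Markov chain with values in a finite set $\mathbb{S}=\{a_1,\dots,a_d\}\subset\mathbb{R}$, with transition intensities matrix $\Lambda=(\lambda_{ij})$ and initial distribution $\nu$. Let $h:\mathbb{S}\to\mathbb{R}$ be a function, $B=(B_t)_{t\ge0}$ a Brownian motion independent of $X$, and for a real constant $\sigma>0$ let $$Y^\sigma_t=\int_0^th(X_s)\,ds+\sigma B_t,\qquad t\ge0 .$$ Let $\pi^\sigma_t$ be the vector of conditional probabilities $\pi^\sigma_t(i)=\mathrm{P}(X_t=a_i\mid Y^\sigma_s,\,s\le t)$, which is the solution of the Wonham filtering equation $$d\pi^\sigma_t=\Lambda^*\pi^\sigma_t\,dt+\sigma^{-2}\big(\mathrm{diag}(\pi^\sigma_t)-\pi^\sigma_t\pi^{\sigma*}_t\big)h\big(dY^\sigma_t-\pi^\sigma_t(h)\,dt\big),\qquad\pi^\sigma_0=\nu .$$ Then $\pi^\sigma_t$ converges to $\nu_t=e^{\Lambda^*t}\nu$ as $\sigma\to\infty$, and for any $p\ge1$ $$\sigma\big(\pi^\sigma_t-\nu_t\big)\xrightarrow[\sigma\to\infty]{L^p}Z_t,\qquad t\ge0,$$ where $Z_t$ is the Gaussian diffusion process $$dZ_t=\Lambda^*Z_t\,dt+\big(\mathrm{diag}(\nu_t)-\nu_t\nu_t^*\big)h\,d\bar B_t,\qquad Z_0=0,$$ with $\bar B_t=\sigma^{-1}\big(Y^\sigma_t-\int_0^t\pi^\sigma_s(h)\,ds\big)$ being the innovation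 Brownian motion. If $X$ is ergodic, with invariant distribution $\mu$, then the algebraic Lyapunov equation $$0=\Lambda^*P+P\Lambda+\big(\mathrm{diag}(\mu)-\mu\mu^*\big)hh^*\big(\mathrm{diag}(\mu)-\mu\mu^*\big)$$ has a unique solution $P$ in the class of nonnegative definite matrices satisfying $\sum_{i,j}P_{ij}=0$, and for any $F:\mathbb{R}^d\to\mathbb{R}$ growing not faster than polynomially, $$\int_{\mathcal{S}^{d-1}}F\big(\sigma(\eta-\mu)\big)\,\mathcal{M}^\sigma_\pi(d\eta)\xrightarrow{\sigma\to\infty}\mathrm{E}F(Z),$$ where $\mathcal{M}^\sigma_\pi$ is the unique invariant measure of the Markov process $\pi^\sigma_t$ and $Z$ is a zero mean Gaussian random vector with covariance matrix $P$.
   Context: All random variables are defined on one complete probability space $(\Omega,\mathcal{F},\mathrm{P})$, and $\mathrm{E}$ is the expectation with respect to $\mathrm{P}$. Probability measures on $\mathbb{S}$ are identified with column vectors in the simplex $\mathcal{S}^{d-1}=\{x\in\mathbb{R}^d:x_i\ge0,\ \sum_i x_i=1\}$, and functions on $\mathbb{S}$ with column vectors in $\mathbb{R}^d$; in particular $h$ also denotes the column vector with entries $h(a_i)$, and $\eta(h)=\sum_ih(a_i)\eta_i$. The superscript $*$ denotes transposition and $\mathrm{diag}(x)$ is the diagonal matrix with diagonal entries $x_i$. The process $\bar B$, and hence the process $Z_t$ driven by it, is built from $Y^\sigma$ and so depends on $\sigma$, although this is not shown in the notation; the $L^p$ convergence means that the difference $\sigma(\pi^\sigma_t-\nu_t)-Z_t$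 tends to $0$ in $L^p$. The chain $X$ is ergodic if $\exp(\Lambda)$ has positive entries, equivalently if all of its states communicate; then its invariant distribution $\mu$ is the unique solution of $\Lambda^*\mu=0$ in $\mathcal{S}^{d-1}$. For ergodic $X$ it is known that, for any $\sigma>0$, the Markov process $\pi^\sigma_t$ has a unique invariant measure on $\mathcal{S}^{d-1}$, denoted $\mathcal{M}^\sigma_\pi$.
   Formalization: In the last limit F is additionally assumed continuous; for general Borel F of polynomial growth the claim fails (d=3, unit off-diagonal rates, h=(0,1,3), F the indicator of the line carrying Z). *)

(* Defs.v *)
From HB Require Import structures.
From mathcomp Require Import all_boot all_order all_algebra.
From mathcomp Require Import all_classical all_reals all_analysis.

Set Implicit Arguments.
Unset Strict Implicit.
Unset Printing Implicit Defensive.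

Import Order.TTheory GRing.Theory Num.Theory.
Import numFieldNormedType.Exports.

Local Open Scope classical_set_scope.
Local Open Scope ring_scope.

Section LinearAlgebra.
Context {R : realType} {d : nat}.

Definition mexp (A : 'M[R]_d) : 'M[R]_d :=
  limn (series (fun k : nat => (k`!%:R)^-1 *: (A ^+ k))).

Definition intensity_matrix (L : 'M[R]_d) : Prop :=
  (forall i j, i != j -> 0 <= L i j) /\ (forall i, \sum_j L i j = 0).

Definition simplex : set 'cV[R]_d :=
  [set x | (forall i, 0 <= x i 0) /\ \sum_i x i 0 = 1].

Definition ergodic (L : 'M[R]_d) : Prop := forall i j, 0 < mexp L i j.

Definition invariant_distribution (L : 'M[R]_d) (mu : 'cV[R]_d) : Prop :=
  simplex mu /\ L^T *m mu = 0.

Definition marginal (L : 'M[R]_d) (nu : 'cV[R]_d) (t : R) : 'cV[R]_d :=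
  mexp (t *: L^T) *m nu.

(* The states are [a i]; only the values of [h] on the states matter. *)
Definition hvec (a : 'I_d -> R) (h : R -> R) : 'cV[R]_d := \col_i h (a i).

Definition mean (hv x : 'cV[R]_d) : R := \sum_i hv i 0 * x i 0.

Definition covar (x : 'cV[R]_d) : 'M[R]_d := diag_mx x^T - x *m x^T.

Definition nonneg_definite (S : 'M[R]_d) : Prop :=
  S^T = S /\ forall u : 'cV[R]_d, 0 <= (u^T *m S *m u) 0 0.

Definition lyapunov_solution (L : 'M[R]_d) (hv mu : 'cV[R]_d) (S : 'M[R]_d) :
    Prop :=
  [/\ nonneg_definite S,
      \sum_i \sum_j S i j = 0 &
      0 = L^T *m S + S *m L + covar mu *m hv *m hv^T *m covar mu].

Definition polynomial_growth (F : 'cV[R]_d -> R) : Prop :=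
  exists (C : R) (k : nat), forall x : 'cV[R]_d, `|F x| <= C * (1 + `|x| ^+ k).

Definition borel_cV := g_sigma_algebraType (@open 'cV[R]_d).

End LinearAlgebra.
Arguments borel_cV : clear implicits.

(* Processes are indexed by R; only their values at times t >= 0 matter. *)
Section Probability.
Context {R : realType} {disp : measure_display} {Om : measurableType disp}.
Variable P : probability Om R.

Definition gen_by (T : set R) (V : R -> Om -> R) : set (set Om) :=
  [set A | exists t C, [/\ T t, measurable C & A = V t @^-1` C]].

Definition past (V : R -> Om -> R) (t : R) : set (set Om) :=
  <<s gen_by `[0, t] V >>.

(* Natural filtration augmented by the null sets of P. *)
Definition augmented_past (V : R -> Om -> R) (t : R) : set (set Om) :=
  <<s gen_by `[0, t] V `|` P.-negligible >>.

Definition independent_sigma (G H : set (set Om)) : Prop :=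
  forall A B, G A -> H B -> P (A `&` B) = (P A * P B)%E.

Definition independent_processes (V W : R -> Om -> R) : Prop :=
  independent_sigma <<s gen_by `[0, +oo[ V >> <<s gen_by `[0, +oo[ W >>.

(* A version of the conditional probability of A given G. *)
Definition is_cond_prob (G : set (set Om)) (A : set Om) (f : Om -> R) : Prop :=
  (forall C, measurable C -> G (f @^-1` C)) /\
  (forall D, G D -> (\int[P]_(w in D) (f w)%:E = P (A `&` D))%E).

(* Normal law with mean m and variance v. [normal_prob] takes the standard
   deviation and is not a point mass when it is zero, hence the case split. *)
Definition normal_law (U : Om -> R) (m v : R) : Prop :=
  [/\ 0 <= v, measurable_fun setT U &
      forall C, measurable C ->
        P (U @^-1` C) = if v == 0 then dirac m C
                        else normal_prob m (Num.sqrt v) C].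

Definition centered_gaussian_vector {d : nat} (Z : Om -> 'cV[R]_d)
    (S : 'M[R]_d) : Prop :=
  forall u : 'cV[R]_d,
    normal_law (fun w => (u^T *m Z w) 0 0) 0 ((u^T *m S *m u) 0 0).

Definition gaussian_process {d : nat} (V : R -> Om -> 'cV[R]_d) : Prop :=
  forall (n : nat) (t : 'I_n -> R) (u : 'I_n -> 'cV[R]_d),
    (forall k, 0 <= t k) ->
    exists m v, normal_law (fun w => \sum_k ((u k)^T *m V (t k) w) 0 0) m v.

Definition brownian_motion (B : R -> Om -> R) : Prop :=
  [/\ forall t : R, 0 <= t -> measurable_fun setT (B t),
      forall w, B 0 w = 0 /\ {within `[0, +oo[, continuous (fun t => B t w)},
      forall s t : R, 0 <= s -> s < t ->
        normal_law (fun w => B t w - B s w) 0 (t - s) &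
      forall s t : R, 0 <= s -> s < t -> forall A C, past B s A -> measurable C ->
        let D := (fun w => B t w - B s w) @^-1` C in
        P (A `&` D) = (P A * P D)%E].

(* Right-continuous chain with left limits and transition semigroup exp(t L). *)
Definition markov_chain {d : nat} (a : 'I_d -> R) (L : 'M[R]_d)
    (nu : 'cV[R]_d) (X : R -> Om -> R) : Prop :=
  [/\ forall t : R, 0 <= t -> measurable_fun setT (X t),
      forall (t : R) w, 0 <= t -> exists i, X t w = a i,
      forall (t : R) w, 0 <= t -> X s w @[s --> t^'+] --> X t w,
      forall (t : R) w, 0 < t -> cvg (X s w @[s --> t^'-]) &
      forall (n : nat) (t : nat -> R) (i : nat -> 'I_d),
        t 0%N = 0 -> (forall k, (k < n)%N -> t k <= t k.+1) ->
        P [set w | forall k, (k <= n)%N -> X (t k) w = a (i k)] =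
        (nu (i 0%N) 0 *
         \prod_(k < n) mexp ((t k.+1 - t k) *: L) (i k) (i k.+1))%:E].

(* The Ito integral of H with respect to M over [0, t], as the limit in
   probability of left-point Riemann sums when the mesh tends to 0. For a
   continuous adapted integrand H and a continuous semimartingale M, the only
   case used below, this is the usual integral. *)
Definition is_ito_integral (H M : R -> Om -> R) (t : R) (I : Om -> R) : Prop :=
  measurable_fun setT I /\
  forall e : R, 0 < e -> exists2 delta : R, 0 < delta &
    forall (n : nat) (tau : nat -> R),
      tau 0%N = 0 -> tau n = t ->
      (forall k, (k < n)%N -> tau k <= tau k.+1 /\ tau k.+1 - tau k < delta) ->
      (P [set w | (e < `| \sum_(k < n) H (tau k) w *
                     (M (tau k.+1) w - M (tau k) w) - I w |)%R] < e%:E)%E.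

(* V is a continuous process with V_0 = x0 and dV_t = b_t dt + c_t dM_t. *)
Definition sde {d : nat} (x0 : 'cV[R]_d) (b c : R -> Om -> 'cV[R]_d)
    (M : R -> Om -> R) (V : R -> Om -> 'cV[R]_d) : Prop :=
  [/\ forall (t : R) i, 0 <= t -> measurable_fun setT (fun w => V t w i 0),
      forall w, {within `[0, +oo[, continuous (fun t => V t w)} &
      forall (t : R) i, 0 <= t ->
        exists2 I, is_ito_integral (fun s w => c s w i 0) M t I &
          {ae P, forall w, V t w i 0 =
            x0 i 0 + \int[lebesgue_measure]_(s in `[0, t]) (b s w i 0) + I w}].

Definition observation (h : R -> R) (sigma : R) (X B : R -> Om -> R)
    (t : R) (w : Om) : R :=
  \int[lebesgue_measure]_(s in `[0, t]) h (X s w) + sigma * B t w.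

Definition residual {d : nat} (hv : 'cV[R]_d) (Y : R -> Om -> R)
    (pi : R -> Om -> 'cV[R]_d) (t : R) (w : Om) : R :=
  Y t w - \int[lebesgue_measure]_(s in `[0, t]) mean hv (pi s w).

Definition innovation {d : nat} (hv : 'cV[R]_d) (sigma : R)
    (Y : R -> Om -> R) (pi : R -> Om -> 'cV[R]_d) (t : R) (w : Om) : R :=
  sigma^-1 * residual hv Y pi t w.

Definition signal_and_noise {d : nat} (a : 'I_d -> R) (L : 'M[R]_d)
    (nu : 'cV[R]_d) (X B : R -> Om -> R) : Prop :=
  [/\ markov_chain a L nu X, brownian_motion B & independent_processes X B].

(* pi is the conditional distribution of X given Y, and solves the Wonham
   equation. *)
Definition wonham_filter {d : nat} (a : 'I_d -> R) (L : 'M[R]_d)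
    (nu : 'cV[R]_d) (h : R -> R) (sigma : R) (X B : R -> Om -> R)
    (pi : R -> Om -> 'cV[R]_d) : Prop :=
  let hv := hvec a h in
  let Y := observation h sigma X B in
  (forall (t : R) i, 0 <= t ->
     is_cond_prob (augmented_past Y t) [set w | X t w = a i]
       (fun w => pi t w i 0)) /\
  sde nu (fun s w => L^T *m pi s w)
         (fun s w => (sigma ^- 2) *: (covar (pi s w) *m hv))
         (residual hv Y pi) pi.

End Probability.

Section InvariantMeasure.
Context {R : realType} {d : nat}.
Variables (a : 'I_d -> R) (L : 'M[R]_d) (h : R -> R) (sigma : R).

(* Q t eta is the law at time t of the filter started at eta, that is, of the
   filter of a chain with initial distribution eta; this law does not depend on
   the underlying probability space. Values of Q t outside the simplex are
   irrelevant. *)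
Definition filter_transition
    (Q : R -> R.-pker (borel_cV R d) ~> (borel_cV R d)) : Prop :=
  forall eta : 'cV[R]_d, simplex eta ->
    exists (disp : measure_display) (Om : measurableType disp)
      (P : probability Om R) (X B : R -> Om -> R) (pi : R -> Om -> 'cV[R]_d),
      [/\ measure_is_complete P, signal_and_noise P a L eta X B,
          wonham_filter P a L eta h sigma X B pi &
          forall (t : R) (A : set (borel_cV R d)), 0 <= t -> measurable A ->
            P (pi t @^-1` A) = Q t eta A].

Definition invariant_measure (M : probability (borel_cV R d) R) : Prop :=
  M simplex = 1%E /\
  exists Q, filter_transition Q /\
    forall (t : R) (A : set (borel_cV R d)), 0 <= t -> measurable A ->
      (\int[M]_(eta in simplex) Q t eta A = M A)%E.

Definition unique_invariant_measure (M : probability (borel_cV R d) R) : Prop :=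
  invariant_measure M /\
  forall M' : probability (borel_cV R d) R, invariant_measure M' ->
    forall A, measurable A -> M' A = M A.

End InvariantMeasure.

(* Main.v *)
(* The innovation W is a Brownian motion for the augmented observation filtration:
   conditionally on the past of s, the characteristic function of W_t - W_s
   solves phi' = - u^2 phi / 2 up to one-step errors that sum to 0, because the drift
   of W - B is orthogonal to the observed past.

   The filter equation then reads pi_t = nu + int L^T pi + sigma^-1 int c(pi) dW,
   with c bounded on the simplex, and moments of stochastic sums bound pi - nu_t
   by C / sigma in every L^q. The error of the linear equation satisfies
   d(sigma (pi - nu_t) - Z) = L^T (...) dt + (c(pi) - c(nu_t)) dW, whose noise
   coefficient is O(1 / sigma) since c is Lipschitz on the simplex, hence the second
   limit. Variation of constants writes Z as a Wiener integral, a limit of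
   linear combinations of W, hence Gaussian.

   For an ergodic chain exp(n L^T) contracts zero-sum vectors geometrically.
   This makes the Lyapunov operator injective on symmetric matrices with zero
   row sums, hence bijective there by finite dimension. Running the filter for
   time 1 under the invariant measure bounds the moments of eta - mu by C / sigma;
   running it for time n shows that the characteristic function of
   sigma (eta - mu) is within C_n / sigma + C rho^n of that of
   N(0, P - exp(n L^T) P exp(n L)). Let sigma and then n tend to infinity, and
   approximate F by trigonometric polynomials on balls, the moments controlling
   the tails. *)
Require Import Defs.
From HB Require Import structures.
From mathcomp Require Import all_boot all_order all_algebra.
From mathcomp Require Import all_classical all_reals all_analysis.
From mathcomp Require Import measurable_realfun ring lra.

Set Implicit Arguments.
Unset Strict Implicit.
Unset Printing Implicit Defensive.

Import Order.TTheory GRing.Theory Num.Theory.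
Import numFieldNormedType.Exports.

Local Open Scope classical_set_scope.
Local Open Scope ring_scope.

(** * Real calculus *)

Section RealCalculus.
Context {R : realType}.
Implicit Types (f g F : R -> R) (x y a b : R).

(** The stochastic integral is by definition a limit in probability of left-point sums, so each of
    its estimates is proved for sums over uniform grids and carried over by a form of Fatou's lemma.
    Linear equations are solved path by path: what remains are ordinary integrals of a continuous
    forcing term against the matrix exponential. Laws and independence are both read off from
    expectations of cosines with a free phase, so everything about normality stays real-valued.

    For the invariant measures the obstacle is that every starting point of the kernel brings its
    own probability space. The constants must therefore be free of the space and of the starting
    law, which enters only through its distance to [mu]. In the bound on characteristic functions
    this distance is multiplied by [sigma], so the bound is of use only once the moments are known
    to be of order 1 / sigma; that is obtained by iterating b -> D / sigma + rho b from the trivial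
    bound [d]. *)

Lemma is_derive_add x f g a b : is_derive x 1 f a -> is_derive x 1 g b ->
  is_derive x 1 (fun y => f y + g y) (a + b).
Proof. by move=> df dg; exact: is_deriveD. Qed.

Lemma is_derive_opp x f a : is_derive x 1 f a -> is_derive x 1 (fun y => - f y) (- a).
Proof. by move=> df; exact: is_deriveN. Qed.

Lemma is_derive_sub x f g a b : is_derive x 1 f a -> is_derive x 1 g b ->
  is_derive x 1 (fun y => f y - g y) (a - b).
Proof. by move=> df dg; exact: is_deriveB. Qed.

Lemma is_derive_mul x f g a b : is_derive x 1 f a -> is_derive x 1 g b ->
  is_derive x 1 (fun y => f y * g y) (f x * b + g x * a).
Proof. by move=> df dg; exact: is_deriveM. Qed.

Lemma is_derive_scale x f (k : R) a : is_derive x 1 f a ->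
  is_derive x 1 (fun y => k * f y) (k * a).
Proof. by move=> df; exact: is_deriveZ. Qed.

Lemma is_derive_pow x f n a : is_derive x 1 f a ->
  is_derive x 1 (fun y => f y ^+ n) (n%:R * f x ^+ n.-1 * a).
Proof. by move=> df; have := @is_deriveX _ _ f n x 1 a df; rewrite exprfctE. Qed.

Lemma is_derive_bigsum (I : Type) (r : seq I) x (f : I -> R -> R) (a : I -> R) :
  (forall i, is_derive x 1 (f i) (a i)) ->
  is_derive x 1 (fun y => \sum_(i <- r) f i y) (\sum_(i <- r) a i).
Proof.
move=> df; elim: r => [|i r IH].
  by rewrite big_nil; under eq_fun do rewrite big_nil; exact: is_derive_cst.
by rewrite big_cons; under eq_fun do rewrite big_cons; exact: is_derive_add.
Qed.

Lemma is_derive_comp x f g a b : is_derive (g x) 1 f a -> is_derive x 1 g b ->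
  is_derive x 1 (fun y => f (g y)) (a * b).
Proof.
move=> df dg; have := @is_derive1_comp _ f g x a b df dg.
by [].
Qed.

Lemma is_derive_continuous F f : (forall x, is_derive x 1 F (f x)) -> continuous F.
Proof.
move=> dF x; apply: differentiable_continuous; apply/derivable1_diffP.
by have [] := dF x.
Qed.

Lemma is_derive_FTC F f a b : a <= b ->
  (forall x, a <= x <= b -> is_derive x 1 F (f x)) ->
  continuous f -> \int[lebesgue_measure]_(x in `[a, b]) f x = F b - F a.
Proof.
rewrite le_eqVlt => /predU1P[-> _ _|ab dF cf].
  by rewrite set_itv1 Rintegral_set1 subrr.
have cF x : a <= x <= b -> {for x, continuous F}.
  move=> xab; apply: differentiable_continuous; apply/derivable1_diffP.
  by have [] := dF x xab.
rewrite /Rintegral (@continuous_FTC2 _ f F)//.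
- exact: continuous_subspaceT.
- split.
  + move=> x; rewrite in_itv/= => /andP[ax xb].
    by have [] := dF x (introT andP (conj (ltW ax) (ltW xb))).
  + by apply: cvg_at_right_filter; apply: cF; rewrite lexx ltW.
  + by apply: cvg_at_left_filter; apply: cF; rewrite lexx ltW.
- move=> x; rewrite in_itv/= => /andP[ax xb]; rewrite derive1E.
  by have [] := dF x (introT andP (conj (ltW ax) (ltW xb))).
Qed.

Lemma is_derive_ge0_le F f a b : a <= b ->
  (forall x, a <= x <= b -> is_derive x 1 F (f x)) ->
  (forall x, a <= x <= b -> 0 <= f x) -> F a <= F b.
Proof.
rewrite le_eqVlt => /predU1P[->//|ab] dF f0.
have [||c] := @MVT R F f a b ab.
- by move=> x; rewrite in_itv/= => /andP[? ?]; apply: dF; rewrite !ltW.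
- apply: derivable_within_continuous => x; rewrite in_itv/= => xab.
  by have [] := dF x xab.
rewrite in_itv/= => /andP[ac cb] E.
by rewrite -subr_ge0 E mulr_ge0 ?f0 ?subr_ge0 ?(ltW ab)// !ltW.
Qed.

Lemma is_derive_eq0_cst F : (forall x, is_derive x 1 F 0) -> forall x y, F x = F y.
Proof. by move=> dF x y; exact: is_derive_0_is_cst. Qed.

(** Stands in for differentiation under the integral sign: a pointwise second-order bound on the
    integrand integrates to this hypothesis on the parameter integral. *)
Lemma quadratic_is_derive F x a (C : R) :
  (forall y, `|F y - F x - (y - x) * a| <= C * (y - x) ^+ 2) -> is_derive x 1 F a.
Proof.
move=> FC; have C0 : 0 <= C.
  by have := FC (x + 1); rewrite (addrC x) addrK expr1n mulr1; exact: le_trans.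
suff cv : h^-1 *: (F (h *: 1 + x) - F x) @[h --> 0^'] --> a.
  by split; [apply/cvg_ex; exists a|exact/cvg_lim].
apply/cvgrPdist_le => e e0.
have e1 : 0 < e / (C + 1) by rewrite divr_gt0// ltr_wpDl.
near=> h.
have h0 : h != 0 by near: h; exact: nbhs_dnbhs_neq.
have hn0 : 0 < `|h| by rewrite normr_gt0.
rewrite distrC (_ : _ *: _ - a = h^-1 * (F (h + x) - F x - h * a)); last first.
  rewrite -[h *: 1]/(h * 1) mulr1 -[h^-1 *: _]/(h^-1 * _).
  by rewrite [RHS]mulrBr mulKf.
have := FC (h + x); rewrite addrK => Fh.
rewrite normrM normfV ler_pdivrMl//.
apply: (le_trans Fh); rewrite -[h ^+ 2]real_normK ?num_real// expr2 mulrCA.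
rewrite ler_wpM2l//.
have : `|h| <= e / (C + 1).
  by near: h; exact: dnbhs0_le.
rewrite ler_pdivlMr ?ltr_wpDl// => h1; rewrite (le_trans _ h1)// mulrC.
by rewrite ler_wpM2l// lerDl.
Unshelve. all: by end_near. Qed.

Lemma sin_norm_le x : `|sin x| <= `|x|.
Proof.
have key y : 0 <= y -> sin y <= y.
  move=> y0; rewrite -subr_ge0.
  have := @is_derive_ge0_le (fun z => z - sin z) (fun z => 1 - cos z) 0 y y0.
  rewrite sin0 subr0; apply; last by move=> z _; rewrite subr_ge0 cos_le1.
have key' y : 0 <= y -> - y <= sin y.
  move=> y0; rewrite -subr_ge0 opprK.
  have := @is_derive_ge0_le (fun z => sin z + z) (fun z => cos z + 1) 0 y y0.
  rewrite sin0 addr0; apply; last by move=> z _; rewrite -lerBlDr sub0r cos_geN1.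
have [x0|x0] := leP 0 x.
  by rewrite ler_norml (ger0_norm x0) key ?key'//.
rewrite -normrN -sinN -[in leRHS]normrN; have Nx0 : 0 <= - x by rewrite oppr_ge0 ltW.
by rewrite ler_norml (ger0_norm Nx0) key ?key'//.
Qed.

Lemma cos_ge_quadratic x : 1 - x ^+ 2 / 2 <= cos x.
Proof.
have key y : 0 <= y -> 1 - y ^+ 2 / 2 <= cos y.
  move=> y0; rewrite -subr_ge0.
  have := @is_derive_ge0_le (fun z => cos z - (1 - z ^+ 2 * 2^-1)) (fun z => z - sin z) 0 y y0.
  rewrite cos0 expr0n/= mul0r subr0 subrr; apply.
    move=> z _.
    have : is_derive z 1 (fun z => cos z - (1 - z ^+ 2 * 2^-1))
       (- sin z - (0 - (z ^+ 2 * 0 + 2^-1 * (2%:R * z ^+ 1 * 1)))).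
      apply: is_derive_sub; apply: is_derive_sub; apply: is_derive_mul.
      exact: is_derive_pow.
    by move=> h; apply: (is_derive_eq h); field.
  move=> z /andP[z0 _]; rewrite subr_ge0 (le_trans (ler_norm _))//.
  by rewrite (le_trans (sin_norm_le _))// ger0_norm.
have [x0|x0] := leP 0 x; first exact: key.
by rewrite -cosN -sqrrN key// oppr_ge0 ltW.
Qed.

(** The constant 1 in place of 1/6 is enough, and lets the comparison of derivatives stop at
    [cos_ge_quadratic]. *)
Lemma sin_sub_norm_le x : `|sin x - x| <= `|x| ^+ 3.
Proof.
have key y : 0 <= y -> - y ^+ 3 <= sin y - y.
  move=> y0; rewrite -subr_ge0 opprK.
  have := @is_derive_ge0_le (fun z => sin z - z + z ^+ 3)
     (fun z => cos z - 1 + 3%:R * z ^+ 2 * 1) 0 y y0.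
  rewrite sin0 expr0n/= subrr add0r; apply.
    by move=> z _; apply: is_derive_add; exact: is_derive_pow.
  move=> z _; have /= := cos_ge_quadratic z; have := sqr_ge0 z; lra.
have [x0|x0] := leP 0 x.
  rewrite ler_norml (ger0_norm x0) key//= (@le_trans _ _ 0) ?exprn_ge0// subr_le0.
  by rewrite (le_trans (ler_norm _))// (le_trans (sin_norm_le _))// ger0_norm.
have Nx0 : 0 <= - x by rewrite oppr_ge0 ltW.
have -> : sin x - x = - (sin (- x) - (- x)) by rewrite sinN; ring.
rewrite normrN -[in leRHS]normrN ler_norml (ger0_norm Nx0) key//=.
rewrite (@le_trans _ _ 0) ?exprn_ge0// subr_le0.
by rewrite (le_trans (ler_norm _))// (le_trans (sin_norm_le _))// ger0_norm.
Qed.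

(** The bound has to hold for increments of any size, because it is integrated against a normal law
    in [normal_cos]. *)
Lemma cos_quadratic_remainder x y :
  `|cos y - cos x + (y - x) * sin x| <= 3 * (y - x) ^+ 2.
Proof.
have E : cos y = cos x * cos (y - x) - sin x * sin (y - x).
  by rewrite -cosD addrC subrK.
set z := y - x in E *.
have -> : cos y - cos x + z * sin x = cos x * (cos z - 1) - sin x * (sin z - z).
  by rewrite E; ring.
have c1 : `|cos z - 1| <= z ^+ 2.
  rewrite ler0_norm ?subr_le0 ?cos_le1// opprB.
  by have /= := cos_ge_quadratic z; have := sqr_ge0 z; lra.
(* The cubic bound serves for [|z| <= 1]; beyond that the trivial bound [2 * |z|] is already
   quadratic. *)
have s1 : `|sin z - z| <= 2 * z ^+ 2.
  have [z1|z1] := leP `|z| 1.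
    rewrite (le_trans (sin_sub_norm_le _))// exprS real_normK ?num_real//.
    have : `|z| * z ^+ 2 <= 1 * z ^+ 2 by rewrite ler_wpM2r ?sqr_ge0.
    by have := sqr_ge0 z; lra.
  rewrite (le_trans (ler_normB _ _))// (@le_trans _ _ (2 * `|z|))//.
    by have := sin_norm_le z; lra.
  rewrite ler_wpM2l// -[z ^+ 2]real_normK ?num_real// expr2 -[leLHS]mulr1.
  by rewrite ler_wpM2l// ltW.
have h1 : `|cos x| * `|cos z - 1| <= z ^+ 2.
  by rewrite (le_trans _ c1)// -[leRHS]mul1r ler_wpM2r ?cos_max.
have h2 : `|sin x| * `|sin z - z| <= 2 * z ^+ 2.
  by rewrite (le_trans _ s1)// -[leRHS]mul1r ler_wpM2r ?sin_max.
by rewrite (le_trans (ler_normB _ _))// !normrM; lra.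
Qed.
End RealCalculus.

(** * Expectation, L^q bounds and independence *)

Notation "''Ex_' P" := (Rintegral P setT) (at level 8, P at level 2).

Section Expectation.
Context d (Om : measurableType d) (R : realType) (P : probability Om R).
Implicit Types (f g U V : Om -> R).
Local Notation integ f := (P.-integrable setT (EFin \o f)).

Lemma integrable_aebounded f (K : R) : measurable_fun setT f ->
  {ae P, forall w, `|f w| <= K} -> integ f.
Proof.
move=> mf fK; apply/integrableP; split; first exact/measurable_EFinP.
have mK : measurable_fun [set: Om] (fun=> `|K|%:E : \bar R).
  exact: measurable_cst.
apply: (@le_lt_trans _ _ (\int[P]_w `|K|%:E)%E).
  apply: ae_ge0_le_integral => //.
  - by apply: measurableT_comp => //; exact/measurable_EFinP.
  - by apply: filterS fK => w fw _ /=; rewrite lee_fin (le_trans fw)// ler_norm.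
by rewrite integral_cst//= probability_setT mule1 ltry.
Qed.

Lemma integrable_bounded f (K : R) : measurable_fun setT f ->
  (forall w, `|f w| <= K) -> integ f.
Proof. by move=> mf fK; apply: (@integrable_aebounded _ K) => //; apply: aeW. Qed.

Lemma integrable_dominated f g : measurable_fun setT f ->
  {ae P, forall w, `|f w| <= g w} -> integ g -> integ f.
Proof.
move=> mf fg /integrableP[mg gfin]; apply/integrableP; split.
  exact/measurable_EFinP.
apply: le_lt_trans gfin; apply: ae_ge0_le_integral => //.
- by apply: measurableT_comp => //; exact/measurable_EFinP.
- exact: measurableT_comp.
- apply: filterS fg => w fw _ /=; rewrite lee_fin (le_trans fw)//.
  exact: ler_norm.
Qed.

Lemma Rintegral_probE f : integ f -> (\int[P]_w (f w)%:E)%E = ('Ex_P f)%:E.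
Proof. by move=> fi; rewrite /Rintegral fineK//; exact: integrable_fin_num. Qed.

Lemma Rintegral_ae_eq f g : measurable_fun setT f -> measurable_fun setT g ->
  {ae P, forall w, f w = g w} -> 'Ex_P f = 'Ex_P g.
Proof.
move=> mf mg fg; rewrite /Rintegral; congr fine.
apply: ae_eq_integral => //; try exact/measurable_EFinP.
by apply: filterS fg => w /= ->.
Qed.

Lemma Rintegral_prob_cst (c : R) : 'Ex_P (fun=> c) = c.
Proof. by rewrite Rintegral_cst// [fine _]/= probability_setT/= mulr1. Qed.

Lemma Rintegral_le_ae f g : integ f -> integ g ->
  {ae P, forall w, f w <= g w} -> 'Ex_P f <= 'Ex_P g.
Proof.
move=> fi gi fg.
have mf : measurable_fun setT f by apply/measurable_EFinP; case/integrableP: fi.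
have mg : measurable_fun setT g by apply/measurable_EFinP; case/integrableP: gi.
rewrite -subr_ge0 -RintegralB//.
have -> : 'Ex_P (fun w => g w - f w) = 'Ex_P (fun w => `|g w - f w|).
  apply: Rintegral_ae_eq; first exact: measurable_funB.
    by apply: measurableT_comp => //; exact: measurable_funB.
  by apply: filterS fg => w fw; rewrite ger0_norm// subr_ge0.
by apply: Rintegral_ge0 => w _.
Qed.

Lemma Rintegral_norm_le f g : integ f -> integ g ->
  {ae P, forall w, `|f w| <= g w} -> `|'Ex_P f| <= 'Ex_P g.
Proof.
move=> fi gi fg; rewrite (le_trans (le_normr_Rintegral _ _))//.
apply: Rintegral_le_ae => //; exact: (integrable_norm fi).
Qed.

Lemma Rintegral_norm_bound f (K : R) : measurable_fun setT f ->
  {ae P, forall w, `|f w| <= K} -> `|'Ex_P f| <= K.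
Proof.
move=> mf fK; rewrite -[leRHS]Rintegral_prob_cst; apply: Rintegral_norm_le => //.
  exact: integrable_aebounded fK.
apply: (@integrable_bounded _ `|K|) => //; exact: measurable_cst.
Qed.

Lemma Rintegral_cvg_bounded (f_ : nat -> Om -> R) f (K : R) :
  (forall n, measurable_fun setT (f_ n)) -> measurable_fun setT f ->
  (forall n, {ae P, forall w, `|f_ n w| <= K}) ->
  {ae P, forall w, f_ n w @[n --> \oo] --> f w} ->
  'Ex_P (f_ n) @[n --> \oo] --> 'Ex_P f.
Proof.
move=> mf_ mf fK fcvg.
have mK : measurable_fun [set: Om] (fun=> K : R) by exact: measurable_cst.
have iK : P.-integrable setT (EFin \o (fun=> K)).
  by apply: (@integrable_bounded _ `|K|).
have [] := @dominated_convergence _ _ _ P setT measurableT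
  (fun n => EFin \o f_ n) (EFin \o f) (EFin \o (fun=> K)).
- by move=> n; exact/measurable_EFinP.
- exact/measurable_EFinP.
- apply: filterS fcvg => w fw _; apply: cvg_EFin; first by apply: nearW.
  exact: fw.
- exact: iK.
- by have /ae_foralln := fK; apply: filterS => w fw n _ /=; rewrite lee_fin.
move=> fi _ h; apply: fine_cvg; rewrite -Rintegral_probE//.
Qed.

End Expectation.

(** * Convergence in probability *)

Section ConvergenceInProbability.
Context d (Om : measurableType d) (R : realType) (P : probability Om R).
Implicit Types (U V : Om -> R).

(** One [e] bounds both the deviation and its probability, which is the form in which
    [is_ito_integral] delivers its limits. *)
Definition cvg_prob (U_ : nat -> Om -> R) U := forall e : R, 0 < e ->
  exists N : nat, forall n, (N <= n)%N ->
    (P [set w | (e < `|U_ n w - U w|)%R] < e%:E)%E.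

Lemma measurable_lt_norm U (e : R) : measurable_fun setT U ->
  measurable [set w | e < `|U w|].
Proof.
move=> mU; rewrite -[X in measurable X]setTI.
have -> : [set w | e < `|U w|] = (fun w => `|U w|) @^-1` `]e, +oo[%classic.
  by apply/seteqP; split=> w /=; rewrite in_itv/= andbT.
have : measurable_fun setT (fun w => `|U w|) by exact: measurableT_comp.
by apply=> //; exact: measurable_itv.
Qed.

(** Off the event where the deviation exceeds [e] the Lipschitz constant gives [K * e]; on it the
    bound [2 * B] is weighted by a probability below [e]. *)
Lemma cvg_prob_Lipschitz (U_ : nat -> Om -> R) U (phi : R -> R) (K B : R) :
  (forall n, measurable_fun setT (U_ n)) -> measurable_fun setT U ->
  measurable_fun setT phi ->
  (forall x, `|phi x| <= B) -> (forall x y, `|phi x - phi y| <= K * `|x - y|) ->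
  cvg_prob U_ U ->
  'Ex_P (fun w => phi (U_ n w)) @[n --> \oo] --> 'Ex_P (fun w => phi (U w)).
Proof.
move=> mU_ mU mphi phiB phiK UU.
have B0 : 0 <= B by exact: le_trans (phiB 0).
have K0 : 0 <= K.
  have := phiK 1 0; rewrite subr0 normr1 mulr1; exact: le_trans.
have mphiU n : measurable_fun setT (fun w => phi (U_ n w)).
  exact: measurableT_comp.
have mphiV : measurable_fun setT (fun w => phi (U w)) by exact: measurableT_comp.
have iphi n : P.-integrable setT (EFin \o (fun w => phi (U_ n w))).
  by apply: (@integrable_bounded _ _ _ _ _ B).
have iphiV : P.-integrable setT (EFin \o (fun w => phi (U w))).
  by apply: (@integrable_bounded _ _ _ _ _ B).
have key n (e : R) : 0 < e -> (P [set w | (e < `|U_ n w - U w|)%R] < e%:E)%E ->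
    `|'Ex_P (fun w => phi (U_ n w)) - 'Ex_P (fun w => phi (U w))|
      <= (K + 2 * B) * e.
  move=> e0 Pe; rewrite -RintegralB//.
  set A := [set w | _] in Pe.
  have mA : measurable A.
    by apply: (@measurable_lt_norm (fun w => U_ n w - U w)); exact: measurable_funB.
  have mI : measurable_fun setT (\1_A : Om -> R) by exact: measurable_indic.
  have iI : P.-integrable setT (EFin \o (\1_A : Om -> R)).
    apply: (@integrable_bounded _ _ _ _ _ 1) => // w.
    by rewrite indicE; case: (_ \in _); rewrite ?normr1 ?normr0.
  have EI : 'Ex_P (fun w => \1_A w : R) = fine (P A).
    by rewrite /Rintegral integral_indic// setIT.
  have PA : fine (P A) <= e.
    rewrite -lee_fin fineK; first exact: ltW.
    exact: fin_num_measure.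
  have iM : P.-integrable setT (EFin \o (fun w => K * e + 2 * B * \1_A w)).
    apply: (@integrable_bounded _ _ _ _ _ (K * e + 2 * B)).
      by apply: measurable_funD => //; exact: measurable_funM.
    move=> w; rewrite indicE; case: (_ \in _); rewrite ?mulr1 ?mulr0 ?addr0 ger0_norm//.
    - by rewrite addr_ge0// mulr_ge0// ltW.
    - by rewrite lerDl mulr_ge0.
    - by rewrite mulr_ge0// ltW.
  apply: (@le_trans _ _ ('Ex_P (fun w => K * e + 2 * B * \1_A w))).
    apply: Rintegral_norm_le => //.
      have := integrableB measurableT (iphi n) iphiV.
      by apply: eq_integrable => // w _; rewrite /= EFinB.
    apply: aeW => w /=; rewrite indicE; have [Aw|Aw] := boolP (w \in A).
      rewrite mulr1 (le_trans (ler_normB _ _))//.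
      have := phiB (U_ n w); have := phiB (U w).
      have : 0 <= K * e by rewrite mulr_ge0// ltW.
      by lra.
    rewrite mulr0 addr0 (le_trans (phiK _ _))// ler_wpM2l//.
    by rewrite leNgt; apply: contraNN Aw => Aw; rewrite inE.
  have -> : 'Ex_P (fun w => K * e + 2 * B * \1_A w) = K * e + 2 * B * fine (P A).
    rewrite RintegralD//.
    - by rewrite Rintegral_prob_cst RintegralZl// EI.
    - by apply: (@integrable_bounded _ _ _ _ _ `|K * e|).
    - have := integrableZl measurableT (2 * B) iI.
      by apply: eq_integrable => // w _.
  by rewrite [leRHS]mulrDl lerD2l ler_wpM2l// mulr_ge0.
apply/cvgrPdist_le => e e0.
pose e' := e / (K + 2 * B + 1).
have c0 : 0 < K + 2 * B + 1 by rewrite ltr_wpDl// addr_ge0// mulr_ge0.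
have e'0 : 0 < e' by rewrite divr_gt0.
have [N HN] := UU _ e'0.
near=> n; rewrite distrC (le_trans (key n e' e'0 _))//.
  by apply: HN; near: n; exists N.
by rewrite /e' mulrA ler_pdivrMr// mulrC ler_wpM2l ?lerDl// ltW.
Unshelve. all: by end_near. Qed.

End ConvergenceInProbability.

(** * Moment bounds and their stability under limits *)

Section LqBounds.
Context d (Om : measurableType d) (R : realType) (P : probability Om R).
Implicit Types (U V : Om -> R) (b : R).

(** Stating the bound on the [q]-th power avoids roots, and stating it in the extended reals makes
    finiteness of the moment part of it. *)
Definition Lq_le (q : nat) U b := [/\ measurable_fun setT U, 0 <= b &
  (\int[P]_w (`|U w| ^+ q)%:E <= (b ^+ q)%:E)%E].

Lemma measurable_normX q U : measurable_fun setT U ->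
  measurable_fun setT (fun w => `|U w| ^+ q).
Proof. by move=> mU; apply: measurable_funX; exact: measurableT_comp. Qed.

(** The passage to [Lnorm] makes Minkowski's inequality available for [Lq_leD]. *)
Lemma Lq_leP q U b : (0 < q)%N -> Lq_le q U b <->
  [/\ measurable_fun setT U, 0 <= b & (Lnorm P q%:R%:E (EFin \o U) <= b%:E)%E].
Proof.
move=> q0; have qr0 : (q%:R : R) != 0 by rewrite pnatr_eq0 -lt0n.
have E : (\int[P]_w (`|U w| ^+ q)%:E = Lnorm P q%:R%:E (EFin \o U) `^ q%:R)%E.
  rewrite powR_Lnorm//; apply: eq_integral => w _.
  by rewrite /= ?poweR_EFin powR_mulrn.
have B b' : 0 <= b' -> ((b' ^+ q)%:E = b'%:E `^ q%:R)%E.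
  by move=> b0; rewrite poweR_EFin powR_mulrn.
split=> [[mU b0]|[mU b0 bb]].
  rewrite E B// => bb; split=> //; rewrite leNgt; apply/negP => bU.
  move: bb; rewrite leNgt => /negP; apply.
  move: bU; case: Lnorm => [x||]//; last first.
    move=> _; rewrite poweRyr// poweR_EFin ltry//.
  rewrite lte_fin => bx; rewrite !poweR_EFin lte_fin gt0_ltr_powR// ?nnegrE//.
  - by rewrite ltr0n.
  - exact: le_trans (ltW bx).
split=> //; rewrite E B//; apply: gt0_ler_poweR => //.
- by rewrite in_itv/= leey Lnorm_ge0.
- by rewrite in_itv/= leey lee_fin b0.
Qed.

Lemma Lq_leD q U V a b : (0 < q)%N -> Lq_le q U a -> Lq_le q V b ->
  Lq_le q (fun w => U w + V w) (a + b).
Proof.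
move=> q0 /Lq_leP-/(_ q0)[mU a0 Ua] /Lq_leP-/(_ q0)[mV b0 Vb].
apply/Lq_leP => //; split; [exact: measurable_funD|exact: addr_ge0|].
have h := @minkowski_EFin _ _ _ P _ _ q%:R mU mV.
by rewrite (le_trans (h _)) ?ler1n// EFinD leeD.
Qed.

Lemma Lq_leZ q U (c : R) b : Lq_le q U b -> Lq_le q (fun w => c * U w) (`|c| * b).
Proof.
move=> [mU b0 Ub]; split; [exact: measurable_funM|exact: mulr_ge0|].
under eq_integral do rewrite normrM exprMn EFinM.
rewrite ge0_integralZl//; first by rewrite exprMn EFinM lee_wpmul2l// lee_fin exprn_ge0.
exact/measurable_EFinP/measurable_normX.
Qed.

Lemma Lq_leW q U a b : Lq_le q U a -> a <= b -> Lq_le q U b.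
Proof.
move=> [mU a0 Ua] ab; split=> //; first exact: le_trans ab.
by rewrite (le_trans Ua)// lee_fin lerXn2r// nnegrE// (le_trans a0).
Qed.

Lemma Lq_le0 q : (0 < q)%N -> Lq_le q (fun=> 0) 0.
Proof.
move=> q0; split=> //.
by under eq_integral do rewrite normr0 expr0n gtn_eqF//; rewrite integral0 expr0n gtn_eqF.
Qed.

Lemma Lq_le_sum q (I : Type) (r : seq I) (U : I -> Om -> R) (b : I -> R) :
  (0 < q)%N -> (forall i, Lq_le q (U i) (b i)) ->
  Lq_le q (fun w => \sum_(i <- r) U i w) (\sum_(i <- r) b i).
Proof.
move=> q0 Ub; elim: r => [|i r IH].
  by under eq_fun do rewrite big_nil; rewrite big_nil; exact: Lq_le0.
by under eq_fun do rewrite big_cons; rewrite big_cons; exact: Lq_leD.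
Qed.

Lemma Lq_le_aebounded q U b : measurable_fun setT U -> 0 <= b ->
  {ae P, forall w, `|U w| <= b} -> Lq_le q U b.
Proof.
move=> mU b0 Ub; split=> //.
apply: (@le_trans _ _ (\int[P]_w (b ^+ q)%:E)%E).
  apply: ae_ge0_le_integral => //.
  - exact/measurable_EFinP/measurable_normX.
  - by move=> w _; rewrite lee_fin exprn_ge0.
  - by apply: filterS Ub => w Ub _; rewrite lee_fin lerXn2r// nnegrE.
by rewrite integral_cst//= probability_setT mule1.
Qed.

Lemma Lq_le_ae q U V b : measurable_fun setT V ->
  {ae P, forall w, U w = V w} -> Lq_le q U b -> Lq_le q V b.
Proof.
move=> mV UV [mU b0 Ub]; split=> //; rewrite (le_trans _ Ub)// le_eqVlt.
apply/orP; left; apply/eqP; apply: ae_eq_integral => //.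
- exact/measurable_EFinP/measurable_normX.
- exact/measurable_EFinP/measurable_normX.
- by apply: filterS UV => w /= ->.
Qed.

Lemma integrable_Lq q U b : Lq_le q U b ->
  P.-integrable setT (EFin \o (fun w => `|U w| ^+ q)).
Proof.
move=> [mU b0 Ub]; apply/integrableP; split.
  exact/measurable_EFinP/measurable_normX.
apply: le_lt_trans (ltry (b ^+ q)); apply: le_trans Ub.
by under eq_integral do rewrite /= ger0_norm ?exprn_ge0//.
Qed.

Lemma Rintegral_Lq q U b : Lq_le q U b -> 'Ex_P (fun w => `|U w| ^+ q) <= b ^+ q.
Proof.
move=> Ub; have := integrable_Lq Ub; move/Rintegral_probE => E.
by rewrite -lee_fin -E; case: Ub.
Qed.

Lemma Lq_le_Rintegral q U b : measurable_fun setT U -> 0 <= b ->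
  P.-integrable setT (EFin \o (fun w => `|U w| ^+ q)) ->
  'Ex_P (fun w => `|U w| ^+ q) <= b ^+ q -> Lq_le q U b.
Proof. by move=> mU b0 iU Ub; split=> //; rewrite Rintegral_probE// lee_fin. Qed.

Lemma integrable_Lq_le q j U b : (j <= q)%N -> Lq_le q U b ->
  P.-integrable setT (EFin \o (fun w => `|U w| ^+ j)).
Proof.
move=> jq Ub; have iU := integrable_Lq Ub; have [mU _ _] := Ub.
have i1 : P.-integrable setT (EFin \o (fun=> 1 : R)).
  by apply: (@integrable_bounded _ _ _ _ _ 1) => // w; rewrite normr1.
have i2 : P.-integrable setT (EFin \o (fun w => 1 + `|U w| ^+ q)).
  have := integrableD measurableT i1 iU.
  by apply: eq_integrable => // w _ /=; rewrite EFinD.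
apply: integrable_dominated i2; first exact: measurable_normX.
apply: aeW => w; rewrite ger0_norm ?exprn_ge0//.
have [U1|/ltW U1] := leP `|U w| 1.
  by rewrite (@le_trans _ _ 1)// ?exprn_ile1// lerDl exprn_ge0.
by rewrite (@le_trans _ _ (`|U w| ^+ q)) ?lerDr// ler_weXn2l.
Qed.

(** Fatou's lemma for a weak mode of convergence: truncation at level [k] bounds the integrands, and
    monotone convergence in [k] then removes it. *)
Lemma Lq_le_lim q (U_ : nat -> Om -> R) U b : measurable_fun setT U -> 0 <= b ->
  (forall n, Lq_le q (U_ n) b) ->
  (forall k : nat, 'Ex_P (fun w => (Num.min `|U_ n w| k%:R) ^+ q) @[n --> \oo] -->
    'Ex_P (fun w => (Num.min `|U w| k%:R) ^+ q)) ->
  Lq_le q U b.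
Proof.
move=> mU b0 Ub cv; split=> //.
have mmin V (k : nat) : measurable_fun setT V ->
    measurable_fun setT (fun w : Om => (Num.min `|V w| k%:R) ^+ q : R).
  move=> mV; apply: measurable_funX; apply: measurable_minr.
    exact: measurableT_comp.
  exact: measurable_cst.
have min0 V (k : nat) w : 0 <= (Num.min `|V w : R| k%:R).
  by rewrite le_min normr_ge0 ler0n.
have imin V (k : nat) : measurable_fun setT V ->
    P.-integrable setT (EFin \o (fun w => (Num.min `|V w| k%:R) ^+ q)).
  move=> mV; apply: (@integrable_bounded _ _ _ _ _ (k%:R ^+ q)); first exact: mmin.
  move=> w; rewrite ger0_norm ?exprn_ge0// lerXn2r// ?nnegrE//.
  by rewrite ge_min lexx orbT.
have bk (k : nat) : (\int[P]_w ((Num.min `|U w| k%:R) ^+ q)%:E <= (b ^+ q)%:E)%E.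
  rewrite Rintegral_probE; last exact: imin.
  rewrite lee_fin; apply: (@cvgr_to_le _ _ _ _ _ _ _ (cv k)).
  near=> n; have Ubn := Ub n; have [mUn _ _] := Ubn.
  apply: le_trans (Rintegral_Lq Ubn); apply: Rintegral_le_ae.
  - exact: imin.
  - exact: integrable_Lq Ubn.
  - apply: aeW => w; rewrite lerXn2r// ?nnegrE// ge_min lexx//.
have mono w : {homo (fun k : nat => ((Num.min `|U w| k%:R) ^+ q)%:E) :
    n m / (n <= m)%N >-> (n <= m)%E}.
  move=> n m nm; rewrite lee_fin lerXn2r// ?nnegrE//.
  by rewrite le_min ge_min lexx/= ge_min ler_nat nm orbT.
have lim w : limn (fun k : nat => ((Num.min `|U w| k%:R) ^+ q)%:E) = (`|U w| ^+ q)%:E.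
  apply: lim_near_cst => //; near=> k.
  have Uk : `|U w| <= k%:R by near: k; exact: nbhs_infty_ger.
  by rewrite min_l.
have mk (n : nat) : measurable_fun setT (fun w => ((Num.min `|U w| n%:R) ^+ q)%:E).
  by apply/measurable_EFinP; exact: mmin.
have k0 (n : nat) w : setT w -> (0 <= ((Num.min `|U w| n%:R) ^+ q)%:E)%E.
  by move=> _; rewrite lee_fin exprn_ge0.
have cm := @cvg_monotone_convergence _ _ _ P setT measurableT _ mk k0
   (fun w _ => mono w).
have <- : (\int[P]_w limn (fun k : nat => ((Num.min `|U w| k%:R) ^+ q)%:E) =
           \int[P]_w (`|U w| ^+ q)%:E)%E by apply: eq_integral => w _; rewrite lim.
rewrite -(cvg_lim _ cm)//; apply: lime_le; first by apply/cvg_ex; eexists; exact: cm.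
by apply: nearW => k; exact: bk.
Unshelve. all: by end_near. Qed.

Lemma norm_minB (x y k : R) : `|Num.min x k - Num.min y k| <= `|x - y|.
Proof.
have [xk|xk] := leP x k; have [yk|yk] := leP y k => //.
- rewrite ler0_norm ?subr_le0// ler0_norm ?subr_le0//; last by rewrite (le_trans xk)// ltW.
  by rewrite !opprB lerB// ltW.
- rewrite ger0_norm ?subr_ge0// ger0_norm ?subr_ge0//; last by rewrite (le_trans yk)// ltW.
  by rewrite lerB// ltW.
- by rewrite subrr normr0.
Qed.

Lemma norm_subX_le (x y k : R) q : 0 <= x <= k -> 0 <= y <= k ->
  `|x ^+ q - y ^+ q| <= q%:R * k ^+ q.-1 * `|x - y|.
Proof.
move=> /andP[x0 xk] /andP[y0 yk]; rewrite subrXX normrM mulrC ler_wpM2r//.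
rewrite (le_trans (ler_norm_sum _ _ _))//.
have -> : q%:R * k ^+ q.-1 = \sum_(i < q) k ^+ q.-1.
  by rewrite sumr_const card_ord mulr_natl.
rewrite ler_sum// => i _; rewrite ger0_norm ?mulr_ge0 ?exprn_ge0//.
rewrite -[X in _ <= _ ^+ X](@subnK i q.-1); last by case: i => /= i; case: (q).
by rewrite exprD ler_pM ?exprn_ge0// lerXn2r// nnegrE (le_trans x0).
Qed.

(** The truncated power is bounded and Lipschitz, so convergence in probability passes to its
    expectation. This carries bounds on Riemann sums over to integrals. *)
Lemma Lq_le_cvg_prob q (U_ : nat -> Om -> R) U b : measurable_fun setT U -> 0 <= b ->
  (forall n, Lq_le q (U_ n) b) -> cvg_prob P U_ U -> Lq_le q U b.
Proof.
move=> mU b0 Ub UU; apply: (Lq_le_lim mU b0 Ub) => k.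
pose phi (x : R) := Num.min `|x| k%:R ^+ q.
have min0 (x : R) : 0 <= Num.min `|x| k%:R <= k%:R.
  by rewrite le_min normr_ge0 ler0n ge_min lexx orbT.
apply: (@cvg_prob_Lipschitz _ _ _ _ _ _ phi (q%:R * k%:R ^+ q.-1) (k%:R ^+ q)) => //.
- by move=> n; have [] := Ub n.
- apply: measurable_funX; apply: measurable_minr => //.
- move=> x; have /andP[? ?] := min0 x.
  by rewrite ger0_norm ?exprn_ge0// lerXn2r// nnegrE.
- move=> x y; rewrite (le_trans (norm_subX_le q (min0 x) (min0 y)))//.
  rewrite ler_wpM2l// ?mulr_ge0 ?exprn_ge0//.
  by rewrite (le_trans (norm_minB _ _ _))// ler_dist_dist.
Qed.

End LqBounds.

(** * Change of variables along a law *)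

Section Transfer.
Context d d' (Om : measurableType d) (T' : measurableType d') (R : realType).
Variables (P : {measure set Om -> \bar R}) (mu : {measure set T' -> \bar R}).
Variable U : Om -> T'.
Hypothesis mU : measurable_fun setT U.
Hypothesis lawU : forall C, measurable C -> P (U @^-1` C) = mu C.
Local Open Scope ereal_scope.

Lemma ge0_integral_law (f : T' -> \bar R) : measurable_fun setT f ->
  (forall y, 0 <= f y) -> \int[P]_w f (U w) = \int[mu]_y f y.
Proof.
move=> mf f0; have := @ge0_integral_pushforward _ _ _ _ _ _ mU P setT f measurableT mf.
rewrite preimage_setT => <- //; apply: eq_measure_integral => // A mA _.
by rewrite -lawU.
Qed.

Lemma integrable_law (f : T' -> \bar R) : measurable_fun setT f ->
  P.-integrable setT (f \o U) <-> mu.-integrable setT f.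
Proof.
move=> mf; have E : \int[P]_w `|f (U w)| = \int[mu]_y `|f y|.
  by rewrite (@ge0_integral_law (fun y => `|f y|))//; exact: measurableT_comp.
split=> /integrableP[_ fi]; apply/integrableP; split=> //.
- by rewrite -E.
- exact: measurableT_comp.
- by rewrite E.
Qed.

Lemma integral_law (f : T' -> \bar R) : measurable_fun setT f ->
  P.-integrable setT (f \o U) -> \int[P]_w f (U w) = \int[mu]_y f y.
Proof.
move=> mf fi; have := @integral_pushforward _ _ _ _ _ _ mU P setT f mf.
rewrite preimage_setT => /(_ fi measurableT) <-; apply: eq_measure_integral => // A mA _.
by rewrite -lawU.
Qed.

End Transfer.

Section Independence.
Context d (Om : measurableType d) (R : realType) (P : probability Om R).
Implicit Types (U V : Om -> R).

Definition indep_rv U V := forall A C, measurable A -> measurable C ->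
  P (U @^-1` A `&` V @^-1` C) = (P (U @^-1` A) * P (V @^-1` C))%E.

Lemma indep_rv_comp U V (f g : R -> R) : measurable_fun setT f ->
  measurable_fun setT g -> indep_rv U V ->
  indep_rv (fun w => f (U w)) (fun w => g (V w)).
Proof.
move=> mf mg UV A C mA mC.
by apply: (UV (f @^-1` A) (g @^-1` C)); rewrite -[X in measurable X]setTI;
  [apply: mf|apply: mg].
Qed.

(** Independence identifies the law of the pair with the product of the marginal laws, and Fubini's
    theorem factors the integral. *)
Lemma Rintegral_indep U V : measurable_fun setT U -> measurable_fun setT V ->
  indep_rv U V -> P.-integrable setT (EFin \o U) -> P.-integrable setT (EFin \o V) ->
  P.-integrable setT (EFin \o (fun w => U w * V w)) /\
  'Ex_P (fun w => U w * V w) = 'Ex_P U * 'Ex_P V.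
Proof.
move=> mU mV UV iU iV.
pose U' : {RV P >-> R} := mfun_Sub (mem_set mU).
pose V' : {RV P >-> R} := mfun_Sub (mem_set mV).
pose m1 := distribution P U'; pose m2 := distribution P V'.
have mW : measurable_fun setT (fun w => (U w, V w)) by exact: measurable_fun_pair.
have lawW C : measurable C -> P ((fun w => (U w, V w)) @^-1` C) = (m1 \x m2)%E C.
  move=> mC; pose m' := distribution P (mfun_Sub (mem_set mW) : {RV P >-> (R * R)%type}).
  have m'E A B : measurable A -> measurable B -> m' (A `*` B) = (m1 A * m2 B)%E.
    by move=> mA mB; rewrite -[RHS]UV.
  by rewrite (product_measure_unique m'E).
have iU' : m1.-integrable setT EFin.
  by apply/(@integrable_law _ _ _ _ _ P m1 U mU) => //.
have iV' : m2.-integrable setT EFin.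
  by apply/(@integrable_law _ _ _ _ _ P m2 V mV) => //.
pose f (z : R * R) := (z.1 * z.2)%:E.
have mf : measurable_fun setT f by apply/measurable_EFinP; exact: measurable_funM.
have fin_abs (m : probability R R) : m.-integrable setT EFin ->
    (\int[m]_x `|x%:E| \is a fin_num)%E.
  move=> /integrableP[_ h]; rewrite ge0_fin_numE//; exact: integral_ge0.
have if' : (m1 \x m2)%E.-integrable setT f.
  apply/integrable12ltyP => //.
  under eq_integral => x _.
    under eq_integral => y _ do rewrite /f/= normrM EFinM.
    rewrite ge0_integralZl//; last by apply/measurable_EFinP; exact: normr_measurable.
    over.
  rewrite ge0_integralZr//.
  - by rewrite ltey_eq fin_numM ?fin_abs.
  - by apply/measurable_EFinP; exact: normr_measurable.
  - exact: integral_ge0.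
have iW : P.-integrable setT (f \o (fun w => (U w, V w))).
  exact/(@integrable_law _ _ _ _ _ P (m1 \x m2)%E _ mW).
split; first exact: iW.
rewrite {1}/Rintegral (_ : (\int[P]_w (U w * V w)%:E)%E = (\int[m1 \x m2]_z f z)%E); last first.
  by rewrite -(@integral_law _ _ _ _ _ P (m1 \x m2)%E _ mW).
rewrite -integral12_prod_meas1// /fubini_F.
under eq_integral => x _.
  under eq_integral => y _ do rewrite /f/= EFinM.
  rewrite integralZl//.
  over.
have -> : (\int[m2]_x x%:E = ('Ex_P V)%:E)%E.
  by rewrite -(@integral_law _ _ _ _ _ P m2 V mV)// Rintegral_probE.
rewrite integralZr//.
have -> : (\int[m1]_x x%:E = ('Ex_P U)%:E)%E.
  by rewrite -(@integral_law _ _ _ _ _ P m1 U mU)// Rintegral_probE.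
by [].
Qed.

End Independence.

(** * Moments and characteristic function of the normal law *)

Section Density.
Context d (T : measurableType d) (R : realType).
Variables (mu nu : {measure set T -> \bar R}) (g : T -> R).
Hypotheses (mg : measurable_fun setT g) (g0 : forall x, 0 <= g x).
Hypothesis nuE : forall A, measurable A -> nu A = (\int[mu]_(x in A) (g x)%:E)%E.
Import HBNNSimple.
Local Open Scope ereal_scope.

Lemma ge0_integral_density (f : T -> \bar R) : measurable_fun setT f ->
  (forall x, 0 <= f x) -> \int[nu]_x f x = \int[mu]_x (f x * (g x)%:E).
Proof.
move=> mf f0; pose h := nnsfun_approx measurableT mf.
have mgE : measurable_fun setT (EFin \o g) by exact/measurable_EFinP.
have mh n : measurable_fun setT (EFin \o h n) by exact/measurable_EFinP.
have hcvg x : (EFin \o h n) x @[n --> \oo] --> f x.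
  by apply: cvg_nnsfun_approx.
have hnd x a b : (a <= b)%N -> (h a x)%:E <= (h b x)%:E.
  by move=> ab; rewrite lee_fin; exact/lefP/nd_nnsfun_approx.
have -> : \int[nu]_x f x = limn (fun n => \int[nu]_x (h n x)%:E).
  rewrite -monotone_convergence//.
  - by apply: eq_integral => x _; apply/esym/cvg_lim => //; exact: hcvg.
  - by move=> n x _; rewrite lee_fin.
  - by move=> x _ a b ab; exact: hnd.
have -> : \int[mu]_x (f x * (g x)%:E) = limn (fun n => \int[mu]_x ((h n x)%:E * (g x)%:E)).
  rewrite -monotone_convergence//.
  - by apply: eq_integral => x _; apply/esym/cvg_lim => //; apply: cvgeZr => //; exact: hcvg.
  - by move=> n; exact: (emeasurable_funM (mh n) mgE).
  - by move=> n x _; rewrite mule_ge0// lee_fin.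
  - by move=> x _ a b ab; rewrite lee_wpmul2r ?lee_fin//; exact: (hnd x).
(* Monotone convergence has reduced both sides to simple functions, where the claim is the
   definition of the density on each level set. *)
congr (limn _); apply/funext => n.
have hE x : h n x = (\sum_(y \in range (h n)) (y * \1_(h n @^-1` [set y]) x))%R.
  exact: fimfunE.
have ind0 y x : 0 <= (y * \1_(h n @^-1` [set y]) x)%:E.
  exact: nnfun_muleindic_ge0.
have mind y : measurable_fun setT (fun x => (y * \1_(h n @^-1` [set y]) x)%:E).
  by apply/measurable_EFinP; apply: measurable_funM.
transitivity (\sum_(y \in range (h n)) \int[nu]_x (y * \1_(h n @^-1` [set y]) x)%:E).
  by rewrite -ge0_integral_fsum//; apply: eq_integral => x _; rewrite hE -fsumEFin.
transitivity (\sum_(y \in range (h n)) \int[mu]_x ((y * \1_(h n @^-1` [set y]) x)%:E * (g x)%:E)).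
  apply: eq_fsbigr => y yh.
  have mA : measurable (h n @^-1` [set y]) by [].
  have y0 : (0 <= y)%R by have [x _ <-] := set_mem yh; exact: fun_ge0.
  under eq_integral do rewrite EFinM.
  rewrite ge0_integralZl//; last exact/measurable_EFinP/measurable_indic.
  under [RHS]eq_integral do rewrite EFinM -muleA.
  rewrite ge0_integralZl//; first last.
  - by move=> x _; rewrite mule_ge0// lee_fin.
  - by apply: emeasurable_funM => //; exact/measurable_EFinP/measurable_indic.
  congr (_ * _); rewrite integral_indic// setIT nuE// integral_mkcond.
  apply: eq_integral => x _; rewrite patchE indicE; case: (_ \in _) => //=.
    by rewrite mul1e.
  by rewrite mul0e.
rewrite -ge0_integral_fsum//; first last.
- by move=> y x _; rewrite mule_ge0// lee_fin.
- by move=> y; exact: (emeasurable_funM (mind y) mgE).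
apply: eq_integral => x _; rewrite hE -fsumEFin// ge0_mule_fsuml//.
Qed.

Lemma integrable_density (f : T -> \bar R) : measurable_fun setT f ->
  mu.-integrable setT (fun x => f x * (g x)%:E) <-> nu.-integrable setT f.
Proof.
move=> mf; have E : \int[nu]_x `|f x| = \int[mu]_x `|f x * (g x)%:E|.
  rewrite ge0_integral_density//; last exact: measurableT_comp.
  by apply: eq_integral => x _; rewrite abseM (@gee0_abs _ (g x)%:E) ?lee_fin.
split=> /integrableP[_ fi]; apply/integrableP; split=> //.
- by rewrite E.
- by apply: emeasurable_funM => //; exact/measurable_EFinP.
- by rewrite -E.
Qed.

Lemma integral_density (f : T -> \bar R) : measurable_fun setT f ->
  \int[nu]_x f x = \int[mu]_x (f x * (g x)%:E).
Proof.
move=> mf; rewrite integralE [RHS]integralE.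
rewrite ge0_integral_density//; last exact: measurable_funepos.
rewrite ge0_integral_density//; last exact: measurable_funeneg.
congr (_ - _); apply: eq_integral => x _.
- rewrite !funeposE; have [f0|f0] := leP 0 (f x).
    by rewrite !max_l// mule_ge0// lee_fin.
  by rewrite mul0e max_r// mule_le0_ge0 ?lee_fin// ltW.
- rewrite !funenegE; have [f0|f0] := leP 0 (- f x).
    by rewrite -muleN !max_l ?muleN ?mulNe// -mulNe mule_ge0// lee_fin.
  by rewrite mul0e max_r// -mulNe mule_le0_ge0 ?lee_fin// ltW.
Qed.

End Density.

Section NormalMoments.
Context {R : realType}.
Variable s : R.
Hypothesis s0 : 0 < s.
Local Notation pdf := (normal_pdf 0 s).
Local Notation law := (normal_prob (0 : R) s).
Implicit Types (f g : R -> R).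

(** A single term of the exponential series is below its sum. *)
Lemma exprn_le_fact_expR (y : R) k : 0 <= y -> y ^+ k <= k`!%:R * expR y.
Proof.
move=> y0; case: k => [|k].
  by rewrite expr0 fact0 mul1r (le_trans _ (expR_ge1Dx y))// lerDl.
have f0 : 0 < k.+1`!%:R :> R by rewrite ltr0n fact_gt0.
rewrite mulrC -ler_pdivrMr// (le_trans _ (expR_ge1Dxn k y0))//.
by rewrite lerDr.
Qed.

Lemma normal_pdfE0 x : pdf x = normal_peak s * expR (- x ^+ 2 / (s ^+ 2 *+ 2)).
Proof. by rewrite normal_pdfE ?gt_eqF// /normal_fun subr0. Qed.

(** Half of the Gaussian exponent absorbs the power, and the remaining half is a normal density of
    standard deviation [sqrt 2 * s]. Integrability thus reduces to that of a density. *)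
Lemma even_moment_pdf_le k : exists2 K : R, 0 <= K &
  forall x : R, x ^+ (k.*2) * pdf x <= K * normal_pdf 0 (Num.sqrt 2 * s) x.
Proof.
set s' := Num.sqrt 2 * s; have s'0 : 0 < s' by rewrite mulr_gt0// sqrtr_gt0.
have p0 : 0 < normal_peak s by rewrite normal_peak_gt0 ?gt_eqF.
have p'0 : 0 < normal_peak s' by rewrite normal_peak_gt0 ?gt_eqF.
exists ((4 * s ^+ 2) ^+ k * k`!%:R * (normal_peak s / normal_peak s')).
  by rewrite !mulr_ge0 ?invr_ge0 ?exprn_ge0 ?mulr_ge0 ?sqr_ge0// ltW.
(* The exponent of the density equals [- 2 * y]; one [y] pays for [y ^+ k <= k! * exp y]. *)
move=> x; pose y := x ^+ 2 / (4 * s ^+ 2).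
have s20 : 0 < s ^+ 2 by rewrite exprn_gt0.
have y0 : 0 <= y by rewrite divr_ge0 ?sqr_ge0// mulr_ge0// ltW.
rewrite normal_pdfE0 normal_pdfE ?gt_eqF// /normal_fun subr0.
have -> : - x ^+ 2 / (s ^+ 2 *+ 2) = - y - y.
  by rewrite /y -mulr_natr; field; rewrite gt_eqF.
have -> : - x ^+ 2 / (s' ^+ 2 *+ 2) = - y.
  by rewrite /y /s' exprMn sqr_sqrtr// -mulr_natr; field; rewrite gt_eqF.
have -> : x ^+ k.*2 = (4 * s ^+ 2) ^+ k * y ^+ k.
  rewrite -exprMn /y mulrCA divff ?mulr1 ?mulf_neq0 ?gt_eqF//.
  by rewrite -exprM mul2n.
rewrite expRD [leRHS](_ : _ = (4 * s ^+ 2) ^+ k * (k`!%:R * expR y) * (normal_peak s * (expR (- y) * expR (- y)))); last first.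
  rewrite expRN; field; rewrite !gt_eqF ?expR_gt0//.
rewrite ler_wpM2r//; first by rewrite !mulr_ge0 ?expR_ge0// ltW.
apply: ler_wpM2l; last exact: exprn_le_fact_expR.
by rewrite exprn_ge0// mulr_ge0// ltW.
Qed.

Lemma normr_exprn_le k (x : R) : `|x| ^+ k <= 1 + x ^+ (k.*2).
Proof.
have -> : x ^+ k.*2 = `|x| ^+ k.*2.
  by rewrite -mul2n !exprM real_normK ?num_real.
have [x1|/ltW x1] := leP `|x| 1.
  by rewrite (@le_trans _ _ 1) ?exprn_ile1// lerDl exprn_ge0.
by rewrite (@le_trans _ _ (`|x| ^+ k.*2)) ?ler_weXn2l ?lerDr// -addnn leq_addr.
Qed.

Lemma integrable_poly_pdf f (C : R) k : measurable_fun setT f ->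
  (forall x, `|f x| <= C * (1 + `|x| ^+ k)) ->
  lebesgue_measure.-integrable setT (EFin \o (fun x => f x * pdf x)).
Proof.
move=> mf fC; have [K K0 HK] := even_moment_pdf_le k.
have C0 : 0 <= C.
  have := fC 0; rewrite normr0; have := normr_ge0 (f 0) => h1 /(le_trans h1).
  by rewrite pmulr_lge0// ltr_pwDl// exprn_ge0.
have mp : measurable_fun setT pdf by exact: measurable_normal_pdf.
have i1 := integrableZl measurableT (C * 2) (integrable_normal_pdf 0 s).
have i2 := integrableZl measurableT (C * K) (integrable_normal_pdf 0 (Num.sqrt 2 * s)).
apply: (le_integrable measurableT _ _ (integrableD measurableT i1 i2)).
  by apply/measurable_EFinP; exact: measurable_funM.
move=> x _ /=; rewrite lee_fin; apply: le_trans (ler_norm _).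
rewrite normrM (ger0_norm (normal_pdf_ge0 _ _ _)).
apply: (@le_trans _ _ (C * (1 + (1 + x ^+ k.*2)) * pdf x)).
  rewrite ler_wpM2r ?normal_pdf_ge0// (le_trans (fC x))// ler_wpM2l// lerD2l.
  exact: normr_exprn_le.
have := HK x; move=> /(ler_wpM2l C0); lra.
Qed.

(** Controls the boundary terms in Stein's identity. *)
Lemma pdf_poly_bounded f (C : R) k : (forall x, `|f x| <= C * (1 + `|x| ^+ k)) ->
  exists M : R, forall x, `|f x| * pdf x <= M.
Proof.
move=> fC; have [K K0 HK] := even_moment_pdf_le k.
have C0 : 0 <= C.
  have := fC 0; rewrite normr0; have := normr_ge0 (f 0) => h1 /(le_trans h1).
  by rewrite pmulr_lge0// ltr_pwDl// exprn_ge0.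
exists (C * 2 * normal_peak s + C * K * normal_peak (Num.sqrt 2 * s)) => x.
have s'0 : Num.sqrt 2 * s != 0 by rewrite mulf_neq0 ?gt_eqF// sqrtr_gt0.
have u1 := @normal_pdf_ub _ 0 s x (lt0r_neq0 s0).
have u2 := @normal_pdf_ub _ 0 _ x s'0.
have h1 := ler_wpM2l (mulr_ge0 C0 (ler0n R 2)) u1.
have h2 := ler_wpM2l (mulr_ge0 C0 K0) u2.
have h3 := ler_wpM2l C0 (HK x).
have h4 : `|f x| * pdf x <= C * (1 + (1 + x ^+ k.*2)) * pdf x.
  rewrite ler_wpM2r ?normal_pdf_ge0// (le_trans (fC x))// ler_wpM2l// lerD2l.
  exact: normr_exprn_le.
lra.
Qed.

Lemma integrable_normal f (C : R) k : measurable_fun setT f ->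
  (forall x, `|f x| <= C * (1 + `|x| ^+ k)) -> law.-integrable setT (EFin \o f).
Proof.
move=> mf fC; apply/(@integrable_density _ _ _ lebesgue_measure law pdf) => //.
- exact: measurable_normal_pdf.
- by move=> x; exact: normal_pdf_ge0.
- exact/measurable_EFinP.
- have := integrable_poly_pdf mf fC.
  by apply: eq_integrable => // x _ /=; rewrite EFinM.
Qed.

Lemma Rintegral_normal f : measurable_fun setT f ->
  \int[law]_x f x = \int[lebesgue_measure]_x (f x * pdf x).
Proof.
move=> mf; rewrite /Rintegral (@integral_density _ _ _ lebesgue_measure law pdf)//.
- exact: measurable_normal_pdf.
- by move=> x; exact: normal_pdf_ge0.
- exact/measurable_EFinP.
Qed.

Lemma is_derive_pdf (x : R) : is_derive x 1 pdf (- (x / s ^+ 2) * pdf x).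
Proof.
have -> : pdf = fun x => normal_peak s * expR ((- (s ^+ 2 *+ 2)^-1) * x ^+ 2).
  apply/funext => y; rewrite normal_pdfE0; congr (_ * expR _).
  by rewrite !mulNr; congr (- _); exact: mulrC.
have h : is_derive x 1 (fun y : R => normal_peak s * expR ((- (s ^+ 2 *+ 2)^-1) * y ^+ 2))
  (normal_peak s * (expR ((- (s ^+ 2 *+ 2)^-1) * x ^+ 2) *
    ((- (s ^+ 2 *+ 2)^-1) * (2%:R * x ^+ 1 * 1)))).
  apply: is_derive_scale; apply: is_derive_comp; apply: is_derive_scale.
  exact: is_derive_pow.
by apply: (is_derive_eq h); rewrite -mulr_natr; field; rewrite gt_eqF.
Qed.

Lemma cvg_Rintegral_symmetric f :
  lebesgue_measure.-integrable setT (EFin \o f) ->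
  \int[lebesgue_measure]_(x in `[- n%:R, n%:R]) f x @[n --> \oo] -->
  \int[lebesgue_measure]_x f x.
Proof.
move=> fi; have mf := measurable_int _ fi.
pose f_ (n : nat) : R -> \bar R := (EFin \o f) \_ `[- n%:R, n%:R].
have [] := @dominated_convergence _ _ _ lebesgue_measure setT measurableT
  f_ (EFin \o f) (fun x => `|f x|%:E).
- by move=> n; apply/(measurable_restrictT _ _).1 => //; exact: measurable_funTS.
- by [].
- apply: aeW => x _; apply/cvg_ballP => e e0; near=> n.
  rewrite /f_ patchE mem_set; first exact: ballxx.
  rewrite /= in_itv/= -ler_norml; near: n; exact: nbhs_infty_ger.
- have := integrable_abse fi; by apply: eq_integrable.
- apply: aeW => x n _; rewrite /f_ patchE; case: ifP => _ //=.
  by rewrite normr0 lee_fin.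
move=> _ _ h; apply: fine_cvg; rewrite /Rintegral fineK; last first.
  exact: integrable_fin_num.
by move: h; under eq_fun do rewrite -integral_mkcond.
Unshelve. all: by end_near. Qed.

(* Stein's identity, by integrating the derivative of [g * pdf]. *)
Lemma normal_stein g g' (C : R) k : (forall x : R, is_derive x 1 g (g' x)) ->
  continuous g' -> (forall x, `|g x| <= C * (1 + `|x| ^+ k)) ->
  (forall x, `|g' x| <= C * (1 + `|x| ^+ k)) ->
  \int[law]_x (x * g x) = s ^+ 2 * \int[law]_x g' x.
Proof.
move=> dg cg' gC g'C.
have cg : continuous g := is_derive_continuous dg.
have mg : measurable_fun setT g := continuous_measurable_fun cg.
have mg' : measurable_fun setT g' := continuous_measurable_fun cg'.
have mxg : measurable_fun setT (fun x : R => x * g x) by exact: measurable_funM.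
have C0 : 0 <= C.
  have := gC 0; rewrite normr0; have := normr_ge0 (g 0) => h1 /(le_trans h1).
  by rewrite pmulr_lge0// ltr_pwDl// exprn_ge0.
have xgC (x : R) : `|x * g x| <= (2 * C) * (1 + `|x| ^+ k.+1).
  rewrite normrM exprS; have h := ler_wpM2l (normr_ge0 x) (gC x).
  apply: (le_trans h); have x0 := normr_ge0 x.
  have : C * `|x| <= C * (1 + `|x| * `|x| ^+ k).
    rewrite ler_wpM2l//; have [x1|/ltW x1] := leP `|x| 1.
      by rewrite (le_trans x1)// lerDl mulr_ge0 ?exprn_ge0.
    by rewrite -[leLHS]add0r lerD// ler_peMr// exprn_ege1.
  have : 0 <= C * (`|x| * `|x| ^+ k) by rewrite !mulr_ge0 ?exprn_ge0.
  lra.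
have i1 := integrable_poly_pdf mg' g'C.
have i2 := integrable_poly_pdf mxg xgC.
pose q (x : R) := g' x * pdf x - (s ^+ 2)^-1 * (x * g x * pdf x).
have iq : lebesgue_measure.-integrable setT (EFin \o q).
  have := integrableB measurableT i1 (integrableZl measurableT (s ^+ 2)^-1 i2).
  by apply: eq_integrable => // x _.
have Eq : \int[lebesgue_measure]_x q x =
    \int[law]_x g' x - (s ^+ 2)^-1 * \int[law]_x (x * g x).
  rewrite !Rintegral_normal// -RintegralZl// -RintegralB//.
  have := integrableZl measurableT (s ^+ 2)^-1 i2.
  by apply: eq_integrable => // x _.
suff : \int[lebesgue_measure]_x q x = 0.
  rewrite Eq => /eqP; rewrite subr_eq0 => /eqP ->; rewrite mulrA divff ?mul1r//.
  by rewrite gt_eqF// exprn_gt0.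
have dG (x : R) : is_derive x 1 (fun x => g x * pdf x) (q x).
  have := is_derive_mul (dg x) (is_derive_pdf x).
  by move=> h; apply: (is_derive_eq h); rewrite /q; ring.
have cpdf : continuous pdf := is_derive_continuous is_derive_pdf.
have cq : continuous q.
  move=> x; apply: cvgB; first exact: cvgM (cg' x) (cpdf x).
  apply: cvgM; first exact: cvg_cst.
  by apply: cvgM (cpdf x); apply: cvgM (cg x); exact: cvg_id.
have [M HM] := pdf_poly_bounded xgC.
have cv0 : \int[lebesgue_measure]_(x in `[- n%:R, n%:R]) q x @[n --> \oo] --> (0 : R).
  apply/cvgrPdist_le => e e0; near=> n.
  have n0 : 0 < n%:R :> R by near: n; exact: nbhs_infty_gtr.
  rewrite sub0r normrN (is_derive_FTC _ (fun x _ => dG x))//; last by rewrite ge0_cp// ltW.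
  (* Bounding [x * g x * pdf x] instead of [g x * pdf x] gains the factor 1 / n at the end
     points. *)
  have b x : `|x| = n%:R -> `|g x * pdf x| <= M / n%:R.
    move=> xn; rewrite ler_pdivlMr// mulrC normrM (ger0_norm (normal_pdf_ge0 _ _ _)).
    by rewrite mulrA -xn -normrM.
  rewrite (le_trans (ler_normB _ _))// (le_trans (lerD (b n%:R _) (b (- n%:R) _)))//.
  - by rewrite ger0_norm// ltW.
  - by rewrite normrN ger0_norm// ltW.
  - rewrite -mulr2n -mulrnAl ler_pdivrMr// mulrC -ler_pdivrMr//.
    by near: n; exact: nbhs_infty_ger.
by have := cvg_unique _ (cvg_Rintegral_symmetric iq) cv0; apply.
Unshelve. all: by end_near. Qed.

End NormalMoments.

Section NormalCharacteristic.
Context {R : realType}.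
Variable s : R.
Hypothesis s0 : 0 < s.
Local Notation law := (normal_prob (0 : R) s).

Lemma is_derive_cos_affine (u c x : R) :
  is_derive x 1 (fun y => cos (u * y + c)) (- (u * sin (u * x + c))).
Proof.
have h : is_derive x 1 (fun y => cos (u * y + c)) (- sin (u * x + c) * (u * 1 + 0)).
  by apply: is_derive_comp; apply: is_derive_add; apply: is_derive_scale.
by apply: (is_derive_eq h); ring.
Qed.

Lemma is_derive_sin_affine (u c x : R) :
  is_derive x 1 (fun y => sin (u * y + c)) (u * cos (u * x + c)).
Proof.
have h : is_derive x 1 (fun y => sin (u * y + c)) (cos (u * x + c) * (u * 1 + 0)).
  by apply: is_derive_comp; apply: is_derive_add; apply: is_derive_scale.
by apply: (is_derive_eq h); ring.
Qed.

Lemma continuous_cos_affine (u c : R) : continuous (fun y : R => cos (u * y + c)).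
Proof. exact: is_derive_continuous (is_derive_cos_affine u c). Qed.

Lemma continuous_sin_affine (u c : R) : continuous (fun y : R => sin (u * y + c)).
Proof. exact: is_derive_continuous (is_derive_sin_affine u c). Qed.

(** By Stein's identity the left side [psi u] solves psi' = - s^2 u psi, so its product with exp
    (s^2 u^2 / 2) is constant and is evaluated at 0. The second moment pays for differentiating
    under the integral. *)
Lemma normal_cos (u c : R) :
  \int[law]_x cos (u * x + c) = cos c * expR (- (s ^+ 2 * u ^+ 2 / 2)).
Proof.
have mcos v : measurable_fun setT (fun x : R => cos (v * x + c)).
  by apply: continuous_measurable_fun; exact: continuous_cos_affine.
have msin v : measurable_fun setT (fun x : R => sin (v * x + c)).
  by apply: continuous_measurable_fun; exact: continuous_sin_affine.
have icos v : law.-integrable setT (EFin \o (fun x : R => cos (v * x + c))).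
  exact: (@integrable_bounded _ _ _ (normal_prob (0 : R) s) _ 1 (mcos v) (fun x => cos_max _)).
have mxsin v : measurable_fun setT (fun x : R => x * sin (v * x + c)).
  exact: measurable_funM.
have ixsin v : law.-integrable setT (EFin \o (fun x : R => x * sin (v * x + c))).
  apply: (@integrable_normal _ _ s0 _ 1 1%N) => [|x]; first exact: mxsin.
  rewrite normrM mul1r expr1 (@le_trans _ _ `|x|) ?lerDr//.
  by rewrite -[leRHS]mulr1 ler_wpM2l// sin_max.
have ix2 : law.-integrable setT (EFin \o (fun x : R => x ^+ 2)).
  apply: (@integrable_normal _ _ s0 _ 1 2%N) => [|x]; first exact: exprn_measurable.
  by rewrite normrX mul1r lerDr.
pose psi (v : R) : R := \int[law]_x cos (v * x + c).
have stein (v : R) : \int[law]_x (x * sin (v * x + c)) = s ^+ 2 * (v * psi v).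
  rewrite -RintegralZl//.
  apply: (@normal_stein _ _ s0 (fun x => sin (v * x + c)) _ (1 + `|v|) 0%N).
  - by move=> x; exact: is_derive_sin_affine.
  - move=> x; apply: cvgM; first exact: cvg_cst.
    exact: continuous_cos_affine.
  - move=> x; rewrite expr0 (le_trans (sin_max _))//.
    by have := normr_ge0 v; lra.
  - move=> x; rewrite expr0 normrM.
    have := ler_wpM2l (normr_ge0 v) (cos_max (v * x + c)).
    by have := normr_ge0 v; lra.
have dpsi (v : R) : is_derive v 1 psi (- (s ^+ 2 * (v * psi v))).
  rewrite -stein; apply: (@quadratic_is_derive _ _ _ _ (3 * \int[law]_x (x ^+ 2))) => w.
  rewrite mulrN opprK /psi -RintegralB// -RintegralZl//.
  rewrite -RintegralD//; first last.
    have := integrableZl measurableT (w - v) (ixsin v).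
    by apply: eq_integrable => // x _.
    have := integrableB measurableT (icos w) (icos v).
    by apply: eq_integrable => // x _.
  rewrite -RintegralZl// -RintegralZr//; last first.
    have := integrableZl measurableT 3 ix2.
    by apply: eq_integrable => // x _.
  apply: Rintegral_norm_le.
  - have i1 := integrableB measurableT (icos w) (icos v).
    have := integrableD measurableT i1 (integrableZl measurableT (w - v) (ixsin v)).
    by apply: eq_integrable => // x _.
  - have := integrableZr measurableT ((w - v) ^+ 2) (integrableZl measurableT 3 ix2).
    by apply: eq_integrable => // x _.
  apply: aeW => x.
  have := cos_quadratic_remainder (v * x + c) (w * x + c).
  have -> : w * x + c - (v * x + c) = (w - v) * x by ring.
  rewrite exprMn => h; rewrite mulrA (le_trans h)//.
  by rewrite -mulrA [x ^+ 2 * _]mulrC.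
have dE (v : R) : is_derive v 1 (fun v : R => expR (s ^+ 2 / 2 * v ^+ 2))
    (s ^+ 2 * v * expR (s ^+ 2 / 2 * v ^+ 2)).
  have h : is_derive v 1 (fun v : R => expR (s ^+ 2 / 2 * v ^+ 2))
    (expR (s ^+ 2 / 2 * v ^+ 2) * (s ^+ 2 / 2 * (2%:R * v ^+ 1 * 1))).
    by apply: is_derive_comp; apply: is_derive_scale; exact: is_derive_pow.
  by apply: (is_derive_eq h); field.
have d0 (v : R) : is_derive v 1 (fun v : R => expR (s ^+ 2 / 2 * v ^+ 2) * psi v) 0.
  have h := is_derive_mul (dE v) (dpsi v).
  by apply: (is_derive_eq h); ring.
have := is_derive_eq0_cst d0 u 0.
rewrite expr0n/= mulr0 expR0 mul1r => h.
have psiE : psi u = cos c * (expR (s ^+ 2 / 2 * u ^+ 2))^-1.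
  have E0 : expR (s ^+ 2 / 2 * u ^+ 2) != 0 by rewrite gt_eqF// expR_gt0.
  apply: (mulfI E0); rewrite h mulrCA mulfV// mulr1 /psi.
  under eq_Rintegral do rewrite mul0r add0r.
  by rewrite Rintegral_prob_cst.
by transitivity (psi u) => //; rewrite psiE -expRN; congr (_ * expR _); field.
Qed.

(** The double factorial (2 j - 1)!!, which is the moment of order 2 j of the standard normal
    law. *)
Definition gauss_moment (j : nat) : R := \prod_(i < j) (2 * i%:R + 1).

(** Stein's identity for the monomial of degree n + 1. *)
Lemma normal_moment_rec n :
  \int[law]_x (x ^+ n.+2) = s ^+ 2 * (n.+1%:R * \int[law]_x (x ^+ n)).
Proof.
have ix m : law.-integrable setT (EFin \o (fun x : R => x ^+ m)).
  apply: (@integrable_normal _ _ s0 _ 1 m) => [|x]; first exact: exprn_measurable.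
  by rewrite normrX mul1r lerDr.
rewrite -RintegralZl//.
have pn (x : R) (m : nat) : (m <= n.+1)%N -> `|x| ^+ m <= 1 + `|x| ^+ n.+1.
  move=> mn; have [x1|/ltW x1] := leP `|x| 1.
    by rewrite (@le_trans _ _ 1) ?exprn_ile1// lerDl exprn_ge0.
  by rewrite (@le_trans _ _ (`|x| ^+ n.+1)) ?lerDr// ler_weXn2l.
have dg (x : R) : is_derive x 1 (fun x => x ^+ n.+1) (n.+1%:R * x ^+ n).
  have := @is_derive_pow _ x id n.+1 1 (is_derive_id _ _).
  by rewrite mulr1.
have cg : continuous (fun x : R => n.+1%:R * x ^+ n).
  by move=> x; apply: cvgM; [exact: cvg_cst|exact: exprn_continuous].
have <- := @normal_stein _ _ s0 _ _ n.+1%:R n.+1 dg cg.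
- by apply: eq_Rintegral => x _; rewrite -exprS.
- move=> x; rewrite normrX (le_trans (pn x n.+1 _))//.
  by rewrite ler_peMl ?ler1n// addr_ge0// exprn_ge0.
- by move=> x; rewrite normrM normrX ger0_norm// ler_wpM2l// pn.
Qed.

Lemma normal_moment_even j : \int[law]_x (x ^+ j.*2) = gauss_moment j * s ^+ j.*2.
Proof.
elim: j => [|j IH].
  under eq_Rintegral do rewrite expr0.
  by rewrite Rintegral_prob_cst /gauss_moment big_ord0 mul1r.
rewrite doubleS normal_moment_rec IH /gauss_moment big_ord_recr/=.
rewrite (exprD s 2 j.*2 : s ^+ j.*2.+2 = _) -natr1 -mul2n natrM; ring.
Qed.

Lemma normal_moment_odd j : \int[law]_x (x ^+ j.*2.+1) = 0.
Proof.
elim: j => [|j IH]; last by rewrite doubleS normal_moment_rec IH !mulr0.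
have dg (x : R) : is_derive x 1 (fun=> 1 : R) 0 by exact: (@is_derive_cst _ _ _ (1 : R) x 1).
have cg : continuous ((fun=> 0) : R -> R) by exact: cst_continuous.
transitivity (\int[law]_x (x * 1)).
  by apply: eq_Rintegral => x _; rewrite mulr1 expr1.
rewrite (@normal_stein _ _ s0 _ _ 1 0%N dg cg).
- by rewrite Rintegral_prob_cst mulr0.
- by move=> x; rewrite normr1 expr0 mul1r lerDl.
- by move=> x; rewrite normr0 expr0 mul1r addr_ge0.
Qed.

End NormalCharacteristic.

Section NormalLaw.
Context d (Om : measurableType d) (R : realType) (P : probability Om R).
Implicit Types (U : Om -> R).

Lemma normal_lawP U (v : R) : 0 < v -> normal_law P U 0 v ->
  forall C, measurable C -> P (U @^-1` C) = normal_prob 0 (Num.sqrt v) C.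
Proof. by move=> v0 [_ _ UE] C mC; rewrite UE// gt_eqF. Qed.

Lemma normal_law_integral U (v : R) (f : R -> R) : 0 < v -> normal_law P U 0 v ->
  measurable_fun setT f -> P.-integrable setT (EFin \o (fun w => f (U w))) ->
  'Ex_P (fun w => f (U w)) = \int[normal_prob 0 (Num.sqrt v)]_x f x.
Proof.
move=> v0 UN mf fi; have [_ mU _] := UN; rewrite /Rintegral.
rewrite (@integral_law _ _ _ _ _ P (normal_prob 0 (Num.sqrt v)) U mU _ (EFin \o f))//.
- exact: normal_lawP.
- exact/measurable_EFinP.
Qed.

Lemma normal_law_integrable_exp U (v : R) n : 0 < v -> normal_law P U 0 v ->
  P.-integrable setT (EFin \o (fun w => U w ^+ n)).
Proof.
move=> v0 UN; have [_ mU _] := UN.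
apply/(@integrable_law _ _ _ _ _ P (normal_prob 0 (Num.sqrt v)) U mU _ (fun x => (x ^+ n)%:E)).
- exact: normal_lawP.
- by apply/measurable_EFinP; exact: exprn_measurable.
apply: (@integrable_normal _ _ _ (fun x => x ^+ n) 1 n); first by rewrite sqrtr_gt0.
- exact: exprn_measurable.
- by move=> x; rewrite normrX mul1r lerDr.
Qed.

Lemma normal_law_even U (v : R) j : 0 < v -> normal_law P U 0 v ->
  'Ex_P (fun w => U w ^+ j.*2) = gauss_moment j * v ^+ j.
Proof.
move=> v0 UN; rewrite (@normal_law_integral _ _ (fun x => x ^+ j.*2) v0 UN).
- by rewrite normal_moment_even ?sqrtr_gt0// -mul2n exprM sqr_sqrtr// ltW.
- exact: exprn_measurable.
- exact: normal_law_integrable_exp UN.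
Qed.

Lemma normal_law_odd U (v : R) j : 0 < v -> normal_law P U 0 v ->
  'Ex_P (fun w => U w ^+ j.*2.+1) = 0.
Proof.
move=> v0 UN; rewrite (@normal_law_integral _ _ (fun x => x ^+ j.*2.+1) v0 UN).
- by rewrite normal_moment_odd ?sqrtr_gt0.
- exact: exprn_measurable.
- exact: normal_law_integrable_exp UN.
Qed.

Lemma measurable_cos_affine U (u c : R) : measurable_fun setT U ->
  measurable_fun setT (fun w => cos (u * U w + c)).
Proof.
move=> mU; apply: (measurableT_comp (f := fun x : R => cos (u * x + c))) => //.
by apply: continuous_measurable_fun; exact: continuous_cos_affine.
Qed.

Lemma integrable_cos_affine U (u c : R) : measurable_fun setT U ->
  P.-integrable setT (EFin \o (fun w => cos (u * U w + c))).
Proof.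
move=> mU; apply: (@integrable_bounded _ _ _ _ _ 1); first exact: measurable_cos_affine.
by move=> w; exact: cos_max.
Qed.

(** Variance 0 is included, where the law is a Dirac mass; later limits of variances may
    degenerate. *)
Lemma normal_law_cos U (v u c : R) : normal_law P U 0 v ->
  'Ex_P (fun w => cos (u * U w + c)) = cos c * expR (- (u ^+ 2 * v / 2)).
Proof.
move=> UN; have [v0 mU UE] := UN; have [v00|vn0] := eqVneq v 0; last first.
  have vp : 0 < v by rewrite lt_def vn0.
  rewrite (@normal_law_integral _ _ (fun x => cos (u * x + c)) vp UN).
  - rewrite normal_cos ?sqrtr_gt0//; congr (_ * expR _).
    by rewrite sqr_sqrtr// mulrC [v * _]mulrC mulrC.
  - by apply: continuous_measurable_fun; exact: continuous_cos_affine.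
  - exact: integrable_cos_affine.
rewrite v00 mulr0 mul0r oppr0 expR0 mulr1.
have lawU C : measurable C -> P (U @^-1` C) = dirac (0 : R) C.
  by move=> mC; rewrite UE// v00 eqxx.
have mc : measurable_fun setT (fun x : R => (cos (u * x + c))%:E).
  by apply/measurable_EFinP; apply: continuous_measurable_fun; exact: continuous_cos_affine.
rewrite /Rintegral (@integral_law _ _ _ _ _ P (dirac (0 : R)) U mU lawU _ mc).
  by rewrite integral_dirac// diracT mul1e/= mulr0 add0r.
exact: integrable_cos_affine.
Qed.

End NormalLaw.

(** * Trigonometric approximation *)

Section MatrixNorm.
Context {R : realType} {m n : nat}.
Implicit Types x y : 'M[R]_(m, n).

Lemma mxnorm_entry x i j : `|x i j| <= `|x|.
Proof.
rewrite [leRHS]/Num.norm/= mx_normrE.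
exact: (@le_bigmax _ _ _ 0 (fun ij : 'I_m * 'I_n => `|x ij.1 ij.2|) (i, j)).
Qed.

Lemma mxnorm_le x (K : R) : 0 <= K -> (forall i j, `|x i j| <= K) -> `|x| <= K.
Proof.
move=> K0 xK; rewrite [leLHS]/Num.norm/= mx_normrE; by apply: bigmax_le.
Qed.

End MatrixNorm.

Lemma mxnorm_tr (R : realType) m n (x : 'M[R]_(m, n)) : `|x^T| = `|x|.
Proof.
apply/eqP; rewrite eq_le; apply/andP; split; apply: mxnorm_le => // i j.
  by rewrite mxE mxnorm_entry.
by have := mxnorm_entry x^T j i; rewrite mxE.
Qed.

Lemma continuous_trmx (R : realType) m n : continuous (@trmx R m n).
Proof.
move=> x A /nbhs_ballP[e e0 sA]; apply/nbhs_ballP; exists e => // y xy.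
apply: sA; move: xy; rewrite -!ball_normE/=.
by rewrite -linearB/= mxnorm_tr.
Qed.

(** * Uniform continuity, trigonometric polynomials and Bernstein weights *)

Section TrigonometricApproximation.
Context {R : realType} {d : nat}.
Implicit Types (f g : 'cV[R]_d -> R) (x y : 'cV[R]_d).

(** Heine's theorem through near coverings. The transposition moves the ball to row vectors, where
    [bounded_closed_compact] applies. *)
Lemma uniform_continuity_ball f (K e : R) : continuous f -> 0 < e ->
  exists2 delta : R, 0 < delta &
    forall x y, `|x| <= K -> `|x - y| < delta -> `|f x - f y| <= e.
Proof.
move=> cf e0; pose A : set 'rV[R]_d := [set x | `|x| <= K].
have cA : compact A.
  apply: bounded_closed_compact.
    exists K; split; first exact: num_real.
    by move=> M KM x /= xK; rewrite (le_trans xK)// ltW.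
  have -> : A = (fun x : 'rV[R]_d => `|x|) @^-1` [set r | r <= K] by [].
  apply: preimage_closed; last exact: closed_le.
  by apply: in1W => x; exact: norm_continuous.
pose P (r : R) (x : 'rV[R]_d) := forall y : 'rV[R]_d, `|x - y| < r -> `|f x^T - f y^T| <= e.
have /compact_near_coveringP/(_ _ (0 : R)^'+ P) := cA.
have h : forall x : 'rV[R]_d, A x -> \forall x' \near x & i \near (0 : R)^'+, P i x'.
  move=> x _.
  have cfx : (fun z : 'rV[R]_d => f z^T) z @[z --> x] --> f x^T.
    by apply: continuous_comp; [exact: continuous_trmx|exact: cf].
  have e20 : 0 < e / 2 by rewrite divr_gt0.
  have /cvgrPdist_le/(_ _ e20)/nbhs_ballP[r /= r0 Hr] := cfx.
  have r20 : 0 < r / 2 by rewrite divr_gt0.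
  exists (ball x (r / 2), [set t : R | t < r / 2]).
    split; first exact: nbhsx_ballx.
    exact: nbhs_right_lt.
  move=> [x' t] [/= xx' tr] y x'y.
  have h1 : `|f x^T - f x'^T| <= e / 2.
    by apply: Hr; apply: le_ball xx'; lra.
  have h2 : `|f x^T - f y^T| <= e / 2.
    apply: Hr; rewrite -ball_normE/=.
    move: xx'; rewrite -ball_normE/= => xx'.
    rewrite (le_lt_trans (ler_distD x' _ _))//.
    by have := lt_trans x'y tr; lra.
  rewrite (le_trans (ler_distD (f x^T) _ _))// distrC; lra.
move=> /(_ _ h) H.
have [r /= r0 Hr] : exists2 r : R, 0 < r & A `<=` P r.
  have : \forall r \near (0 : R)^'+, 0 < r /\ A `<=` P r.
    by near=> r; split; [near: r; exact: nbhs_right_gt|near: r; exact: H].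
  by move=> /filter_ex[r [r0 Ar]]; exists r.
exists r => // x y xK xy.
have := Hr x^T; rewrite /A/= mxnorm_tr => /(_ xK y^T).
by rewrite -linearB/= mxnorm_tr !trmxK; exact.
Unshelve. all: by end_near. Qed.

Definition dotc (u x : 'cV[R]_d) : R := (u^T *m x) 0 0.

Lemma dotcE u x : dotc u x = \sum_i u i 0 * x i 0.
Proof. by rewrite /dotc mxE; apply: eq_bigr => i _; rewrite mxE. Qed.

Lemma dotcDl u v x : dotc (u + v) x = dotc u x + dotc v x.
Proof. by rewrite /dotc linearD/= mulmxDl mxE. Qed.

Lemma dotcNl u x : dotc (- u) x = - dotc u x.
Proof. by rewrite /dotc linearN/= mulNmx mxE. Qed.

(** The phase [c] covers sines as well. Any statement linear in the function follows by induction
    from the case of one cosine. *)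
Inductive trigpoly : ('cV[R]_d -> R) -> Prop :=
| trigpoly_cos u c : trigpoly (fun x => cos (dotc u x + c))
| trigpoly_lin a f b g : trigpoly f -> trigpoly g ->
    trigpoly (fun x => a * f x + b * g x).

Lemma trigpoly_ext f g : (forall x, f x = g x) -> trigpoly f -> trigpoly g.
Proof. by move=> fg; have -> : g = f by exact/funext. Qed.

Lemma trigpoly_cst c : trigpoly (fun=> c).
Proof.
apply: (@trigpoly_ext (fun x => c * cos (dotc 0 x + 0) + 0 * cos (dotc 0 x + 0))).
  by move=> x; rewrite /dotc trmx0 mul0mx mxE addr0 cos0; ring.
by apply: trigpoly_lin; exact: trigpoly_cos.
Qed.

Lemma trigpolyD f g : trigpoly f -> trigpoly g -> trigpoly (fun x => f x + g x).
Proof.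
move=> tf tg; apply: (trigpoly_ext _ (trigpoly_lin 1 1 tf tg)) => x.
by rewrite !mul1r.
Qed.

(** Products of cosines turn into sums, so the class is an algebra and contains polynomials in
    cosines of the coordinates. *)
Lemma trigpolyM f g : trigpoly f -> trigpoly g -> trigpoly (fun x => f x * g x).
Proof.
move=> tf tg; elim: tf => [u c|a f1 b f2 _ IH1 _ IH2]; last first.
  by apply: (trigpoly_ext _ (trigpoly_lin a b IH1 IH2)) => x; ring.
elim: tg => [v c'|a g1 b g2 _ IH1 _ IH2]; last first.
  by apply: (trigpoly_ext _ (trigpoly_lin a b IH1 IH2)) => x; ring.
apply: (trigpoly_ext _ (trigpoly_lin (2^-1) (2^-1)
  (trigpoly_cos (u + v) (c + c')) (trigpoly_cos (u - v) (c - c')))) => x.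
rewrite !dotcDl dotcNl.
have -> : dotc u x + dotc v x + (c + c') = (dotc u x + c) + (dotc v x + c') by ring.
have -> : dotc u x - dotc v x + (c - c') = (dotc u x + c) - (dotc v x + c') by ring.
by rewrite cosB cosD; field.
Qed.

Lemma trigpolyX f n : trigpoly f -> trigpoly (fun x => f x ^+ n).
Proof.
move=> tf; elim: n => [|n IH].
  by apply: (trigpoly_ext _ (trigpoly_cst 1)) => x; rewrite expr0.
by apply: (trigpoly_ext _ (trigpolyM tf IH)) => x; rewrite exprS.
Qed.

Lemma trigpoly_sum (I : Type) (r : seq I) (f : I -> 'cV[R]_d -> R) :
  (forall i, trigpoly (f i)) -> trigpoly (fun x => \sum_(i <- r) f i x).
Proof.
move=> tf; elim: r => [|i r IH].
  by apply: (trigpoly_ext _ (trigpoly_cst 0)) => x; rewrite big_nil.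
by apply: (trigpoly_ext _ (trigpolyD (tf i) IH)) => x; rewrite big_cons.
Qed.

Lemma trigpoly_prod (I : Type) (r : seq I) (f : I -> 'cV[R]_d -> R) :
  (forall i, trigpoly (f i)) -> trigpoly (fun x => \prod_(i <- r) f i x).
Proof.
move=> tf; elim: r => [|i r IH].
  by apply: (trigpoly_ext _ (trigpoly_cst 1)) => x; rewrite big_nil.
by apply: (trigpoly_ext _ (trigpolyM (tf i) IH)) => x; rewrite big_cons.
Qed.

(* Tensor Bernstein polynomials evaluated at [(1 + cos) / 2] are trigonometric
   polynomials bounded by the sup norm of the approximated function, also
   outside the ball on which they approximate it. *)
Definition bernstein (n : nat) (t : R) (k : nat) : R :=
  'C(n, k)%:R * t ^+ k * (1 - t) ^+ (n - k).

(** Pascal's rule: the expectation under a binomial law is computed by conditioning on one more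
    trial. Mass and variance follow by induction from it. *)
Lemma bernstein_sumS n t (phi : nat -> R) :
  \sum_(k < n.+2) bernstein n.+1 t k * phi k =
  (1 - t) * \sum_(k < n.+1) bernstein n t k * phi k +
  t * \sum_(k < n.+1) bernstein n t k * phi k.+1.
Proof.
rewrite big_ord_recl/= {1}/bernstein bin0 subn0 expr0 !mul1r.
have -> : \sum_(i < n.+1) bernstein n.+1 t (bump 0 i) * phi (bump 0 i) =
   \sum_(i < n.+1) (1 - t) * ('C(n, i.+1)%:R * t ^+ i.+1 * (1 - t) ^+ (n - i.+1) * phi i.+1) +
   t * \sum_(i < n.+1) bernstein n t i * phi i.+1.
  rewrite mulr_sumr -big_split/=; apply: eq_bigr => i _.
  rewrite /bump/= add1n /bernstein binS natrD subSS exprS.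
  have [|] := ltnP i n => ni; first by rewrite -(@subnSK i n)// [(1 - t) ^+ _.+1]exprS; ring.
  by rewrite bin_small//; ring.
rewrite addrA; congr (_ + _); rewrite big_ord_recr/= bin_small// !mul0r mulr0 addr0.
rewrite [in RHS]big_ord_recl/= {1}/bernstein bin0 subn0 expr0 !mul1r mulrDr mulrA -exprS.
by congr (_ + _); rewrite mulr_sumr; apply: eq_bigr => i _; rewrite /bump/= add1n.
Qed.

Lemma bernstein_sum1 n t : \sum_(k < n.+1) bernstein n t k = 1.
Proof.
elim: n => [|n IH].
  by rewrite big_ord1 /bernstein bin0 !expr0 !mulr1.
have := bernstein_sumS n t (fun=> 1).
under eq_bigr do rewrite mulr1; move=> ->.
under eq_bigr do rewrite mulr1.
by rewrite IH; ring.
Qed.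

(** The shift [a] is what makes the induction close, since one more trial moves the centre by [- t]
    or [1 - t]. *)
Lemma bernstein_variance n t a :
  \sum_(k < n.+1) bernstein n t k * (k%:R + a - n%:R * t) ^+ 2 =
  n%:R * t * (1 - t) + a ^+ 2.
Proof.
elim: n a => [|n IH] a.
  by rewrite big_ord1 /bernstein/= bin0 subnn !expr0; ring.
rewrite (bernstein_sumS n t (fun k => (k%:R + a - n.+1%:R * t) ^+ 2)).
have -> : \sum_(k < n.+1) bernstein n t k * (k%:R + a - n.+1%:R * t) ^+ 2 =
   n%:R * t * (1 - t) + (a - t) ^+ 2.
  rewrite -IH; apply: eq_bigr => k _; congr (_ * _ ^+ 2).
  by rewrite -[n.+1%:R]natr1; ring.
have -> : \sum_(k < n.+1) bernstein n t k * (k.+1%:R + a - n.+1%:R * t) ^+ 2 =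
   n%:R * t * (1 - t) + (a + 1 - t) ^+ 2.
  rewrite -IH; apply: eq_bigr => k _; congr (_ * _ ^+ 2).
  by rewrite -[n.+1%:R]natr1 -[k.+1%:R]natr1; ring.
by rewrite -[n.+1%:R]natr1; ring.
Qed.

Lemma bernstein_ge0 n t k : 0 <= t <= 1 -> 0 <= bernstein n t k.
Proof.
by move=> /andP[t0 t1]; rewrite !mulr_ge0 ?exprn_ge0// subr_ge0.
Qed.

(** Quantifies the injectivity of the cosine on [0, pi]: in half angles p, q the difference of the
    two sides is 4 sin (p - q) cos p sin q, a product of nonnegative factors when b <= a. *)
Lemma cos_dist_ge (a b : R) : 0 <= a <= pi -> 0 <= b <= pi ->
  1 - cos (a - b) <= `|cos a - cos b|.
Proof.
have key : forall a b : R, 0 <= b -> b <= a -> a <= pi -> 1 - cos (a - b) <= `|cos a - cos b|.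
  move=> {a b} a b b0 ba api.
  rewrite distrC (le_trans _ (ler_norm _))// -subr_ge0.
  pose p := a / 2; pose q := b / 2.
  have -> : cos b - cos a - (1 - cos (a - b)) = 4 * (sin (p - q) * (cos p * sin q)).
    have -> : a = p + p by rewrite /p; field.
    have -> : b = q + q by rewrite /q; field.
    have -> : p + p - (q + q) = (p - q) + (p - q) by ring.
    rewrite !cosD !sinD !cosN !sinN.
    have hp := cos2Dsin2 p; have hq := cos2Dsin2 q.
    have E1 : (cos p ^+ 2 + sin p ^+ 2) * (cos q ^+ 2 + sin q ^+ 2) = 1.
      by rewrite hp hq mulr1.
    have E2 : sin p ^+ 2 * (cos q ^+ 2 + sin q ^+ 2) = sin p ^+ 2.
      by rewrite hq mulr1.
    have E3 : sin q ^+ 2 * (cos p ^+ 2 + sin p ^+ 2) = sin q ^+ 2.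
      by rewrite hp mulr1.
    lra.
  have pi0 := pi_gt0 R.
  rewrite mulr_ge0// mulr_ge0//; first by apply: sin_ge0_pi; rewrite /p /q; lra.
  rewrite mulr_ge0//; last by apply: sin_ge0_pi; rewrite /q; lra.
  by apply: cos_ge0_pihalf; rewrite /p; lra.
move=> /andP[a0 api] /andP[b0 bpi]; have [ba|/ltW ab] := leP b a; first exact: key.
by rewrite -cosN opprB distrC key.
Qed.

End TrigonometricApproximation.

(** * Approximation on a ball by bounded trigonometric polynomials *)

Section TrigApprox.
Context {R : realType} {d : nat}.
Variables (f : 'cV[R]_d -> R) (K B : R).
Hypotheses (cf : continuous f) (K0 : 0 < K).
Hypothesis fB : forall x, `|x| <= K -> `|f x| <= B.

(** The affine map [ang] sends [-K, K] onto [0, pi], where the cosine is injective, and [tt] takes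
    values in [0, 1] at every real, so that Bernstein weights remain weights outside the ball. *)
Let lam : R := pi / (2 * K).
Let ang (r : R) : R := lam * r + pi / 2.
Let tt (r : R) : R := (1 + cos (ang r)) / 2.
Let lam0 : 0 < lam. Proof. by rewrite divr_gt0 ?pi_gt0// mulr_gt0. Qed.
Let lamK : lam * K = pi / 2.
Proof. by rewrite /lam invfM mulrA -mulrA mulVf ?mulr1// gt_eqF. Qed.

Let ang_itv r : `|r| <= K -> 0 <= ang r <= pi.
Proof.
rewrite ler_norml => /andP[h1 h2].
have := ler_wpM2l (ltW lam0) h1; have := ler_wpM2l (ltW lam0) h2.
by rewrite mulrN lamK /ang => *; apply/andP; split; lra.
Qed.

Let tt_itv r : 0 <= tt r <= 1.
Proof.
have h1 := cos_le1 (ang r); have h2 := cos_geN1 (ang r).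
by rewrite /tt; apply/andP; split; lra.
Qed.

Let B0 : 0 <= B. Proof. by apply: le_trans (fB (x := 0) _) => //; rewrite normr0 ltW. Qed.

Section BernsteinDegree.
Variable n : nat.
Hypothesis n0 : (0 < n)%N.

(** The point of [-K, K] at which [tt] equals k / n. *)
Let node (k : nat) : R := K * (2 * acos (2 * k%:R / n%:R - 1) / pi - 1).

Let nodeP (k : 'I_n.+1) : `|node k| <= K /\ cos (ang (node k)) = 2 * k%:R / n%:R - 1.
Proof.
have nr0 : 0 < n%:R :> R by rewrite ltr0n.
have kn : (k : nat)%:R <= n%:R :> R by rewrite ler_nat -ltnS.
have k0 : 0 <= (k : nat)%:R / n%:R :> R by rewrite divr_ge0.
have k1 : (k : nat)%:R / n%:R <= 1 :> R by rewrite ler_pdivrMr// mul1r.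
have itv : (-1 : R) <= 2 * (k : nat)%:R / n%:R - 1 <= (1 : R).
  by rewrite -[2 * _ / _]mulrA; apply/andP; split; lra.
have a0 := acos_ge0 itv; have api := acos_lepi itv; have pi0 := pi_gt0 R.
split.
  rewrite /node normrM gtr0_norm// -[leRHS]mulr1; apply: ler_wpM2l; first exact: ltW.
  rewrite ler_norml.
  have h1 : 0 <= 2 * acos (2 * (k : nat)%:R / n%:R - 1) / pi :> R.
    by rewrite divr_ge0 ?mulr_ge0// ltW.
  have h2 : 2 * acos (2 * (k : nat)%:R / n%:R - 1) / pi <= 2 :> R.
    by rewrite ler_pdivrMr// ler_wpM2l.
  by apply/andP; split; lra.
have -> : ang (node k) = acos (2 * (k : nat)%:R / n%:R - 1).
  have h (q A : R) : 0 < q -> q / 2 * (2 * A / q - 1) + q / 2 = A.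
    by move=> q0; field; rewrite gt_eqF.
  by rewrite /ang /node mulrA lamK h.
by rewrite acosK// in_itv.
Qed.

Let ynode (kap : {ffun 'I_d -> 'I_n.+1}) : 'cV[R]_d := \col_i node (kap i).

Let weight (x : 'cV[R]_d) (kap : {ffun 'I_d -> 'I_n.+1}) : R :=
  \prod_i bernstein n (tt (x i 0)) (kap i).

Let approx (x : 'cV[R]_d) := \sum_kap f (ynode kap) * weight x kap.

Let weight_ge0 x kap : 0 <= weight x kap.
Proof. by apply: prodr_ge0 => i _; apply: bernstein_ge0; exact: tt_itv. Qed.

Let weight_sum1 x : \sum_kap weight x kap = 1.
Proof.
rewrite /weight -(bigA_distr_bigA (fun i (k : 'I_n.+1) => bernstein n (tt (x i 0)) k)).
by apply: big1 => i _; exact: bernstein_sum1.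
Qed.

(** Under the product weights the coordinates are independent binomial variables, and the sums over
    the other coordinates equal 1. *)
Let weight_marginal x (q : nat -> R) (i0 : 'I_d) :
  \sum_kap weight x kap * q (kap i0) =
  \sum_(k < n.+1) bernstein n (tt (x i0 0)) k * q k.
Proof.
pose F (i : 'I_d) (k : 'I_n.+1) := bernstein n (tt (x i 0)) k * (if i == i0 then q k else 1).
transitivity (\sum_(kap : {ffun 'I_d -> 'I_n.+1}) \prod_i F i (kap i)).
  apply: eq_bigr => kap _; rewrite /F big_split/=; congr (_ * _).
  by rewrite -big_mkcond/= big_pred1_eq.
rewrite -(bigA_distr_bigA F) (bigD1 i0)//= [X in _ * X]big1 ?mulr1; last first.
  move=> i ii0; rewrite /F (negbTE ii0).
  by under eq_bigr do rewrite mulr1; exact: bernstein_sum1.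
by apply: eq_bigr => k _; rewrite /F eqxx.
Qed.

Let trigpoly_tt (i : 'I_d) : trigpoly (fun x : 'cV[R]_d => tt (x i 0)).
Proof.
apply: (trigpoly_ext _ (trigpoly_lin (2^-1) (2^-1) (trigpoly_cst 1)
  (trigpoly_cos (lam *: delta_mx i 0) (pi / 2)))) => x.
rewrite /tt /ang dotcE (bigD1 i)//= big1 ?addr0; last first.
  by move=> j ji; rewrite !mxE (negbTE ji)/= mulr0 mul0r.
by rewrite !mxE !eqxx/= !mulr1 [RHS]mulrC [RHS]mulrDr mulr1.
Qed.

Let trigpoly_approx : trigpoly approx.
Proof.
apply: trigpoly_sum => kap; apply: trigpolyM; first exact: trigpoly_cst.
apply: trigpoly_prod => i; rewrite /bernstein; apply: trigpolyM.
  by apply: trigpolyM; [exact: trigpoly_cst|exact: trigpolyX].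
apply: trigpolyX; apply: trigpolyD; first exact: trigpoly_cst.
have := trigpolyM (trigpoly_cst (-1)) (trigpoly_tt i).
by apply: trigpoly_ext => x; rewrite mulN1r.
Qed.

Let ynode_le kap : `|ynode kap| <= K.
Proof.
apply: mxnorm_le; first exact: ltW.
by move=> i j; rewrite mxE; have [] := nodeP (kap i).
Qed.

Let approx_le x : `|approx x| <= B.
Proof.
rewrite (le_trans (ler_norm_sum _ _ _))// -[leRHS]mulr1 -(weight_sum1 x) mulr_sumr.
apply: ler_sum => kap _; rewrite normrM (ger0_norm (weight_ge0 _ _)).
by rewrite ler_wpM2r// fB// ynode_le.
Qed.

(** Bernstein's argument: the error is an average of [f x - f y] over random nodes, and the
    quadratic term averages to a variance. The hypothesis measures distance by the cosines, the
    variables in which the variance is known. *)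
Lemma trig_approx_degree (e M : R) : 0 <= M ->
  (forall x y, `|x| <= K -> `|y| <= K -> `|f x - f y| <= e +
     M * \sum_i (cos (ang (y i 0)) - cos (ang (x i 0))) ^+ 2) ->
  exists p, [/\ trigpoly p, forall x, `|p x| <= B &
    forall x, `|x| <= K -> `|f x - p x| <= e + M * (d%:R / n%:R)].
Proof.
move=> M0 fM; exists approx; split => // x xK.
have nr0 : 0 < n%:R :> R by rewrite ltr0n.
have -> : f x - approx x = \sum_kap (f x - f (ynode kap)) * weight x kap.
  under [RHS]eq_bigr do rewrite mulrBl.
  by rewrite sumrB -mulr_sumr weight_sum1 mulr1.
rewrite (le_trans (ler_norm_sum _ _ _))//.
apply: (@le_trans _ _ (\sum_(kap : {ffun 'I_d -> 'I_n.+1}) (e + M * \sum_i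
   (cos (ang (node (kap i))) - cos (ang (x i 0))) ^+ 2) * weight x kap)).
  apply: ler_sum => kap _; rewrite normrM (ger0_norm (weight_ge0 _ _)).
  rewrite ler_wpM2r// (le_trans (fM _ _ xK (ynode_le kap)))//.
  by under eq_bigr do rewrite mxE.
under eq_bigr do rewrite mulrDl.
rewrite big_split/= -mulr_sumr weight_sum1 mulr1 lerD2l.
under eq_bigr do rewrite -mulrA.
rewrite -mulr_sumr ler_wpM2l//.
under eq_bigr do rewrite mulr_suml.
rewrite exchange_big/= [leRHS](_ : _ = \sum_(i < d) n%:R^-1); last first.
  by rewrite sumr_const card_ord mulr_natl.
apply: ler_sum => i _.
under eq_bigr => kap _.
  rewrite (nodeP (kap i)).2 mulrC; over.
rewrite (weight_marginal x (fun k => (2 * k%:R / n%:R - 1 - cos (ang (x i 0))) ^+ 2) i).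
set t := tt (x i 0).
have ct : cos (ang (x i 0)) = 2 * t - 1 by rewrite /t /tt; field.
have -> : \sum_(k < n.+1) bernstein n t k *
      (2 * (k : nat)%:R / n%:R - 1 - cos (ang (x i 0))) ^+ 2 =
    (4 / n%:R ^+ 2) * \sum_(k < n.+1) bernstein n t k * ((k : nat)%:R + 0 - n%:R * t) ^+ 2.
  rewrite mulr_sumr; apply: eq_bigr => k _; rewrite ct; field.
  by rewrite gt_eqF.
(* With the factor 4 from the change of variable, each coordinate contributes 4 t (1 - t) / n, which
   is at most 1 / n. *)
rewrite bernstein_variance expr0n/= addr0.
have -> : 4 / n%:R ^+ 2 * (n%:R * t * (1 - t)) = (4 * (t * (1 - t))) * n%:R^-1.
  by field; rewrite gt_eqF.
rewrite -[leRHS]mul1r; apply: ler_wpM2r; first by rewrite invr_ge0 ltW.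
have h (r : R) : 4 * (r * (1 - r)) <= 1 by have := sqr_ge0 (2 * r - 1); lra.
exact: h.
Qed.

End BernsteinDegree.

Lemma trig_approx (e : R) : 0 < e ->
  exists p, [/\ trigpoly p, forall x, `|p x| <= B &
    forall x, `|x| <= K -> `|f x - p x| <= e].
Proof.
move=> e0; have e20 : 0 < e / 2 by rewrite divr_gt0.
have [del del0 fdel] := uniform_continuity_ball K cf e20.
(* The cap [2 * K] keeps [lam * del1] in [0, pi], where the cosine decreases; halving [del] yields
   the strict inequality needed to find a coordinate. *)
pose del1 := Num.min (del / 2) (2 * K).
have del10 : 0 < del1 by rewrite lt_min divr_gt0// mulr_gt0.
have ld0 : 0 < lam * del1 by rewrite mulr_gt0.
have ldpi : lam * del1 <= pi.
  have : del1 <= 2 * K by rewrite ge_min lexx orbT.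
  by move=> /(ler_wpM2l (ltW lam0)); have := lamK; lra.
have pi0 := pi_gt0 R.
pose c := 1 - cos (lam * del1).
have c0 : 0 < c.
  have h1 : lam * del1 \in `[0, pi] by rewrite in_itv/= ldpi ltW.
  have h2 : (0 : R) \in `[0, pi] by rewrite in_itv/= lexx ltW.
  by rewrite subr_gt0 -(cos0 R) ltr_cos.
(* Points at distance at least [del] have some pair of cosines differing by at least [c], so the
   quadratic term then exceeds the trivial bound [2 * B]. *)
pose M := 2 * B / c ^+ 2.
have M0 : 0 <= M by rewrite divr_ge0 ?sqr_ge0// mulr_ge0.
have fM (x y : 'cV[R]_d) : `|x| <= K -> `|y| <= K -> `|f x - f y| <= e / 2 +
     M * \sum_i (cos (ang (y i 0)) - cos (ang (x i 0))) ^+ 2.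
  move=> xK yK.
  have S0 : 0 <= \sum_i (cos (ang (y i 0)) - cos (ang (x i 0))) ^+ 2.
    by apply: sumr_ge0 => i _; exact: sqr_ge0.
  have [xy|xy] := ltP `|x - y| del.
    by rewrite (le_trans (fdel _ _ xK xy))// lerDl mulr_ge0.
  have [i hi] : exists i, del1 <= `|x i 0 - y i 0|.
    apply: contrapT => /forallNP h; move: xy; apply/negP; rewrite -ltNge.
    apply: (@le_lt_trans _ _ (del / 2)); last by lra.
    apply: mxnorm_le => [|i j]; first by rewrite ltW// divr_gt0.
    rewrite (ord1 j) !mxE; have /negP := h i; rewrite -ltNge => /ltW/le_trans; apply.
    by rewrite ge_min lexx.
  have hx := ang_itv (le_trans (mxnorm_entry x i 0) xK).
  have hy := ang_itv (le_trans (mxnorm_entry y i 0) yK).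
  have hc : c <= `|cos (ang (y i 0)) - cos (ang (x i 0))|.
    rewrite distrC; apply: le_trans (cos_dist_ge hx hy).
    rewrite /c lerD2l lerN2.
    have -> : ang (x i 0) - ang (y i 0) = lam * (x i 0 - y i 0) by rewrite /ang; ring.
    have -> : cos (lam * (x i 0 - y i 0)) = cos (lam * `|x i 0 - y i 0|).
      by have [_|_] := ger0P (x i 0 - y i 0) => //; rewrite mulrN cosN.
    have hle : lam * del1 <= lam * `|x i 0 - y i 0| by rewrite ler_wpM2l// ltW.
    have hpi : lam * `|x i 0 - y i 0| <= pi.
      have : `|x i 0 - y i 0| <= 2 * K.
        rewrite (le_trans (ler_normB _ _))//.
        have := le_trans (mxnorm_entry x i 0) xK.
        by have := le_trans (mxnorm_entry y i 0) yK; lra.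
      by move=> /(ler_wpM2l (ltW lam0)); have := lamK; lra.
    move: hle; rewrite le_eqVlt => /predU1P[->//|hlt].
    rewrite ltW// ltr_cos// in_itv/=; apply/andP; split; lra.
  have : c ^+ 2 <= \sum_i (cos (ang (y i 0)) - cos (ang (x i 0))) ^+ 2.
    rewrite (bigD1 i)//= -[leLHS]addr0 lerD//; last first.
      by apply: sumr_ge0 => j _; exact: sqr_ge0.
    by rewrite -[leRHS]real_normK ?num_real// lerXn2r// nnegrE// ltW.
  move=> /(ler_wpM2l M0).
  have -> : M * c ^+ 2 = 2 * B by rewrite /M; field; rewrite gt_eqF.
  have := fB xK; have := fB yK; have := ler_normB (f x) (f y); lra.
pose n := (Num.truncn (M * d%:R / (e / 2))).+1.
have [p [tp pB ph]] := trig_approx_degree (ltn0Sn _ : 0 < n)%N M0 fM.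
exists p; split => // x xK; rewrite (le_trans (ph x xK))//.
suff : M * (d%:R / n%:R) <= e / 2 by lra.
have nr0 : 0 < n%:R :> R by rewrite ltr0n.
rewrite mulrA ler_pdivrMr// [leRHS]mulrC -ler_pdivrMr//.
by rewrite /n ltW// truncnS_gt.
Qed.

End TrigApprox.

(** * Uniqueness of characteristic functions *)

(** Dynkin's theorem as an induction principle. *)
Lemma sigma_algebra_dynkin_ind (T : Type) (G : set (set T)) (H : set T -> Prop) :
  setI_closed G -> (forall A, G A -> H A) -> H setT ->
  (forall A, H A -> H (~` A)) ->
  (forall F : nat -> set T, trivIset setT F -> (forall n, H (F n)) ->
     H (\bigcup_n F n)) ->
  forall A, <<s G >> A -> H A.
Proof.
move=> GI GH HT HC HU A; rewrite -setI_closed_g_dynkin_g_sigma_algebra//.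
have sub : <<d G>> `<=` H by apply: smallest_sub.
exact: sub.
Qed.

Lemma measurable_indic_comp d (Om : measurableType d) (R : realType) (U : Om -> R)
    (A : set R) : measurable_fun setT U -> measurable A ->
  measurable_fun setT (fun w => \1_A (U w) : R).
Proof.
move=> mU mA; have mUA : measurable (U @^-1` A).
  by rewrite -[X in measurable X]setTI; exact: mU.
by have : measurable_fun setT (\1_(U @^-1` A) : Om -> R) by exact: measurable_indic.
Qed.

Section WeightedTail.
Context d (Om : measurableType d) (R : realType) (P : probability Om R).
Variable U : Om -> R.
Hypothesis mU : measurable_fun setT U.

Lemma Rintegral_indic_le1 (A : set Om) : measurable A ->
  'Ex_P (\1_A : Om -> R) = fine (P A).
Proof. by move=> mA; rewrite /Rintegral integral_indic// setIT. Qed.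

Lemma tail_small (e : R) : 0 < e -> exists2 K : R, 0 < K &
  'Ex_P (\1_[set w | K < `|U w|] : Om -> R) <= e.
Proof.
move=> e0.
have mA (K : R) : measurable [set w | K < `|U w|] by exact: measurable_lt_norm.
have cv : 'Ex_P (\1_[set w | n%:R < `|U w|] : Om -> R) @[n --> \oo] --> 'Ex_P (fun=> 0 : R).
  apply: (@Rintegral_cvg_bounded _ _ _ _ _ _ 1) => //.
  - by move=> n; apply: aeW => w; rewrite indicE; case: (_ \in _); rewrite ?normr1 ?normr0.
  - apply: aeW => w; apply: cvg_near_cst; near=> n.
    rewrite indicE memNset//= => h; have : `|U w| <= n%:R by near: n; exact: nbhs_infty_ger.
    by rewrite leNgt h.
rewrite Rintegral_prob_cst in cv.
have /cvgrPdist_le/(_ _ e0) [N _ HN] := cv.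
exists N.+1%:R; first by rewrite ltr0n.
have := HN N.+1 (leqnSn _) => /=.
by rewrite sub0r normrN => /(le_trans (ler_norm _)).
Unshelve. all: by end_near. Qed.

Lemma integrable_weighted (xi : Om -> R) (f : R -> R) (B : R) :
  measurable_fun setT xi -> (forall w, 0 <= xi w <= 1) ->
  measurable_fun setT f -> (forall x, `|f x| <= B) ->
  P.-integrable setT (EFin \o (fun w => xi w * f (U w))).
Proof.
move=> mxi xi01 mf fB; apply: (@integrable_bounded _ _ _ _ _ B).
  by apply: measurable_funM => //; exact: measurableT_comp.
move=> w; have /andP[x0 x1] := xi01 w.
rewrite normrM ger0_norm// (le_trans (ler_wpM2l x0 (fB _)))//.
have B0 : 0 <= B := le_trans (normr_ge0 _) (fB 0).
by rewrite -[leRHS]mul1r ler_wpM2r.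
Qed.

(** The weight [xi] lets one argument serve two ends: the constant 1 yields uniqueness of laws, an
    indicator yields independence of an event. The supremum bound on [p] outside the ball is what
    controls the tail. *)
Lemma weighted_approx (xi : Om -> R) (f p : R -> R) (B K e : R) :
  measurable_fun setT xi -> (forall w, 0 <= xi w <= 1) ->
  measurable_fun setT f -> measurable_fun setT p -> 0 <= e ->
  (forall x, `|f x| <= B) -> (forall x, `|p x| <= B) ->
  (forall x, `|x| <= K -> `|f x - p x| <= e) ->
  `|'Ex_P (fun w => xi w * f (U w)) - 'Ex_P (fun w => xi w * p (U w))| <=
    e + 2 * B * 'Ex_P (\1_[set w | K < `|U w|] : Om -> R).
Proof.
move=> mxi xi01 mf mp e0 fB pB fp.
have B0 : 0 <= B := le_trans (normr_ge0 _) (fB 0).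
have i1 := integrable_weighted mxi xi01 mf fB.
have i2 := integrable_weighted mxi xi01 mp pB.
have mA : measurable [set w | K < `|U w|] by exact: measurable_lt_norm.
have iI : P.-integrable setT (EFin \o (\1_[set w | K < `|U w|] : Om -> R)).
  apply: (@integrable_bounded _ _ _ _ _ 1) => // w.
  by rewrite indicE; case: (_ \in _); rewrite ?normr1 ?normr0.
rewrite -RintegralB// -RintegralZl// -{1}(Rintegral_prob_cst P e) -RintegralD//; first last.
- have := integrableZl measurableT (2 * B) iI.
  by apply: eq_integrable => // w _.
- by apply: (@integrable_bounded _ _ _ _ _ `|e|).
apply: Rintegral_norm_le.
- have := integrableB measurableT i1 i2.
  by apply: eq_integrable => // w _.
- have ie : P.-integrable setT (EFin \o (fun=> e)).
    by apply: (@integrable_bounded _ _ _ _ _ `|e|).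
  have := integrableD measurableT ie (integrableZl measurableT (2 * B) iI).
  by apply: eq_integrable => // w _.
apply: aeW => w /=; rewrite -mulrBr normrM.
have /andP[x0 x1] := xi01 w; rewrite (ger0_norm x0).
have h : `|f (U w) - p (U w)| <= e + 2 * B * \1_[set w | K < `|U w|] w.
  rewrite indicE; have [UK|KU] := leP `|U w| K.
    by rewrite memNset/= ?mulr0 ?addr0 ?fp//; apply/negP; rewrite -leNgt.
  rewrite mem_set//= mulr1; have := fB (U w); have := pB (U w).
  by have := ler_normB (f (U w)) (p (U w)); lra.
by rewrite (le_trans (ler_wpM2l x0 h))// -[leRHS]mul1r ler_wpM2r// (le_trans _ h).
Qed.

End WeightedTail.

(** * Equality of weighted laws from equality of cosine expectations *)

Section WeightedUnique.
Context {R : realType}.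
Context d1 (O1 : measurableType d1) (P1 : probability O1 R).
Context d2 (O2 : measurableType d2) (P2 : probability O2 R).
Variables (U1 xi1 : O1 -> R) (U2 xi2 : O2 -> R).
Hypotheses (mU1 : measurable_fun setT U1) (mU2 : measurable_fun setT U2).
Hypotheses (mxi1 : measurable_fun setT xi1) (mxi2 : measurable_fun setT xi2).
Hypotheses (xi1P : forall w, 0 <= xi1 w <= 1) (xi2P : forall w, 0 <= xi2 w <= 1).
Hypothesis cosE : forall u c : R, 'Ex_P1 (fun w => xi1 w * cos (u * U1 w + c)) =
  'Ex_P2 (fun w => xi2 w * cos (u * U2 w + c)).

Let col1 (x : R) : 'cV[R]_1 := const_mx x.

Lemma trigpoly_cV1 (p : 'cV[R]_1 -> R) : trigpoly p ->
  [/\ continuous (fun x => p (col1 x)), exists B : R, forall x, `|p (col1 x)| <= B &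
   'Ex_P1 (fun w => xi1 w * p (col1 (U1 w))) = 'Ex_P2 (fun w => xi2 w * p (col1 (U2 w)))].
Proof.
elim=> [u c|a f b g _ [cf [B fB] Ef] _ [cg [B' gB] Eg]].
  have E x : cos (dotc u (col1 x) + c) = cos (u 0 0 * x + c).
    by rewrite dotcE big_ord1 mxE.
  split.
  - under eq_fun do rewrite E; exact: continuous_cos_affine.
  - by exists 1 => x; exact: cos_max.
  - under eq_Rintegral do rewrite E; rewrite cosE.
    by under [RHS]eq_Rintegral do rewrite E.
split.
- by move=> x; apply: cvgD; apply: cvgM; (try exact: cvg_cst); [exact: cf|exact: cg].
- exists (`|a| * B + `|b| * B') => x; rewrite (le_trans (ler_normD _ _))//.
  by rewrite !normrM lerD// ler_wpM2l.
have mf := continuous_measurable_fun cf; have mg := continuous_measurable_fun cg.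
have split_int d (O : measurableType d) (P : probability O R) (U xi : O -> R) :
    measurable_fun setT U -> measurable_fun setT xi -> (forall w, 0 <= xi w <= 1) ->
    'Ex_P (fun w => xi w * (a * f (col1 (U w)) + b * g (col1 (U w)))) =
    a * 'Ex_P (fun w => xi w * f (col1 (U w))) + b * 'Ex_P (fun w => xi w * g (col1 (U w))).
  move=> mU mxi xiP.
  have i1 := @integrable_weighted _ _ _ P U mU xi _ B mxi xiP mf fB.
  have i2 := @integrable_weighted _ _ _ P U mU xi _ B' mxi xiP mg gB.
  rewrite -!RintegralZl// -RintegralD//.
  - by apply: eq_Rintegral => w _; ring.
  - have := integrableZl measurableT a i1; by apply: eq_integrable => // w _.
  - have := integrableZl measurableT b i2; by apply: eq_integrable => // w _.
by rewrite !split_int// Ef Eg.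
Qed.

Lemma weighted_continuous_unique (f : R -> R) (B : R) : continuous f ->
  (forall x, `|f x| <= B) ->
  'Ex_P1 (fun w => xi1 w * f (U1 w)) = 'Ex_P2 (fun w => xi2 w * f (U2 w)).
Proof.
move=> cf fB; have B0 : 0 <= B := le_trans (normr_ge0 _) (fB 0).
have mf := continuous_measurable_fun cf.
apply/eqP; rewrite -subr_eq0 -normr_le0; apply/ler_addgt0Pr => e e0; rewrite add0r.
(* The two weighted approximations each cost [e' + 2 * B * e']. *)
pose e' := e / (4 * B + 2).
have c0 : 0 < 4 * B + 2 by lra.
have e'0 : 0 < e' by rewrite divr_gt0.
have [K1 K10 tail1] := tail_small P1 mU1 e'0.
have [K2 K20 tail2] := tail_small P2 mU2 e'0.
pose F (x : 'cV[R]_1) := f (x 0 0).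
have cF : continuous F.
  by move=> x; apply: continuous_comp; [exact: coord_continuous|exact: cf].
have mono d (O : measurableType d) (P : probability O R) (U : O -> R) (K K' : R) :
    measurable_fun setT U -> K <= K' -> 'Ex_P (\1_[set w | K' < `|U w|] : O -> R) <=
      'Ex_P (\1_[set w | K < `|U w|] : O -> R).
  move=> mU KK'; have mA r : measurable [set w | r < `|U w|] by exact: measurable_lt_norm.
  rewrite !Rintegral_indic_le1// fine_le ?fin_num_measure// le_measure ?inE//.
  by move=> w /=; exact: le_lt_trans.
pose K := Num.max K1 K2.
have K0 : 0 < K by rewrite lt_max K10.
have FB x : `|x| <= K -> `|F x| <= B by move=> _; exact: fB.
have [p [tp pB Fp]] := trig_approx cF K0 FB e'0.
have [cp _ Ep] := trigpoly_cV1 tp.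
have mp := continuous_measurable_fun cp.
have fp x : `|x| <= K -> `|f x - p (col1 x)| <= e'.
  move=> xK; have := Fp (col1 x); rewrite /F mxE; apply.
  by apply: mxnorm_le => [|i j]; rewrite ?mxE// ltW.
have h1 := @weighted_approx _ _ _ P1 U1 mU1 xi1 f _ B K e' mxi1 xi1P mf mp (ltW e'0) fB (fun x => pB _) fp.
have h2 := @weighted_approx _ _ _ P2 U2 mU2 xi2 f _ B K e' mxi2 xi2P mf mp (ltW e'0) fB (fun x => pB _) fp.
have t1 : 'Ex_P1 (\1_[set w | K < `|U1 w|] : O1 -> R) <= e'.
  by apply: le_trans tail1; apply: mono => //; rewrite le_max lexx.
have t2 : 'Ex_P2 (\1_[set w | K < `|U2 w|] : O2 -> R) <= e'.
  by apply: le_trans tail2; apply: mono => //; rewrite le_max lexx orbT.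
rewrite Ep in h1.
have B20 : 0 <= 2 * B by lra.
have g1 := ler_wpM2l B20 t1; have g2 := ler_wpM2l B20 t2.
rewrite (le_trans (ler_distD ('Ex_P2 (fun w => xi2 w * p (col1 (U2 w)))) _ _))//.
rewrite [X in _ + X]distrC.
have ee : (4 * B + 2) * e' = e by rewrite /e' mulrC divfK// gt_eqF.
lra.
Qed.

(** Continuous ramps converge pointwise to the indicator of the ray. *)
Lemma weighted_ray_unique (a : R) :
  'Ex_P1 (fun w => xi1 w * \1_`]a, +oo[ (U1 w)) = 'Ex_P2 (fun w => xi2 w * \1_`]a, +oo[ (U2 w)).
Proof.
(* [y - a - min (y - a) 0] is the positive part of [y - a]. *)
pose phi (n : nat) (y : R) : R := Num.min (n%:R * (y - a - Num.min (y - a) 0)) 1.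
have phi0 n y : 0 <= phi n y <= 1.
  apply/andP; split; last by rewrite ge_min lexx orbT.
  by rewrite le_min ler01 andbT mulr_ge0// subr_ge0 ge_min lexx.
have cphi n : continuous (phi n).
  have cmin (g : R -> R) (k : R) : continuous g -> continuous (fun y => Num.min (g y) k).
    move=> cg y; apply/cvgrPdist_le => e e0.
    have /cvgrPdist_le/(_ e e0) := cg y; apply: filterS => z; apply: le_trans.
    exact: norm_minB.
  have cya : continuous (fun y : R => y - a).
    by move=> z; apply: cvgB; [exact: cvg_id|exact: cvg_cst].
  have c2 : continuous (fun y : R => Num.min (y - a) 0) by exact: cmin.
  apply: cmin => y; apply: cvgM; first exact: cvg_cst.
  by apply: cvgB; [exact: cya|exact: c2].
have philim y : phi n y @[n --> \oo] --> (\1_`]a, +oo[ y : R).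
  rewrite indicE; have [ya|ay] := leP y a.
    rewrite memNset/=; last by rewrite in_itv/= andbT; apply/negP; rewrite -leNgt.
    apply: cvg_near_cst; near=> n; rewrite /phi [X in _ * (_ - X)]min_l ?subr_le0// subrr mulr0 min_l//.
  rewrite mem_set/= ?in_itv/= ?andbT//.
  apply: cvg_near_cst; near=> n; rewrite /phi [X in _ * (_ - X)]min_r ?subr_ge0 ?(ltW ay)// subr0 min_r//.
  rewrite -ler_pdivrMr ?subr_gt0//; near: n; exact: nbhs_infty_ger.
have lim d (O : measurableType d) (P : probability O R) (U xi : O -> R) :
    measurable_fun setT U -> measurable_fun setT xi -> (forall w, 0 <= xi w <= 1) ->
    'Ex_P (fun w => xi w * phi n (U w)) @[n --> \oo] --> 'Ex_P (fun w => xi w * \1_`]a, +oo[ (U w)).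
  move=> mU mxi xiP; apply: (@Rintegral_cvg_bounded _ _ _ _ _ _ 1).
  - move=> n; apply: measurable_funM => //; apply: measurableT_comp => //.
    exact: continuous_measurable_fun.
  - apply: measurable_funM => //; exact: measurable_indic_comp.
  - move=> n; apply: aeW => w; have /andP[x0 x1] := xiP w; have /andP[p0 p1] := phi0 n (U w).
    by rewrite ger0_norm ?mulr_ge0// mulr_ile1.
  - by apply: aeW => w; apply: cvgM; [exact: cvg_cst|exact: philim].
have l1 := lim _ _ P1 _ _ mU1 mxi1 xi1P; have l2 := lim _ _ P2 _ _ mU2 mxi2 xi2P.
apply: (cvg_unique _ l1); first exact: Rhausdorff.
move: l2; under eq_fun => n.
  rewrite -(@weighted_continuous_unique (phi n) 1) //; last first.
    by move=> x; have /andP[p0 p1] := phi0 n x; rewrite ger0_norm.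
  over.
by [].
Unshelve. all: by end_near. Qed.

(** Rays form a generating family closed under intersection; the class of good sets is a Dynkin
    class. *)
Lemma weighted_law_unique (C : set R) : measurable C ->
  'Ex_P1 (fun w => xi1 w * \1_C (U1 w)) = 'Ex_P2 (fun w => xi2 w * \1_C (U2 w)).
Proof.
move=> mC.
pose H (C : set R) := measurable C /\
  'Ex_P1 (fun w => xi1 w * \1_C (U1 w)) = 'Ex_P2 (fun w => xi2 w * \1_C (U2 w)).
suff : H C by case.
have iw d (O : measurableType d) (P : probability O R) (U xi : O -> R) (A : set R) :
    measurable_fun setT U -> measurable_fun setT xi -> (forall w, 0 <= xi w <= 1) ->
    measurable A -> P.-integrable setT (EFin \o (fun w => xi w * \1_A (U w))).
  move=> mU mxi xiP mA; apply: (@integrable_weighted _ _ _ P U mU xi (\1_A) 1) => //.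
  by move=> x; rewrite indicE; case: (_ \in _); rewrite ?normr1 ?normr0.
(* Frequency and phase 0 give equal total masses, which complements require. *)
have xiT : 'Ex_P1 xi1 = 'Ex_P2 xi2.
  have := cosE 0 0.
  by under eq_Rintegral do rewrite mul0r add0r cos0 mulr1;
    under [in X in _ = X -> _]eq_Rintegral do rewrite mul0r add0r cos0 mulr1.
have ix d (O : measurableType d) (P : probability O R) (xi : O -> R) :
    measurable_fun setT xi -> (forall w, 0 <= xi w <= 1) ->
    P.-integrable setT (EFin \o xi).
  move=> mxi xiP; apply: (@integrable_bounded _ _ _ _ _ 1) => // w.
  by have /andP[x0 x1] := xiP w; rewrite ger0_norm.
have : (RGenOInfty.G (R := R)).-sigma.-measurable C by rewrite -RGenOInfty.measurableE.
apply: sigma_algebra_dynkin_ind.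
- move=> _ _ [a ->] [b ->]; exists (Num.max a b); apply/seteqP; split=> x /=;
    by rewrite !in_itv/= !andbT gt_max => /andP.
- move=> _ [a ->]; split; first exact: measurable_itv.
  exact: weighted_ray_unique.
- split => //.
  under eq_Rintegral do rewrite indicT mulr1.
  by under [RHS]eq_Rintegral do rewrite indicT mulr1.
- move=> A [mA EA]; split; first exact: measurableC.
  have E d (O : measurableType d) (P : probability O R) (U xi : O -> R) :
      measurable_fun setT U -> measurable_fun setT xi -> (forall w, 0 <= xi w <= 1) ->
      'Ex_P (fun w => xi w * \1_(~` A) (U w)) = 'Ex_P xi - 'Ex_P (fun w => xi w * \1_A (U w)).
    move=> mU mxi xiP; rewrite -RintegralB//; [|exact: ix|exact: iw].
    apply: eq_Rintegral => w _; rewrite !indicE in_setC.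
    by case: (_ \in _) => /=; ring.
  by rewrite !E// xiT EA.
- move=> F tF HF; split; first by apply: bigcupT_measurable => n; have [] := HF n.
  have lim d (O : measurableType d) (P : probability O R) (U xi : O -> R) :
      measurable_fun setT U -> measurable_fun setT xi -> (forall w, 0 <= xi w <= 1) ->
      \sum_(k < n) 'Ex_P (fun w => xi w * \1_(F k) (U w)) @[n --> \oo] -->
      'Ex_P (fun w => xi w * \1_(\bigcup_n F n) (U w)).
    move=> mU mxi xiP.
    have sumE n : \sum_(k < n) 'Ex_P (fun w => xi w * \1_(F k) (U w)) =
       'Ex_P (fun w => xi w * \1_(\big[setU/set0]_(k < n) F k) (U w)).
      elim: n => [|n IH].
        rewrite !big_ord0; under eq_Rintegral do rewrite indicE in_set0 mulr0.
        by rewrite Rintegral_prob_cst.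
      have mFn : measurable (\big[setU/set0]_(k < n) F k).
        by apply: bigsetU_measurable => i _; have [] := HF i.
      rewrite big_ord_recr/= IH -RintegralD//; [|exact: iw|by apply: iw => //; have [] := HF n].
      apply: eq_Rintegral => w _; rewrite big_ord_recr/= -mulrDr; congr (_ * _).
      rewrite !indicE in_setU.
      have [h1|h1] := boolP (U w \in F n); have [h2|h2] := boolP (U w \in _) => //=; rewrite ?addr0 ?add0r//.
      move: h1 h2; rewrite !inE -bigcup_mkord => h1 [k /= kn h2].
      have := tF k n Logic.I Logic.I; rewrite -set0P => h.
      have nk : k = n by apply: (tF k n Logic.I Logic.I); exists (U w).
      by rewrite nk ltnn in kn.
    under eq_fun do rewrite sumE.
    apply: (@Rintegral_cvg_bounded _ _ _ _ _ _ 1).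
    + move=> n; apply: measurable_funM => //.
      by apply: measurable_indic_comp => //; apply: bigsetU_measurable => i _; have [] := HF i.
    + apply: measurable_funM => //.
      by apply: measurable_indic_comp => //; apply: bigcupT_measurable => n; have [] := HF n.
    + move=> n; apply: aeW => w; have /andP[x0 x1] := xiP w.
      by rewrite indicE; case: (_ \in _); rewrite ?mulr1 ?mulr0 ?normr0// ger0_norm.
    + apply: aeW => w; apply: cvgM; first exact: cvg_cst.
      apply: cvg_near_cst; rewrite indicE.
      have [|h] := boolP (U w \in \bigcup_n F n).
        rewrite inE => -[k _ Fk]; near=> n.
        rewrite indicE mem_set// -bigcup_mkord; exists k => //=.
        by near: n; exact: nbhs_infty_gt.
      near=> n; rewrite indicE memNset//= -bigcup_mkord => -[k _ Fk].
      by move: h; rewrite notin_setE; apply; exists k.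
  have l1 := lim _ _ P1 _ _ mU1 mxi1 xi1P; have l2 := lim _ _ P2 _ _ mU2 mxi2 xi2P.
  apply: (cvg_unique _ l1); first exact: Rhausdorff.
  move: l2; under eq_fun => n.
    under eq_bigr => k _ do rewrite -(HF k).2.
    over.
  by [].
Unshelve. all: by end_near. Qed.

End WeightedUnique.

Section NormalFromCos.
Context d (Om : measurableType d) (R : realType) (P : probability Om R).

(* [cos_normal_law] and [cos_indep] are the uniqueness theorem for
   characteristic functions in the forms needed for laws and for independence. *)
Lemma cos_normal_law (U : Om -> R) (v : R) : measurable_fun setT U -> 0 <= v ->
  (forall u c : R, 'Ex_P (fun w => cos (u * U w + c)) = cos c * expR (- (u ^+ 2 * v / 2))) ->
  normal_law P U 0 v.
Proof.
move=> mU v0 UE; split => // C mC.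
have key (Q : probability (measurableTypeR R) R) :
    (forall u c : R, \int[Q]_x cos (u * x + c) = cos c * expR (- (u ^+ 2 * v / 2))) ->
    P (U @^-1` C) = Q C.
  move=> QE.
  have h := @weighted_law_unique R _ _ P _ _ Q U (fun=> 1) id (fun=> 1) mU (@measurable_id _ _ setT).
  have := h (@measurable_cst _ _ _ _ _ _) (@measurable_cst _ _ _ _ _ _)
    (fun w => introT andP (conj ler01 (lexx 1))) (fun w => introT andP (conj ler01 (lexx 1))) _ C mC.
  have mUC : measurable (U @^-1` C) by rewrite -[X in measurable X]setTI; exact: mU.
  have E1 : 'Ex_P (fun w => 1 * \1_C (U w)) = fine (P (U @^-1` C)).
    rewrite -Rintegral_indic_le1//; apply: eq_Rintegral => w _; rewrite mul1r.
    by rewrite !indicE; congr (_%:R); apply/idP/idP; rewrite !inE.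
  have E2 : 'Ex_Q (fun w => 1 * \1_C w) = fine (Q C).
    by rewrite -Rintegral_indic_le1//; apply: eq_Rintegral => w _; rewrite mul1r.
  rewrite E1 E2 => /(_ _)E.
  rewrite -[LHS]fineK ?fin_num_measure// -[RHS]fineK ?fin_num_measure//; congr EFin.
  apply: E => u c; under eq_Rintegral do rewrite mul1r.
  by rewrite UE -QE; apply: eq_Rintegral => x _; rewrite mul1r.
have [v00|vn0] := eqVneq v 0.
  have h := key (@dirac _ (measurableTypeR R) 0 R); apply: h => u c.
  have mc : measurable_fun setT (fun x : R => (cos (u * x + c))%:E).
    by apply/measurable_EFinP; apply: continuous_measurable_fun; exact: continuous_cos_affine.
  rewrite /Rintegral integral_dirac// diracT mul1e/= mulr0 add0r.
  by rewrite v00 mulr0 mul0r oppr0 expR0 mulr1.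
have h := key (normal_prob (0 : R) (Num.sqrt v)); apply: h => u c.
have vp : 0 < v by rewrite lt_def vn0.
rewrite normal_cos ?sqrtr_gt0// sqr_sqrtr//; congr (_ * expR _).
by rewrite [v * _]mulrC.
Qed.

Lemma cos_indep (A : set Om) (U : Om -> R) (v : R) : measurable A ->
  normal_law P U 0 v ->
  (forall u c : R, 'Ex_P (fun w => \1_A w * cos (u * U w + c)) =
     fine (P A) * (cos c * expR (- (u ^+ 2 * v / 2)))) ->
  forall C, measurable C -> P (A `&` U @^-1` C) = (P A * P (U @^-1` C))%E.
Proof.
move=> mA UN AE C mC; have [v0 mU _] := UN.
have mUC : measurable (U @^-1` C) by rewrite -[X in measurable X]setTI; exact: mU.
have PA01 : 0 <= fine (P A) <= 1.
  by rewrite -!lee_fin fineK ?fin_num_measure// measure_ge0 probability_le1.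
have mI : measurable_fun setT (\1_A : Om -> R) by exact: measurable_indic.
(* The indicator of [A] on one side is compared with the constant weight P(A) on the other, over the
   same space and variable. *)
have := @weighted_law_unique R _ _ P _ _ P U (\1_A) U (fun=> fine (P A)) mU mU
  mI (@measurable_cst _ _ _ _ _ _) _ (fun=> PA01) _ C mC.
have E1 : 'Ex_P (fun w => \1_A w * \1_C (U w)) = fine (P (A `&` U @^-1` C)).
  rewrite -Rintegral_indic_le1; last exact: measurableI.
  apply: eq_Rintegral => w _; rewrite !indicE in_setI.
  have -> : (w \in U @^-1` C) = (U w \in C) by apply/idP/idP; rewrite !inE.
  by case: (_ \in A); rewrite ?mul1r ?mul0r.
have E2 : 'Ex_P (fun w => fine (P A) * \1_C (U w)) = fine (P A) * fine (P (U @^-1` C)).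
  have iI : P.-integrable setT (EFin \o (\1_(U @^-1` C) : Om -> R)).
    apply: (@integrable_bounded _ _ _ _ _ 1) => // w.
    by rewrite indicE; case: (_ \in _); rewrite ?normr1 ?normr0.
  by rewrite -(Rintegral_indic_le1 _ mUC) -RintegralZl.
rewrite E1 E2 => E.
rewrite -[LHS]fineK ?fin_num_measure//; last exact: measurableI.
rewrite -[P A]fineK ?fin_num_measure// -[P (U @^-1` C)]fineK ?fin_num_measure//.
rewrite -EFinM; congr EFin; apply: E.
- by move=> w; rewrite indicE; case: (_ \in _); rewrite lexx ler01.
- move=> u c; rewrite AE RintegralZl//; last exact: integrable_cos_affine.
  by rewrite (normal_law_cos u c UN).
Qed.

End NormalFromCos.

(** * Riemann sums and the matrix exponential *)

Section RiemannSums.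
Context {R : realType}.
Local Notation leb := (@lebesgue_measure R).
Implicit Types (f g : R -> R) (s t : R).

Definition grid s t (n k : nat) : R := s + k%:R * ((t - s) / n%:R).

Lemma grid0 s t n : grid s t n 0 = s.
Proof. by rewrite /grid mul0r addr0. Qed.

Lemma grid_last s t n : (0 < n)%N -> grid s t n n = t.
Proof.
move=> n0; rewrite /grid mulrCA divff ?mulr1 ?pnatr_eq0 -?lt0n//.
by rewrite addrC subrK.
Qed.

Lemma gridS s t n k : grid s t n k.+1 - grid s t n k = (t - s) / n%:R.
Proof. by rewrite /grid -natr1; ring. Qed.

Lemma grid_le s t n k l : s <= t -> (k <= l)%N -> grid s t n k <= grid s t n l.
Proof.
move=> st kl; rewrite /grid lerD2l ler_wpM2r ?ler_nat//.
by rewrite divr_ge0// subr_ge0.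
Qed.

Lemma grid_lt s t n k l : s < t -> (0 < n)%N -> (k < l)%N -> grid s t n k < grid s t n l.
Proof.
move=> st n0 kl; rewrite /grid ltrD2l ltr_pM2r ?ltr_nat//.
by rewrite divr_gt0 ?subr_gt0// ltr0n.
Qed.

Lemma grid_itv s t n k : s <= t -> (k <= n)%N -> s <= grid s t n k <= t.
Proof.
move=> st; case: n => [|n] kn; last first.
  have := @grid_le s t n.+1 0 k st (leq0n k).
  have := @grid_le s t n.+1 k n.+1 st kn.
  by rewrite grid0 grid_last// => -> ->.
by move: kn; rewrite leqn0 => /eqP ->; rewrite grid0 lexx.
Qed.

(** Right end points, so that right continuity alone gives convergence: the paths of the chain have
    jumps. *)
Definition rsum f s t (n : nat) : R :=
  (t - s) / n%:R * \sum_(k < n) f (grid s t n k.+1).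

Definition right_cont f s t := forall r, s <= r < t -> f x @[x --> r^'+] --> f r.

Let step f s t n (r : R) : R :=
  \sum_(k < n) f (grid s t n k.+1) * \1_`[grid s t n k, grid s t n k.+1[ r.

(** The value of the step function at [r] is that of [f] at a point strictly to the right of [r] and
    within one mesh of it. *)
Let step_eq f s t n r : s < t -> (0 < n)%N -> s <= r < t ->
  exists2 x, step f s t n r = f x & r < x <= r + (t - s) / n%:R /\ x <= t.
Proof.
move=> st n0 /andP[sr rt].
have h0 : 0 < (t - s) / n%:R by rewrite divr_gt0 ?subr_gt0// ltr0n.
pose k := Num.truncn ((r - s) / ((t - s) / n%:R)).
have q0 : 0 <= (r - s) / ((t - s) / n%:R) by rewrite divr_ge0 ?subr_ge0// ltW.
have /andP[k1 k2] := truncn_itv q0.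
rewrite -/k ler_pdivlMr// in k1; rewrite -/k ltr_pdivrMr// in k2.
have kn : (k < n)%N.
  rewrite -(ltr_nat R) -(ltr_pM2r h0) (le_lt_trans k1)//.
  by rewrite mulrCA divff ?mulr1 ?pnatr_eq0 -?lt0n// ltrD2r.
have gk : grid s t n k <= r by rewrite /grid addrC -lerBrDr.
have gk1 : r < grid s t n k.+1 by rewrite /grid addrC -ltrBlDr.
exists (grid s t n k.+1); last first.
  split; last by have /andP[] := @grid_itv s t n k.+1 (ltW st) kn.
  by rewrite gk1/= -(gridS s t n k) -lerBlDr opprB addrC subrK.
rewrite /step (bigD1 (Ordinal kn))//= indicE mem_set/= ?in_itv/= ?gk ?gk1//.
rewrite mulr1 big1 ?addr0// => j jk.
rewrite indicE memNset/= ?mulr0// in_itv/= => /andP[h1 h2].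
have [jltk|kltj|E] := ltngtP j k.
- have := @grid_le s t n j.+1 k (ltW st) jltk.
  by rewrite leNgt (le_lt_trans gk h2).
- have := @grid_le s t n k.+1 j (ltW st) kltj.
  by rewrite leNgt (le_lt_trans h1 gk1).
- by move/eqP: jk; apply; apply/val_inj.
Qed.

Let step_cvg f s t r : s < t -> right_cont f s t -> s <= r < t ->
  step f s t n r @[n --> \oo] --> f r.
Proof.
move=> st rc srt; apply/cvgrPdist_le => e e0.
have /cvgrPdist_le/(_ e e0)[del /= del0 Hdel] := rc r srt.
have ts0 : 0 < t - s by rewrite subr_gt0.
near=> n.
have n0 : (0 < n)%N by near: n; exact: nbhs_infty_gt.
have nr0 : 0 < n%:R :> R by rewrite ltr0n.
have [x -> [/andP[rx xr] xt]] := step_eq f st n0 srt.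
apply: Hdel => //=; rewrite distrC gtr0_norm ?subr_gt0//.
rewrite ltrBlDl (le_lt_trans xr)// ltrD2l ltr_pdivrMr// mulrC -ltr_pdivrMr//.
by near: n; exact: nbhs_infty_gtr.
Unshelve. all: by end_near. Qed.

Let measurable_step f s t n : measurable_fun setT (step f s t n).
Proof.
apply: measurable_sum => k; apply: measurable_funM; first exact: measurable_cst.
by apply: measurable_indic; exact: measurable_itv.
Qed.

Lemma right_cont_measurable f s t : s < t -> right_cont f s t ->
  measurable_fun `[s, t[ f.
Proof.
move=> st rc; apply: (@measurable_fun_cvg _ _ _ _ (step f s t)).
  by move=> n; exact: measurable_funTS.
by move=> r; rewrite /= in_itv/= => srt; exact: step_cvg.
Qed.

Let step_le f s t n r (K : R) : s < t -> (forall x, s <= x <= t -> `|f x| <= K) ->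
  s <= r < t -> `|step f s t n r| <= K.
Proof.
move=> st fK srt; case: n => [|n].
  rewrite /step big_ord0 normr0; apply: le_trans (fK s _) => //.
  by rewrite lexx ltW.
have [x -> [/andP[rx _] xt]] := step_eq f st (ltn0Sn n) srt.
by apply: fK; rewrite xt andbT (le_trans _ (ltW rx))//; case/andP: srt.
Qed.

Lemma integrable_bounded_itv f s t (K : R) : measurable_fun `[s, t[ f ->
  (forall x, s <= x <= t -> `|f x| <= K) -> leb.-integrable `[s, t[ (EFin \o f).
Proof.
move=> mf fK; apply: measurable_bounded_integrable => //.
- have h : (leb (`[s, t[%classic : set R) < +oo)%E.
    by rewrite lebesgue_measure_itv/=; case: ifP => // _; rewrite -EFinB ltry.
  exact: h.
- exists K; split; first exact: num_real.
  move=> M KM x /=; rewrite in_itv/= => /andP[sx xt].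
  by rewrite (le_trans (fK x _))// ?sx ?ltW.
Qed.

Lemma integrable_right_cont f s t (K : R) : s < t -> right_cont f s t ->
  (forall x, s <= x <= t -> `|f x| <= K) -> leb.-integrable `[s, t] (EFin \o f).
Proof.
move=> st rc fK; have mf := right_cont_measurable st rc.
apply: measurable_bounded_integrable => //.
- have h : (leb (`[s, t]%classic : set R) < +oo)%E.
    by rewrite lebesgue_measure_itv/=; case: ifP => // _; rewrite -EFinB ltry.
  exact: h.
- rewrite -(@setUitv1 _ _ (BLeft s) t true) ?bnd_simp ?(ltW st)//; apply/measurable_funU => //.
  by split => //; exact: measurable_fun_set1.
- exists K; split; first exact: num_real.
  move=> M KM x /=; rewrite in_itv/= => sxt.
  by rewrite (le_trans (fK x _))// ltW.
Qed.

Let Rintegral_step f s t n : s < t -> (0 < n)%N ->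
  \int[leb]_(r in `[s, t[) step f s t n r = rsum f s t n.
Proof.
move=> st n0.
have mitv : measurable (`[s, t[%classic : set R) by exact: measurable_itv.
have ind k : leb.-integrable `[s, t[ (EFin \o (\1_`[grid s t n k, grid s t n k.+1[ : R -> R)).
  apply: (@integrable_bounded_itv _ s t 1).
    by apply: measurable_indic; exact: measurable_itv.
  by move=> x _; rewrite indicE; case: (_ \in _); rewrite ?normr1 ?normr0.
have -> : \int[leb]_(r in `[s, t[) step f s t n r = \sum_(k < n)
    f (grid s t n k.+1) * \int[leb]_(r in `[s, t[) \1_`[grid s t n k, grid s t n k.+1[ r.
  rewrite /step.
  have h (m : nat) : leb.-integrable `[s, t[ (EFin \o (fun r =>
      \sum_(k < m) f (grid s t n k.+1) * \1_`[grid s t n k, grid s t n k.+1[ r)) /\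
      \int[leb]_(r in `[s, t[) (\sum_(k < m) f (grid s t n k.+1) * \1_`[grid s t n k, grid s t n k.+1[ r)
    = \sum_(k < m) f (grid s t n k.+1) * \int[leb]_(r in `[s, t[) \1_`[grid s t n k, grid s t n k.+1[ r.
    elim: m => [|m [IH1 IH2]].
      have E0 : (fun r : R => \sum_(k < 0) f (grid s t n k.+1) *
          \1_`[grid s t n k, grid s t n k.+1[ r) = (fun=> 0).
        by apply/funext => r; rewrite big_ord0.
      rewrite E0; split; first exact: integrable0.
      rewrite big_ord0.
      by rewrite Rintegral_cst ?mul0r//; exact: measurable_itv.
    have i1 : leb.-integrable `[s, t[ (EFin \o (fun r =>
        f (grid s t n m.+1) * \1_`[grid s t n m, grid s t n m.+1[ r)).
      have := @integrableZl _ _ _ leb _ mitv (f (grid s t n m.+1)) _ (ind m).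
      by apply: eq_integrable => // x _.
    split.
      have := @integrableD _ _ _ leb _ mitv _ _ IH1 i1.
      by apply: eq_integrable => // x _ /=; rewrite big_ord_recr/= EFinD.
    rewrite big_ord_recr/= -IH2 -RintegralZl// -RintegralD//.
    by apply: eq_Rintegral => x _; rewrite big_ord_recr.
  exact: (h n).2.
rewrite /rsum mulr_sumr; apply: eq_bigr => k _; rewrite mulrC; congr (_ * _).
rewrite /Rintegral integral_indic//; [|exact: measurable_itv..].
have -> : `[grid s t n k, grid s t n k.+1[%classic `&` `[s, t[%classic =
    `[grid s t n k, grid s t n k.+1[%classic.
  apply/setIidPl => x /=; rewrite !in_itv/= => /andP[h1 h2].
  have /andP[k1 _] := @grid_itv s t n k (ltW st) (ltnW (ltn_ord k)).
  have /andP[_ k2] := @grid_itv s t n k.+1 (ltW st) (ltn_ord k).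
  by rewrite (le_trans k1)// (lt_le_trans h2).
have E : (leb (`[grid s t n k, grid s t n k.+1[%classic : set R) = ((t - s) / n%:R)%:E)%E.
  by rewrite lebesgue_measure_itv/= lte_fin grid_lt// -EFinB gridS.
exact: (congr1 fine E).
Qed.

(** Dominated convergence of the step functions. This realises time integrals of processes as
    pointwise limits of finite sums, through which measurability, adaptedness and moment bounds
    pass. *)
Lemma rsum_cvg f s t (K : R) : s <= t -> right_cont f s t ->
  (forall x, s <= x <= t -> `|f x| <= K) ->
  rsum f s t n @[n --> \oo] --> \int[leb]_(x in `[s, t]) f x.
Proof.
rewrite le_eqVlt => /predU1P[<- _ _|st rc fK].
  rewrite set_itv1 Rintegral_set1; apply: cvg_near_cst; apply: nearW => n.
  by rewrite /rsum subrr mul0r mul0r.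
have mf := right_cont_measurable st rc.
have fi := integrable_bounded_itv mf fK.
rewrite -Rintegral_itv_bndo_bndc//.
have mitv : measurable (`[s, t[%classic : set R) by exact: measurable_itv.
have [] := @dominated_convergence _ _ _ leb `[s, t[%classic mitv
  (fun n => EFin \o step f s t n) (EFin \o f) (fun=> K%:E).
- by move=> n; apply/measurable_EFinP; apply: measurable_funTS; exact: measurable_step.
- exact/measurable_EFinP.
- apply: aeW => x; rewrite /= in_itv/= => sxt; apply: cvg_EFin; first exact: nearW.
  exact: step_cvg.
- apply: (@integrable_bounded_itv (fun=> K) s t `|K|) => // x _.
- apply: aeW => x n; rewrite /= in_itv/= => sxt; rewrite lee_fin; exact: step_le.
move=> _ _ h; have := fine_cvg (a := \int[leb]_(x in `[s, t[) f x) (F := \oo)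
  (f := fun n => (\int[leb]_(x in `[s, t[) (step f s t n x)%:E)%E).
rewrite /Rintegral fineK; last exact: integrable_fin_num.
move=> /(_ _ h); apply: cvg_trans; apply: near_eq_cvg; near=> n.
by rewrite -Rintegral_step//; near: n; exact: nbhs_infty_gt.
Unshelve. all: by end_near. Qed.

Lemma norm_rsum_le f s t n (K : R) : s <= t -> 0 <= K ->
  (forall x, s <= x <= t -> `|f x| <= K) -> `|rsum f s t n| <= (t - s) * K.
Proof.
move=> st K0 fK; case: n => [|n].
  by rewrite /rsum big_ord0 mulr0 normr0 mulr_ge0// subr_ge0.
rewrite /rsum normrM ger0_norm ?divr_ge0 ?subr_ge0//.
have h : `|\sum_(k < n.+1) f (grid s t n.+1 k.+1)| <= n.+1%:R * K.
  rewrite (le_trans (ler_norm_sum _ _ _))// mulr_natl -[n.+1 in leRHS]card_ord -sumr_const.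
  by apply: ler_sum => k _; apply: fK; exact: grid_itv.
rewrite -mulrA ler_wpM2l ?subr_ge0// ler_pdivrMl//.
Qed.

Lemma norm_Rintegral_itv_le f s t (K : R) : s <= t -> right_cont f s t ->
  (forall x, s <= x <= t -> `|f x| <= K) ->
  `|\int[leb]_(x in `[s, t]) f x| <= (t - s) * K.
Proof.
move=> st rc fK; have cv := rsum_cvg st rc fK.
have K0 : 0 <= K by apply: le_trans (fK s _); rewrite ?normr_ge0// lexx.
apply: (cvgr_to_le (cvg_norm cv)); apply: nearW => n.
exact: norm_rsum_le.
Qed.

Lemma Rintegral_itv_add f s t r : s <= t -> t <= r ->
  leb.-integrable `[s, r] (EFin \o f) ->
  \int[leb]_(x in `[s, r]) f x = \int[leb]_(x in `[s, t]) f x + \int[leb]_(x in `[t, r]) f x.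
Proof.
move=> st tr fi; have := @Rintegral_itvB R f (BLeft s) (BRight r) t fi.
rewrite !bnd_simp => /(_ st tr) E.
rewrite -[X in _ = _ + X]Rintegral_itv_obnd_cbnd; last first.
  by apply: integrableS fi => //; apply: subset_itvr; rewrite bnd_simp.
by rewrite -E addrC subrK.
Qed.

End RiemannSums.

Lemma cvg_bigsum (R : realType) (T : Type) (F : set_system T) {FF : Filter F}
    (I : Type) (r : seq I) (f : I -> T -> R) (l : I -> R) :
  (forall i, f i x @[x --> F] --> l i) ->
  \sum_(i <- r) f i x @[x --> F] --> \sum_(i <- r) l i.
Proof.
move=> fl; elim: r => [|i r IH].
  by rewrite big_nil; under eq_fun do rewrite big_nil; exact: cvg_cst.
by rewrite big_cons; under eq_fun do rewrite big_cons; exact: cvgD.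
Qed.

(** * Entries of the matrix exponential as power series in time *)

Section MatrixExponential.
Context {R : realType} {d : nat}.
Implicit Types (A B : 'M[R]_d) (s t : R).

Definition mexp_coeff A (i j : 'I_d) (k : nat) : R := (A ^+ k) i j / k`!%:R.

Lemma exprmxZ A t k : (t *: A) ^+ k = t ^+ k *: A ^+ k.
Proof.
elim: k => [|k IH]; first by rewrite !expr0 scale1r.
by rewrite !exprS IH -[LHS]/(_ *m _) -scalemxAl -scalemxAr scalerA.
Qed.

Lemma norm_mxX A k i j : `|(A ^+ k) i j| <= (d%:R * `|A|) ^+ k.
Proof.
elim: k i j => [|k IH] i j.
  by rewrite !expr0 mxE; case: eqP; rewrite ?normr1 ?normr0.
rewrite exprS mxE (le_trans (ler_norm_sum _ _ _))//.
apply: (@le_trans _ _ (\sum_(l < d) `|A| * (d%:R * `|A|) ^+ k)).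
  by apply: ler_sum => l _; rewrite normrM ler_pM// mxnorm_entry.
by rewrite sumr_const card_ord exprS -[leLHS]mulr_natl mulrA.
Qed.

Lemma cvg_pseries_dominated (c : nat -> R) (a x : R) : 0 <= a ->
  (forall k, `|c k| <= a ^+ k / k`!%:R) -> cvgn (pseries c x).
Proof.
move=> a0 ca; apply: normed_cvg; rewrite /pseries.
apply: (@series_le_cvg _ _ (exp_coeff (a * `|x|))).
- by move=> n /=.
- by move=> n; rewrite exp_coeffE/= mulr_ge0 ?invr_ge0// exprn_ge0// mulr_ge0.
- move=> n /=; rewrite normrM normrX exp_coeffE/= exprMn mulrA ler_wpM2r ?exprn_ge0//.
  by rewrite mulrC ca.
- exact: is_cvg_series_exp_coeff.
Qed.

Lemma mexp_coeff_le A i j k : `|mexp_coeff A i j k| <= (d%:R * `|A|) ^+ k / k`!%:R.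
Proof.
rewrite /mexp_coeff normrM [X in _ * X]ger0_norm ?invr_ge0// ler_wpM2r ?invr_ge0//.
exact: norm_mxX.
Qed.

Lemma cvg_mexp_pseries A i j x : cvgn (pseries (mexp_coeff A i j) x).
Proof.
by apply: (@cvg_pseries_dominated _ (d%:R * `|A|)); [rewrite mulr_ge0|exact: mexp_coeff_le].
Qed.

(** Entrywise, the exponential becomes a scalar power series in [t], to which termwise
    differentiation applies. *)
Lemma mexpE A t i j : mexp (t *: A) i j = limn (pseries (mexp_coeff A i j) t).
Proof.
pose M : 'M[R]_d := \matrix_(i, j) limn (pseries (mexp_coeff A i j) t).
suff cv : series (fun k => (k`!%:R)^-1 *: ((t *: A) ^+ k)) n @[n --> \oo] --> M.
  by rewrite /mexp (cvg_lim _ cv)// mxE.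
have E n i' j' : (series (fun k => (k`!%:R)^-1 *: ((t *: A) ^+ k)) n) i' j' =
    pseries (mexp_coeff A i' j') t n.
  rewrite /series/= summxE; apply: eq_bigr => k _.
  by rewrite exprmxZ !mxE /mexp_coeff /=; ring.
apply/cvgrPdist_le => e e0.
have h : \forall n \near \oo, forall ij : 'I_d * 'I_d,
    `|M ij.1 ij.2 - pseries (mexp_coeff A ij.1 ij.2) t n| <= e.
  apply: filter_forall => -[i' j'] /=; rewrite mxE.
  have := @cvg_mexp_pseries A i' j' t.
  by move=> /cvgrPdist_le; exact.
near=> n; apply: mxnorm_le => [|i' j']; first exact: ltW.
rewrite !mxE E; have := near h n; rewrite /= => /(_ _ (i', j')).
by rewrite mxE; apply.
Unshelve. all: by end_near. Qed.

Lemma mexp_coeff_diffs A i j k : pseries_diffs (mexp_coeff A i j) k =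
  \sum_l A i l * mexp_coeff A l j k.
Proof.
rewrite /pseries_diffs /mexp_coeff exprS mxE factS natrM.
have f0 : k`!%:R != 0 :> R by rewrite pnatr_eq0 -lt0n fact_gt0.
have k0 : k.+1%:R != 0 :> R by rewrite pnatr_eq0.
rewrite invfM mulrCA mulVKf//.
by rewrite mulr_suml; apply: eq_bigr => l _; rewrite mulrA.
Qed.

Lemma cvg_pseries_sum (I : finType) (a : I -> R) (c : I -> nat -> R) (b : nat -> R) x :
  (forall k, b k = \sum_l a l * c l k) -> (forall l, cvgn (pseries (c l) x)) ->
  pseries b x n @[n --> \oo] --> \sum_l a l * limn (pseries (c l) x).
Proof.
move=> bE cc.
have -> : pseries b x = fun n => \sum_l a l * pseries (c l) x n.
  apply/funext => n; rewrite /pseries /series/=.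
  under [RHS]eq_bigr do rewrite mulr_sumr.
  rewrite exchange_big/=; apply: eq_bigr => k _; rewrite bE mulr_suml.
  by apply: eq_bigr => l _; rewrite mulrA.
by apply: cvg_bigsum => l; apply: cvgM; [exact: cvg_cst|exact: cc].
Qed.

Lemma is_derive_mexp A t i j :
  is_derive t 1 (fun t => mexp (t *: A) i j) ((A *m mexp (t *: A)) i j).
Proof.
have E1 : pseries_diffs (mexp_coeff A i j) = fun k => \sum_l A i l * mexp_coeff A l j k.
  by apply/funext => k; exact: mexp_coeff_diffs.
(* Termwise differentiation asks for convergence of the first two formal derivatives; these have the
   coefficients of A exp and A^2 exp. *)
have c1 x : cvgn (pseries (pseries_diffs (mexp_coeff A i j)) x).
  apply/cvg_ex; eexists; apply: cvg_pseries_sum; first by move=> k; rewrite E1.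
  by move=> l; exact: cvg_mexp_pseries.
have c2 x : cvgn (pseries (pseries_diffs (pseries_diffs (mexp_coeff A i j))) x).
  apply/cvg_ex; eexists; apply: (@cvg_pseries_sum _ (A i) (fun l => pseries_diffs (mexp_coeff A l j))).
    move=> k; rewrite E1 {1}/pseries_diffs mulr_sumr; apply: eq_bigr => l _.
    by rewrite /pseries_diffs; ring.
  move=> l; apply/cvg_ex; eexists; apply: cvg_pseries_sum.
    by move=> k; exact: mexp_coeff_diffs.
  by move=> m; exact: cvg_mexp_pseries.
under eq_fun do rewrite mexpE.
have -> : (A *m mexp (t *: A)) i j = limn (pseries (pseries_diffs (mexp_coeff A i j)) t).
  rewrite mxE; apply/esym/cvg_lim => //.
  under eq_bigr do rewrite mexpE.
  by apply: cvg_pseries_sum => [k|l]; [rewrite E1|exact: cvg_mexp_pseries].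
apply: (@pseries_snd_diffs _ _ (`|t| + 1)) => //; first exact: cvg_mexp_pseries.
by rewrite [ltRHS]ger0_norm ?addr_ge0// ltrDl.
Qed.

Lemma mexp_comm A t : A *m mexp (t *: A) = mexp (t *: A) *m A.
Proof.
apply/matrixP => i j; rewrite !mxE.
have h1 := @cvg_pseries_sum _ (fun l => A i l) (fun l => mexp_coeff A l j) _ t
   (fun k => erefl) (fun l => @cvg_mexp_pseries A l j t).
have h2 := @cvg_pseries_sum _ (fun l => A l j) (fun l => mexp_coeff A i l) _ t
   (fun k => erefl) (fun l => @cvg_mexp_pseries A i l t).
have E : (fun k => \sum_l A i l * mexp_coeff A l j k) =
         (fun k => \sum_l A l j * mexp_coeff A i l k).
  apply/funext => k; transitivity ((A ^+ k.+1) i j / k`!%:R).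
    by rewrite exprS mxE mulr_suml; apply: eq_bigr => l _; rewrite mulrA.
  rewrite exprSr mxE mulr_suml; apply: eq_bigr => l _.
  by rewrite /mexp_coeff; ring.
rewrite E in h1; have := cvg_unique (@Rhausdorff R) h1 h2.
under eq_bigr do rewrite -mexpE; move=> ->.
by apply: eq_bigr => l _; rewrite mulrC mexpE.
Qed.

Lemma mexp_0 A : mexp (0 *: A) = 1%:M.
Proof.
apply/matrixP => i j; rewrite mexpE; apply/cvg_lim => //.
apply: cvg_near_cst; near=> n.
have n0 : (0 < n)%N by near: n; exact: nbhs_infty_gt.
rewrite /pseries/= /series/= big_ltn// big1_seq ?addr0.
  by rewrite expr0 mulr1 /mexp_coeff expr0 fact0 divr1.
move=> k /andP[_]; rewrite mem_index_iota => /andP[k0 _].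
by rewrite expr0n gtn_eqF// mulr0.
Unshelve. all: by end_near. Qed.

(** The product exp ((s + t - r) A) exp (r A) has zero derivative in [r]; its values at 0 and at [t]
    are compared. *)
Lemma mexpD A s t : mexp ((s + t) *: A) = mexp (s *: A) *m mexp (t *: A).
Proof.
apply/matrixP => i j.
pose G (r : R) := \sum_l mexp ((s + t - r) *: A) i l * mexp (r *: A) l j.
have dG (r : R) : is_derive r 1 G 0.
  have h : is_derive r 1 G (\sum_l (mexp ((s + t - r) *: A) i l * (A *m mexp (r *: A)) l j +
      mexp (r *: A) l j * ((A *m mexp ((s + t - r) *: A)) i l * (0 - 1)))).
    apply: is_derive_bigsum => l; apply: is_derive_mul; last exact: is_derive_mexp.
    have d1 : is_derive r 1 (fun r : R => s + t - r) (0 - 1) by apply: is_derive_sub.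
    exact: (@is_derive_comp R r (fun q => mexp (q *: A) i l) (fun q => s + t - q) _ _
      (is_derive_mexp A (s + t - r) i l) d1).
  apply: (is_derive_eq h); rewrite sub0r big_split/=.
  have -> : \sum_l mexp ((s + t - r) *: A) i l * (A *m mexp (r *: A)) l j =
      (mexp ((s + t - r) *: A) *m (A *m mexp (r *: A))) i j by rewrite mxE.
  have -> : \sum_l mexp (r *: A) l j * ((A *m mexp ((s + t - r) *: A)) i l * -1) =
      - ((A *m mexp ((s + t - r) *: A)) *m mexp (r *: A)) i j.
    rewrite mxE -sumrN; apply: eq_bigr => l _; ring.
  by rewrite mulmxA -mexp_comm subrr.
have := is_derive_eq0_cst dG 0 t; rewrite /G.
under eq_bigr do rewrite subr0 mexp_0.
under [RHS]eq_bigr do rewrite addrK.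
move=> h; rewrite [RHS]mxE -h (bigD1 j)//= big1 ?addr0; last first.
  by move=> l lj; rewrite mxE (negbTE lj) mulr0.
by rewrite mxE eqxx mulr1.
Qed.

Lemma mexp_tr A : (mexp A)^T = mexp A^T.
Proof.
have trX k : (A ^+ k)^T = A^T ^+ k.
  elim: k => [|k IH]; first by rewrite !expr0 trmx1.
  by rewrite exprS exprSr -IH trmx_mul.
apply/matrixP => i j; rewrite mxE.
have -> : mexp A = mexp (1 *: A) by rewrite scale1r.
have -> : mexp A^T = mexp (1 *: A^T) by rewrite scale1r.
rewrite !mexpE.
congr (limn (pseries _ _)); apply/funext => k.
by rewrite /mexp_coeff -trX mxE.
Qed.

End MatrixExponential.

Section PathCalculus.
Context {R : realType}.
Local Notation leb := (@lebesgue_measure R).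
Implicit Types (f g : R -> R) (s t x y : R).

(** Freezing a path before time 0 turns continuity within [0, +oo[ into continuity on the whole
    line. *)
Definition ext0 f s := f (Num.max s 0).

Lemma ext0E f s : 0 <= s -> ext0 f s = f s.
Proof. by move=> s0; rewrite /ext0 max_l. Qed.

Lemma continuous_ext0 f : {within `[0, +oo[, continuous f} -> continuous (ext0 f).
Proof.
move=> /continuous_within_itvcyP[cf f0] x.
have [x0|x0|x0] := ltgtP x 0.
- rewrite /continuous_at {2}/ext0 max_r ?ltW//; apply: cvg_near_cst.
  near=> y; rewrite /ext0 max_r//.
  by near: y; apply: filterS (lt_nbhsl x0) => z /ltW.
- rewrite /continuous_at ext0E ?ltW//.
  have : f y @[y --> x] --> f x by apply: cf; rewrite in_itv/= x0.
  apply: cvg_trans; apply: near_eq_cvg; near=> y; rewrite ext0E//.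
  by near: y; apply: filterS (lt_nbhsr x0) => z /ltW.
- rewrite x0 /continuous_at ext0E//; apply/cvgrPdist_le => e e0.
  have /cvgrPdist_le/(_ e e0)[del /= del0 H] := f0.
  exists del => //= y yd.
  have [y0|y0] := leP y 0; first by rewrite /ext0 max_r// subrr normr0 ltW.
  by rewrite ext0E; [exact: (H y yd y0)|exact: ltW].
Unshelve. all: by end_near. Qed.

Lemma continuous_right_cont f s t : continuous f -> right_cont f s t.
Proof. by move=> cf r _; apply: cvg_at_right_filter; exact: cf. Qed.

Lemma continuous_itv_bounded f s t : continuous f ->
  exists2 K : R, 0 <= K & forall x, s <= x <= t -> `|f x| <= K.
Proof.
move=> cf; have [st|ts] := leP s t; last first.
  by exists 0 => // x /andP[sx xt]; have := le_trans sx xt; rewrite leNgt ts.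
have cnf : {within `[s, t], continuous (fun x => `|f x|)}.
  by apply: continuous_subspaceT => x; apply: cvg_norm; exact: cf.
have [c _ Hc] := EVT_max st cnf.
by exists `|f c| => // x xst; apply: Hc; rewrite in_itv.
Qed.

Lemma integrable_continuous f s t : continuous f -> leb.-integrable `[s, t] (EFin \o f).
Proof.
move=> cf; apply: continuous_compact_integrable; first exact: segment_compact.
exact: continuous_subspaceT.
Qed.

Lemma Rintegral_sum_continuous (I : Type) (r : seq I) (f : I -> R -> R) s t :
  (forall i, continuous (f i)) ->
  \int[leb]_(x in `[s, t]) (\sum_(i <- r) f i x) =
  \sum_(i <- r) \int[leb]_(x in `[s, t]) f i x.
Proof.
move=> cf; elim: r => [|i r IH].
  under eq_Rintegral do rewrite big_nil.
  by rewrite big_nil Rintegral_cst ?mul0r.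
under eq_Rintegral do rewrite big_cons.
rewrite big_cons -IH -RintegralD//; first exact: integrable_continuous.
by apply: integrable_continuous => x; apply: cvg_bigsum => j; exact: cf.
Qed.

(** The base point -1 leaves room on the left of 0, so the derivative at 0 is two-sided. *)
Lemma is_derive_primitive f x : continuous f -> -1 < x ->
  is_derive x 1 (fun y => \int[leb]_(r in `[-1, y]) f r) (f x).
Proof.
move=> cf x1; have xx1 : x < x + 1 by rewrite ltrDl.
have [] := @continuous_FTC1 R f (BLeft (-1)) x (x + 1) xx1.
- exact: integrable_continuous.
- by rewrite /= lte_fin.
- exact: cf.
by move=> h1 h2; apply: DeriveDef; [exact: h1|rewrite -derive1E; exact: h2].
Qed.

Lemma Rintegral_primitive f s t : continuous f -> -1 <= s -> s <= t ->
  \int[leb]_(r in `[s, t]) f r =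
  \int[leb]_(r in `[-1, t]) f r - \int[leb]_(r in `[-1, s]) f r.
Proof.
move=> cf s1 st; rewrite (@Rintegral_itv_add _ f (-1) s t)//.
  by rewrite addrC addKr.
exact: integrable_continuous.
Qed.

Lemma continuous_primitive f : continuous f ->
  continuous (fun t => \int[leb]_(r in `[0, t]) f r).
Proof.
move=> cf.
pose F t := \int[leb]_(r in `[-1, t]) f r - \int[leb]_(r in `[-1, 0]) f r.
(* For negative [t] the interval is empty and the integral is 0, which is also [F 0]. *)
have -> : (fun t => \int[leb]_(r in `[0, t]) f r) = ext0 F.
  apply/funext => t; have [t0|t0] := leP 0 t.
    by rewrite ext0E// /F Rintegral_primitive// lerN10.
  rewrite /ext0 max_r ?ltW// /F subrr set_itv_ge ?Rintegral_set0//.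
  by rewrite bnd_simp -ltNge.
move=> x; apply: (@continuous_comp _ _ _ (fun s => Num.max s 0) F).
  have -> : (fun s : R => Num.max s 0) = fun s => - Num.min (- s) 0.
    by apply/funext => s; rewrite oppr_min opprK oppr0.
  apply: cvgN; apply/cvgrPdist_le => e e0; exists e => //= y xy.
  by rewrite (le_trans (norm_minB _ _ _))// opprK addrC distrC ltW.
apply: cvgB; last exact: cvg_cst.
have x1 : -1 < Num.max x 0 by rewrite lt_max ltrN10 orbT.
apply: differentiable_continuous; apply/derivable1_diffP.
by have [] := is_derive_primitive cf x1.
Qed.

(** Two comparisons of derivatives; the sign [s] with [s ^+ 2 = 1] treats the upper and lower bounds
    together. *)
Lemma taylor2 g g' g'' (C : R) x y : x <= y ->
  (forall z : R, is_derive z 1 g (g' z)) -> (forall z : R, is_derive z 1 g' (g'' z)) ->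
  (forall z, x <= z <= y -> `|g'' z| <= C) ->
  `|g y - g x - (y - x) * g' x| <= C * (y - x) ^+ 2.
Proof.
move=> xy dg dg' g''C.
have one (s : R) : s ^+ 2 = 1 -> forall z, x <= z <= y -> s * (g' z - g' x) <= C * (z - x).
  move=> s2 z /andP[xz zy].
  have s1 : `|s| = 1 by apply/eqP; rewrite -[_ == _](@eqrXn2 _ 2) ?expr1n// real_normK ?num_real// s2.
  have := @is_derive_ge0_le R (fun z => C * (z - x) - s * (g' z - g' x))
     (fun z => C * (1 - 0) - s * (g'' z - 0)) x z xz.
  rewrite !subrr !mulr0 subrr subr_ge0; apply.
  - move=> r /andP[xr rz]; rewrite !subr0 mulr1 subr_ge0.
    rewrite (le_trans (ler_norm _))// normrM s1 mul1r g''C// xr.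
    exact: le_trans zy.
have two (s : R) : s ^+ 2 = 1 -> s * (g y - g x - (y - x) * g' x) <= C * (y - x) ^+ 2.
  move=> s2; have C0 : 0 <= C by apply: le_trans (g''C x _); rewrite ?normr_ge0// lexx.
  have h := @is_derive_ge0_le R
     (fun z => C * (z - x) ^+ 2 - s * (g z - g x - g' x * (z - x)))
     (fun z => C * (2%:R * (z - x) ^+ 1 * (1 - 0)) - s * (g' z - 0 - g' x * (1 - 0))) x y xy.
  have d1 (r : R) : is_derive r 1 (fun z : R => z - x) (1 - 0) by apply: is_derive_sub.
  suff : C * (x - x) ^+ 2 - s * (g x - g x - g' x * (x - x)) <=
      C * (y - x) ^+ 2 - s * (g y - g x - g' x * (y - x)) by lra.
  apply: h => r rxy.
    apply: is_derive_sub; apply: is_derive_scale.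
      exact: (is_derive_pow 2 (d1 r)).
  have := one s s2 r rxy; have /andP[xr _] := rxy.
  have : 0 <= C * (r - x) by rewrite mulr_ge0// subr_ge0.
  by rewrite /= !subr0 !mulr1 expr1; lra.
have e : (- 1 : R) ^+ 2 = 1 by rewrite sqrrN expr1n.
rewrite ler_norml; have := two 1 (expr1n _ _); have := two (-1) e.
rewrite mulN1r mul1r => h1 h2; apply/andP; split; lra.
Qed.

Lemma summation_by_parts (a b : nat -> R) n :
  \sum_(k < n) a k * (b k.+1 - b k) =
  a n * b n - a 0%N * b 0%N - \sum_(k < n) (a k.+1 - a k) * b k.+1.
Proof.
elim: n => [|n IH]; first by rewrite !big_ord0; ring.
by rewrite !big_ord_recr/= IH; ring.
Qed.

(* Integrating by parts defines Wiener integrals of smooth integrands pathwise. *)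
Lemma stieltjes_sum_cvg g g' g'' (W : R -> R) t : 0 <= t ->
  (forall z : R, is_derive z 1 g (g' z)) -> (forall z : R, is_derive z 1 g' (g'' z)) ->
  continuous g'' -> continuous W -> W 0 = 0 ->
  \sum_(k < n) g (t - grid 0 t n k) * (W (grid 0 t n k.+1) - W (grid 0 t n k)) @[n --> \oo]
  --> g 0 * W t + \int[leb]_(s in `[0, t]) (g' (t - s) * W s).
Proof.
move=> t0 dg dg' cg'' cW W0.
have cg' : continuous g' := is_derive_continuous dg'.
have cts : continuous (fun s : R => t - s).
  by move=> s; apply: cvgB; [exact: cvg_cst|exact: cvg_id].
have cf : continuous (fun s => g' (t - s) * W s).
  move=> s; apply: cvgM; last exact: cW.
  by apply: (@continuous_comp _ _ _ (fun s => t - s) g'); [exact: cts|exact: cg'].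
have [Kf _ fK] := continuous_itv_bounded 0 t cf.
have rs := rsum_cvg t0 (continuous_right_cont cf) fK.
have [C C0 HC] := continuous_itv_bounded 0 t cg''.
have [K K0 HK] := continuous_itv_bounded 0 t cW.
set S := fun n => \sum_(k < n) _.
suff err : S n - g 0 * W t - rsum (fun s => g' (t - s) * W s) 0 t n @[n --> \oo] --> (0 : R).
  have h : (S n - g 0 * W t - rsum (fun s => g' (t - s) * W s) 0 t n) +
      rsum (fun s => g' (t - s) * W s) 0 t n + g 0 * W t @[n --> \oo] -->
      0 + \int[leb]_(s in `[0, t]) (g' (t - s) * W s) + g 0 * W t.
    by apply: cvgD; [exact: cvgD|exact: cvg_cst].
  move: h; rewrite add0r addrC; apply: cvg_trans; apply: near_eq_cvg.
  by apply: nearW => n; rewrite !subrK.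
apply/cvgrPdist_le => e e0; near=> n.
have n0 : (0 < n)%N by near: n; exact: nbhs_infty_gt.
have nr0 : 0 < n%:R :> R by rewrite ltr0n.
set h := t / n%:R.
have h0 : 0 <= h by rewrite divr_ge0// ltW.
have gh k : grid 0 t n k.+1 - grid 0 t n k = h by rewrite gridS subr0.
rewrite sub0r normrN /S (summation_by_parts (fun k => g (t - grid 0 t n k)) (fun k => W (grid 0 t n k))).
rewrite grid_last// grid0 W0 subrr mulr0 subr0 /rsum subr0 -/h.
set a := g 0 * W t.
have -> : forall x y : R, a - x - a - y = - (x + y) by move=> *; ring.
rewrite normrN mulr_sumr -big_split/=.
(* After summation by parts each cell carries a second-order Taylor error times a value of [W], so
   the total error is of order 1 / n. *)
apply: (@le_trans _ _ (\sum_(k < n) (C * h ^+ 2 * K))).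
  rewrite (le_trans (ler_norm_sum _ _ _))//; apply: ler_sum => k _.
  have k1 := @grid_itv R 0 t n k.+1 t0 (ltn_ord k).
  have k2 := @grid_itv R 0 t n k t0 (ltnW (ltn_ord k)).
  rewrite mulrA -mulrDl normrM ler_pM ?HK//.
  have hh : t - grid 0 t n k = t - grid 0 t n k.+1 + h by rewrite -(gh k); ring.
  have := @taylor2 g g' g'' C (t - grid 0 t n k.+1) (t - grid 0 t n k) _ dg dg' _.
  rewrite {1}hh lerDl => /(_ h0); rewrite {4}hh [_ + h - _]addrC addKr.
  rewrite {3}hh [_ + h - _]addrC addKr.
  have -> : g (t - grid 0 t n k.+1) - g (t - grid 0 t n k) + h * g' (t - grid 0 t n k.+1) =
    - (g (t - grid 0 t n k) - g (t - grid 0 t n k.+1) - h * g' (t - grid 0 t n k.+1)) by ring.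
  rewrite normrN; apply => z /andP[z1 z2]; apply: HC.
  by move: k1 k2 => /andP[? ?] /andP[? ?]; apply/andP; split; lra.
rewrite sumr_const card_ord -mulr_natl.
have -> : n%:R * (C * h ^+ 2 * K) = (C * K * t ^+ 2) / n%:R.
  by rewrite /h; field; rewrite gt_eqF.
rewrite ler_pdivrMr// [leRHS]mulrC -ler_pdivrMr//; near: n; exact: nbhs_infty_ger.
Unshelve. all: by end_near. Qed.

End PathCalculus.

Section VariationOfConstants.
Context {R : realType} {d : nat}.
Local Notation leb := (@lebesgue_measure R).
Variables (A : 'M[R]_d) (D : 'I_d -> R -> R).
Hypothesis cD : forall i, continuous (D i).

(** What is left of [D] once the linear drift is removed. For a solution of a linear equation it is
    the initial value plus the noise, but as a function of [D] it is defined and continuous on every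
    path. *)
Definition forcing (i : 'I_d) (t : R) : R :=
  D i t - \sum_l A i l * \int[leb]_(s in `[0, t]) D l s.

Lemma continuous_forcing i : continuous (forcing i).
Proof.
move=> t; apply: cvgB; first exact: cD.
apply: cvg_bigsum => l; apply: cvgM; first exact: cvg_cst.
by have c := continuous_primitive (@cD l); exact: c.
Qed.

Lemma is_derive_mexp_backward (t s : R) i j :
  is_derive s 1 (fun s : R => mexp ((t - s) *: A) i j) (- (A *m mexp ((t - s) *: A)) i j).
Proof.
have d1 : is_derive s 1 (fun r : R => t - r) (0 - 1) by apply: is_derive_sub.
have h := @is_derive_comp R s (fun q => mexp (q *: A) i j) (fun q => t - q) _ _
      (is_derive_mexp A (t - s) i j) d1.
by apply: (is_derive_eq h); ring.
Qed.

Lemma continuous_mexp_backward (t : R) i j : continuous (fun s : R => mexp ((t - s) *: A) i j).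
Proof. by apply: is_derive_continuous => s; exact: is_derive_mexp_backward. Qed.

(* [D] solves [D = forcing + A * (primitive of D)] with a merely continuous forcing, so
   that the formula applies path by path to equations driven by [W]. *)
Lemma variation_of_constants (t : R) i : 0 <= t -> D i t = forcing i t +
  \sum_l A i l * \sum_j \int[leb]_(s in `[0, t]) (mexp ((t - s) *: A) l j * forcing j s).
Proof.
move=> t0.
suff key l : \int[leb]_(s in `[0, t]) D l s =
    \sum_j \int[leb]_(s in `[0, t]) (mexp ((t - s) *: A) l j * forcing j s).
  by rewrite /forcing; under [X in _ + X]eq_bigr do rewrite -key; rewrite subrK.
pose F j s := \int[leb]_(r in `[-1, s]) D j r - \int[leb]_(r in `[-1, 0]) D j r.
have FE j s : 0 <= s -> F j s = \int[leb]_(r in `[0, s]) D j r.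
  by move=> s0; rewrite /F -Rintegral_primitive ?lerN10//; exact: cD.
have F0 j : F j 0 = 0 by rewrite /F subrr.
have dF j s : 0 <= s <= t -> is_derive s 1 (F j) (D j s).
  move=> /andP[s0 _]; have s1 : -1 < s by rewrite (lt_le_trans _ s0)// ltrN10.
  have h := is_derive_sub (is_derive_primitive (@cD j) s1)
    (is_derive_cst (\int[leb]_(r in `[-1, 0]) D j r) s 1).
  by apply: (is_derive_eq h); rewrite subr0.
(* The primitive F satisfies F' = A F + forcing on [0, t], and the integrating factor cancels the
   term A F. Working with the primitive is what spares any derivative of the forcing. *)
pose G s := \sum_j mexp ((t - s) *: A) l j * F j s.
have dG s : 0 <= s <= t -> is_derive s 1 G (\sum_j mexp ((t - s) *: A) l j * forcing j s).
  move=> st; have /andP[s0 _] := st.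
  have h : is_derive s 1 G (\sum_j (mexp ((t - s) *: A) l j * D j s +
      F j s * (- (A *m mexp ((t - s) *: A)) l j))).
    by apply: is_derive_bigsum => j; apply: is_derive_mul;
      [exact: is_derive_mexp_backward|exact: dF].
  apply: (is_derive_eq h); rewrite big_split/=.
  under [RHS]eq_bigr do rewrite /forcing mulrBr.
  rewrite sumrB; congr (_ + _); rewrite -sumrN.
  transitivity (- \sum_j F j s * (mexp ((t - s) *: A) *m A) l j).
    by rewrite -sumrN -mexp_comm; apply: eq_bigr => j _; rewrite mulrN.
  rewrite sumrN; congr (- _).
  under eq_bigr do rewrite mxE mulr_sumr.
  rewrite exchange_big/=; apply: eq_bigr => j _; rewrite mulr_sumr.
  by apply: eq_bigr => m _; rewrite FE//; ring.
have cint j : continuous (fun s : R => mexp ((t - s) *: A) l j * forcing j s).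
  move=> s; apply: cvgM; first exact: continuous_mexp_backward.
  exact: continuous_forcing.
have cI : continuous (fun s => \sum_j mexp ((t - s) *: A) l j * forcing j s).
  by move=> s; apply: cvg_bigsum => j; have c := cint j; exact: c.
have := is_derive_FTC t0 dG cI; rewrite Rintegral_sum_continuous// => ->.
rewrite /G [X in _ - X]big1 ?subr0; last by move=> j _; rewrite F0 mulr0.
rewrite (bigD1 l)//= big1 ?addr0; last first.
  by move=> j jl; rewrite subrr mexp_0 mxE eq_sym (negbTE jl) mul0r.
by rewrite subrr mexp_0 mxE eqxx mul1r FE.
Qed.

End VariationOfConstants.

(** * Filtered Brownian motion and moments of stochastic sums *)

Section Adapted.
Context {Om : Type} {R : realType}.
Variable G : set (set Om).

Definition adapted (f : Om -> R) := forall C : set R, measurable C -> G (f @^-1` C).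

Hypothesis saG : sigma_algebra setT G.
Implicit Types (f g : Om -> R).

(** A point of [Om] turns it into a carrier for [g_sigma_algebraType], whose measurable functions
    then supply the closure properties. If [Om] is empty, every preimage is [set0]. *)
Let pointed_of (w : Om) : pointedType := HB.pack_for pointedType Om
  (gen_eqMixin Om) (gen_choiceMixin Om) (isPointed.Build Om w).

Let adaptedP (w : Om) f :
  adapted f <-> measurable_fun [set: @g_sigma_algebraType (pointed_of w) G] f.
Proof.
have E : <<s G >> = G by apply: sigma_algebra_id.
split=> [fG _ C mC|mf C mC].
  by rewrite setTI /measurable/= E; exact: fG.
have := mf measurableT C mC; rewrite setTI.
by rewrite /measurable/= E.
Qed.

Let adapted_inh f : (Om -> adapted f) -> adapted f.
Proof.
move=> fG C mC; have [[w _]|/forallNP no] := pselect (exists w : Om, True); first exact: (fG w).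
have -> : f @^-1` C = set0 by apply/seteqP; split=> w; have := no w.
by case: saG.
Qed.

Lemma adapted_cst (c : R) : adapted (fun=> c).
Proof. by apply: adapted_inh => w; apply/(adaptedP w); exact: measurable_cst. Qed.

Lemma adaptedD f g : adapted f -> adapted g -> adapted (fun w => f w + g w).
Proof.
move=> fG gG; apply: adapted_inh => w; apply/(adaptedP w).
by apply: measurable_funD; exact/(adaptedP w).
Qed.

Lemma adaptedB f g : adapted f -> adapted g -> adapted (fun w => f w - g w).
Proof.
move=> fG gG; apply: adapted_inh => w; apply/(adaptedP w).
by apply: measurable_funB; exact/(adaptedP w).
Qed.

Lemma adaptedM f g : adapted f -> adapted g -> adapted (fun w => f w * g w).
Proof.
move=> fG gG; apply: adapted_inh => w; apply/(adaptedP w).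
by apply: measurable_funM; exact/(adaptedP w).
Qed.

Lemma adapted_comp (h : R -> R) f : measurable_fun setT h -> adapted f ->
  adapted (fun w => h (f w)).
Proof.
move=> mh fG; apply: adapted_inh => w; apply/(adaptedP w).
by apply: (measurableT_comp mh); exact/(adaptedP w).
Qed.

Lemma adaptedX f n : adapted f -> adapted (fun w => f w ^+ n).
Proof. exact: (@adapted_comp (fun x => x ^+ n) f (exprn_measurable n)). Qed.

Lemma adapted_sum_ord n (f : nat -> Om -> R) :
  (forall i, (i < n)%N -> adapted (f i)) -> adapted (fun w => \sum_(i < n) f i w).
Proof.
elim: n => [|n IH] fG.
  under eq_fun do rewrite big_ord0; exact: adapted_cst.
under eq_fun do rewrite big_ord_recr/=; apply: adaptedD; last exact: fG.
by apply: IH => i lt_in; apply: fG; exact: ltnW.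
Qed.

Lemma adapted_cvg (f_ : nat -> Om -> R) f : (forall n, adapted (f_ n)) ->
  (forall w, f_ n w @[n --> \oo] --> f w) -> adapted f.
Proof.
move=> fG ff; apply: adapted_inh => w; apply/(adaptedP w).
apply: (measurable_fun_cvg (D:=[set: @g_sigma_algebraType (pointed_of w) G]) (h:=f_)); first by move=> n; exact/(adaptedP w).
by move=> ? _; exact: ff.
Qed.

End Adapted.

Section FilteredBrownianMotion.
Context d (Om : measurableType d) (R : realType) (P : probability Om R).

(* The filtration [G] may be larger than the one generated by [W]. *)
Record filtered_bm (G : R -> set (set Om)) (W : R -> Om -> R) : Prop := FilteredBM {
  fbm_sigma : forall t, 0 <= t -> sigma_algebra setT (G t);
  fbm_measurable : forall t A, 0 <= t -> G t A -> measurable A;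
  fbm_mono : forall s t, 0 <= s -> s <= t -> G s `<=` G t;
  fbm_adapted : forall t, 0 <= t -> adapted (G t) (W t);
  fbm_normal : forall s t, 0 <= s -> s < t ->
    normal_law P (fun w => W t w - W s w) 0 (t - s);
  fbm_indep : forall s t A C, 0 <= s -> s < t -> G s A -> measurable C ->
    let D := (fun w => W t w - W s w) @^-1` C in
    P (A `&` D) = (P A * P D)%E }.

Variables (G : R -> set (set Om)) (W : R -> Om -> R).
Hypothesis bmW : filtered_bm G W.

Lemma adapted_measurable t (f : Om -> R) : 0 <= t -> adapted (G t) f -> measurable_fun setT f.
Proof.
by move=> t0 fG _ C mC; rewrite setTI; apply: (fbm_measurable bmW t0); exact: fG.
Qed.

Lemma adapted_mono s t (f : Om -> R) : 0 <= s -> s <= t -> adapted (G s) f -> adapted (G t) f.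
Proof. by move=> s0 st fG C mC; apply: (fbm_mono bmW s0 st); exact: fG. Qed.

Lemma fbm_measurable_W t : 0 <= t -> measurable_fun setT (W t).
Proof. by move=> t0; apply: (adapted_measurable t0); exact: fbm_adapted. Qed.

(** Independence of increments in the form used throughout: expectations of a past variable times a
    function of a later increment factor. *)
Lemma fbm_factor s t (xi : Om -> R) (f : R -> R) : 0 <= s -> s < t ->
  adapted (G s) xi -> P.-integrable setT (EFin \o xi) -> measurable_fun setT f ->
  P.-integrable setT (EFin \o (fun w => f (W t w - W s w))) ->
  P.-integrable setT (EFin \o (fun w => xi w * f (W t w - W s w))) /\
  'Ex_P (fun w => xi w * f (W t w - W s w)) =
  'Ex_P xi * 'Ex_P (fun w => f (W t w - W s w)).
Proof.
move=> s0 st xiG ixi mf iif; have t0 : 0 <= t by rewrite (le_trans s0)// ltW.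
have mW : measurable_fun setT (fun w => W t w - W s w).
  by apply: measurable_funB; exact: fbm_measurable_W.
apply: Rintegral_indep => //.
- exact: adapted_measurable xiG.
- exact: measurableT_comp.
apply: (@indep_rv_comp _ _ _ P xi (fun w => W t w - W s w) id f) => //.
by move=> A C mA mC; apply: (fbm_indep bmW s0 st) => //; exact: xiG.
Qed.

(* Only even moments and discrete sums are needed, so the binomial expansion of
   [(S + H D) ^ (2 m)] and a Gronwall step replace the Burkholder-Davis-Gundy
   inequality. *)
Definition bdg_cst (m : nat) (T : R) : R :=
  \sum_(i < m.*2) 'C(m.*2, i.+1)%:R * gauss_moment i.+1./2 * (1 + T) ^+ i.+1.

Lemma gauss_moment_ge0 j : 0 <= gauss_moment j :> R.
Proof. by apply: prodr_ge0 => i _; rewrite addr_ge0// mulr_ge0. Qed.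

Lemma bdg_cst_ge0 m (T : R) : 0 <= T -> 0 <= bdg_cst m T.
Proof.
move=> T0; apply: sumr_ge0 => i _; rewrite !mulr_ge0 ?gauss_moment_ge0//.
by rewrite exprn_ge0// addr_ge0.
Qed.

(** Odd moments vanish and even ones of positive order contain at least one factor [v]. Being linear
    in [v], the bounds can be summed over a grid. *)
Lemma normal_moment_bound (U : Om -> R) (v T : R) i : 0 < v -> v <= T ->
  normal_law P U 0 v ->
  `|'Ex_P (fun w => U w ^+ i.+1)| <= gauss_moment i.+1./2 * (1 + T) ^+ i.+1 * v.
Proof.
move=> v0 vT UN; have T0 : 0 <= T by rewrite (le_trans (ltW v0)).
have [odd_i|even_i] := boolP (odd i.+1).
  rewrite -[i.+1 in leLHS]odd_double_half odd_i add1n (normal_law_odd _ v0 UN).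
  by rewrite normr0 !mulr_ge0 ?gauss_moment_ge0 ?exprn_ge0 ?addr_ge0// ltW.
have E : i.+1 = (i.+1./2).*2 by rewrite -[LHS]odd_double_half (negbTE even_i).
rewrite [in leLHS]E (normal_law_even _ v0 UN) ger0_norm; last first.
  by rewrite mulr_ge0 ?gauss_moment_ge0// exprn_ge0// ltW.
rewrite -mulrA ler_wpM2l ?gauss_moment_ge0//.
have : (0 < i.+1./2)%N by rewrite half_gt0; case: (i) even_i.
case: (i.+1./2) E => // j E _; rewrite exprSr ler_wpM2r ?(ltW v0)//.
rewrite (@le_trans _ _ ((1 + T) ^+ j))//.
  by rewrite lerXn2r ?nnegrE ?addr_ge0 ?(ltW v0)// (le_trans vT)// lerDr.
by rewrite ler_weXn2l ?lerDl// E -addnn addSn leqW// leq_addr || rewrite ler_weXn2l ?lerDl.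
Qed.

(** A crude Young inequality, sufficient to bound every mixed moment by the two pure ones. *)
Lemma exprM_le_add (x y : R) a b : 0 <= x -> 0 <= y ->
  x ^+ a * y ^+ b <= x ^+ (a + b) + y ^+ (a + b).
Proof.
move=> x0 y0; have [xy|/ltW yx] := leP x y.
  rewrite -[leLHS]add0r lerD ?exprn_ge0// exprD ler_wpM2r ?exprn_ge0//.
  by rewrite lerXn2r.
rewrite -[leLHS]addr0 lerD ?exprn_ge0// exprD ler_wpM2l ?exprn_ge0//.
by rewrite lerXn2r.
Qed.

Lemma norm_even_exprn (x : R) m : `|x| ^+ m.*2 = x ^+ m.*2.
Proof. by rewrite -mul2n !exprM real_normK ?num_real. Qed.

Section StochasticSum.
Variables (tau : nat -> R) (H : nat -> Om -> R) (delta T : R) (m : nat).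
Hypotheses (tau0 : 0 <= tau 0%N) (tauS : forall k, tau k.+1 - tau k = delta).
Hypotheses (delta0 : 0 < delta) (deltaT : delta <= T).

Definition stoch_sum n (w : Om) : R :=
  \sum_(k < n) H k w * (W (tau k.+1) w - W (tau k) w).

Lemma tau_ge0 k : 0 <= tau k.
Proof.
elim: k => [//|k IH]; rewrite -[tau _](subrK (tau k)) tauS.
by rewrite addr_ge0// ltW.
Qed.

Lemma tau_lt k : tau k < tau k.+1.
Proof. by rewrite -subr_gt0 tauS. Qed.

Lemma adapted_stoch_sum n : (forall k, (k < n)%N -> adapted (G (tau k)) (H k)) ->
  adapted (G (tau n)) (stoch_sum n).
Proof.
elim: n => [|n IH] HG.
  have -> : stoch_sum 0 = fun=> 0 by apply/funext => w; rewrite /stoch_sum big_ord0.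
  exact: (adapted_cst (fbm_sigma bmW (tau_ge0 0))).
have sa := fbm_sigma bmW (tau_ge0 n.+1).
have le := ltW (tau_lt n).
have -> : stoch_sum n.+1 = fun w => stoch_sum n w + H n w * (W (tau n.+1) w - W (tau n) w).
  by apply/funext => w; rewrite /stoch_sum big_ord_recr.
apply: (adaptedD sa).
  apply: (adapted_mono (tau_ge0 n) le); apply: IH => k kn; apply: HG.
  exact: ltnW.
apply: (adaptedM sa); first by apply: (adapted_mono (tau_ge0 n) le); exact: HG.
apply: (adaptedB sa); first exact: (fbm_adapted bmW (tau_ge0 _)).
by apply: (adapted_mono (tau_ge0 n) le); exact: (fbm_adapted bmW (tau_ge0 _)).
Qed.

Let bdg := bdg_cst m T.

(** Tracking the moment plus [h] makes the recursion homogeneous: each step multiplies it by at most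
    1 + bdg delta. In the binomial expansion the term without increment is the old moment and every
    other term is of order [delta]. *)
Lemma stoch_sum_moment n h : (0 < m)%N ->
  (forall k, (k < n)%N -> adapted (G (tau k)) (H k)) ->
  (forall k, (k < n)%N -> P.-integrable setT (EFin \o (fun w => H k w ^+ m.*2)) /\
     'Ex_P (fun w => H k w ^+ m.*2) <= h) -> 0 <= h ->
  P.-integrable setT (EFin \o (fun w => stoch_sum n w ^+ m.*2)) /\
  'Ex_P (fun w => stoch_sum n w ^+ m.*2) + h <= expR (bdg * (n%:R * delta)) * h.
Proof.
move=> m0 HG Hm h0; elim: n HG Hm => [|n IH] HG Hm.
  have -> : (fun w => stoch_sum 0 w ^+ m.*2) = fun=> 0.
    by apply/funext => w; rewrite /stoch_sum big_ord0 expr0n double_eq0 (gtn_eqF m0).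
  by rewrite Rintegral_prob_cst mul0r mulr0 expR0 mul1r add0r; split=> //; apply: integrable_bounded (measurable_cst _) _ => w; rewrite normr0.
have [iS ES] := IH (fun k kn => HG k (ltnW kn)) (fun k kn => Hm k (ltnW kn)).
have SG := adapted_stoch_sum (fun k kn => HG k (ltnW kn)).
have HnG := HG n (ltnSn n); have [iH EH] := Hm n (ltnSn n).
have sa := fbm_sigma bmW (tau_ge0 n).
set S := stoch_sum n in iS ES SG *; set D := fun w => W (tau n.+1) w - W (tau n) w.
have DN : normal_law P D 0 delta by rewrite -(tauS n); exact: (fbm_normal bmW (tau_ge0 n) (tau_lt n)).
pose xi (i : nat) w := S w ^+ (m.*2 - i) * H n w ^+ i.
have xiG i : adapted (G (tau n)) (xi i) by apply: (adaptedM sa); exact: adaptedX.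
have xi_le i : (i <= m.*2)%N -> forall w, `|xi i w| <= S w ^+ m.*2 + H n w ^+ m.*2.
  move=> im w; rewrite /xi normrM !normrX (le_trans (exprM_le_add _ _ _ _))//.
  by rewrite subnK// !norm_even_exprn.
have iSH : P.-integrable setT (EFin \o (fun w => S w ^+ m.*2 + H n w ^+ m.*2)).
  by apply: (integrableD measurableT iS iH).
have ixi i : (i <= m.*2)%N -> P.-integrable setT (EFin \o xi i).
  move=> im; apply: (@integrable_dominated _ _ _ P _ (fun w => S w ^+ m.*2 + H n w ^+ m.*2)) => //.
    exact: adapted_measurable (tau_ge0 n) _.
  by apply: aeW => w; exact: xi_le.
have Exi i : (i <= m.*2)%N -> `|'Ex_P (xi i)| <= 'Ex_P (fun w => S w ^+ m.*2) + h.
  move=> im; apply: (le_trans (Rintegral_norm_le (ixi i im) iSH _)).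
    by apply: aeW => w; exact: xi_le.
  by rewrite RintegralD// lerD2l.
have fac i : (i <= m.*2)%N ->
    P.-integrable setT (EFin \o (fun w => xi i w * D w ^+ i)) /\
    'Ex_P (fun w => xi i w * D w ^+ i) = 'Ex_P (xi i) * 'Ex_P (fun w => D w ^+ i).
  move=> im; apply: (@fbm_factor (tau n) (tau n.+1) (xi i) (fun x => x ^+ i) (tau_ge0 n) (tau_lt n)) => //.
  - exact: ixi.
  - exact: normal_law_integrable_exp DN.
have E w : stoch_sum n.+1 w ^+ m.*2 =
    \sum_(i < m.*2.+1) 'C(m.*2, i)%:R * (xi i w * D w ^+ i).
  rewrite /stoch_sum big_ord_recr/= -/(stoch_sum n w) -/S exprDn.
  by apply: eq_bigr => i _; rewrite -mulr_natl /xi exprMn -mulrA.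
have im (i : 'I_(m.*2.+1)) : (i <= m.*2)%N by rewrite -ltnS.
have ii (i : 'I_(m.*2.+1)) : P.-integrable setT
    (EFin \o (fun w => 'C(m.*2, i)%:R * (xi i w * D w ^+ i))).
  by apply: (integrableZl measurableT _ (fac i (im i)).1).
have -> : (fun w => stoch_sum n.+1 w ^+ m.*2) =
    fun w => \sum_(i < m.*2.+1) 'C(m.*2, i)%:R * (xi i w * D w ^+ i).
  by apply/funext => w; exact: E.
split.
  rewrite (_ : EFin \o _ = fun w => (\sum_(i < m.*2.+1) ('C(m.*2, i)%:R * (xi i w * D w ^+ i))%:E)%E).
    by apply: integrable_sum => // i _; exact: ii.
  by apply/funext => w; rewrite /= sumEFin.
have -> : 'Ex_P (fun w => \sum_(i < m.*2.+1) 'C(m.*2, i)%:R * (xi i w * D w ^+ i)) =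
    \sum_(i < m.*2.+1) 'C(m.*2, i)%:R * ('Ex_P (xi i) * 'Ex_P (fun w => D w ^+ i)).
  rewrite /Rintegral; under eq_integral do rewrite -sumEFin.
  rewrite integral_sum//.
  under eq_bigr => i _ do rewrite Rintegral_probE// RintegralZl ?(fac i (im i)).1// (fac i (im i)).2.
  by rewrite sumEFin.
rewrite big_ord_recl bin0 /= mul1r.
have -> : 'Ex_P (xi 0%N) * 'Ex_P (fun w => D w ^+ 0) = 'Ex_P (fun w => S w ^+ m.*2).
  rewrite (_ : (fun w => D w ^+ 0) = fun=> 1)// Rintegral_prob_cst mulr1.
  by congr Rintegral; apply/funext => w; rewrite /xi subn0 mulr1.
set a := 'Ex_P (fun w => S w ^+ m.*2) in ES Exi *.
have a0 : 0 <= a by apply: Rintegral_ge0 => w _; rewrite -norm_even_exprn exprn_ge0.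
apply: (@le_trans _ _ ((1 + bdg * delta) * (a + h))).
  rewrite mulrDl mul1r addrAC lerD2l /bdg /bdg_cst mulrAC mulr_suml [leRHS]mulr_suml.
  apply: ler_sum => i _; rewrite /bump/= add1n.
  apply: (le_trans (ler_norm _)); rewrite !normrM normr_nat.
  rewrite -[leRHS]mulrA -[leRHS]mulrA -[leRHS]mulrA ler_wpM2l//.
  have := normal_moment_bound i delta0 deltaT DN.
  have := Exi i.+1 (ltn_ord i); set p := `|_| => ple; set q := `|_|; set g := gauss_moment _ * _ => qle.
  rewrite mulrA -/g mulrCA; apply: (le_trans (ler_pM _ _ ple qle)); rewrite ?normr_ge0//.
apply: (@le_trans _ _ (expR (bdg * delta) * (a + h))).
  by rewrite ler_wpM2r ?addr_ge0// expR_ge1Dx.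
rewrite (_ : bdg * (n.+1%:R * delta) = bdg * delta + bdg * (n%:R * delta)); last by rewrite -natr1; ring.
by rewrite expRD -mulrA ler_wpM2l// expR_ge0.
Qed.

Lemma Lq_le_stoch_sum n b : (0 < m)%N ->
  (forall k, (k < n)%N -> adapted (G (tau k)) (H k)) ->
  (forall k, (k < n)%N -> Lq_le P m.*2 (H k) b) -> 0 <= b ->
  Lq_le P m.*2 (stoch_sum n) (expR (bdg * (n%:R * delta)) * b).
Proof.
move=> m0 HG Hb b0; have mS := adapted_measurable (tau_ge0 n) (adapted_stoch_sum HG).
pose e := expR (bdg * (n%:R * delta)).
have e1 : 1 <= e.
  have e0 : 0 <= bdg * (n%:R * delta).
    by rewrite mulr_ge0 ?mulr_ge0 ?(ltW delta0)// bdg_cst_ge0// (le_trans (ltW delta0)).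
  by rewrite (le_trans _ (expR_ge1Dx _))// lerDl.
have E f : (fun w => `|f w| ^+ m.*2) = (fun w => f w ^+ m.*2) :> (Om -> R).
  by apply/funext => w; rewrite norm_even_exprn.
have [] := @stoch_sum_moment n (b ^+ m.*2) m0 HG _ (exprn_ge0 _ b0).
  by move=> k kn; rewrite -E; split; [exact: integrable_Lq (Hb k kn)|exact: Rintegral_Lq (Hb k kn)].
move=> iS ES; apply: Lq_le_Rintegral; rewrite ?E//.
  by rewrite mulr_ge0// expR_ge0.
rewrite exprMn (@le_trans _ _ (e * b ^+ m.*2))//.
  by rewrite (le_trans _ ES)// lerDl exprn_ge0.
(* Since [e] is at least 1 it is below its own power, so no root of the exponential has to be
   taken. *)
rewrite ler_wpM2r ?exprn_ge0// -/e -[leLHS]expr1 ler_weXn2l// double_gt0//.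
Qed.

End StochasticSum.

(** The bound for sums over uniform grids is free of the mesh, hence survives the limit in
    probability defining the integral. *)
Lemma Lq_le_ito m (H : R -> Om -> R) (U : Om -> R) t b : (0 < m)%N -> 0 <= t -> 0 <= b ->
  (forall s, 0 <= s <= t -> adapted (G s) (H s)) ->
  (forall s, 0 <= s <= t -> Lq_le P m.*2 (H s) b) ->
  is_ito_integral P H W t U ->
  Lq_le P m.*2 U (expR (bdg_cst m t * t) * b).
Proof.
move=> m0 t0 b0 HG Hb [mU HU].
pose S n w := \sum_(k < n) H (grid 0 t n k) w * (W (grid 0 t n k.+1) w - W (grid 0 t n k) w).
have SU : cvg_prob P (fun n => S n.+1) U.
  move=> e e0; have [delta delta0 K] := HU e e0.
  have [N NP] : exists N : nat, forall n, (N <= n)%N -> t / n.+1%:R < delta.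
    exists (Num.truncn (t / delta)).+1 => n Nn.
    rewrite ltr_pdivrMr ?ltr0n// mulrC -ltr_pdivrMr// (lt_le_trans (truncnS_gt _))//.
    by rewrite ler_nat leqW.
  exists N => n Nn; apply: K; [exact: grid0|exact: grid_last|].
  move=> k kn; rewrite gridS subr0 NP//; split=> //; apply: grid_le => //.
apply: (@Lq_le_cvg_prob _ _ _ P m.*2 (fun n => S n.+1)) => //.
  by rewrite mulr_ge0// expR_ge0.
(* At time 0 the mesh vanishes and the estimate for positive mesh does not apply; the sums are then
   0. *)
move=> n; have [t00|tn0] := eqVneq t 0.
  have -> : S n.+1 = fun=> 0.
    apply/funext => w; rewrite /S big1// => k _.
    have g0 j : grid 0 t n.+1 j = 0 by rewrite /grid t00 subrr mul0r mulr0 addr0.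
    by rewrite !g0 subrr mulr0.
  by apply: (@Lq_leW _ _ _ P _ _ 0); rewrite ?mulr_ge0 ?expR_ge0//; apply: Lq_le0; rewrite double_gt0.
have tp : 0 < t by rewrite lt_neqAle eq_sym tn0.
have gP k : (k < n.+1)%N -> 0 <= grid 0 t n.+1 k <= t by move=> kn; apply: grid_itv => //; exact: ltnW.
have := @Lq_le_stoch_sum (grid 0 t n.+1) (fun k => H (grid 0 t n.+1 k)) (t / n.+1%:R) t m.
move=> /(_ _ _ _ _ n.+1 b m0); rewrite (_ : n.+1%:R * (t / n.+1%:R) = t); last first.
  by rewrite mulrCA divff ?mulr1// pnatr_eq0.
apply => //.
- by rewrite grid0.
- by move=> k; rewrite gridS subr0.
- by rewrite divr_gt0// ltr0n.
- by rewrite ler_pdivrMr ?ltr0n// ler_peMr// ler1n.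
- by move=> k kn; apply: HG; exact: gP.
- by move=> k kn; apply: Hb; exact: gP.
Qed.

End FilteredBrownianMotion.

(** * The innovation Brownian motion *)

Section ConditionalProbability.
Context d (Om : measurableType d) (R : realType) (P : probability Om R).
Variables (G : set (set Om)) (A : set Om) (f : Om -> R).
Hypotheses (saG : sigma_algebra setT G) (Gm : forall D, G D -> measurable D).
Hypotheses (mA : measurable A) (fP : is_cond_prob P G A f).

Lemma cond_prob_measurable : measurable_fun setT f.
Proof. by move=> _ C mC; rewrite setTI; apply: Gm; exact: fP.1. Qed.

(** Testing on the level sets below - 1 / (n + 1) and above 1 + 1 / (n + 1), which belong to [G],
    forces them to be null. *)
Lemma cond_prob_itv : {ae P, forall w, 0 <= f w <= 1}.
Proof.
have mf := cond_prob_measurable.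
have nonpos_eq0 (x : \bar R) (e : R) : 0 < e -> (0 <= x)%E -> (e%:E * x <= 0)%E -> x = 0%E.
  move=> e0 x0; rewrite pmule_rle0 ?lte_fin// => xle; apply/eqP.
  by rewrite eq_le xle x0.
have lo n : {ae P, forall w, - n.+1%:R^-1 <= f w}.
  pose D := f @^-1` `]-oo, - n.+1%:R^-1[.
  have GD : G D by apply: fP.1; exact: measurable_itv.
  have mD := Gm GD.
  have e0 : 0 < n.+1%:R^-1 :> R by rewrite invr_gt0 ltr0n.
  have Df w : D w -> n.+1%:R^-1 <= - f w.
    by rewrite /D /= in_itv/= lerNr => /ltW.
  exists D; split=> //; last by move=> w /= /negP; rewrite -ltNge /D /= in_itv.
  apply: (nonpos_eq0 _ _ e0); first exact: measure_ge0.
  apply: (@le_trans _ _ (\int[P]_(w in D) (- f w)%:E)%E).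
    rewrite -(integral_cst P mD); apply: ge0_le_integral => //.
    - by move=> w _; rewrite lee_fin ltW.
    - by apply/measurable_EFinP; apply: measurable_funTS; exact: measurableT_comp.
  have Nf0 w : D w -> (0 <= (- f w)%:E)%E.
    by move=> Dw; rewrite lee_fin (le_trans (ltW e0))// Df.
  rewrite -[leLHS]oppeK -(integral_ge0N P Nf0).
  by under eq_integral do rewrite -EFinN opprK; rewrite (fP.2 D GD) oppe_le0.
have up n : {ae P, forall w, f w <= 1 + n.+1%:R^-1}.
  pose D := f @^-1` `]1 + n.+1%:R^-1, +oo[.
  have GD : G D by apply: fP.1; exact: measurable_itv.
  have mD := Gm GD.
  have e0 : 0 < n.+1%:R^-1 :> R by rewrite invr_gt0 ltr0n.
  exists D; split=> //; last first.
    by move=> w /= /negP; rewrite -ltNge /D /= in_itv/= andbT.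
  have : ((1 + n.+1%:R^-1)%:E * P D <= P D)%E.
    apply: (@le_trans _ _ (\int[P]_(w in D) (f w)%:E)%E); last first.
      by rewrite (fP.2 D GD) le_measure ?inE//; exact: measurableI.
    rewrite -(integral_cst P mD); apply: ge0_le_integral => //.
    - by move=> w _; rewrite lee_fin addr_ge0// ltW.
    - by apply/measurable_EFinP; apply: measurable_funTS.
    - by move=> w; rewrite /D /= in_itv/= andbT => /ltW; rewrite lee_fin.
  have PD : P D \is a fin_num by exact: fin_num_measure.
  rewrite -(fineK PD) -EFinM lee_fin mulrDl mul1r gerDl => h.
  congr EFin; apply/eqP; rewrite eq_le fine_ge0// andbT.
  by move: h; rewrite pmulr_rle0.
have [lo' up'] := (ae_foralln lo, ae_foralln up).
apply: filterS2 lo' up' => w l u; apply/andP; split; rewrite leNgt; apply/negP => fw.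
  have [k] := ltr_add_invr fw; apply/negP; rewrite -leNgt -lerBlDr sub0r; exact: l.
have [k] := ltr_add_invr fw; apply/negP; rewrite -leNgt; exact: u.
Qed.

(** The sum of indicators is the integer part of [x]. Rescaled by [n], it approximates a function
    with values in [0, 1] by its level sets within 1 / n. *)
Lemma layer_approx (x : R) n : 0 <= x <= n%:R ->
  `|\sum_(k < n) \1_`[k.+1%:R, +oo[ x - x| <= 1.
Proof.
elim: n x => [|n IH] x /andP[x0 xn].
  have -> : x = 0 by apply: le_anti; rewrite x0 xn.
  by rewrite big_ord0 subrr normr0.
rewrite big_ord_recr/=; have [xn'|nx] := leP x n%:R.
  rewrite indicE memNset ?addr0; first by apply: IH; rewrite x0.
  by rewrite /= in_itv/= andbT => /(le_trans)/(_ xn'); rewrite ler_nat ltnn.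
rewrite (eq_bigr (fun=> 1)); last first.
  move=> k _; rewrite indicE mem_set//= in_itv/= andbT (le_trans _ (ltW nx))//.
  by rewrite ler_nat.
rewrite sumr_const card_ord; have : 0 <= (\1_`[n.+1%:R, +oo[ x : R) <= 1.
  by rewrite indicE; case: (_ \in _); rewrite ?lexx ?ler01.
move: xn nx; rewrite -natr1 => xn nx /andP[a b]; rewrite ler_norml; apply/andP; split; last lra.
have [xn1|xn1] := leP (n%:R + 1) x; last lra.
by rewrite indicE mem_set//= ?in_itv/= ?andbT ?natr1 //; lra.
Qed.

(* Conditional probabilities are tested on bounded adapted variables, which
   are limits of sums of indicators of their level sets. *)
Lemma cond_prob_test (xi : Om -> R) : adapted G xi -> (forall w, `|xi w| <= 1) ->
  'Ex_P (fun w => xi w * (\1_A w - f w)) = 0.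
Proof.
have mf := cond_prob_measurable.
have mIf : measurable_fun setT (fun w => \1_A w - f w) by exact: measurable_funB.
have dle : {ae P, forall w, `|\1_A w - f w| <= 1}.
  apply: filterS cond_prob_itv => w /andP[f0 f1].
  have : 0 <= (\1_A w : R) <= 1 by rewrite indicE; case: (_ \in _); rewrite ?lexx ?ler01.
  by move=> /andP[a0 a1]; rewrite ler_norml; apply/andP; split; lra.
have Ind D : G D -> 'Ex_P (fun w => \1_D w * (\1_A w - f w)) = 0.
  move=> GD; have mD := Gm GD.
  have i1 : P.-integrable setT (EFin \o (fun w => \1_D w * \1_A w : R)).
    apply: (@integrable_bounded _ _ _ P _ 1); first by apply: measurable_funM; exact: measurable_indic.
    by move=> w; rewrite !indicE; case: (_ \in _); case: (_ \in _); rewrite ?mulr0 ?mul0r ?mul1r ?normr0 ?normr1 ?ler01.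
  have i2 : P.-integrable setT (EFin \o (fun w => \1_D w * f w)).
    apply: (@integrable_aebounded _ _ _ P _ 1); first by apply: measurable_funM.
    apply: filterS cond_prob_itv => w /andP[f0 f1]; rewrite indicE.
    by case: (_ \in _); rewrite ?mul0r ?normr0 ?ler01// mul1r ger0_norm.
  under eq_fun do rewrite mulrBr; rewrite RintegralB//; apply/eqP; rewrite subr_eq0; apply/eqP.
  rewrite /Rintegral; congr fine.
  transitivity (P (A `&` D)).
    rewrite -integral_indic// [RHS]integral_mkcond; apply: eq_integral => w _.
    by rewrite epatch_indic/= muleC.
  rewrite -(fP.2 D GD) [LHS]integral_mkcond; apply: eq_integral => w _.
  by rewrite epatch_indic/= muleC.
have nonneg (x : Om -> R) : adapted G x -> (forall w, 0 <= x w <= 1) ->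
    'Ex_P (fun w => x w * (\1_A w - f w)) = 0.
  move=> xG x01; have mx : measurable_fun setT x by move=> _ C mC; rewrite setTI; apply: Gm; exact: xG.
  have le_inv n : `|'Ex_P (fun w => x w * (\1_A w - f w))| <= n.+1%:R^-1.
    pose D (k : nat) := [set w | k.+1%:R <= n.+1%:R * x w].
    have GD k : G (D k).
      rewrite (_ : D k = x @^-1` `[k.+1%:R / n.+1%:R, +oo[); last first.
        by apply/seteqP; split=> w; rewrite /D /= in_itv/= andbT ler_pdivrMr ?ltr0n// mulrC.
      by apply: xG; exact: measurable_itv.
    pose S w : R := n.+1%:R^-1 * \sum_(k < n.+1) \1_(D k) w.
    have mS : measurable_fun setT S.
      by apply: measurable_funM => //; apply: measurable_sum => k; apply: measurable_indic; exact: Gm.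
    have Sx w : `|S w - x w| <= n.+1%:R^-1.
      have := @layer_approx (n.+1%:R * x w) n.+1.
      have /andP[x0 x1] := x01 w.
      rewrite mulr_ge0//= ler_piMr// => /(_ isT).
      rewrite (eq_bigr (fun k : 'I_n.+1 => \1_(D k) w)); last first.
        move=> k _; rewrite !indicE; congr (_%:R); congr nat_of_bool.
        by apply/idP/idP; rewrite !inE /D/= in_itv/= andbT.
      have -> : S w - x w = n.+1%:R^-1 * (\sum_(k < n.+1) \1_(D k) w - n.+1%:R * x w).
        by rewrite mulrBr mulKf// pnatr_eq0.
      move=> h; rewrite normrM ger0_norm ?invr_ge0//; exact: ler_piMr.
    have iS : 'Ex_P (fun w => S w * (\1_A w - f w)) = 0.
      have E w : S w * (\1_A w - f w) = n.+1%:R^-1 * \sum_(k < n.+1) (\1_(D k) w * (\1_A w - f w)).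
        by rewrite /S -mulrA mulr_suml.
      have ii k : P.-integrable setT (EFin \o (fun w => \1_(D k) w * (\1_A w - f w))).
        apply: (@integrable_aebounded _ _ _ P _ 1).
          by apply: measurable_funM => //; apply: measurable_indic; exact: Gm.
        apply: filterS dle => w h; rewrite indicE.
        by case: (_ \in _); rewrite ?mul1r// mul0r normr0 ler01.
      rewrite /Rintegral; under eq_integral do rewrite E EFinM -sumEFin.
      rewrite integralZl//; last by apply: integrable_sum => // k _; exact: ii.
      rewrite integral_sum//; last by move=> k; exact: ii.
      under eq_bigr => k _ do rewrite Rintegral_probE// Ind//.
      by rewrite sumEFin big1// mule0.
    have ix (y : Om -> R) (K : R) : measurable_fun setT y -> (forall w, `|y w| <= K) ->
        P.-integrable setT (EFin \o (fun w => y w * (\1_A w - f w))).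
      move=> my yK; apply: (@integrable_aebounded _ _ _ P _ K); first exact: measurable_funM.
      apply: filterS dle => w h; rewrite normrM (le_trans (ler_wpM2l _ h))// mulr1.
      exact: yK.
    have sub0 (z y c : R) : y = 0 -> `|z - y| <= c -> `|z| <= c by move=> ->; rewrite subr0.
    apply: (sub0 _ _ _ iS); rewrite -RintegralB//; last 2 first.
    - by apply: (ix x 1) => // w; have /andP[? ?] := x01 w; rewrite ger0_norm.
    - apply: (ix S (1 + n.+1%:R^-1)) => // w; rewrite -[S w](subrK (x w)) addrC.
      rewrite (le_trans (ler_normD _ _))// lerD//.
      by have /andP[? ?] := x01 w; rewrite ger0_norm.
    apply: Rintegral_norm_bound.
      by apply: measurable_funB; apply: measurable_funM.
    apply: filterS dle => w h; rewrite -mulrBl normrM distrC -[leRHS]mulr1.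
    by apply: ler_pM.
  apply/eqP; rewrite -normr_le0 leNgt; apply/negP => lt0.
  have [k] := ltr_add_invr lt0; apply/negP; rewrite -leNgt add0r; exact: le_inv.
move=> xiG xi1.
have mxi : measurable_fun setT xi by move=> _ C mC; rewrite setTI; apply: Gm; exact: xiG.
have GT : G setT by rewrite -[setT]setC0 -setTD; case: saG => g0 gC _; exact: gC.
(* A signed test variable is an affine image of one with values in [0, 1]. *)
have e1 : 'Ex_P (fun w => (1 + xi w) / 2 * (\1_A w - f w)) = 0.
  apply: nonneg; last by move=> w; move: (xi1 w); rewrite ler_norml => /andP[? ?]; apply/andP; split; lra.
  apply: (@adapted_comp _ _ _ saG (fun x => (1 + x) / 2) xi) => //.
  by apply: measurable_funM => //; apply: measurable_funD.
have e2 := Ind _ GT.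
have -> : (fun w => xi w * (\1_A w - f w)) = fun w =>
    2 * ((1 + xi w) / 2 * (\1_A w - f w)) - \1_[set: Om] w * (\1_A w - f w).
  by apply/funext => w; rewrite indicT/=; field.
have i1 : P.-integrable setT (EFin \o (fun w => (1 + xi w) / 2 * (\1_A w - f w))).
  apply: (@integrable_aebounded _ _ _ P _ 1).
    apply: measurable_funM => //; apply: measurable_funM => //; exact: measurable_funD.
  apply: filterS dle => w h; rewrite normrM -[leRHS]mulr1 ler_pM//.
  by move: (xi1 w); rewrite ler_norml => /andP[? ?]; rewrite ler_norml; apply/andP; split; lra.
rewrite RintegralB ?RintegralZl ?e1 ?e2 ?mulr0 ?subr0//.
  exact: (integrableZl measurableT _ i1).
by under eq_fun do rewrite indicT mul1r; apply: (@integrable_aebounded _ _ _ P _ 1).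
Qed.

End ConditionalProbability.

Lemma sigma_algebraI (T : Type) (G : set (set T)) A B :
  sigma_algebra setT G -> G A -> G B -> G (A `&` B).
Proof.
move=> [G0 GC GU] GA GB; rewrite -[A `&` B]setCK setCI -setTD -bigcup2E.
by apply: (GC); apply: GU => -[|[|n]] //=; rewrite -setTD; exact: GC.
Qed.

(** * Independence from a join of sigma-algebras, up to null sets *)

Section ProductOfIndependent.
Context d (Om : measurableType d) (R : realType) (P : probability Om R).
Hypothesis P_complete : measure_is_complete P.
Variables (E F : set (set Om)) (D : set Om).
Hypotheses (saE : sigma_algebra setT E) (saF : sigma_algebra setT F).
Hypotheses (Em : forall A, E A -> measurable A) (Fm : forall A, F A -> measurable A).
Hypothesis mD : measurable D.
Hypothesis EFD : forall A B, E A -> F B -> P (A `&` B `&` D) = (P (A `&` B) * P D)%E.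

Definition join_sigma := <<s [set C | exists A B, [/\ E A, F B & C = A `&` B]] >>.

Lemma join_sigma_measurable C : join_sigma C -> measurable C.
Proof.
move=> jC; have := @sigma_algebra_measurable _ Om => sM.
apply: (smallest_sub sM _ jC) => _ [A [B [EA FB ->]]].
by apply: measurableI; [exact: Em|exact: Fm].
Qed.

(** Intersections of one set from each family are closed under intersection, so the product rule
    extends by Dynkin's theorem. *)
Lemma join_sigma_indep C : join_sigma C -> P (C `&` D) = (P C * P D)%E.
Proof.
move=> jC; have : measurable C /\ P (C `&` D) = (P C * P D)%E; last by case.
move: C jC; apply: sigma_algebra_dynkin_ind => //.
- move=> _ _ [A [B [EA FB ->]]] [A' [B' [EA' FB' ->]]].
  exists (A `&` A'), (B `&` B'); rewrite setIACA; split=> //.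
    exact: (sigma_algebraI saE EA EA').
  exact: (sigma_algebraI saF FB FB').
- move=> _ [A [B [EA FB ->]]]; split; last exact: EFD.
  by apply: measurableI; [exact: Em|exact: Fm].
- by rewrite setTI probability_setT mul1e.
- move=> A [mA AD]; split; first exact: measurableC.
  rewrite setIC -setDE measureD//; last by rewrite ltey_eq fin_num_measure.
  rewrite [X in (_ - X)%E](_ : _ = P A * P D)%E; last by rewrite setIC; exact: AD.
  rewrite probability_setC// muleBl ?mul1e//.
  - exact: fin_num_measure.
- move=> K tK KP; have mK n : measurable (K n) := (KP n).1.
  split; first exact: bigcup_measurable.
  rewrite setI_bigcupl measure_bigcup//; last 2 first.
  - by move=> n _; exact: measurableI.
  - exact: trivIset_setIr.
  rewrite measure_bigcup//.
  rewrite -(fineK (fin_num_measure P D mD)) muleC -nneseriesZl//; apply: eq_eseriesr => n _.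
  by rewrite fineK ?fin_num_measure// muleC; exact: (KP n).2.
Qed.

(** Adding null sets changes each event by a null set only, and probabilities do not see the change.
    Completeness makes the added sets measurable. *)
Lemma join_sigma_negligible_indep C :
  <<s join_sigma `|` P.-negligible >> C -> P (C `&` D) = (P C * P D)%E.
Proof.
(* Events that agree up to null sets with an event of the join; they form a sigma-algebra containing
   all generators. *)
pose N := [set C | measurable C /\ exists C', [/\ join_sigma C', P (C `\` C') = 0%E & P (C' `\` C) = 0%E]].
have saJ : sigma_algebra setT join_sigma by exact: smallest_sigma_algebra.
have [J0 JC JU] := saJ.
have bigcup0 (K : nat -> set Om) : (forall n, measurable (K n)) ->
    (forall n, P (K n) = 0%E) -> P (\bigcup_n K n) = 0%E.
  move=> mK K0; apply: measure_negligible; first exact: bigcup_measurable.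
  by apply: negligible_bigcup => n; apply/(negligibleP P (mK n)); exact: K0.
have saN : sigma_algebra setT N.
  split.
  - by split=> //; exists set0; split=> //; rewrite setDv measure0.
  - move=> A [mA [A' [jA' d1 d2]]]; split; first by rewrite setTD; exact: measurableC.
    exists (setT `\` A'); split; first exact: JC.
      by rewrite !setTD setDE setCK setIC -setDE.
    by rewrite !setTD setDE setCK setIC -setDE.
  - move=> A NA; have mA n : measurable (A n) by exact: (NA n).1.
    have [A' A'P] := choice (fun n => (NA n).2).
    have mA' n : measurable (A' n) by apply: join_sigma_measurable; have [] := A'P n.
    split; first exact: bigcup_measurable.
    exists (\bigcup_n A' n); split; first by apply: JU => n; have [] := A'P n.
      apply: (@subset_measure0 _ _ _ P _ (\bigcup_n (A n `\` A' n))).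
      - by apply: measurableD; exact: bigcup_measurable.
      - by apply: bigcup_measurable => n _; exact: measurableD.
      - by move=> w [[n _ An] NA']; exists n => //; split=> // A'n; apply: NA'; exists n.
      - apply: bigcup0 => n; [exact: measurableD|by have [] := A'P n].
    apply: (@subset_measure0 _ _ _ P _ (\bigcup_n (A' n `\` A n))).
    - by apply: measurableD; exact: bigcup_measurable.
    - by apply: bigcup_measurable => n _; exact: measurableD.
    - by move=> w [[n _ An] NA']; exists n => //; split=> // A'n; apply: NA'; exists n.
    - apply: bigcup0 => n; [exact: measurableD|by have [] := A'P n].
move=> sC; have [mC [C' [jC' d1 d2]]] : N C.
  apply: (smallest_sub saN _ sC) => A [jA|nA].
    by split; [exact: join_sigma_measurable|exists A; split=> //; rewrite setDv measure0].
  have mA := P_complete nA; split=> //; exists set0; split=> //; last by rewrite set0D measure0.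
  by rewrite setD0; apply/negligibleP.
have mC' := join_sigma_measurable jC'.
have eqP_ (K : set Om) : measurable K -> P (C `&` K) = P (C' `&` K).
  move=> mK; have h A B : measurable A -> measurable B -> P (A `\` B) = 0%E ->
      (P (A `&` K) <= P (B `&` K))%E.
    move=> mA mB AB0; apply: (@le_trans _ _ (P (B `&` K `|` (A `\` B)))%E).
      apply: le_measure; rewrite ?inE; [exact: measurableI| |].
        by apply: measurableU; [exact: measurableI|exact: measurableD].
      by move=> w [Aw Kw]; have [Bw|NBw] := pselect (B w); [left|right].
    apply: (le_trans (measureU2 _ _ _)); [exact: measurableI|exact: measurableD|].
    by rewrite [X in (_ + X)%E](_ : _ = 0%E) ?adde0.
  by apply/eqP; rewrite eq_le !h.
rewrite eqP_// join_sigma_indep// -[in LHS](setIT C') -eqP_// setIT//.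
Qed.

End ProductOfIndependent.

Section ExpectationSums.
Context d (Om : measurableType d) (R : realType) (P : probability Om R).
Context (I : Type).
Implicit Types (r : seq I) (f : I -> Om -> R).

Lemma integrable_sumR r f : (forall i, P.-integrable setT (EFin \o f i)) ->
  P.-integrable setT (EFin \o (fun w => \sum_(i <- r) f i w)).
Proof.
move=> fi; rewrite (_ : EFin \o _ = fun w => (\sum_(i <- r) (f i w)%:E)%E).
  by apply: integrable_sum => // i _; exact: fi.
by apply/funext => w; rewrite /= sumEFin.
Qed.

Lemma Rintegral_sumR r f : (forall i, P.-integrable setT (EFin \o f i)) ->
  'Ex_P (fun w => \sum_(i <- r) f i w) = \sum_(i <- r) 'Ex_P (f i).
Proof.
move=> fi; rewrite /Rintegral; under eq_integral do rewrite -sumEFin.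
rewrite integral_sum//.
by under eq_bigr => i _ do rewrite Rintegral_probE//; rewrite sumEFin.
Qed.

End ExpectationSums.

Section RightContinuity.
Context {R : realType}.

Lemma right_cont_ext (f g : R -> R) s t : (forall x, s <= x -> f x = g x) ->
  right_cont f s t -> right_cont g s t.
Proof.
move=> fg fc r /andP[sr rt]; rewrite -(fg r sr).
apply: cvg_trans (fc r _); last by rewrite sr.
apply: near_eq_cvg; near=> x; rewrite fg// (le_trans sr)//.
Unshelve. all: by end_near. Qed.

Lemma right_contB (f g : R -> R) s t : right_cont f s t -> right_cont g s t ->
  right_cont (fun x => f x - g x) s t.
Proof. by move=> fc gc r sr; apply: cvgB; [exact: fc|exact: gc]. Qed.

Lemma within_continuous_coord d (V : R -> 'cV[R]_d) i :
  {within `[0, +oo[, continuous V} -> {within `[0, +oo[, continuous (fun t => V t i 0)}.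
Proof.
move=> cV t; apply: (@continuous_comp (subspace (`[0, +oo[ : set R) : topologicalType) _ _ V
  (fun x : 'cV[R]_d => x i 0)); [exact: cV|exact: coord_continuous].
Qed.

(** Approximation of a time by multiples of 1 / (n + 1): almost sure statements at countably many
    times extend by continuity. *)
Lemma dense_itv_cvg (s : R) : 0 <= s -> (Num.truncn (s * n.+1%:R))%:R / n.+1%:R @[n --> \oo] --> s.
Proof.
move=> s0; apply/cvgrPdist_le => e e0; near=> n.
have n0 : 0 < n.+1%:R :> R by rewrite ltr0n.
have x0 : 0 <= s * n.+1%:R by rewrite mulr_ge0.
have -> : s - (Num.truncn (s * n.+1%:R))%:R / n.+1%:R =
    (s * n.+1%:R - (Num.truncn (s * n.+1%:R))%:R) / n.+1%:R by rewrite mulrBl mulfK ?gt_eqF.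
rewrite normrM normfV [X in _ / X]ger0_norm ?(ltW n0)//.
apply: (@le_trans _ _ n.+1%:R^-1); last first.
  near: n; have [m _ mP] := near_infty_natSinv_lt (PosNum e0).
  by exists m => // n /mP /= /ltW.
rewrite ler_piMl ?invr_ge0 ?(ltW n0)//.
have := truncn_itv x0 => /andP[a b]; rewrite ger0_norm ?subr_ge0// lerBlDr.
by rewrite addrC natr1 ltW.
Unshelve. all: by end_near. Qed.

Lemma limr_ge_cst (u : nat -> R) l c : u n @[n --> \oo] --> l -> (forall n, c <= u n) -> c <= l.
Proof.
move=> ul uc; rewrite -(cvg_lim (@Rhausdorff R) ul); apply: limr_ge; first exact: cvgP ul.
by apply: nearW.
Qed.

Lemma limr_le_cst (u : nat -> R) l c : u n @[n --> \oo] --> l -> (forall n, u n <= c) -> l <= c.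
Proof.
move=> ul uc; rewrite -(cvg_lim (@Rhausdorff R) ul); apply: limr_le; first exact: cvgP ul.
by apply: nearW.
Qed.

End RightContinuity.

(** * Regularity of the signal *)

Section Signal.
Context disp (Om : measurableType disp) (R : realType) (P : probability Om R) (d : nat).
Variables (a : 'I_d -> R) (L : 'M[R]_d) (nu : 'cV[R]_d) (h : R -> R) (X : R -> Om -> R).
Hypotheses (a_inj : injective a) (mcX : markov_chain P a L nu X).

(** The sum, rather than the maximum, also bounds [mean hv x] as soon as the entries of [x] lie in
    [0, 1]. *)
Definition hmax : R := \sum_i `|h (a i)|.

Lemma hmax_ge0 : 0 <= hmax. Proof. exact: sumr_ge0. Qed.

Lemma measurable_signal_eq t i : 0 <= t -> measurable [set w | X t w = a i].
Proof.
move=> t0; have [mX _ _ _ _] := mcX.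
rewrite (_ : [set w | _] = X t @^-1` [set a i])//.
by rewrite -[X in measurable X]setTI; exact: mX.
Qed.

Lemma signal_hE t w : 0 <= t -> h (X t w) = \sum_i h (a i) * \1_[set w | X t w = a i] w.
Proof.
move=> t0; have [_ fX _ _ _] := mcX; have [i Xi] := fX t w t0.
rewrite (bigD1 i)//= big1 ?addr0 => [|j ji]; first by rewrite indicE mem_set// mulr1 Xi.
by rewrite indicE memNset ?mulr0//= Xi => /a_inj/eqP; rewrite eq_sym (negbTE ji).
Qed.

Lemma norm_signal_h t w : 0 <= t -> `|h (X t w)| <= hmax.
Proof.
move=> t0; have [_ fX _ _ _] := mcX; have [i ->] := fX t w t0.
by rewrite /hmax (bigD1 i)//= lerDl sumr_ge0.
Qed.

(** With finitely many separated states, a right-continuous path stays in its state for a while, so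
    no regularity of [h] enters. *)
Lemma right_cont_signal_h w s t : 0 <= s -> right_cont (fun r => h (X r w)) s t.
Proof.
move=> s0 r /andP[sr _]; have r0 := le_trans s0 sr.
have [_ fX rX _ _] := mcX; have [i Xi] := fX r w r0.
have near_ne : \forall x \near r^'+, forall j, j != i -> X x w != a j.
  apply: filter_forall => j; have [->|ji] := eqVneq j i; first by apply: nearW => x /negP; case.
  have d0 : 0 < `|a i - a j|.
    by rewrite normr_gt0 subr_eq0; apply: contra ji => /eqP/a_inj ->.
  have := rX r w r0; rewrite Xi => /cvgrPdist_lt/(_ _ d0); apply: filterS => x + _.
  by apply: contraTneq => ->; rewrite ltxx.
have near_eq : \forall x \near r^'+, h (X x w) = h (X r w).
  apply: filterS2 near_ne (nbhs_right_gt r) => x ne rx.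
  have x0 : 0 <= x by rewrite (le_trans r0)// ltW.
  have [j Xj] := fX x w x0; have [ji|ji] := eqVneq j i; first by rewrite Xi Xj ji.
  by have := ne j ji; rewrite Xj eqxx.
exact: cvg_near_cst near_eq.
Qed.

End Signal.

Section AdaptedObservation.
Context {Om : Type} {R : realType}.
Variable G : set (set Om).
Hypothesis saG : sigma_algebra setT G.

Lemma adapted_indic (A : set Om) : G A -> adapted G (\1_A : Om -> R).
Proof.
move=> GA C mC; rewrite preimage_indic; have [G0 GC _] := saG.
have GT : G setT by rewrite -[setT]setD0; exact: GC.
by case: ifP => _; case: ifP => _ //; rewrite -setTD; exact: GC.
Qed.

Lemma adapted_bigsum (I : Type) (r : seq I) (f : I -> Om -> R) :
  (forall i, adapted G (f i)) -> adapted G (fun w => \sum_(i <- r) f i w).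
Proof.
move=> fG; elim: r => [|i r IH].
  under eq_fun do rewrite big_nil; exact: adapted_cst.
by under eq_fun do rewrite big_cons; exact: adaptedD.
Qed.

Lemma adaptedZ (c : R) f : adapted G f -> adapted G (fun w => c * f w).
Proof. by move=> fG; apply: adaptedM => //; exact: adapted_cst. Qed.

Lemma adapted_rsum (f : R -> Om -> R) s t n : s <= t ->
  (forall r, s <= r <= t -> adapted G (f r)) ->
  adapted G (fun w => rsum (f^~ w) s t n).
Proof.
move=> st fG; apply: adaptedZ; apply: (@adapted_sum_ord _ _ _ saG n (fun k => f (grid s t n k.+1))).
by move=> k kn; apply: fG; exact: grid_itv.
Qed.

(** As a pointwise limit of Riemann sums the integral is adapted without any joint measurability in
    time and chance. *)
Lemma adapted_Rintegral (f : R -> Om -> R) s t : s <= t ->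
  (forall w, right_cont (f^~ w) s t) ->
  (forall w, exists K : R, forall r, s <= r <= t -> `|f r w| <= K) ->
  (forall r, s <= r <= t -> adapted G (f r)) ->
  adapted G (fun w => \int[@lebesgue_measure R]_(r in `[s, t]) f r w).
Proof.
move=> st rc bd fG; apply: (adapted_cvg saG (f_ := fun n w => rsum (f^~ w) s t n)).
  by move=> n; exact: adapted_rsum.
by move=> w; have [K HK] := bd w; apply: rsum_cvg HK => //; exact: rc.
Qed.

End AdaptedObservation.

Section CosExpansion.
Context {R : realType}.
Implicit Types x y z : R.

Lemma sin_dist_le x y : `|sin x - sin y| <= `|x - y|.
Proof.
have E : sin x - sin y = 2 * cos ((x + y) / 2) * sin ((x - y) / 2).
  have [xE yE] : x = (x + y) / 2 + (x - y) / 2 /\ y = (x + y) / 2 - (x - y) / 2 by split; field.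
  have -> : sin x = sin ((x + y) / 2 + (x - y) / 2) by rewrite -xE.
  have -> : sin y = sin ((x + y) / 2 - (x - y) / 2) by rewrite -yE.
  by rewrite sinD sinB; ring.
rewrite E !normrM normr_nat.
have c1 : `|cos ((x + y) / 2)| <= 1 by rewrite ler_norml cos_geN1 cos_le1.
have := sin_norm_le ((x - y) / 2); rewrite normrM normfV normr_nat => s1.
have := ler_pM (normr_ge0 _) (normr_ge0 _) c1 s1; lra.
Qed.

(** The first-order term carries [sin x], not [sin (x + y)]: with [y] the noise increment and [z]
    the drift, [sin x] belongs to the past and the term has zero expectation. The price is the mixed
    error |z| |y|. *)
Lemma cos_increment_le x y z :
  `|cos (x + y + z) - cos (x + y) + z * sin x| <= 3 * z ^+ 2 + `|z| * `|y|.
Proof.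
have -> : cos (x + y + z) - cos (x + y) + z * sin x =
    cos (x + y) * (cos z - 1) - sin (x + y) * (sin z - z) - z * (sin (x + y) - sin x).
  by rewrite [cos (x + y + z)]cosD; ring.
have c1 : `|cos (x + y)| <= 1 by rewrite ler_norml cos_geN1 cos_le1.
have s1 : `|sin (x + y)| <= 1 by rewrite ler_norml sin_geN1 sin_le1.
have cz : `|cos z - 1| <= z ^+ 2.
  have := cos_ge_quadratic z; have := cos_le1 z; have := sqr_ge0 z.
  by rewrite ler_norml => *; apply/andP; split; lra.
have sz : `|sin z - z| <= 2 * z ^+ 2.
  rewrite -(real_normK (num_real z)); have z0 := normr_ge0 z.
  have [z1|z1] := leP `|z| 1.
    apply: (le_trans (sin_sub_norm_le z)).
    have : `|z| ^+ 3 <= `|z| ^+ 2 by rewrite exprSr ler_piMr ?exprn_ge0.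
    by have := exprn_ge0 2 z0; lra.
  have : `|sin z - z| <= 2 * `|z|.
    by rewrite (le_trans (ler_normB _ _))// mulr_natl mulr2n lerD2r sin_norm_le.
  have : `|z| * 1 <= `|z| * `|z| by rewrite ler_wpM2l// ltW.
  by rewrite -expr2; lra.
have sy : `|z * (sin (x + y) - sin x)| <= `|z| * `|y|.
  rewrite normrM ler_wpM2l// (le_trans (sin_dist_le _ _))//.
  by rewrite addrAC subrr add0r.
have a1 := ler_pM (normr_ge0 _) (normr_ge0 _) c1 cz.
have a2 := ler_pM (normr_ge0 _) (normr_ge0 _) s1 sz.
apply: (le_trans (ler_normB _ _)); apply: (le_trans (lerD (ler_normB _ _) (lexx _))).
rewrite !normrM in a1 a2 *; move: sy; rewrite normrM; lra.
Qed.

End CosExpansion.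

Section Innovation.
Context disp (Om : measurableType disp) (R : realType) (P : probability Om R) (d : nat).
Variables (a : 'I_d -> R) (L : 'M[R]_d) (nu : 'cV[R]_d) (h : R -> R)
  (X B : R -> Om -> R) (sigma : R) (pi : R -> Om -> 'cV[R]_d).
Hypotheses (P_complete : measure_is_complete P) (a_inj : injective a).
Hypotheses (XB : signal_and_noise P a L nu X B) (sigma0 : 0 < sigma).
Hypothesis wf : wonham_filter P a L nu h sigma X B pi.

Notation leb := (@lebesgue_measure R).
Notation hv := (hvec a h).
Notation Y := (observation h sigma X B).
Notation filt := (augmented_past P Y).
Notation W := (innovation hv sigma Y pi).

Let mcX : markov_chain P a L nu X. Proof. by case: XB. Qed.
Let bmB : brownian_motion P B. Proof. by case: XB. Qed.

Lemma continuous_filter_coord w i : continuous (ext0 (fun t => pi t w i 0)).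
Proof.
apply: continuous_ext0; apply: within_continuous_coord.
by have [_ [_ + _]] := wf; exact.
Qed.

Lemma continuous_filter_mean w : continuous (ext0 (fun t => mean hv (pi t w))).
Proof.
move=> x; rewrite /continuous_at /ext0 /mean; apply: cvg_bigsum => i.
by apply: cvgM; [exact: cvg_cst|exact: continuous_filter_coord].
Qed.

Lemma right_cont_filter_mean w s t : 0 <= s -> right_cont (fun r => mean hv (pi r w)) s t.
Proof.
move=> s0; apply: (@right_cont_ext _ (ext0 (fun t => mean hv (pi t w)))).
  by move=> x sx; rewrite ext0E// (le_trans s0).
by apply: continuous_right_cont; exact: continuous_filter_mean.
Qed.

Lemma bounded_filter_mean w s t : 0 <= s ->
  exists K : R, forall r, s <= r <= t -> `|mean hv (pi r w)| <= K.
Proof.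
move=> s0; have [K _ HK] := @continuous_itv_bounded _ _ s t (@continuous_filter_mean w).
by exists K => r /andP[sr rt]; rewrite -(@ext0E _ (fun t => mean hv (pi t w)) r) ?HK ?sr// (le_trans s0).
Qed.

Lemma adapted_signal_h G r : sigma_algebra setT G ->
  0 <= r -> (forall i, G [set w | X r w = a i]) -> adapted G (fun w => h (X r w)).
Proof.
move=> saG r0 GX; under eq_fun do rewrite (signal_hE h a_inj mcX)//.
by apply: adapted_bigsum => // i; apply: adaptedZ => //; exact: adapted_indic.
Qed.

(** Stated for any family [G], to serve both for plain measurability and for the join of the signal
    with the past of the noise. *)
Lemma adapted_observation G t : sigma_algebra setT G -> 0 <= t ->
  (forall s i, 0 <= s <= t -> G [set w | X s w = a i]) -> adapted G (B t) ->
  adapted G (Y t).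
Proof.
move=> saG t0 GX GB; apply: adaptedD => //; last exact: adaptedZ.
apply: (adapted_Rintegral saG (f := fun s w => h (X s w))) => //.
- by move=> w; apply: (@right_cont_signal_h _ _ _ P _ a L nu h X).
- move=> w; exists (hmax a h) => r /andP[r0 _]; exact: (norm_signal_h h mcX).
- by move=> r /andP[r0 rt]; apply: adapted_signal_h => // i; apply: GX; rewrite r0.
Qed.

Lemma measurable_observation t : 0 <= t -> measurable_fun setT (Y t).
Proof.
move=> t0; have sM := @sigma_algebra_measurable _ Om.
have YG : adapted measurable (Y t).
  apply: adapted_observation => //.
    by move=> s i /andP[s0 _]; exact: (measurable_signal_eq mcX).
  have [mB _ _ _] := bmB.
  by move=> C mC; rewrite -[X in measurable X]setTI; exact: mB.
by move=> _ C mC; rewrite setTI; exact: YG.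
Qed.

Lemma filt_sigma t : sigma_algebra setT (filt t).
Proof. exact: smallest_sigma_algebra. Qed.

Lemma filt_measurable t A : filt t A -> measurable A.
Proof.
move=> fA; apply: (smallest_sub (@sigma_algebra_measurable _ Om) _ fA) => D [|nD].
  move=> [s [C [/= s0t mC ->]]]; rewrite -[X in measurable X]setTI.
  by apply: measurable_observation => //; move: s0t; rewrite in_itv/= => /andP[].
exact: P_complete.
Qed.

Lemma filt_mono s t : s <= t -> filt s `<=` filt t.
Proof.
move=> st; apply: sub_smallest2r; first exact: filt_sigma.
apply: setSU => D [r [C [/= r0s mC ->]]].
exists r, C; split=> //=; move: r0s; rewrite !in_itv/= => /andP[-> rs].
exact: le_trans st.
Qed.

Lemma filt_observation s t : 0 <= s <= t -> adapted (filt t) (Y s).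
Proof.
by move=> s0t C mC; apply: sub_sigma_algebra; left; exists s, C; rewrite /= in_itv.
Qed.

Lemma filt_filter s t i : 0 <= s <= t -> adapted (filt t) (fun w => pi s w i 0).
Proof.
move=> /andP[s0 st] C mC; apply: (filt_mono st).
by have [+ _] := wf => /(_ s i s0)[+ _]; exact.
Qed.

Lemma filt_filter_mean s t : 0 <= s <= t -> adapted (filt t) (fun w => mean hv (pi s w)).
Proof.
move=> st; apply: adapted_bigsum; first exact: filt_sigma.
by move=> i; apply: adaptedZ; [exact: filt_sigma|exact: filt_filter].
Qed.

Lemma filt_innovation s t : 0 <= s <= t -> adapted (filt t) (W s).
Proof.
move=> s0t; have /andP[s0 st] := s0t; have saF := filt_sigma t.
apply: adaptedZ => //; apply: adaptedB => //; first exact: filt_observation.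
apply: (adapted_Rintegral saF (f := fun s w => mean hv (pi s w))) => //.
- by move=> w; exact: right_cont_filter_mean.
- by move=> w; exact: bounded_filter_mean.
- by move=> r /andP[r0 rs]; apply: filt_filter_mean; rewrite r0 (le_trans rs).
Qed.

(** The bounds hold almost surely at each time of a countable dense set; continuity of the filter
    gives one null set for all times. *)
Lemma filter_itv :
  {ae P, forall w, forall t i, 0 <= t -> 0 <= pi t w i 0 <= 1}.
Proof.
have H1 (n k : nat) (i : 'I_d) : {ae P, forall w, 0 <= pi (k%:R / n.+1%:R) w i 0 <= 1}.
  have t0 : 0 <= k%:R / n.+1%:R :> R by [].
  have [+ _] := wf => /(_ _ i t0) cp.
  by apply: (cond_prob_itv (filt_measurable (t := _)) (measurable_signal_eq mcX i t0) cp).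
have H2 n k : {ae P, forall w, forall i, 0 <= pi (k%:R / n.+1%:R) w i 0 <= 1}.
  by apply: filter_forall => i; exact: H1.
have := ae_foralln (fun n => ae_foralln (H2 n)).
apply: filterS => w Hw t i t0.
have cv : pi ((Num.truncn (t * n.+1%:R))%:R / n.+1%:R) w i 0 @[n --> \oo] --> pi t w i 0.
  rewrite -(@ext0E _ (fun t => pi t w i 0) t t0).
  have := cvg_comp _ _ (dense_itv_cvg t0) (@continuous_filter_coord w i t); rewrite /comp.
  by under eq_fun do rewrite ext0E//.
apply/andP; split.
  by apply: (limr_ge_cst cv) => n; have /andP[] := Hw n (Num.truncn (t * n.+1%:R)) i.
by apply: (limr_le_cst cv) => n; have /andP[] := Hw n (Num.truncn (t * n.+1%:R)) i.
Qed.

Lemma noise_indep s t A C : 0 <= s -> s < t -> filt s A -> measurable C ->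
  let D := (fun w => B t w - B s w) @^-1` C in
  P (A `&` D) = (P A * P D)%E.
Proof.
move=> s0 st fA mC D; have [mB B0 nB iB] := bmB; have t0 : 0 <= t by rewrite (le_trans s0)// ltW.
have indXB : independent_processes P X B by case: XB.
pose E := <<s gen_by `[0, +oo[ X >>; pose F := past B s; pose J := join_sigma E F.
have saE : sigma_algebra setT E by exact: smallest_sigma_algebra.
have saF : sigma_algebra setT F by exact: smallest_sigma_algebra.
have saJ : sigma_algebra setT J by exact: smallest_sigma_algebra.
have saB : sigma_algebra setT <<s gen_by `[0, +oo[ B >> by exact: smallest_sigma_algebra.
have setTsa (K : set (set Om)) : sigma_algebra setT K -> K setT.
  by move=> [K0 KC _]; rewrite -[setT]setD0; exact: KC.
have gen_m (V : R -> Om -> R) T : (forall r, 0 <= r -> measurable_fun setT (V r)) ->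
    (forall r, T r -> 0 <= r) -> forall A, <<s gen_by T V >> A -> measurable A.
  move=> mV T0 K; apply: (smallest_sub (@sigma_algebra_measurable _ Om)) => _ [r [K' [Tr mK ->]]].
  by rewrite -[X in measurable X]setTI; apply: mV => //; exact: T0.
have Em : forall A, E A -> measurable A.
  by apply: gen_m => [|r]; [case: mcX|rewrite /= in_itv/= andbT].
have Fm : forall A, F A -> measurable A.
  by apply: gen_m => // r; rewrite /= in_itv/= => /andP[].
have FB : F `<=` <<s gen_by `[0, +oo[ B >>.
  apply: sub_smallest2r => // _ [r [K [/= rs mK ->]]]; exists r, K; split=> //=.
  by move: rs; rewrite !in_itv/= => /andP[->].
have DB : <<s gen_by `[0, +oo[ B >> D.
  have BG r : 0 <= r -> adapted <<s gen_by `[0, +oo[ B >> (B r).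
    by move=> r0 K mK; apply: sub_sigma_algebra; exists r, K; rewrite /= in_itv/= r0.
  by apply: (adaptedB saB (BG _ t0) (BG _ s0)).
have mD : measurable D by apply: (gen_m B _ mB _ D DB) => r; rewrite /= in_itv/= andbT.
have EFD K1 K2 : E K1 -> F K2 -> P (K1 `&` K2 `&` D) = (P (K1 `&` K2) * P D)%E.
  move=> EK FK; have FK' := FB _ FK.
  rewrite -setIA (indXB _ _ EK (sigma_algebraI saB FK' DB)) (indXB _ _ EK FK').
  by rewrite -muleA; congr (_ * _)%E; exact: iB.
apply: (join_sigma_negligible_indep P_complete saE saF Em Fm mD EFD) => {D DB mD EFD}.
have saK : sigma_algebra setT <<s J `|` P.-negligible >> by exact: smallest_sigma_algebra.
apply: (smallest_sub saK _ fA) => K0 [[r [K [/= r0s mK ->]]]|nK]; last first.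
  by apply: sub_sigma_algebra; right.
move: r0s; rewrite in_itv/= => /andP[r0 rs].
apply: sub_sigma_algebra; left; apply: (adapted_observation saJ r0) => //.
- move=> q i /andP[q0 _]; apply: sub_sigma_algebra; exists [set w | X q w = a i], setT.
  rewrite setIT; split=> //; last exact: setTsa.
  by apply: sub_sigma_algebra; exists q, [set a i]; rewrite /= in_itv/= q0; split.
- move=> K' mK'; apply: sub_sigma_algebra; exists setT, (B r @^-1` K').
  rewrite setTI; split=> //; first exact: setTsa.
  by apply: sub_sigma_algebra; exists r, K'; rewrite /= in_itv/= r0.
Qed.

End Innovation.

(** * The innovation as a Brownian motion for the observed filtration *)

Section InnovationBrownian.
Context disp (Om : measurableType disp) (R : realType) (P : probability Om R) (d : nat).
Variables (a : 'I_d -> R) (L : 'M[R]_d) (nu : 'cV[R]_d) (h : R -> R)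
  (X B : R -> Om -> R) (sigma : R) (pi : R -> Om -> 'cV[R]_d).
Hypotheses (P_complete : measure_is_complete P) (a_inj : injective a).
Hypotheses (XB : signal_and_noise P a L nu X B) (sigma0 : 0 < sigma).
Hypothesis wf : wonham_filter P a L nu h sigma X B pi.

Notation leb := (@lebesgue_measure R).
Notation hv := (hvec a h).
Notation Y := (observation h sigma X B).
Notation filt := (augmented_past P Y).
Notation W := (innovation hv sigma Y pi).

Let mcX : markov_chain P a L nu X. Proof. by case: XB. Qed.
Let bmB : brownian_motion P B. Proof. by case: XB. Qed.

Let gap r w := h (X r w) - mean hv (pi r w).
(* The gap is orthogonal to the observed past, hence so is its integral, the
   drift of the innovation with respect to [B]. *)
Definition drift s t w : R := \int[leb]_(r in `[s, t]) gap r w.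

Lemma right_cont_gap w s t : 0 <= s -> right_cont (gap^~ w) s t.
Proof.
move=> s0; apply: right_contB; first exact: (@right_cont_signal_h _ _ _ P _ a L nu h X).
exact: (right_cont_filter_mean wf).
Qed.

Lemma bounded_gap w s t : 0 <= s ->
  exists K : R, forall r, s <= r <= t -> `|gap r w| <= K.
Proof.
move=> s0; have [K HK] := bounded_filter_mean wf w t s0.
exists (hmax a h + K) => r srt; rewrite (le_trans (ler_normB _ _))// lerD ?HK//.
by apply: (norm_signal_h h mcX); move: srt => /andP[sr _]; exact: le_trans sr.
Qed.

Lemma gap_ae : {ae P, forall w, forall r, 0 <= r -> `|gap r w| <= 2 * hmax a h}.
Proof.
apply: filterS (filter_itv P_complete a_inj XB wf) => w Hw r r0.
rewrite (le_trans (ler_normB _ _))// mulr_natl mulr2n lerD//.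
  exact: (norm_signal_h h mcX).
rewrite (le_trans (ler_norm_sum _ _ _))//; apply: ler_sum => i _.
have /andP[p0 p1] := Hw r i r0.
by rewrite normrM [X in _ * X]ger0_norm// mxE ler_piMr.
Qed.

Lemma drift_ae : {ae P, forall w, forall s t, 0 <= s <= t ->
  `|drift s t w| <= (t - s) * (2 * hmax a h)}.
Proof.
apply: filterS gap_ae => w Hw s t /andP[s0 st]; apply: norm_Rintegral_itv_le => //.
  exact: right_cont_gap.
by move=> x /andP[sx _]; apply: Hw; exact: le_trans sx.
Qed.

Lemma measurable_gap r : 0 <= r -> measurable_fun setT (gap r).
Proof.
move=> r0; have sM := @sigma_algebra_measurable _ Om.
suff gG : adapted measurable (gap r) by move=> _ C mC; rewrite setTI; exact: gG.
apply: adaptedB => //.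
  by apply: (adapted_signal_h h a_inj XB sM r0) => i; exact: (measurable_signal_eq mcX).
move=> C mC; apply: (filt_measurable P_complete a_inj XB (h := h) (sigma := sigma)).
by apply: (filt_filter_mean wf (s := r) (t := r)) => //; rewrite r0 lexx.
Qed.

Lemma measurable_drift s t : 0 <= s <= t -> measurable_fun setT (drift s t).
Proof.
move=> /andP[s0 st]; have sM := @sigma_algebra_measurable _ Om.
suff gG : adapted measurable (drift s t) by move=> _ C mC; rewrite setTI; exact: gG.
apply: (adapted_Rintegral sM st) => [w|w|r /andP[sr _] C mC].
- exact: right_cont_gap.
- exact: bounded_gap.
- by rewrite -[X in measurable X]setTI; apply: (measurable_gap (le_trans s0 sr)).
Qed.

(** State by state, the gap at time [r] is an indicator minus its conditional probability. Bounded
    convergence of Riemann sums transfers the orthogonality to the time integral. *)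
Lemma drift_test s t (xi : Om -> R) : 0 <= s <= t -> adapted (filt s) xi ->
  (forall w, `|xi w| <= 1) -> 'Ex_P (fun w => xi w * drift s t w) = 0.
Proof.
move=> /andP[s0 st] xiG xi1.
have fm := filt_measurable P_complete a_inj XB (h := h) (sigma := sigma).
have mxi : measurable_fun setT xi by move=> _ C mC; rewrite setTI; apply: fm; exact: xiG.
have rs0 (w : Om) n : rsum (gap^~ w) s t n = (t - s) / n%:R * \sum_(k < n) gap (grid s t n k.+1) w by [].
have K0 : 0 <= 2 * hmax a h by rewrite mulr_ge0// hmax_ge0.
have gi r (y : Om -> R) (c : R) : 0 <= r -> measurable_fun setT y -> (forall w, `|y w| <= c) ->
    P.-integrable setT (EFin \o (fun w => y w * gap r w)).
  move=> r0 my yc; apply: (@integrable_aebounded _ _ _ P _ (c * (2 * hmax a h))).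
    by apply: measurable_funM => //; exact: measurable_gap.
  apply: filterS gap_ae => w Hw; rewrite normrM; apply: ler_pM => //; exact: Hw.
have gap0 r : s <= r -> 'Ex_P (fun w => xi w * gap r w) = 0.
  move=> sr; have r0 := le_trans s0 sr.
  have xiGr : adapted (filt r) xi by move=> C mC; apply: (filt_mono (P := P) sr); exact: xiG.
  have mpi i : measurable_fun setT (fun w => pi r w i 0).
    by move=> _ C mC; rewrite setTI; apply: fm; apply: (filt_filter wf (s := r) (t := r) i _ mC); rewrite r0 lexx.
  have E w : xi w * gap r w =
      \sum_i h (a i) * (xi w * (\1_[set w | X r w = a i] w - pi r w i 0)).
    rewrite /gap (signal_hE h a_inj mcX)// /mean -sumrB mulr_sumr.
    by apply: eq_bigr => i _; rewrite mxE; ring.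
  under eq_fun do rewrite E.
  have ii i : P.-integrable setT (EFin \o (fun w => xi w * (\1_[set w | X r w = a i] w - pi r w i 0))).
    apply: (@integrable_aebounded _ _ _ P _ 1).
      apply: measurable_funM => //; apply: measurable_funB => //.
      by apply: measurable_indic; exact: (measurable_signal_eq mcX).
    apply: filterS (filter_itv P_complete a_inj XB wf) => w Hw; have /andP[p0 p1] := Hw r i r0.
    rewrite normrM -[leRHS]mulr1; apply: ler_pM => //.
    have : 0 <= (\1_[set w | X r w = a i] w : R) <= 1 by rewrite indicE; case: (_ \in _); rewrite ?lexx ?ler01.
    by move=> /andP[? ?]; rewrite ler_norml; apply/andP; split; lra.
  rewrite (@Rintegral_sumR _ _ _ P _ _ (fun i w => h (a i) * (xi w * (\1_[set w | X r w = a i] w - pi r w i 0)))); last first.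
    by move=> i; exact: (integrableZl measurableT _ (ii i)).
  rewrite big1// => i _; rewrite (RintegralZl _ measurableT (ii i)).
  have [+ _] := wf => /(_ r i r0) cp.
  rewrite (cond_prob_test (filt_sigma _ _ _ _ _ r) (fm r) (measurable_signal_eq mcX i r0) cp xiGr xi1).
  by rewrite mulr0.
have E0 n : 'Ex_P (fun w => xi w * rsum (gap^~ w) s t n) = 0.
  have E w : xi w * rsum (gap^~ w) s t n =
      (t - s) / n%:R * \sum_(k < n) (xi w * gap (grid s t n k.+1) w).
    by rewrite rs0 mulrCA mulr_sumr.
  under eq_fun do rewrite E.
  have gr (k : 'I_n) : s <= grid s t n k.+1 by have /andP[] := grid_itv st (ltn_ord k).
  have ii (k : 'I_n) : P.-integrable setT (EFin \o (fun w => xi w * gap (grid s t n k.+1) w)).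
    exact: (gi _ _ 1 (le_trans s0 (gr k)) mxi xi1).
  rewrite RintegralZl//; last exact: (integrable_sumR _ ii).
  by rewrite (Rintegral_sumR _ ii) big1 ?mulr0// => k _; exact: gap0.
have K1 : 0 <= (t - s) * (2 * hmax a h) by rewrite mulr_ge0// subr_ge0.
have cv : 'Ex_P (fun w => xi w * rsum (gap^~ w) s t n) @[n --> \oo] --> 'Ex_P (fun w => xi w * drift s t w).
  apply: (@Rintegral_cvg_bounded _ _ _ P _ _ ((t - s) * (2 * hmax a h))).
  - move=> n; apply: measurable_funM => //; apply: measurable_funM => //.
    apply: measurable_sum => k; apply: measurable_gap.
    by rewrite (le_trans s0)//; have /andP[] := grid_itv st (ltn_ord k).
  - by apply: measurable_funM => //; apply: measurable_drift; rewrite s0.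
  - move=> n; apply: filterS gap_ae => w Hw; rewrite normrM -[leRHS]mul1r; apply: ler_pM => //.
    apply: norm_rsum_le => // x /andP[sx _]; apply: Hw; exact: le_trans sx.
  - apply: aeW => w; apply: cvgM; first exact: cvg_cst.
    have [K HK] := bounded_gap w t s0.
    by apply: rsum_cvg HK => //; exact: right_cont_gap.
by move: cv; rewrite (funext E0) => cv; exact: (cvg_unique _ cv (cvg_cst 0)).
Qed.

Lemma innovation_increment s t w : 0 <= s -> s < t ->
  W t w - W s w = (B t w - B s w) + sigma^-1 * drift s t w.
Proof.
move=> s0 st; have t0 := le_lt_trans s0 st.
have [Km HKm] := bounded_filter_mean wf w t (lexx 0).
have ih : leb.-integrable `[0, t] (EFin \o (fun r => h (X r w))).
  apply: (@integrable_right_cont _ _ _ _ (hmax a h)) => //.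
    exact: (@right_cont_signal_h _ _ _ P _ a L nu h X).
  by move=> x /andP[x0 _]; exact: (norm_signal_h h mcX).
have im : leb.-integrable `[0, t] (EFin \o (fun r => mean hv (pi r w))).
  by apply: integrable_right_cont HKm => //; exact: (right_cont_filter_mean wf).
have sub : `[s, t] `<=` `[0, t] by apply: subset_itvr; rewrite bnd_simp.
have dE : drift s t w = \int[leb]_(r in `[s, t]) h (X r w) - \int[leb]_(r in `[s, t]) mean hv (pi r w).
  rewrite /drift /gap RintegralB//.
  - by apply: integrableS ih.
  - by apply: integrableS im.
rewrite /innovation /residual /observation dE.
rewrite (Rintegral_itv_add s0 (ltW st) ih) (Rintegral_itv_add s0 (ltW st) im).
by field; rewrite gt_eqF.
Qed.

Section Characteristic.
Variables (s : R) (A : set Om) (u c : R).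
Hypotheses (s0 : 0 <= s) (fA : filt s A).

Let Phi r := 'Ex_P (fun w => \1_A w * cos (u * (W r w - W s w) + c)).
(** Almost sure bound on the rate of change of W - B. *)
Let K := 2 * hmax a h / sigma.

Let K0 : 0 <= K.
Proof. by rewrite divr_ge0 ?(ltW sigma0)// mulr_ge0// hmax_ge0. Qed.

Let adW r : s <= r -> adapted (filt r) (fun w => W r w - W s w).
Proof.
move=> sr; have r0 := le_trans s0 sr; apply: (adaptedB (filt_sigma _ _ _ _ _ _)).
  by apply: (filt_innovation wf); rewrite r0 lexx.
by apply: (filt_innovation wf); rewrite s0 sr.
Qed.

Let adxi r (f : R -> R) : s <= r -> measurable_fun setT f ->
  adapted (filt r) (fun w => \1_A w * f (u * (W r w - W s w) + c)).
Proof.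
move=> sr mf; have sF := filt_sigma P h X B sigma r; apply: (adaptedM sF).
  by apply: (adapted_indic sF); exact: (filt_mono (P := P) sr).
apply: (@adapted_comp _ _ _ sF (fun x => f (u * x + c))); last exact: adW.
by apply: (measurableT_comp mf); apply: measurable_funD => //; exact: measurable_funM.
Qed.

Let xi1 (f : R -> R) r : (forall x, `|f x| <= 1) ->
  forall w, `|\1_A w * f (u * (W r w - W s w) + c)| <= 1.
Proof.
move=> f1 w; rewrite indicE; case: (_ \in _); rewrite ?mul1r// mul0r normr0; exact: ler01.
Qed.

Let cos1 x : `|cos x : R| <= 1. Proof. by rewrite ler_norml cos_geN1 cos_le1. Qed.
Let sin1 x : `|sin x : R| <= 1. Proof. by rewrite ler_norml sin_geN1 sin_le1. Qed.

Let mcos : measurable_fun setT (cos : R -> R).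
Proof. by apply: continuous_measurable_fun; exact: continuous_cos. Qed.
Let msin : measurable_fun setT (sin : R -> R).
Proof. by apply: continuous_measurable_fun; exact: continuous_sin. Qed.

Let bounded_integrable (f : Om -> R) (M : R) : measurable_fun setT f ->
  {ae P, forall w, `|f w| <= M} -> P.-integrable setT (EFin \o f).
Proof. by move=> mf; exact: integrable_aebounded. Qed.

(* The defect is [O ((t - r) ^ (3/2))], so that summing over a grid of mesh tending
   to 0 gives the exact formula. *)
Lemma characteristic_step r t : s <= r -> r < t ->
  `|Phi t - expR (- (u ^+ 2 * (t - r) / 2)) * Phi r| <=
  3 * (u * K * (t - r)) ^+ 2 + u ^+ 2 * K * (t - r) * Num.sqrt (t - r).
Proof.
move=> sr rt; have r0 := le_trans s0 sr; have t0 := le_lt_trans r0 rt.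
have st : s <= t by rewrite (le_trans sr)// ltW.
set dl := t - r; have dl0 : 0 < dl by rewrite subr_gt0.
pose D w := B t w - B r w; have [_ _ nB _] := bmB.
have DN : normal_law P D 0 dl by exact: nB.
have mD : measurable_fun setT D by case: DN.
have fm := filt_measurable P_complete a_inj XB (h := h) (sigma := sigma).
have admeas (f : Om -> R) : adapted (filt r) f -> measurable_fun setT f.
  by move=> fG _ C mC; rewrite setTI; apply: fm; exact: fG.
pose th w := u * (W r w - W s w) + c.
pose xc w := \1_A w * cos (th w); pose xs w := \1_A w * sin (th w).
have axc : adapted (filt r) xc by exact: adxi.
have axs : adapted (filt r) xs by exact: adxi.
have [mxc mxs] := (admeas _ axc, admeas _ axs).
have xc1 w : `|xc w| <= 1 by exact: (xi1 _ cos1).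
have xs1 w : `|xs w| <= 1 by exact: (xi1 _ sin1).
have fac (y : Om -> R) (f : R -> R) : adapted (filt r) y -> (forall w, `|y w| <= 1) ->
    measurable_fun setT f -> (forall x, `|f x| <= 1) ->
    P.-integrable setT (EFin \o (fun w => y w * f (D w))) /\
    'Ex_P (fun w => y w * f (D w)) = 'Ex_P y * 'Ex_P (fun w => f (D w)).
  move=> ay y1 mf f1; have my := admeas _ ay.
  have mfD : measurable_fun setT (fun w => f (D w)) by exact: measurableT_comp.
  apply: Rintegral_indep => //.
  - apply: (@indep_rv_comp _ _ _ P y D id f) => // A' C' mA' mC'.
    by apply: (noise_indep P_complete a_inj XB r0 rt (h := h) (sigma := sigma)) => //; exact: ay.
  - exact: (@integrable_bounded _ _ _ P _ 1).
  - by apply: (@integrable_bounded _ _ _ P _ 1).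
have mcu : measurable_fun setT (fun x : R => cos (u * x)) by apply: (measurableT_comp mcos); exact: measurable_funM.
have msu : measurable_fun setT (fun x : R => sin (u * x)) by apply: (measurableT_comp msin); exact: measurable_funM.
have [ic Ec] := fac xc (fun x => cos (u * x)) axc xc1 mcu (fun x => cos1 _).
have [is_ Es] := fac xs (fun x => sin (u * x)) axs xs1 msu (fun x => sin1 _).
have EcD : 'Ex_P (fun w => cos (u * D w)) = expR (- (u ^+ 2 * dl / 2)).
  by have := normal_law_cos u 0 DN; rewrite cos0 mul1r => <-; congr Rintegral; apply/funext => w; rewrite addr0.
have EsD : 'Ex_P (fun w => sin (u * D w)) = 0.
  have := normal_law_cos u (- (trigo.pi / 2)) DN; rewrite cosN cos_pihalf mul0r => <-.
  by congr Rintegral; apply/funext => w; rewrite -[u * D w in LHS](subrK (trigo.pi / 2)) sinDpihalf.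
(* The value that would result if [W] moved like [B] over the step; independence of the noise
   increment evaluates its expectation exactly. *)
pose T0 w := xc w * cos (u * D w) - xs w * sin (u * D w).
have iT0 : P.-integrable setT (EFin \o T0) by apply: (integrableB measurableT ic is_).
have ET0 : 'Ex_P T0 = expR (- (u ^+ 2 * dl / 2)) * Phi r.
  by rewrite RintegralB// Ec Es EcD EsD mulr0 subr0 mulrC.
have mdr : measurable_fun setT (drift r t).
  by apply: measurable_drift; rewrite r0 ltW.
pose T1 w := xs w * drift r t w.
have aeb : {ae P, forall w, `|drift r t w| <= dl * (2 * hmax a h)}.
  by apply: filterS drift_ae => w Hw; apply: Hw; rewrite r0 ltW.
have iT1 : P.-integrable setT (EFin \o T1).
  apply: (@bounded_integrable _ (dl * (2 * hmax a h))); first exact: measurable_funM.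
  apply: filterS aeb => w Hw; rewrite normrM -[leRHS]mul1r; exact: ler_pM.
have ET1 : 'Ex_P T1 = 0 by apply: drift_test => //; rewrite r0 ltW.
pose Ft w := \1_A w * cos (u * (W t w - W s w) + c).
have mFt : measurable_fun setT Ft.
  by move=> _ C mC; rewrite setTI; apply: fm; exact: (adxi st mcos).
have iFt : P.-integrable setT (EFin \o Ft).
  by apply: (@integrable_bounded _ _ _ P _ 1) => // w; exact: (xi1 _ cos1).
pose cc := u / sigma.
have iZ1 : P.-integrable setT (EFin \o (fun w => cc * T1 w)) by exact: (integrableZl measurableT _ iT1).
have iFB : P.-integrable setT (EFin \o (fun w => Ft w - T0 w)) by apply: (integrableB measurableT iFt iT0).
pose rem w := Ft w - T0 w + cc * T1 w.
have irem : P.-integrable setT (EFin \o rem) by apply: (integrableD measurableT iFB iZ1).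
have -> : Phi t - expR (- (u ^+ 2 * dl / 2)) * Phi r = 'Ex_P rem.
  by rewrite /rem RintegralD// RintegralB// (RintegralZl _ measurableT iT1) ET1 mulr0 addr0 ET0.
have sq0 : 0 < Num.sqrt dl by rewrite sqrtr_gt0.
(* The increment |D| is replaced by the arithmetic-geometric bound sqrt dl / 2 + D^2 / (2 sqrt dl),
   whose expectation is sqrt dl. *)
pose q w := 3 * (u * K * dl) ^+ 2 + u ^+ 2 * K * dl * (Num.sqrt dl / 2 + (2 * Num.sqrt dl)^-1 * D w ^+ 2).
have iD2 := normal_law_integrable_exp 2 dl0 DN.
have intD (f g : Om -> R) : P.-integrable setT (EFin \o f) -> P.-integrable setT (EFin \o g) ->
    P.-integrable setT (EFin \o (fun w => f w + g w)) by move=> i1 i2; exact: (integrableD measurableT i1 i2).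
have iq2 : P.-integrable setT (EFin \o (fun w => Num.sqrt dl / 2 + (2 * Num.sqrt dl)^-1 * D w ^+ 2)).
  apply: intD; last exact: (integrableZl measurableT _ iD2).
  exact: finite_measure_integrable_cst.
have iq : P.-integrable setT (EFin \o q).
  apply: intD; first exact: finite_measure_integrable_cst.
  exact: (integrableZl measurableT _ iq2).
apply: (@le_trans _ _ ('Ex_P q)); last first.
  rewrite /q RintegralD//; [|exact: finite_measure_integrable_cst|exact: (integrableZl measurableT _ iq2)].
  rewrite (RintegralZl _ measurableT iq2) RintegralD//; [|exact: finite_measure_integrable_cst|exact: (integrableZl measurableT _ iD2)].
  rewrite (RintegralZl _ measurableT iD2) !Rintegral_prob_cst.
  have -> : 'Ex_P (fun w => D w ^+ 2) = dl.
    by rewrite (normal_law_even 1 dl0 DN) /gauss_moment big_ord_recl big_ord0/=; ring.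
  rewrite (_ : Num.sqrt dl / 2 + _ = Num.sqrt dl)//.
  by rewrite -[X in _ + _ * X](sqr_sqrtr (ltW dl0)); field; rewrite gt_eqF.
apply: Rintegral_norm_le => //; apply: filterS aeb => w Hw.
pose rho := sigma^-1 * drift r t w.
have rhoK : `|u * rho| <= `|u| * (K * dl).
  rewrite /rho !normrM normfV (gtr0_norm sigma0) ler_wpM2l//.
  rewrite mulrC ler_pdivrMr//; apply: (le_trans Hw).
  by rewrite /K mulrAC mulfVK ?gt_eqF// mulrC.
have E : rem w = \1_A w * (cos (th w + u * D w + u * rho) - cos (th w + u * D w) + u * rho * sin (th w)).
  rewrite /rem /Ft /T0 /T1 /xc /xs [cos (th w + u * D w)]cosD.
  have -> : u * (W t w - W s w) + c = th w + u * D w + u * rho.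
    rewrite /th -[W t w - W s w](addrNK (W r w - W s w)).
    rewrite (_ : W t w - W s w - (W r w - W s w) = W t w - W r w); last by ring.
    by rewrite (innovation_increment w r0 rt) /D /rho; ring.
  by rewrite /cc /rho; ring.
rewrite E normrM (@le_trans _ _ (3 * (u * rho) ^+ 2 + `|u * rho| * `|u * D w|))//.
  rewrite -[leRHS]mul1r; apply: ler_pM => //; last exact: cos_increment_le.
  by rewrite indicE; case: (_ \in _); rewrite ?normr1 ?normr0.
have uu : `|u| * `|u| = u ^+ 2 by rewrite -expr2 real_normK ?num_real.
have Kd0 : 0 <= K * dl by rewrite mulr_ge0// ltW.
apply: lerD.
  rewrite ler_wpM2l// -(real_normK (num_real (u * rho))) -(real_normK (num_real (u * K * dl))).
  by rewrite lerXn2r ?nnegrE// (le_trans rhoK)// -mulrA normrM (ger0_norm Kd0).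
apply: (@le_trans _ _ (`|u| * (K * dl) * (`|u| * `|D w|))).
  by rewrite [`|u * D w|]normrM; apply: ler_wpM2r => //; exact: mulr_ge0.
rewrite (_ : `|u| * (K * dl) * (`|u| * `|D w|) = u ^+ 2 * K * dl * `|D w|); last by rewrite -uu; ring.
apply: ler_wpM2l; first by rewrite -mulrA mulr_ge0 ?sqr_ge0.
have : 0 <= (`|D w| - Num.sqrt dl) ^+ 2 by exact: sqr_ge0.
rewrite sqrrB -(real_normK (num_real (D w))) => h2.
rewrite -(ler_pM2l (x := 2 * Num.sqrt dl)) ?mulr_gt0//.
rewrite mulrDr mulVKf ?gt_eqF ?mulr_gt0//.
have -> : 2 * Num.sqrt dl * (Num.sqrt dl / 2) = Num.sqrt dl ^+ 2 by field.
by move: h2; rewrite mulr2n; lra.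
Qed.

(** The one-step factors are at most 1, so errors add up without amplification; over n cells they
    total (t - s) times a quantity of order (t - s) / n + sqrt ((t - s) / n). *)
Lemma characteristic_innovation t : s <= t ->
  Phi t = fine (P A) * (cos c * expR (- (u ^+ 2 * (t - s) / 2))).
Proof.
move=> st; have mA : measurable A := filt_measurable P_complete a_inj XB fA.
have Phis : Phi s = fine (P A) * cos c.
  rewrite /Phi; under eq_fun do rewrite subrr mulr0 add0r mulrC.
  by rewrite RintegralZl ?Rintegral_indic_le1 1?mulrC//; exact: (@integrable_indic _ _ _ P).
have [->|tns] := eqVneq t s; first by rewrite Phis subrr mulr0 mul0r oppr0 expR0 mulr1.
have {tns} lst : s < t by rewrite lt_neqAle eq_sym tns.
pose ev x := expR (- (u ^+ 2 * x / 2)).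
have ev1 x : 0 <= x -> ev x <= 1.
  by move=> x0; rewrite -expR0 ler_expR oppr_le0 divr_ge0// mulr_ge0// sqr_ge0.
pose er x := 3 * (u * K * x) ^+ 2 + u ^+ 2 * K * x * Num.sqrt x.
have step n k : (0 < n)%N -> (k <= n)%N ->
    `|Phi (grid s t n k) - ev (k%:R * ((t - s) / n%:R)) * Phi s| <= k%:R * er ((t - s) / n%:R).
  move=> n0; set de := (t - s) / n%:R.
  have de0 : 0 < de by rewrite divr_gt0 ?subr_gt0 ?ltr0n.
  elim: k => [_|k IH kn]; first by rewrite grid0 /ev !mul0r mulr0 mul0r oppr0 expR0 mul1r subrr normr0.
  have gk : s <= grid s t n k by rewrite -{1}(grid0 s t n); apply: grid_le.
  have := characteristic_step gk (grid_lt lst n0 (ltnSn k)); rewrite gridS -/de -/(er de) -/(ev de).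
  have := IH (ltnW kn); set x := Phi (grid s t n k); set y := Phi (grid s t n k.+1) => h1 h2.
  have -> : ev (k.+1%:R * de) = ev de * ev (k%:R * de).
    by rewrite /ev -expRD; congr expR; rewrite -natr1; field.
  have -> : y - ev de * ev (k%:R * de) * Phi s = (y - ev de * x) + ev de * (x - ev (k%:R * de) * Phi s) by ring.
  rewrite (le_trans (ler_normD _ _))// -natr1 mulrDl mul1r addrC lerD//.
  rewrite normrM ger0_norm ?expR_ge0//; apply: le_trans h1; rewrite ler_piMl//; exact: ev1 (ltW de0).
have bound n : `|Phi t - ev (t - s) * Phi s| <= (t - s) * (3 * (u * K) ^+ 2 * ((t - s) / n.+1%:R) + u ^+ 2 * K * Num.sqrt ((t - s) / n.+1%:R)).
  have n0 : n.+1%:R != 0 :> R by rewrite pnatr_eq0.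
  have := @step n.+1 n.+1 isT (leqnn _); rewrite grid_last// mulrCA divff// mulr1 => /le_trans; apply.
  set q := Num.sqrt _; rewrite /er -/q le_eqVlt; apply/orP; left; apply/eqP.
  by move: n0 q; move: (n.+1%:R : R) => N N0 q; field.
have cv : (t - s) * (3 * (u * K) ^+ 2 * ((t - s) / n.+1%:R) + u ^+ 2 * K * Num.sqrt ((t - s) / n.+1%:R)) @[n --> \oo] --> (t - s) * (3 * (u * K) ^+ 2 * 0 + u ^+ 2 * K * Num.sqrt 0).
  have c0 : (t - s) / n.+1%:R @[n --> \oo] --> (0 : R).
    by rewrite -[X in _ --> X](mulr0 (t - s)); apply: cvgM; [exact: cvg_cst|exact: cvg_harmonic].
  apply: cvgM; first exact: cvg_cst.
  apply: cvgD; apply: cvgM; try exact: cvg_cst; first exact: c0.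
  by apply: (cvg_comp _ _ c0); exact: sqrt_continuous.
have := limr_ge_cst cv bound; rewrite sqrtr0 !mulr0 addr0 mulr0 normr_le0 subr_eq0 => /eqP ->.
by rewrite Phis /ev; ring.
Qed.

End Characteristic.

(** The characteristic function on the whole space identifies the law of an increment, and on a
    general event of the past its independence. *)
Lemma innovation_filtered_bm : filtered_bm P filt W.
Proof.
have fm := filt_measurable P_complete a_inj XB (h := h) (sigma := sigma).
have nW s t : 0 <= s -> s < t -> normal_law P (fun w => W t w - W s w) 0 (t - s).
  move=> s0 st; have t0 := le_lt_trans s0 st.
  have mW r : 0 <= r -> measurable_fun setT (W r).
    move=> r0 _ C mC; rewrite setTI; apply: (fm r).
    by apply: (filt_innovation wf) => //; rewrite r0 lexx.
  apply: cos_normal_law; first by apply: measurable_funB; apply: mW => //; exact: ltW.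
    by rewrite subr_ge0 ltW.
  move=> u c; have fT : filt s setT.
    by have [f0 fC _] := filt_sigma P h X B sigma s; rewrite -[setT]setD0; exact: fC.
  have := characteristic_innovation u c s0 fT (ltW st).
  by rewrite probability_setT mul1r => <-; congr Rintegral; apply/funext => w; rewrite indicT mul1r.
split.
- by move=> t _; exact: filt_sigma.
- by move=> t A _; exact: fm.
- by move=> s t _ st; exact: filt_mono.
- by move=> t t0; apply: (filt_innovation wf); rewrite t0 lexx.
- exact: nW.
- move=> s t A C s0 st fA mC; apply: (cos_indep (fm _ _ fA) (nW s t s0 st)) => // u c.
  by rewrite -(characteristic_innovation u c s0 fA (ltW st)).
Qed.

(** The time integral of the signal is Lipschitz with constant [hmax], although its integrand
    jumps. *)
Lemma innovation_continuous w : W 0 w = 0 /\ {within `[0, +oo[, continuous (fun t => W t w)}.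
Proof.
have [_ B0 _ _] := bmB; have [Bz cB] := B0 w.
split.
  rewrite /innovation /residual /observation Bz !set_itv1 !Rintegral_set1.
  by rewrite mulr0 addr0 subr0 mulr0.
pose F t : R := \int[leb]_(r in `[0, t]) h (X r w).
have rch s t : 0 <= s -> right_cont (fun r => h (X r w)) s t.
  exact: (@right_cont_signal_h _ _ _ P _ a L nu h X).
have FL s t : 0 <= s -> s <= t -> `|F t - F s| <= hmax a h * (t - s).
  move=> s0 st; have hb x : s <= x <= t -> `|h (X x w)| <= hmax a h.
    by move=> /andP[sx _]; apply: (norm_signal_h h mcX); exact: le_trans sx.
  have [t0|] := eqVneq t 0.
    have -> : s = t by apply: le_anti; rewrite st t0 s0.
    by rewrite !subrr normr0 mulr0.
  move=> tn0; have tp : 0 < t by rewrite lt_neqAle eq_sym tn0 (le_trans s0).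
  have ih : leb.-integrable `[0, t] (EFin \o (fun r => h (X r w))).
    apply: (@integrable_right_cont _ _ _ _ (hmax a h)) => //; first exact: rch.
    by move=> x /andP[x0 _]; exact: (norm_signal_h h mcX).
  rewrite /F (Rintegral_itv_add s0 st ih) addrAC subrr add0r mulrC.
  by apply: norm_Rintegral_itv_le => //; exact: rch.
have FL' s t : 0 <= s -> 0 <= t -> `|F t - F s| <= hmax a h * `|t - s|.
  move=> s0 t0; have [st|/ltW ts] := leP s t.
    by rewrite (ger0_norm (_ : 0 <= t - s)) ?subr_ge0//; exact: FL.
  by rewrite distrC (distrC t s) (ger0_norm (_ : 0 <= s - t)) ?subr_ge0//; exact: FL.
have cmax : continuous (fun t : R => Num.max t 0).
  by move=> x; apply: continuous_max; [exact: cvg_id|exact: cvg_cst].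
have c1 : continuous (fun t : R => F (Num.max t 0)).
  move=> x; apply/cvgrPdist_le => e e0; near=> y.
  apply: (@le_trans _ _ (hmax a h * `|Num.max x 0 - Num.max y 0|)).
    by apply: FL'; rewrite le_max lexx orbT.
  apply: (@le_trans _ _ (hmax a h * (e / (hmax a h + 1)))).
    rewrite ler_wpM2l ?hmax_ge0//; near: y.
    by have /cvgrPdist_le := cmax x; apply; rewrite divr_gt0// ltr_wpDl// hmax_ge0.
  have h1 : 0 < hmax a h + 1 by rewrite ltr_wpDl// hmax_ge0.
  by rewrite mulrCA ler_piMr ?(ltW e0)// ler_pdivrMr// mul1r lerDl.
have cmean := @continuous_filter_mean _ _ _ P _ a L nu h X B sigma pi wf w.
pose I (y : R) : R := \int[leb]_(r in `[0, y]) ext0 (fun t => mean hv (pi t w)) r.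
have cI : continuous I := continuous_primitive cmean.
have c2 : continuous (fun t : R => I (Num.max t 0)).
  by move=> z; exact: (@continuous_comp _ _ _ (fun t : R => Num.max t 0) I z (cmax z) (cI _)).
have c3 := continuous_ext0 cB.
pose g (t : R) : R := sigma^-1 * (F (Num.max t 0) + sigma * ext0 (fun t => B t w) t - I (Num.max t 0)).
have cg : continuous g.
  move=> z; apply: cvgM; first exact: cvg_cst.
  apply: cvgB; last exact: c2.
  by apply: cvgD; [exact: c1|apply: cvgM; [exact: cvg_cst|exact: c3]].
apply: (subspace_eq_continuous (f := g)); last exact: continuous_subspaceT.
move=> t; rewrite inE/= in_itv/= andbT => t0.
rewrite /g /I ext0E// max_l// /innovation /residual /observation; congr (_ * (_ - _)).
apply: eq_Rintegral => r; rewrite inE/= in_itv/= => /andP[r0 _]; by rewrite ext0E.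
Unshelve. all: by end_near. Qed.

Lemma innovation_brownian_motion : brownian_motion P W.
Proof.
have F := innovation_filtered_bm; split.
- by move=> t t0; exact: (fbm_measurable_W F).
- exact: innovation_continuous.
- by move=> s t s0 st; exact: (fbm_normal F).
- move=> s t s0 st A C pA mC; apply: (fbm_indep F s0 st) => //.
  apply: (smallest_sub (filt_sigma P h X B sigma s) _ pA) => K1 [r [K' [/= rs mK ->]]].
  by apply: (filt_innovation wf) => //; move: rs; rewrite in_itv.
Qed.

End InnovationBrownian.

(** * Gaussian linear equations *)

Section ProbabilityLimits.
Context d (Om : measurableType d) (R : realType) (P : probability Om R).

(** The truncation of |U_n - U| at level [e] is bounded, so its expectation tends to 0, and Markov's
    inequality concludes. *)
Lemma cvg_prob_ae (U_ : nat -> Om -> R) (U : Om -> R) : (forall n, measurable_fun setT (U_ n)) ->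
  measurable_fun setT U -> {ae P, forall w, U_ n w @[n --> \oo] --> U w} ->
  cvg_prob P U_ U.
Proof.
move=> mU_ mU cU e e0.
pose m n w := Num.min `|U_ n w - U w| e.
have mm n : measurable_fun setT (m n).
  apply: measurable_minr => //; apply: measurableT_comp => //; exact: measurable_funB.
have m0 n w : 0 <= m n w by rewrite le_min normr_ge0 ltW.
have me n w : `|m n w| <= e by rewrite ger0_norm// ge_min lexx orbT.
have im n : P.-integrable setT (EFin \o m n) by apply: (@integrable_bounded _ _ _ P _ e).
have aeb n : {ae P, forall w, `|m n w| <= e} by apply: aeW; exact: me.
have cm0 : {ae P, forall w, m n w @[n --> \oo] --> (0 : R)}.
  apply: filterS cU => w cw; rewrite /m.
  have : `|U_ n w - U w| @[n --> \oo] --> (0 : R).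
    rewrite -[X in _ --> X](@normr0 _ R) -(subrr (U w)); apply: cvg_norm; apply: cvgB => //; exact: cvg_cst.
  move=> /cvgrPdist_le h0; apply/cvgrPdist_le => x x0; have := h0 _ x0.
  apply: filterS => n; rewrite !sub0r !normrN normr_id => hx.
  by rewrite (ger0_norm (m0 n w)) ge_min hx.
have := Rintegral_cvg_bounded mm (measurable_cst _) aeb cm0.
rewrite Rintegral_prob_cst => cm.
(* Markov's inequality divides by [e] and the probability must still be below [e]. *)
have e2 : 0 < e ^+ 2 by rewrite exprn_gt0.
have /cvgrPdist_lt/(_ _ e2)[N _ NP] := cm.
exists N => n Nn; have := NP n Nn; rewrite /= sub0r normrN => lt_e.
have mS : measurable [set w | e < `|U_ n w - U w|] by apply: measurable_lt_norm; exact: measurable_funB.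
rewrite -(fineK (fin_num_measure P _ mS)) lte_fin -(Rintegral_indic_le1 P mS).
rewrite -(ltr_pM2l e0) -expr2; apply: le_lt_trans lt_e.
rewrite -RintegralZl//; last exact: integrable_indic.
apply: le_trans (ler_norm _); apply: Rintegral_le_ae => //.
  apply: (@integrable_bounded _ _ _ P _ e) => [|w]; first by apply: measurable_funM => //; exact: measurable_indic.
  by case: (_ \in _); rewrite ?mulr1 ?mulr0 ?normr0 ?gtr0_norm// ltW.
apply: aeW => w; have [|_] := boolP (w \in _); last by rewrite mulr0.
by rewrite inE/= mulr1 /m le_min lexx andbT => /ltW.
Qed.

Lemma cvg_probDr (U_ : nat -> Om -> R) (U V : Om -> R) : cvg_prob P U_ U ->
  cvg_prob P (fun n w => U_ n w + V w) (fun w => U w + V w).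
Proof.
move=> cU e e0; have [N NP] := cU e e0; exists N => n Nn.
rewrite (_ : [set w | _] = [set w | e < `|U_ n w - U w|]); first exact: NP.
by apply/funext => w /=; rewrite opprD addrACA subrr addr0.
Qed.

Lemma cvg_probZ (U_ : nat -> Om -> R) (U : Om -> R) (c : R) :
  (forall n, measurable_fun setT (U_ n)) -> measurable_fun setT U ->
  cvg_prob P U_ U -> cvg_prob P (fun n w => c * U_ n w) (fun w => c * U w).
Proof.
move=> mU_ mU cU e e0; have [c0|c0] := eqVneq c 0.
  exists 0%N => n _; rewrite (_ : [set w | _] = set0) ?measure0 ?lte_fin//.
  by apply/seteqP; split=> w //=; rewrite c0 !mul0r subrr normr0 ltNge ltW.
have nc : 0 < `|c| by rewrite normr_gt0.
have [|N NP] := cU (Num.min e (e / `|c|)) _; first by rewrite lt_min e0 divr_gt0.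
exists N => n Nn; apply: (@le_lt_trans _ _ (P [set w | Num.min e (e / `|c|) < `|U_ n w - U w|])); last first.
  by apply: (lt_le_trans (NP n Nn)); rewrite lee_fin ge_min lexx.
apply: le_measure; rewrite ?inE.
- apply: measurable_lt_norm; apply: measurable_funB; exact: measurable_funM.
- by apply: measurable_lt_norm; exact: measurable_funB.
- by move=> w /=; rewrite -mulrBr normrM => he; rewrite gt_min ltr_pdivrMr// [_ * `|c|]mulrC he orbT.
Qed.

Lemma measurable_Rintegral_itv (f : R -> Om -> R) (t : R) : 0 <= t ->
  (forall w, continuous (f^~ w)) -> (forall s, measurable_fun setT (f s)) ->
  measurable_fun setT (fun w => \int[@lebesgue_measure R]_(s in `[0, t]) f s w).
Proof.
move=> t0 cf mf; apply: (@measurable_fun_cvg _ _ _ _ (fun n w => rsum (f^~ w) 0 t n)).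
  by move=> n; apply: measurable_funM => //; apply: measurable_sum => k.
move=> w _; have [K _ HK] := continuous_itv_bounded 0 t (cf w).
by apply: rsum_cvg HK => //; exact: continuous_right_cont.
Qed.

Lemma rsum_cvg_prob (f : R -> Om -> R) (t : R) : 0 <= t ->
  (forall w, continuous (f^~ w)) -> (forall s, measurable_fun setT (f s)) ->
  cvg_prob P (fun n w => rsum (f^~ w) 0 t n)
    (fun w => \int[@lebesgue_measure R]_(s in `[0, t]) f s w).
Proof.
move=> t0 cf mf; apply: cvg_prob_ae.
- by move=> n; apply: measurable_funM => //; apply: measurable_sum => k.
- exact: measurable_Rintegral_itv.
- apply: aeW => w; have [K _ HK] := continuous_itv_bounded 0 t (cf w).
  by apply: rsum_cvg HK => //; exact: continuous_right_cont.
Qed.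

(** Minkowski's integral inequality, from the triangle inequality for Riemann sums. *)
Lemma Lq_le_Rintegral_itv q (f : R -> Om -> R) (t b : R) : (0 < q)%N -> 0 <= t -> 0 <= b ->
  (forall w, continuous (f^~ w)) -> (forall s, measurable_fun setT (f s)) ->
  (forall s, 0 <= s <= t -> Lq_le P q (f s) b) ->
  Lq_le P q (fun w => \int[@lebesgue_measure R]_(s in `[0, t]) f s w) (t * b).
Proof.
move=> q0 t0 b0 cf mf fb.
apply: (@Lq_le_cvg_prob _ _ _ P q (fun n w => rsum (f^~ w) 0 t n.+1)).
- exact: measurable_Rintegral_itv.
- exact: mulr_ge0.
- move=> n; have : Lq_le P q (fun w => \sum_(k < n.+1) f (grid 0 t n.+1 k.+1) w) (\sum_(k < n.+1) b).
    apply: (@Lq_le_sum _ _ _ P q _ _ (fun (k : 'I_n.+1) => f (grid 0 t n.+1 k.+1)) (fun=> b) q0) => k.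
    by apply: fb; apply: grid_itv.
  move=> /(@Lq_leZ _ _ _ P q _ ((t - 0) / n.+1%:R)) H.
  apply: (Lq_leW H); rewrite sumr_const card_ord subr0 ger0_norm ?divr_ge0//.
  by rewrite -[b *+ _]mulr_natr -mulrA [_^-1 * _]mulrC -[b * _ / _]mulrA divff ?mulr1// pnatr_eq0.
- move=> e e0; have [N NP] := rsum_cvg_prob t0 cf mf e0.
  by exists N => n Nn; apply: NP; exact: leqW.
Qed.

End ProbabilityLimits.

(** * The closed linear span of a Brownian motion *)

Section GaussianClass.
Context d (Om : measurableType d) (R : realType) (P : probability Om R).
Variables (G : R -> set (set Om)) (W : R -> Om -> R).
Hypotheses (bmW : filtered_bm P G W) (W0 : forall w, W 0 w = 0).

Definition bm_comb (l : seq (R * R)) (w : Om) : R := \sum_(p <- l) p.1 * W p.2 w.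

(** An inductive closure carries no variance, so stability under sums and integrals needs no
    covariance computation; the variance is recovered at the end from the characteristic
    function. *)
Inductive bm_gaussian : (Om -> R) -> Prop :=
| BmComb l : all (fun p => 0 <= p.2) l -> bm_gaussian (bm_comb l)
| BmLim (U_ : nat -> Om -> R) (U : Om -> R) : (forall n, bm_gaussian (U_ n)) ->
    measurable_fun setT U -> cvg_prob P U_ U -> bm_gaussian U.

(* The characteristic function of the centered normal law of variance [v]; the
   phase [c] makes cosines suffice for both real and imaginary parts. *)
Definition gaussian_cos (U : Om -> R) (v : R) := 0 <= v /\
  forall u c : R, 'Ex_P (fun w => cos (u * U w + c)) = cos c * expR (- (u ^+ 2 * v / 2)).

Lemma measurable_bm_comb l : all (fun p => 0 <= p.2) l -> measurable_fun setT (bm_comb l).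
Proof.
rewrite /bm_comb; elim: l => [_|p l IH /=/andP[p0 /IH ml]].
  by under eq_fun do rewrite big_nil; exact: measurable_cst.
under eq_fun do rewrite big_cons; apply: measurable_funD => //.
by apply: measurable_funM => //; exact: (fbm_measurable_W bmW).
Qed.

Lemma bm_gaussian_measurable U : bm_gaussian U -> measurable_fun setT U.
Proof. by case=> // l; exact: measurable_bm_comb. Qed.

Lemma bm_gaussian_ae U V : bm_gaussian U -> measurable_fun setT V ->
  {ae P, forall w, U w = V w} -> bm_gaussian V.
Proof.
move=> gU mV UV; apply: (@BmLim (fun=> U)) => //; apply: cvg_prob_ae => //.
  by move=> _; exact: bm_gaussian_measurable.
by apply: filterS UV => w ->; exact: cvg_cst.
Qed.

Lemma bm_gaussianZ c U : bm_gaussian U -> bm_gaussian (fun w => c * U w).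
Proof.
elim=> [l l0|U_ U' gU IH mU cU].
  rewrite (_ : (fun w => _) = bm_comb [seq (c * p.1, p.2) | p <- l]); last first.
    by apply/funext => w; rewrite /bm_comb big_map mulr_sumr; apply: eq_bigr => p _ /=; rewrite mulrA.
  by constructor; rewrite all_map.
apply: BmLim IH _ _; first exact: measurable_funM.
by apply: cvg_probZ => // n; exact: bm_gaussian_measurable.
Qed.

Lemma bm_gaussianD U V : bm_gaussian U -> bm_gaussian V ->
  bm_gaussian (fun w => U w + V w).
Proof.
move=> gU gV; elim: gU => [l l0|U_ U' gU IH mU cU]; last first.
  apply: BmLim IH _ _; last exact: cvg_probDr.
  by apply: measurable_funD => //; exact: bm_gaussian_measurable.
elim: gV => [l' l'0|V_ V' gV IH mV cV].
  rewrite (_ : (fun w => _) = bm_comb (l ++ l')).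
    by constructor; rewrite all_cat l0.
  by apply/funext => w; rewrite /bm_comb big_cat.
apply: BmLim IH _ _; first by apply: measurable_funD => //; exact: measurable_bm_comb.
rewrite (_ : (fun w => _ + _) = fun w => V' w + bm_comb l w); last by apply/funext => w; rewrite addrC.
rewrite (_ : (fun n w => _) = fun n w => V_ n w + bm_comb l w); last first.
  by apply/funext => n; apply/funext => w; rewrite addrC.
exact: cvg_probDr.
Qed.

Lemma bm_gaussian_sum (I : Type) (r : seq I) (U : I -> Om -> R) :
  (forall i, bm_gaussian (U i)) -> bm_gaussian (fun w => \sum_(i <- r) U i w).
Proof.
move=> gU; elim: r => [|i r IH].
  under eq_fun do rewrite big_nil; have -> : (fun=> 0) = bm_comb [::] by apply/funext => w; rewrite /bm_comb big_nil.
  by constructor.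
by under eq_fun do rewrite big_cons; exact: bm_gaussianD.
Qed.

Lemma bm_gaussian_Rintegral (f : R -> Om -> R) (t : R) : 0 <= t ->
  (forall w, continuous (f^~ w)) -> (forall s, measurable_fun setT (f s)) ->
  (forall s, 0 <= s <= t -> bm_gaussian (f s)) ->
  bm_gaussian (fun w => \int[@lebesgue_measure R]_(s in `[0, t]) f s w).
Proof.
move=> t0 cf mf gf; apply: BmLim (rsum_cvg_prob P t0 cf mf); last exact: measurable_Rintegral_itv.
move=> n; apply: bm_gaussianZ.
apply: (@bm_gaussian_sum _ _ (fun (k : 'I_n) => f (grid 0 t n k.+1))) => k; apply: gf.
exact: grid_itv.
Qed.

Lemma bm_gaussian_ito (c : R -> R) t I : 0 <= t ->
  is_ito_integral P (fun s _ => c s) W t I -> bm_gaussian I.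
Proof.
move=> t0 [mI HI].
pose S n w := \sum_(k < n.+1) c (grid 0 t n.+1 k) * (W (grid 0 t n.+1 k.+1) w - W (grid 0 t n.+1 k) w).
apply: (@BmLim S) => // [n|].
  apply: (@bm_gaussian_sum _ _ (fun (k : 'I_n.+1) w => c (grid 0 t n.+1 k) * (W (grid 0 t n.+1 k.+1) w - W (grid 0 t n.+1 k) w))) => k.
  apply: bm_gaussianZ; set s := grid _ _ _ _; set r := grid _ _ _ _.
  rewrite (_ : (fun w => _) = bm_comb [:: (1, s); (-1, r)]).
    constructor => /=; rewrite andbT; apply/andP; split.
      by have /andP[] := grid_itv t0 (ltn_ord k).
    by have /andP[] := grid_itv t0 (ltnW (ltn_ord k)).
  by apply/funext => w; rewrite /bm_comb !big_cons big_nil/= mul1r mulN1r addr0.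
move=> e e0; have [delta delta0 K] := HI e e0.
have [N NP] : exists N : nat, forall n, (N <= n)%N -> t / n.+1%:R < delta.
  exists (Num.truncn (t / delta)).+1 => n Nn.
  rewrite ltr_pdivrMr ?ltr0n// mulrC -ltr_pdivrMr// (lt_le_trans (truncnS_gt _))//.
  by rewrite ler_nat leqW.
exists N => n Nn; apply: K; [exact: grid0|exact: grid_last|].
by move=> k kn; rewrite gridS subr0 NP//; split=> //; apply: grid_le.
Qed.

(** An independent increment multiplies characteristic functions and adds variances; the sine part
    drops out by symmetry. *)
Lemma Rintegral_cos_indep (s t k v : R) (U : Om -> R) : 0 <= s -> s <= t ->
  adapted (G s) U -> gaussian_cos U v ->
  gaussian_cos (fun w => U w + k * (W t w - W s w)) (v + k ^+ 2 * (t - s)).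
Proof.
move=> s0 st aU [v0 cU]; split.
  by rewrite addr_ge0// mulr_ge0 ?sqr_ge0// subr_ge0.
have [->|ts] := eqVneq t s.
  move=> u c; under eq_fun do rewrite subrr mulr0 addr0.
  by rewrite subrr mulr0 addr0; exact: cU.
have {ts} lst : s < t by rewrite lt_neqAle eq_sym ts.
move=> u c; set D := fun w => W t w - W s w.
have DN : normal_law P D 0 (t - s) by exact: (fbm_normal bmW).
have mD : measurable_fun setT D by case: DN.
have mU := adapted_measurable bmW s0 aU.
have sa := fbm_sigma bmW s0.
have mcos : measurable_fun setT (cos : R -> R) by apply: continuous_measurable_fun; exact: continuous_cos.
have msin : measurable_fun setT (sin : R -> R) by apply: continuous_measurable_fun; exact: continuous_sin.
have cos1 x : `|cos x : R| <= 1 by rewrite ler_norml cos_geN1 cos_le1.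
have sin1 x : `|sin x : R| <= 1 by rewrite ler_norml sin_geN1 sin_le1.
have fac (f g : R -> R) : measurable_fun setT f -> measurable_fun setT g ->
    (forall x, `|f x| <= 1) -> (forall x, `|g x| <= 1) ->
    P.-integrable setT (EFin \o (fun w => f (u * U w + c) * g (u * k * D w))) /\
    'Ex_P (fun w => f (u * U w + c) * g (u * k * D w)) =
    'Ex_P (fun w => f (u * U w + c)) * 'Ex_P (fun w => g (u * k * D w)).
  move=> mf mg f1 g1.
  have mfa : measurable_fun setT (fun x => f (u * x + c)).
    by apply: (measurableT_comp mf); apply: measurable_funD => //; exact: measurable_funM.
  have mga : measurable_fun setT (fun x => g (u * k * x)).
    by apply: (measurableT_comp mg); exact: measurable_funM.
  apply: (fbm_factor bmW (f := fun x => g (u * k * x)) s0 lst) => //.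
  - exact: (adapted_comp sa mfa aU).
  - by apply: (@integrable_bounded _ _ _ P _ 1) => //; exact: (measurableT_comp mfa mU).
  - by apply: (@integrable_bounded _ _ _ P _ 1) => //; exact: (measurableT_comp mga mD).
have [i1 E1] := fac cos cos mcos mcos cos1 cos1.
have [i2 E2] := fac sin sin msin msin sin1 sin1.
have EcD : 'Ex_P (fun w => cos (u * k * D w)) = expR (- ((u * k) ^+ 2 * (t - s) / 2)).
  by have := normal_law_cos (u * k) 0 DN; rewrite cos0 mul1r => <-; congr Rintegral; apply/funext => w; rewrite addr0.
have EsD : 'Ex_P (fun w => sin (u * k * D w)) = 0.
  have := normal_law_cos (u * k) (- (trigo.pi / 2)) DN; rewrite cosN cos_pihalf mul0r => <-.
  by congr Rintegral; apply/funext => w; rewrite -[u * k * D w in LHS](subrK (trigo.pi / 2)) sinDpihalf.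
have E w : cos (u * (U w + k * D w) + c) =
    cos (u * U w + c) * cos (u * k * D w) - sin (u * U w + c) * sin (u * k * D w).
  by rewrite -cosD; congr cos; ring.
under eq_fun do rewrite E.
rewrite RintegralB// E1 E2 EcD EsD mulr0 subr0 cU -[LHS]mulrA -expRD; congr (_ * expR _).
by field.
Qed.

(** With the latest time first, p W(r) + q W(s) = p (W(r) - W(s)) + (p + q) W(s) splits off an
    increment independent of all that remains. *)
Lemma bm_comb_sorted_cos n (p : R * R) l : size l = n ->
  all (fun p => 0 <= p.2) (p :: l) -> sorted (fun p q => q.2 <= p.2) (p :: l) ->
  exists v, gaussian_cos (bm_comb (p :: l)) v.
Proof.
elim: n p l => [|n IH] p [|q l] //=.
  move=> _ /andP[p0 _] _.
  have z0 : gaussian_cos (fun=> 0) 0.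
    split=> // u c; under eq_fun do rewrite mulr0 add0r.
    by rewrite Rintegral_prob_cst mulr0 mul0r oppr0 expR0 mulr1.
  have a0 : adapted (G 0) (fun=> 0 : R) by apply: adapted_cst; exact: (fbm_sigma bmW).
  have := Rintegral_cos_indep p.1 (lexx 0) p0 a0 z0.
  rewrite (_ : (fun w => 0 + _) = bm_comb [:: p]); first by exists (0 + p.1 ^+ 2 * (p.2 - 0)).
  by apply/funext => w; rewrite /bm_comb big_cons big_nil W0 subr0 add0r addr0.
move=> [sz] /and3P[p0 q0 l0] /andP[qp sl].
have h1 : all (fun p => 0 <= p.2) ((p.1 + q.1, q.2) :: l) by rewrite /= q0.
have h2 : sorted (fun p q => q.2 <= p.2) ((p.1 + q.1, q.2) :: l) by case: l sl {sz l0 h1}.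
have [v gv] := IH (p.1 + q.1, q.2) l sz h1 h2.
have ad : adapted (G q.2) (bm_comb ((p.1 + q.1, q.2) :: l)).
  have sa := fbm_sigma bmW q0.
  suff H l' : all (fun r => 0 <= r.2 <= q.2) l' -> adapted (G q.2) (bm_comb l').
    apply: H => /=; rewrite q0 lexx/=.
    have := sl; rewrite (path_sortedE (leT := fun p q => q.2 <= p.2)); last by move=> a b c ab bc; exact: le_trans ab.
    move=> /andP[al _]; apply/allP => r rl; rewrite (allP l0)//.
    exact: (allP al _ rl).
  rewrite /bm_comb; elim: l' => [_|r l' IH' /= /andP[/andP[r0 rq] /IH' al]].
    by under eq_fun do rewrite big_nil; exact: adapted_cst.
  under eq_fun do rewrite big_cons; apply: (adaptedD sa) => //.
  apply: (adaptedZ sa); apply: (adapted_mono bmW r0 rq); exact: (fbm_adapted bmW).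
have := Rintegral_cos_indep p.1 q0 qp ad gv.
rewrite (_ : (fun w => _ + _) = bm_comb [:: p, q & l]); first by exists (v + p.1 ^+ 2 * (p.2 - q.2)).
by apply/funext => w; rewrite /bm_comb !big_cons/=; ring.
Qed.

Lemma bm_comb_cos l : all (fun p => 0 <= p.2) l -> exists v, gaussian_cos (bm_comb l) v.
Proof.
move=> l0; pose r (p q : R * R) := q.2 <= p.2.
have rtot : total r by move=> p q; exact: le_total.
(* A zero term makes the list nonempty, as required after sorting. *)
have E : bm_comb l = bm_comb ((0, 0) :: l).
  by apply/funext => w; rewrite /bm_comb big_cons mul0r add0r.
have -> : bm_comb l = bm_comb (sort r ((0, 0) :: l)).
  by rewrite E; apply/funext => w; apply: perm_big; rewrite perm_sym perm_sort.
have sl := sort_sorted rtot ((0, 0) :: l).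
have al : all (fun p => 0 <= p.2) (sort r ((0, 0) :: l)) by rewrite all_sort/= lexx.
have : size (sort r ((0, 0) :: l)) = (size l).+1 by rewrite size_sort.
case: (sort _ _) sl al => // p l' sl al [sz].
exact: (bm_comb_sorted_cos sz al sl).
Qed.

(** Variances converge because they can be read off from the characteristic function at one
    frequency [u0] where the limit is positive; such a frequency exists near 0. *)
Lemma gaussian_cos_lim (U_ : nat -> Om -> R) (v_ : nat -> R) (U : Om -> R) :
  (forall n, measurable_fun setT (U_ n)) -> measurable_fun setT U ->
  (forall n, gaussian_cos (U_ n) (v_ n)) -> cvg_prob P U_ U ->
  exists v, gaussian_cos U v.
Proof.
move=> mU_ mU gU cU.
have cE (u c : R) : 'Ex_P (fun w => cos (u * U_ n w + c)) @[n --> \oo] --> 'Ex_P (fun w => cos (u * U w + c)).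
  apply: (@cvg_prob_Lipschitz _ _ _ P U_ U (fun x => cos (u * x + c)) `|u| 1) => //.
  - by apply: continuous_measurable_fun; exact: continuous_cos_affine.
  - by move=> x; rewrite ler_norml cos_geN1 cos_le1.
  - move=> x y; rewrite -!sinDpihalf (le_trans (sin_dist_le _ _))//.
    by rewrite (_ : _ - _ = u * (x - y)) ?normrM//; ring.
have [u0 u00 phi0] : exists2 u0 : R, 0 < u0 & 0 < 'Ex_P (fun w => cos (u0 * U w + 0)).
  have cu : 'Ex_P (fun w => cos (n.+1%:R^-1 * U w + 0)) @[n --> \oo] --> (1 : R).
    rewrite -[X in _ --> X](Rintegral_prob_cst P 1).
    apply: (@Rintegral_cvg_bounded _ _ _ P _ _ 1).
    - by move=> n; exact: measurable_cos_affine.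
    - exact: measurable_cst.
    - by move=> n; apply: aeW => w; rewrite ler_norml cos_geN1 cos_le1.
    - apply: aeW => w; rewrite -[X in _ --> X](@cos0 R).
      have : n.+1%:R^-1 * U w + 0 @[n --> \oo] --> (0 : R).
        rewrite -[X in _ --> X](mul0r (U w)); under eq_fun do rewrite addr0.
        by apply: cvgM; [exact: cvg_harmonic|exact: cvg_cst].
      by move=> h; apply: (cvg_comp _ _ h); exact: continuous_cos.
  have /cvgrPdist_lt/(_ _ (ltr01 : (0 : R) < 1))[N _ NP] := cu.
  exists N.+1%:R^-1; first by rewrite invr_gt0 ltr0n.
  by have := NP N (leqnn N); rewrite /= ltr_norml => /andP[_]; lra.
set phi := 'Ex_P _ in phi0.
have u02 : 0 < u0 ^+ 2 by rewrite exprn_gt0.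
(* Solves phi = exp (- u0^2 v / 2) for the variance. *)
pose v := - 2 * ln phi / u0 ^+ 2.
have vE n : v_ n = - 2 * ln ('Ex_P (fun w => cos (u0 * U_ n w + 0))) / u0 ^+ 2.
  by rewrite (gU n).2 cos0 mul1r expRK; field; rewrite gt_eqF.
have cv : v_ n @[n --> \oo] --> v.
  under eq_fun do rewrite vE; apply: cvgM; last exact: cvg_cst.
  apply: cvgM; first exact: cvg_cst.
  by apply: (cvg_comp _ _ (cE u0 0)); exact: continuous_ln.
exists v; split; first by apply: (limr_ge_cst cv) => n; exact: (gU n).1.
move=> u c; apply: (cvg_unique _ (cE u c)) => //.
rewrite (_ : (fun n => _) = fun n => cos c * expR (- (u ^+ 2 * v_ n / 2))); last first.
  by apply/funext => n; exact: (gU n).2.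
apply: cvgM; first exact: cvg_cst.
have cve : - (u ^+ 2 * v_ n / 2) @[n --> \oo] --> - (u ^+ 2 * v / 2).
  apply: cvgN; apply: cvgM; last exact: cvg_cst.
  by apply: cvgM; [exact: cvg_cst|exact: cv].
by apply: (cvg_comp _ _ cve); exact: continuous_expR.
Qed.

Lemma bm_gaussian_normal U : bm_gaussian U -> exists v, normal_law P U 0 v.
Proof.
move=> gU; suff [v [v0 gv]] : exists v, gaussian_cos U v.
  by exists v; apply: cos_normal_law => //; exact: bm_gaussian_measurable.
elim: gU => [l /bm_comb_cos//|U_ U' gU_ IH mU cU].
have [v_ gv] := choice IH.
by apply: gaussian_cos_lim gv cU => // n; exact: bm_gaussian_measurable.
Qed.

End GaussianClass.

(** * Limits of the filter at a fixed time *)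

Section Resolvent.
Context {R : realType} {d : nat}.
Notation leb := (@lebesgue_measure R).
Variable A : 'M[R]_d.

Definition resolvent_bound (t K : R) := 0 <= K /\
  forall l j s, 0 <= s <= t -> `|mexp ((t - s) *: A) l j| <= K.

Lemma exists_resolvent_bound t : exists K, resolvent_bound t K.
Proof.
have [K HK] : exists K : 'I_d -> 'I_d -> R, forall l j, 0 <= K l j /\
    forall s, 0 <= s <= t -> `|mexp ((t - s) *: A) l j| <= K l j.
  have H l : exists K : 'I_d -> R, forall j, 0 <= K j /\
      forall s, 0 <= s <= t -> `|mexp ((t - s) *: A) l j| <= K j.
    suff /choice[K HK] : forall j, exists K : R, 0 <= K /\
        forall s, 0 <= s <= t -> `|mexp ((t - s) *: A) l j| <= K by exists K.
    move=> j; have [K K0 HK] := continuous_itv_bounded 0 t (@continuous_mexp_backward _ _ A t l j).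
    by exists K.
  by have [K HK] := choice H; exists K.
exists (\sum_l \sum_j K l j); split.
  by apply: sumr_ge0 => l _; apply: sumr_ge0 => j _; exact: (HK l j).1.
move=> l j s st; apply: (le_trans ((HK l j).2 s st)).
rewrite (bigD1 l)//= (bigD1 j)//= -addrA lerDl addr_ge0//.
  by apply: sumr_ge0 => ? _; exact: (HK _ _).1.
by apply: sumr_ge0 => ? _; apply: sumr_ge0 => ? _; exact: (HK _ _).1.
Qed.

(** The solution map from the forcing to the solution, as in [variation_of_constants]. It is linear,
    so two equations driven by different noises are compared through the difference of their
    forcings. *)
Definition resolve (J : 'I_d -> R -> R) i t := J i t +
  \sum_l A i l * \sum_j \int[leb]_(s in `[0, t]) (mexp ((t - s) *: A) l j * J j s).

(** Bounds the norm of [resolve] on every L^q when the resolvent is bounded by [K] on [0, t]. *)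
Definition resolve_cst t K i : R := 1 + \sum_l `|A i l| * \sum_(j < d) t * K.

Lemma resolve_cst_ge0 t K i : 0 <= t -> 0 <= K -> 0 <= resolve_cst t K i.
Proof.
move=> t0 K0; rewrite addr_ge0//; apply: sumr_ge0 => l _; rewrite mulr_ge0//.
by apply: sumr_ge0 => j _; exact: mulr_ge0.
Qed.

Lemma resolveB J1 J2 i t : (forall j, continuous (J1 j)) -> (forall j, continuous (J2 j)) ->
  resolve J1 i t - resolve J2 i t = resolve (fun j s => J1 j s - J2 j s) i t.
Proof.
move=> c1 c2; rewrite /resolve opprD addrACA; congr (_ + _).
rewrite -sumrB; apply: eq_bigr => l _; rewrite -mulrBr -sumrB; congr (_ * _).
apply: eq_bigr => j _; rewrite -RintegralB//.
- by apply: eq_Rintegral => s _; rewrite mulrBr.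
- by apply: integrable_continuous => s; apply: cvgM; [exact: continuous_mexp_backward|exact: c1].
- by apply: integrable_continuous => s; apply: cvgM; [exact: continuous_mexp_backward|exact: c2].
Qed.

Lemma forcingZB (D1 D2 : 'I_d -> R -> R) c i t : (forall j, continuous (D1 j)) ->
  (forall j, continuous (D2 j)) ->
  forcing A (fun l s => c * (D1 l s - D2 l s)) i t = c * (forcing A D1 i t - forcing A D2 i t).
Proof.
move=> c1 c2; rewrite /forcing.
have E l : \int[leb]_(s in `[0, t]) (c * (D1 l s - D2 l s)) =
    c * (\int[leb]_(s in `[0, t]) D1 l s - \int[leb]_(s in `[0, t]) D2 l s).
  rewrite RintegralZl//; last by apply: integrable_continuous => s; apply: cvgB; [exact: c1|exact: c2].
  by rewrite RintegralB//; exact: integrable_continuous.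
under eq_bigr do rewrite E mulrCA mulrBr.
by rewrite -mulr_sumr sumrB; ring.
Qed.

End Resolvent.

Section RandomResolvent.
Context dd (Om : measurableType dd) (R : realType) (P : probability Om R) (d : nat).
Variables (A : 'M[R]_d) (J : 'I_d -> R -> Om -> R).
Notation leb := (@lebesgue_measure R).
Hypotheses (cJ : forall i w, continuous (J i ^~ w)) (mJ : forall i t, measurable_fun setT (J i t)).

Lemma Lq_le_resolve q t K b i : (0 < q)%N -> 0 <= t -> resolvent_bound A t K -> 0 <= b ->
  (forall j s, 0 <= s <= t -> Lq_le P q (J j s) b) ->
  Lq_le P q (fun w => resolve A (fun j s => J j s w) i t) (resolve_cst A t K i * b).
Proof.
move=> q0 t0 [K0 HK] b0 Jb; rewrite /resolve_cst mulrDl mul1r.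
apply: Lq_leD => //; first by apply: Jb; rewrite t0 lexx.
rewrite mulr_suml; apply: (@Lq_le_sum _ _ _ P q _ _ (fun l w => A i l * (\sum_j _)) (fun l => _)) => // l.
rewrite -mulrA; apply: Lq_leZ; rewrite mulr_suml.
apply: (@Lq_le_sum _ _ _ P q _ _ (fun j w => \int[leb]_(s in `[0, t]) _) (fun j => _)) => // j.
rewrite -mulrA; apply: Lq_le_Rintegral_itv => //.
- exact: mulr_ge0.
- move=> w s; apply: cvgM; [exact: continuous_mexp_backward|exact: cJ].
- by move=> s; apply: measurable_funM.
- move=> s st; apply: (Lq_leW (Lq_leZ (mexp ((t - s) *: A) l j) (Jb j s st))).
  by rewrite ler_wpM2r// HK.
Qed.

Lemma bm_gaussian_resolve G W t i : filtered_bm P G W -> (forall w, W 0 w = 0) -> 0 <= t ->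
  (forall j s, 0 <= s <= t -> bm_gaussian P W (J j s)) ->
  bm_gaussian P W (fun w => resolve A (fun j s => J j s w) i t).
Proof.
move=> bW W0 t0 gJ; apply: (bm_gaussianD bW); first by apply: gJ; rewrite t0 lexx.
apply: (@bm_gaussian_sum _ _ _ P G W bW _ _ (fun l w => A i l * (\sum_j _))) => l.
apply: (bm_gaussianZ bW).
apply: (@bm_gaussian_sum _ _ _ P G W bW _ _ (fun j w => \int[leb]_(s in `[0, t]) _)) => j.
apply: (bm_gaussian_Rintegral bW) => //.
- by move=> w s; apply: cvgM; [exact: continuous_mexp_backward|exact: cJ].
- by move=> s; apply: measurable_funM.
- by move=> s st; apply: (bm_gaussianZ bW); exact: gJ.
Qed.

End RandomResolvent.

Section LinearSDE.
Context dd (Om : measurableType dd) (R : realType) (P : probability Om R) (d : nat).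
Notation leb := (@lebesgue_measure R).

Lemma Lq_le_dominated q (U V : Om -> R) b : measurable_fun setT U ->
  {ae P, forall w, `|U w| <= V w} -> Lq_le P q V b -> Lq_le P q U b.
Proof.
move=> mU UV [mV b0 Vb]; split=> //; apply: le_trans Vb.
apply: ae_ge0_le_integral => //.
- by apply/measurable_EFinP; exact: measurable_normX.
- by apply/measurable_EFinP; exact: measurable_normX.
- apply: filterS UV => w UVw _; rewrite lee_fin lerXn2r ?nnegrE//.
  exact: le_trans (ler_norm _).
Qed.

Lemma ito_integral_lin (H1 H2 M : R -> Om -> R) t I1 I2 (x y : R) :
  (forall s, 0 <= s -> measurable_fun setT (H1 s)) ->
  (forall s, 0 <= s -> measurable_fun setT (H2 s)) ->
  (forall s, 0 <= s -> measurable_fun setT (M s)) ->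
  is_ito_integral P H1 M t I1 -> is_ito_integral P H2 M t I2 ->
  is_ito_integral P (fun s w => x * H1 s w + y * H2 s w) M t (fun w => x * I1 w + y * I2 w).
Proof.
move=> mH1 mH2 mM [mI1 HI1] [mI2 HI2]; split.
  by apply: measurable_funD; exact: measurable_funM.
move=> e e0; pose k : R := `|x| + `|y| + 1.
have k0 : 0 < k by rewrite ltr_wpDl// addr_ge0.
(* [e / 2] splits the probability between the two exceptional events, [e / k] splits the
   deviation. *)
pose e' := Num.min (e / 2) (e / k).
have e'0 : 0 < e' by rewrite lt_min !divr_gt0.
have [d1 d10 P1] := HI1 e' e'0; have [d2 d20 P2] := HI2 e' e'0.
exists (Num.min d1 d2); first by rewrite lt_min d10.
move=> n tau t0 tn th.
have th1 k' : (k' < n)%N -> tau k' <= tau k'.+1 /\ tau k'.+1 - tau k' < d1.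
  by move=> /th[? +]; rewrite lt_min => /andP[].
have th2 k' : (k' < n)%N -> tau k' <= tau k'.+1 /\ tau k'.+1 - tau k' < d2.
  by move=> /th[? +]; rewrite lt_min => /andP[].
have tau0 k' : (k' <= n)%N -> 0 <= tau k'.
  elim: k' => [|k' IH] kn; first by rewrite t0.
  exact: le_trans (IH (ltnW kn)) (th k' kn).1.
have {P1} P1 := P1 n tau t0 tn th1; have {P2} P2 := P2 n tau t0 tn th2.
have mS (H : R -> Om -> R) : (forall s, 0 <= s -> measurable_fun setT (H s)) ->
    measurable_fun setT (fun w => \sum_(k < n) H (tau k) w * (M (tau k.+1) w - M (tau k) w)).
  move=> mH; apply: measurable_sum => k'; apply: measurable_funM.
    by apply: mH; apply: tau0; exact: ltnW.
  by apply: measurable_funB; apply: mM; apply: tau0 => //; exact: ltnW.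
pose S (H : R -> Om -> R) w := \sum_(k < n) H (tau k) w * (M (tau k.+1) w - M (tau k) w).
pose B1 := [set w | e' < `|S H1 w - I1 w|]; pose B2 := [set w | e' < `|S H2 w - I2 w|].
have mB1 : measurable B1 by apply: measurable_lt_norm; apply: measurable_funB => //; exact: mS.
have mB2 : measurable B2 by apply: measurable_lt_norm; apply: measurable_funB => //; exact: mS.
have mH s : 0 <= s -> measurable_fun setT (fun w => x * H1 s w + y * H2 s w).
  by move=> s0; apply: measurable_funD; apply: measurable_funM => //; [exact: mH1|exact: mH2].
apply: (@le_lt_trans _ _ (P (B1 `|` B2))).
  apply: le_measure; rewrite ?inE.
  - apply: measurable_lt_norm; apply: measurable_funB; first exact: (mS _ mH).
    by apply: measurable_funD; exact: measurable_funM.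
  - exact: measurableU.
  move=> w /= he; apply: contrapT => /not_orP[/negP n1 /negP n2].
  move: n1 n2 he; rewrite -!leNgt => n1 n2; apply/negP; rewrite -leNgt.
  have -> : \sum_(k < n) (x * H1 (tau k) w + y * H2 (tau k) w) * (M (tau k.+1) w - M (tau k) w) -
      (x * I1 w + y * I2 w) = x * (S H1 w - I1 w) + y * (S H2 w - I2 w).
    rewrite !mulrBr addrACA -opprD; congr (_ - _); rewrite /S !mulr_sumr -big_split/=.
    by apply: eq_bigr => j _; ring.
  apply: (@le_trans _ _ (`|x| * e' + `|y| * e')).
    by apply: (le_trans (ler_normD _ _)); rewrite !normrM; apply: lerD; exact: ler_wpM2l.
  rewrite -mulrDl; apply: (@le_trans _ _ (k * e')).
    by apply: ler_wpM2r; [exact: ltW|rewrite lerDl].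
  by rewrite mulrC -ler_pdivlMr// ge_min lexx orbT.
apply: (le_lt_trans (measureU2 _ mB1 mB2)).
apply: (@lt_le_trans _ _ (e'%:E + e'%:E)%E); first exact: lteD.
by rewrite -EFinD lee_fin -[e' in leLHS]mul1r -mulrDl mulrC -ler_pdivlMr ?ge_min ?lexx.
Qed.

Lemma ito_integral_scale_integrator (H M : R -> Om -> R) t I (k : R) :
  is_ito_integral P H (fun s w => k * M s w) t I ->
  is_ito_integral P (fun s w => k * H s w) M t I.
Proof.
move=> [mI HI]; split=> // e e0; have [de de0 K] := HI e e0; exists de => // n tau t0 tn th.
rewrite (_ : [set w | _] = [set w | e < `|\sum_(k' < n) H (tau k') w * (k * M (tau k'.+1) w - k * M (tau k') w) - I w|]); first exact: K.
apply/funext => w /=; congr (is_true (_ < `|_ - _|)); apply: eq_bigr => j _; ring.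
Qed.

Definition path_coord (V : R -> Om -> 'cV[R]_d) (i : 'I_d) (t : R) (w : Om) : R :=
  ext0 (fun s => V s w i 0) t.

(** Turns the stochastic equation into a deterministic one for each path, with the stochastic
    integral as its forcing. *)
Lemma sde_forcing x0 (A : 'M[R]_d) c M V :
  sde P x0 (fun s w => A *m V s w) c M V -> forall t i, 0 <= t ->
  exists2 I, is_ito_integral P (fun s w => c s w i 0) M t I &
    {ae P, forall w, forcing A (fun l s => path_coord V l s w) i t = x0 i 0 + I w}.
Proof.
move=> [mV cV HV] t i t0; have [I II IV] := HV t i t0; exists I => //.
have cc l w : continuous (path_coord V l ^~ w).
  by apply: (@continuous_ext0 _ (fun s => V s w l 0)); apply: within_continuous_coord.
apply: filterS IV => w; rewrite /forcing {1}/path_coord ext0E// => ->.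
have -> : \int[leb]_(s in `[0, t]) (A *m V s w) i 0 =
    \sum_l A i l * \int[leb]_(s in `[0, t]) path_coord V l s w.
  transitivity (\int[leb]_(s in `[0, t]) (\sum_l A i l * path_coord V l s w)).
    apply: eq_Rintegral => s; rewrite inE/= in_itv/= => /andP[s0 _]; rewrite mxE.
    by apply: eq_bigr => l _; rewrite /path_coord ext0E.
  rewrite (@Rintegral_sum_continuous _ _ _ (fun l s => A i l * path_coord V l s w)); last first.
    by move=> l s; apply: cvgM; [exact: cvg_cst|exact: cc].
  apply: eq_bigr => l _; rewrite RintegralZl//; exact: integrable_continuous.
by rewrite addrAC addrK.
Qed.

End LinearSDE.

Section Marginal.
Context {R : realType} {d : nat}.
Variables (L : 'M[R]_d) (nu : 'cV[R]_d).

Lemma is_derive_marginal i (t : R) :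
  is_derive t 1 (fun t => marginal L nu t i 0) ((L^T *m marginal L nu t) i 0).
Proof.
rewrite /marginal mulmxA mxE.
have -> : (fun t : R => (mexp (t *: L^T) *m nu) i 0) = fun t => \sum_j nu j 0 * mexp (t *: L^T) i j.
  by apply/funext => s; rewrite mxE; apply: eq_bigr => j _; rewrite mulrC.
under eq_bigr do rewrite mulrC.
by apply: is_derive_bigsum => j; apply: is_derive_scale; exact: is_derive_mexp.
Qed.

Lemma continuous_marginal i : continuous (fun t => marginal L nu t i 0).
Proof. by apply: is_derive_continuous => t; exact: is_derive_marginal. Qed.

Lemma marginal_forcing i t : 0 <= t ->
  forcing L^T (fun l s => marginal L nu s l 0) i t = nu i 0.
Proof.
move=> t0; rewrite /forcing.
under eq_bigr do rewrite -RintegralZl ?(integrable_continuous _ _ (@continuous_marginal _))//.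
rewrite -(@Rintegral_sum_continuous _ _ _ (fun l s => L^T i l * marginal L nu s l 0)); last first.
  by move=> l s; apply: cvgM; [exact: cvg_cst|exact: continuous_marginal].
have -> : \int[@lebesgue_measure R]_(s in `[0, t]) (\sum_l L^T i l * marginal L nu s l 0) =
    marginal L nu t i 0 - marginal L nu 0 i 0.
  apply: (@is_derive_FTC _ (fun t => marginal L nu t i 0)) => // [x _|x].
    by have := is_derive_marginal i x; rewrite mxE.
  by apply: cvg_bigsum => l; apply: cvgM; [exact: cvg_cst|exact: continuous_marginal].
by rewrite opprB addrC subrK /marginal mexp_0 mul1mx.
Qed.

End Marginal.

Lemma measurable_forcing dd (Om : measurableType dd) (R : realType) (d : nat) (A : 'M[R]_d)
    (D : 'I_d -> R -> Om -> R) i t : 0 <= t -> (forall i w, continuous (D i ^~ w)) ->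
  (forall i t, measurable_fun setT (D i t)) ->
  measurable_fun setT (fun w => forcing A (fun l s => D l s w) i t).
Proof.
move=> t0 cD mD; apply: measurable_funB => //; apply: measurable_sum => l.
by apply: measurable_funM => //; apply: measurable_Rintegral_itv.
Qed.

Section NonnegativeForcing.
Context dd (Om : measurableType dd) (R : realType) (d : nat) (A : 'M[R]_d).
Variable D : 'I_d -> R -> Om -> R.
Hypotheses (cD : forall i w, continuous (D i ^~ w)) (mD : forall i t, measurable_fun setT (D i t)).
Notation leb := (@lebesgue_measure R).

(* Truncating time at 0 makes measurability hold at every time. *)
Definition forcing0 j s w := forcing A (fun l r => D l r w) j (Num.max s 0).

Lemma forcing0E j s w : 0 <= s -> forcing0 j s w = forcing A (fun l r => D l r w) j s.
Proof. by move=> s0; rewrite /forcing0 max_l. Qed.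

Lemma continuous_forcing0 j w : continuous (forcing0 j ^~ w).
Proof.
move=> x; apply: (@continuous_comp _ _ _ (fun s : R => Num.max s 0)
  (forcing A (fun l r => D l r w) j) x).
  by apply: continuous_max; [exact: cvg_id|exact: cvg_cst].
by apply: continuous_forcing => l; exact: cD.
Qed.

Lemma measurable_forcing0 j s : measurable_fun setT (forcing0 j s).
Proof. by apply: measurable_forcing => //; rewrite le_max lexx orbT. Qed.

Lemma forcing0_resolve t i w : 0 <= t ->
  D i t w = resolve A (fun j s => forcing0 j s w) i t.
Proof.
move=> t0; have cd l : continuous (D l ^~ w) by exact: cD.
rewrite [LHS](@variation_of_constants _ _ A (fun l s => D l s w) cd t i t0).
have IE l j : \int[leb]_(s in `[0, t]) (mexp ((t - s) *: A) l j * forcing0 j s w) =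
    \int[leb]_(s in `[0, t]) (mexp ((t - s) *: A) l j * forcing A (fun l s => D l s w) j s).
  by apply: eq_Rintegral => s; rewrite inE/= in_itv/= => /andP[s0 _]; rewrite forcing0E.
rewrite /resolve (forcing0E i w t0).
under [in RHS]eq_bigr => l _ do under eq_bigr => j _ do rewrite IE.
reflexivity.
Qed.

End NonnegativeForcing.

Lemma bdg_cst_homo (R : realType) m (s t : R) : 0 <= s -> s <= t ->
  expR (bdg_cst m s * s) <= expR (bdg_cst m t * t).
Proof.
move=> s0 st; rewrite ler_expR; apply: ler_pM => //; first exact: bdg_cst_ge0.
apply: ler_sum => i _; rewrite ler_wpM2l ?mulr_ge0 ?gauss_moment_ge0//.
by apply: lerXn2r; rewrite ?nnegrE; lra.
Qed.

Lemma covar_mulE (R : realType) d (x hv : 'cV[R]_d) i :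
  (covar x *m hv) i 0 = x i 0 * (hv i 0 - mean hv x).
Proof.
rewrite mulmxBl mxE mul_diag_mx !mxE mulrBr; congr (_ - _).
under eq_bigr do rewrite mxE big_ord1 mxE -mulrA.
by rewrite -mulr_sumr; congr (_ * _); apply: eq_bigr => j _; rewrite mulrC.
Qed.

(** * Moment bounds for the scaled deviation of the filter *)

Section FilterDeviation.
Context disp (Om : measurableType disp) (R : realType) (P : probability Om R) (d : nat).
Variables (a : 'I_d -> R) (L : 'M[R]_d) (nu : 'cV[R]_d) (h : R -> R)
  (X B : R -> Om -> R) (sigma : R) (pi : R -> Om -> 'cV[R]_d).
Hypotheses (P_complete : measure_is_complete P) (a_inj : injective a).
Hypotheses (XB : signal_and_noise P a L nu X B) (sigma0 : 0 < sigma).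
Hypothesis wf : wonham_filter P a L nu h sigma X B pi.

Notation leb := (@lebesgue_measure R).
Notation hv := (hvec a h).
Notation Y := (observation h sigma X B).
Notation filt := (augmented_past P Y).
Notation W := (innovation hv sigma Y pi).
Notation A := (L^T).

Let bmW : filtered_bm P filt W.
Proof. exact: innovation_filtered_bm P_complete a_inj XB sigma0 wf. Qed.

Let mW s : 0 <= s -> measurable_fun setT (W s).
Proof. by move=> s0; exact: (fbm_measurable_W bmW). Qed.

Lemma measurable_filter s i : 0 <= s -> measurable_fun setT (fun w => pi s w i 0).
Proof.
move=> s0; apply: (adapted_measurable bmW s0); apply: (filt_filter wf).
by rewrite s0 lexx.
Qed.

Lemma adapted_covar s i : 0 <= s -> adapted (filt s) (fun w => (covar (pi s w) *m hv) i 0).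
Proof.
move=> s0; have sF := filt_sigma P h X B sigma s.
under eq_fun do rewrite covar_mulE; apply: (adaptedM sF).
  by apply: (filt_filter wf); rewrite s0 lexx.
apply: (adaptedB sF); first exact: adapted_cst.
by apply: (filt_filter_mean wf); rewrite s0 lexx.
Qed.

Lemma filter_forcing t i : 0 <= t ->
  exists2 I, is_ito_integral P (fun s w => (covar (pi s w) *m hv) i 0) W t I &
    {ae P, forall w, forcing A (fun l s => path_coord pi l s w) i t = nu i 0 + sigma^-1 * I w}.
Proof.
move=> t0; have [I0 II0 EI0] := sde_forcing wf.2 i t0.
have RE : residual hv Y pi = fun t w => sigma * W t w.
  by apply/funext => s; apply/funext => w; rewrite /innovation mulVKf// gt_eqF.
rewrite RE in II0; have {}II0 := ito_integral_scale_integrator II0.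
have mH s : 0 <= s -> measurable_fun setT
    (fun w => sigma * ((sigma ^- 2 *: (covar (pi s w) *m hv)) i 0)).
  move=> s0; apply: measurable_funM => //; under eq_fun do rewrite mxE.
  by apply: measurable_funM => //; apply: (adapted_measurable bmW s0); exact: adapted_covar.
(* With second weight 0 this is multiplication by [sigma]. The residual is [sigma * W], so the gain
   sigma^-2 becomes sigma^-1 against [W]; its two remaining powers of [sigma] are cleared here. *)
have := ito_integral_lin sigma 0 mH mH mW II0 II0.
set H := (X in is_ito_integral _ X) => II.
exists (fun w => sigma * I0 w + 0 * I0 w).
  rewrite (_ : (fun s w => _) = H)//; apply/funext => s; apply/funext => w.
  have scE (k : R) (v : 'cV[R]_d) : (k *: v) i 0 = k * v i 0 by rewrite mxE.
  by rewrite /H mul0r addr0 scE; field; rewrite gt_eqF.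
apply: filterS EI0 => w ->; congr (_ + _).
by rewrite mul0r addr0 mulKf// gt_eqF.
Qed.

Let dev l s w := sigma * (path_coord pi l s w - marginal L nu s l 0).

Let cpi l w : continuous (path_coord pi l ^~ w).
Proof.
by apply: (@continuous_ext0 _ (fun s => pi s w l 0)); apply: within_continuous_coord; case: wf.2.
Qed.

Let cdev l w : continuous (dev l ^~ w).
Proof.
move=> s; apply: cvgM; first exact: cvg_cst.
by apply: cvgB; [exact: cpi|exact: continuous_marginal].
Qed.

Let mdev l s : measurable_fun setT (dev l s).
Proof.
apply: measurable_funM => //; apply: measurable_funB => //.
by apply: measurable_filter; rewrite le_max lexx orbT.
Qed.

Let devE l s w : 0 <= s -> dev l s w = sigma * (pi s w l 0 - marginal L nu s l 0).
Proof. by move=> s0; rewrite /dev /path_coord ext0E. Qed.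

Let J0 j s w := forcing0 A dev j s w.

Let cJ0 j w : continuous (J0 j ^~ w).
Proof. exact: continuous_forcing0. Qed.

Let mJ0 j s : measurable_fun setT (J0 j s).
Proof. exact: measurable_forcing0. Qed.

Let dev_resolve t i w : 0 <= t -> dev i t w = resolve A (fun j s => J0 j s w) i t.
Proof. exact: forcing0_resolve. Qed.

Let J_ito s j : 0 <= s ->
  exists2 I, is_ito_integral P (fun s w => (covar (pi s w) *m hv) j 0) W s I &
    {ae P, forall w, I w = J0 j s w}.
Proof.
move=> s0; have [I II EI] := filter_forcing j s0; exists I => //.
apply: filterS EI => w EI; rewrite /J0 forcing0E// /dev forcingZB.
- by rewrite EI marginal_forcing// addrAC subrr add0r mulVKf// gt_eqF.
- by move=> l; exact: cpi.
- by move=> l; exact: continuous_marginal.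
Qed.

Lemma covar_ae : {ae P, forall w, forall s i, 0 <= s ->
  `|(covar (pi s w) *m hv) i 0| <= 2 * hmax a h}.
Proof.
apply: filterS (filter_itv P_complete a_inj XB wf) => w Hw s i s0.
rewrite covar_mulE normrM; have /andP[p0 p1] := Hw s i s0.
rewrite (ger0_norm p0) -[leRHS]mul1r; apply: ler_pM => //.
rewrite (le_trans (ler_normB _ _))// mulr_natl mulr2n lerD//.
  by rewrite mxE /hmax (bigD1 i)//= lerDl sumr_ge0.
rewrite (le_trans (ler_norm_sum _ _ _))//; apply: ler_sum => j _.
have /andP[q0 q1] := Hw s j s0.
by rewrite normrM [X in _ * X]ger0_norm// mxE ler_piMr.
Qed.

(** The forcing of the scaled deviation is the integral of [covar pi *m hv] against [W], and this
    integrand is almost surely bounded uniformly in [sigma]. *)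
Lemma Lq_le_filter_deviation m t K i : (0 < m)%N -> 0 <= t -> resolvent_bound A t K ->
  Lq_le P m.*2 (fun w => sigma * (pi t w i 0 - marginal L nu t i 0))
    (resolve_cst A t K i * (expR (bdg_cst m t * t) * (2 * hmax a h))).
Proof.
move=> m0 t0 HK; under eq_fun do rewrite -devE// dev_resolve//.
have b0 : 0 <= 2 * hmax a h by rewrite mulr_ge0// hmax_ge0.
apply: Lq_le_resolve => //; first by rewrite double_gt0.
  by rewrite mulr_ge0 ?expR_ge0.
move=> j s /andP[s0 st]; have [I II EI] := J_ito j s0.
apply: (Lq_le_ae (mJ0 j s) EI); apply: (@Lq_leW _ _ _ P _ _ (expR (bdg_cst m s * s) * (2 * hmax a h))).
  apply: (Lq_le_ito bmW m0 s0 b0 _ _ II) => r /andP[r0 _]; first exact: adapted_covar.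
  apply: Lq_le_aebounded => //; first by apply: (adapted_measurable bmW r0); exact: adapted_covar.
  by apply: filterS covar_ae => w; apply.
by rewrite ler_wpM2r// bdg_cst_homo.
Qed.

(** The curve [y] is left free: taken as the marginal flow it gives the limit at a fixed time, taken
    as the constant [mu] it gives the reference for the invariant measure. *)
Lemma Lq_le_filter_compare (y : R -> 'cV[R]_d) (J2 : 'I_d -> R -> Om -> R) m t K i (Y0 b : R) :
  (0 < m)%N -> 0 <= t -> resolvent_bound A t K -> 0 <= Y0 -> 0 <= b ->
  (forall s j, 0 <= s <= t -> `|y s j 0| <= Y0) ->
  (forall s j, 0 <= s <= t -> Lq_le P m.*2 (fun w => pi s w j 0 - y s j 0) b) ->
  (forall j w, continuous (J2 j ^~ w)) -> (forall j s, measurable_fun setT (J2 j s)) ->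
  (forall s j, 0 <= s <= t ->
    exists2 I, is_ito_integral P (fun s w => (covar (y s) *m hv) j 0) W s I &
      {ae P, forall w, I w = J2 j s w}) ->
  Lq_le P m.*2
    (fun w => sigma * (pi t w i 0 - marginal L nu t i 0) - resolve A (fun j s => J2 j s w) i t)
    (resolve_cst A t K i * (expR (bdg_cst m t * t) * ((2 + Y0) * hmax a h * (d%:R * b)))).
Proof.
move=> m0 t0 HK Y00 b0 yY piy cJ2 mJ2 J2I.
have q0 : (0 < m.*2)%N by rewrite double_gt0.
have h0 : 0 <= hmax a h by exact: hmax_ge0.
set b1 := (2 + Y0) * hmax a h * (d%:R * b); have b10 : 0 <= b1 by rewrite !mulr_ge0// addr_ge0.
under eq_fun do rewrite -devE// dev_resolve// resolveB//.
apply: (@Lq_le_resolve _ _ _ P d A (fun j s w => J0 j s w - J2 j s w)) => //.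
- by move=> j w s; apply: cvgB; [exact: cJ0|exact: cJ2].
- by move=> j s; exact: measurable_funB.
- by rewrite mulr_ge0 ?expR_ge0.
move=> j s /andP[s0 st]; have s0t : 0 <= s <= t by rewrite s0.
have [I II EI] := J_ito j s0; have [I2 II2 EI2] := J2I s j s0t.
have mc r : 0 <= r -> measurable_fun setT (fun w => (covar (pi r w) *m hv) j 0).
  by move=> r0; apply: (adapted_measurable bmW r0); exact: adapted_covar.
have III := ito_integral_lin 1 (-1) mc (fun r _ => measurable_cst _) mW II II2.
apply: (@Lq_le_ae _ _ _ P _ (fun w => 1 * I w + -1 * I2 w)).
- exact: measurable_funB.
- by apply: filterS2 EI EI2 => w -> ->; rewrite mul1r mulN1r.
apply: (@Lq_leW _ _ _ P _ _ (expR (bdg_cst m s * s) * b1)); last by rewrite ler_wpM2r// bdg_cst_homo.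
apply: (Lq_le_ito bmW m0 s0 b10 _ _ III) => r /andP[r0 rs].
  have sF := filt_sigma P h X B sigma r.
  apply: (adaptedD sF); first by apply: (adaptedZ sF); exact: adapted_covar.
  exact: (adapted_cst sF (-1 * (covar (y r) *m hv) j 0)).
have r0t : 0 <= r <= t by rewrite r0 (le_trans rs).
have sumb : Lq_le P m.*2 (fun w => (2 + Y0) * hmax a h * \sum_k `|pi r w k 0 - y r k 0|) b1.
  have c0 : 0 <= (2 + Y0) * hmax a h by rewrite mulr_ge0// addr_ge0.
  have : Lq_le P m.*2 (fun w => \sum_k `|pi r w k 0 - y r k 0|) (\sum_(k < d) b).
    apply: (@Lq_le_sum _ _ _ P _ _ _ (fun k w => `|pi r w k 0 - y r k 0|) (fun=> b) q0) => k.
    apply: (@Lq_le_dominated _ _ _ P _ _ (fun w => `|pi r w k 0 - y r k 0|)).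
    - by apply: measurableT_comp => //; have [] := piy r k r0t.
    - by apply: aeW => w; rewrite normr_id.
    have [mm bb H] := piy r k r0t; split=> //; first exact: measurableT_comp.
    by under eq_integral do rewrite normr_id.
  move=> /(Lq_leZ ((2 + Y0) * hmax a h)) /Lq_leW; apply.
  by rewrite (ger0_norm c0) sumr_const card_ord /b1 [d%:R * b]mulr_natl.
apply: Lq_le_dominated sumb.
  by apply: measurable_funD => //; apply: measurable_funM => //; exact: mc.
apply: filterS (filter_itv P_complete a_inj XB wf) => w Hw.
rewrite !covar_mulE mul1r mulN1r; set D := \sum_k _.
have D0 : 0 <= D by exact: sumr_ge0.
have Dj : `|pi r w j 0 - y r j 0| <= D by rewrite /D (bigD1 j)//= lerDl sumr_ge0.
have hj : `|hv j 0| <= hmax a h by rewrite mxE /hmax (bigD1 j)//= lerDl sumr_ge0.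
have mp : `|mean hv (pi r w)| <= hmax a h.
  rewrite (le_trans (ler_norm_sum _ _ _))//; apply: ler_sum => k _.
  have /andP[p0 p1] := Hw r k r0.
  by rewrite normrM [X in _ * X]ger0_norm// mxE ler_piMr.
have md : `|mean hv (pi r w) - mean hv (y r)| <= hmax a h * D.
  rewrite /mean -sumrB (le_trans (ler_norm_sum _ _ _))// mulr_sumr; apply: ler_sum => k _.
  rewrite -mulrBr normrM ler_wpM2r// mxE /hmax (bigD1 k)//= lerDl sumr_ge0//.
(* Three terms, each with a small factor: two are bounded by [hmax] times the deviation, the third
   also by [Y0]. This is the origin of the constant [2 + Y0]. *)
have -> : pi r w j 0 * (hv j 0 - mean hv (pi r w)) - y r j 0 * (hv j 0 - mean hv (y r)) =
    (pi r w j 0 - y r j 0) * hv j 0 - (pi r w j 0 - y r j 0) * mean hv (pi r w) -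
    y r j 0 * (mean hv (pi r w) - mean hv (y r)) by ring.
apply: (le_trans (ler_normB _ _)); apply: (le_trans (lerD (ler_normB _ _) (lexx _))).
rewrite !normrM.
have e1 := ler_pM (normr_ge0 _) (normr_ge0 _) Dj hj.
have e2 := ler_pM (normr_ge0 _) (normr_ge0 _) Dj mp.
have e3 := ler_pM (normr_ge0 _) (normr_ge0 _) (yY r j r0t) md.
by apply: (le_trans (lerD (lerD e1 e2) e3)); rewrite le_eqVlt; apply/orP; left; apply/eqP; ring.
Qed.

End FilterDeviation.

(** * From even moments to convergence in L^p *)

Section LnormConvergence.
Context dd (Om : measurableType dd) (R : realType) (P : probability Om R) (d : nat).

Lemma mxnorm_le_sum (x : 'cV[R]_d) : `|x| <= \sum_i `|x i 0|.
Proof.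
apply: mxnorm_le => [|i j]; first exact: sumr_ge0.
by rewrite (ord1 j) (bigD1 i)//= lerDl sumr_ge0.
Qed.

Lemma measurable_mxnorm (V : Om -> 'cV[R]_d) :
  (forall i, measurable_fun setT (fun w => V w i 0)) -> measurable_fun setT (fun w => `|V w|).
Proof.
move=> mV.
have E w : `|V w| = \big[Num.max/0]_(i < d) `|V w i 0|.
  apply/eqP; rewrite eq_le; apply/andP; split.
    apply: mxnorm_le => [|i j]; first by apply: bigmax_ge_id.
    by rewrite (ord1 j); exact: (@le_bigmax _ _ _ 0 (fun i => `|V w i 0|) i).
  by apply: bigmax_le => // i _; exact: mxnorm_entry.
under eq_fun do rewrite E.
elim: (index_enum _) => [|i r IH].
  by under eq_fun do rewrite big_nil; exact: measurable_cst.
under eq_fun do rewrite big_cons; apply: measurable_maxr => //.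
exact: measurableT_comp.
Qed.

(** Passes from a real exponent to an even integer one. Dividing by [b] keeps the bound homogeneous,
    so the rate in [sigma] is preserved. *)
Lemma powR_le_exprn (x b p : R) m : 0 <= x -> 0 < b -> 1 <= p -> p <= m.*2%:R ->
  x `^ p <= b `^ p * (1 + (x / b) ^+ m.*2).
Proof.
move=> x0 b0 p1 pm; have p0 : 0 <= p by rewrite (le_trans ler01).
have y0 : 0 <= x / b by rewrite divr_ge0// ltW.
rewrite -{1}(divfK (lt0r_neq0 b0) x) powRM ?(ltW b0)// mulrC ler_wpM2l ?powR_ge0//.
have [y1|y1] := leP (x / b) 1.
  rewrite (@le_trans _ _ 1) ?lerDl ?exprn_ge0//.
  apply: (@le_trans _ _ (1 `^ p)); last by rewrite powR1.
  by rewrite ge0_ler_powR ?nnegrE.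
rewrite (@le_trans _ _ ((x / b) `^ m.*2%:R)) ?powR_mulrn ?lerDr//.
by rewrite -powR_mulrn// ler_powR// ltW.
Qed.

Lemma Lnorm_le_Lq (V : Om -> 'cV[R]_d) p m b : 1 <= p -> p <= m.*2%:R -> 0 < b ->
  (forall i, measurable_fun setT (fun w => V w i 0)) ->
  Lq_le P m.*2 (fun w => \sum_i `|V w i 0|) b ->
  (Lnorm P p%:E (fun w => (`|V w|)%:E) <= (2 * b)%:E)%E.
Proof.
move=> p1 pm b0 mV Ub; have p0 : 0 < p by rewrite (lt_le_trans ltr01).
set U := (X in Lq_le _ _ X _) in Ub.
have U0 w : 0 <= U w by exact: sumr_ge0.
have [mU _ Hb] := Ub.
have mN := measurable_mxnorm mV.
have H : (\int[P]_w (`| (`|V w|)%:E | `^ p) <= ((2 * b) `^ p)%:E)%E.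
  (* The right side integrates to at most 2 b^p, which is at most (2 b)^p because p >= 1. *)
  apply: (@le_trans _ _ (\int[P]_w ((b `^ p)%:E * (1 + (b ^- m.*2)%:E * (`|U w| ^+ m.*2)%:E)))%E).
    apply: ge0_le_integral => //.
    - by move=> w _; exact: poweR_ge0.
    - apply: (@measurableT_comp _ _ _ _ _ _ (fun x : \bar R => (x `^ p)%E)).
        exact: measurable_poweR.
      by apply: measurableT_comp => //; exact/measurable_EFinP.
    - apply: emeasurable_funM => //; apply: emeasurable_funD => //; apply: emeasurable_funM => //.
      by apply/measurable_EFinP; exact: measurable_normX.
    move=> w _; rewrite [leRHS](_ : _ = (b `^ p * (1 + b ^- m.*2 * `|U w| ^+ m.*2))%:E)//.
    rewrite /= normr_id ?poweR_EFin lee_fin.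
    rewrite (@le_trans _ _ (`|V w| `^ p))//.
    rewrite (@le_trans _ _ (U w `^ p))//.
      by apply: ge0_ler_powR; rewrite ?nnegrE ?(ltW p0)//; exact: mxnorm_le_sum.
    by rewrite (le_trans (powR_le_exprn (U0 w) b0 p1 pm))// ger0_norm// exprMn exprVn mulrC [_ ^- _ * _]mulrC mulrC.
  rewrite ge0_integralZl//; last 3 first.
  - by apply: emeasurable_funD => //; apply: emeasurable_funM => //; apply/measurable_EFinP; exact: measurable_normX.
  - by move=> w _; rewrite [leRHS](_ : _ = (1 + b ^- m.*2 * `|U w| ^+ m.*2)%:E)// lee_fin addr_ge0// mulr_ge0 ?exprn_ge0// invr_ge0 exprn_ge0// ltW.
  - by rewrite lee_fin powR_ge0.
  rewrite ge0_integralD//; last 2 first.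
  - by move=> w _; rewrite -EFinM lee_fin mulr_ge0 ?exprn_ge0// invr_ge0 exprn_ge0// ltW.
  - by apply: emeasurable_funM => //; apply/measurable_EFinP; exact: measurable_normX.
  rewrite ge0_integralZl//; last 2 first.
  - by apply/measurable_EFinP; exact: measurable_normX.
  - by rewrite lee_fin invr_ge0 exprn_ge0// ltW.
  rewrite integral_cst// mul1e [X in (X + _)%E](_ : _ = 1%E); last exact: probability_setT.
  apply: (@le_trans _ _ ((b `^ p)%:E * (1 + (b ^- m.*2)%:E * (b ^+ m.*2)%:E))%E).
    by rewrite lee_pmul2l ?lte_fin ?powR_gt0// leeD2l// lee_pmul2l// lte_fin invr_gt0 exprn_gt0.
  rewrite [leLHS](_ : _ = (b `^ p * (1 + b ^- m.*2 * b ^+ m.*2))%:E)//.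
  rewrite mulVf ?expf_neq0 ?gt_eqF// lee_fin powRM ?(ltW b0)// mulrC.
  rewrite ler_wpM2r ?powR_ge0//; apply: (@le_trans _ _ (2 `^ 1)); first by rewrite powRr1.
  by apply: ler_powR => //; rewrite ler1n.
rewrite unlock /Lnorm; apply: (@le_trans _ _ (((2 * b) `^ p)%:E `^ p^-1)%E).
  apply: gt0_ler_poweR => //; rewrite ?invr_ge0 ?(ltW p0)// in_itv/= leey andbT.
    by apply: integral_ge0 => w _; rewrite lee_fin powR_ge0.
  by rewrite lee_fin powR_ge0.
by rewrite poweR_EFin -powRrM mulfV ?gt_eqF// powRr1// mulr_ge0// ltW.
Qed.

Lemma Lnorm_cvg0 (V : R -> Om -> 'cV[R]_d) p : 1 <= p ->
  (forall m, (0 < m)%N -> exists2 C : R, 0 <= C & forall sigma, 0 < sigma -> forall i,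
    Lq_le P m.*2 (fun w => V sigma w i 0) (sigma^-1 * C)) ->
  Lnorm P p%:E (fun w => (`|V sigma w|)%:E) @[sigma --> +oo] --> 0%E.
Proof.
move=> p1 HV; have p0 : 0 <= p by rewrite (le_trans ler01).
pose m := (Num.truncn p).+1.
have pm : p <= m.*2%:R.
  by apply: (le_trans (ltW (truncnS_gt p))); rewrite ler_nat -addnn leq_addr.
have [C C0 HC] := HV m isT.
have bnd sigma : 0 < sigma -> (Lnorm P p%:E (fun w => (`|V sigma w|)%:E) <=
    ((2 * (d%:R * C + 1)) * sigma^-1)%:E)%E.
  move=> s0; rewrite -mulrA; apply: (@Lnorm_le_Lq _ p m) => //.
  - by rewrite mulr_gt0 ?invr_gt0// ltr_wpDl// mulr_ge0.
  - by move=> i; have [] := HC sigma s0 i.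
  have : Lq_le P m.*2 (fun w => \sum_i `|V sigma w i 0|) (\sum_(i < d) (sigma^-1 * C)).
    apply: (@Lq_le_sum _ _ _ P _ _ _ (fun i w => `|V sigma w i 0|) (fun=> _)) => // i.
    have [mm bb H] := HC sigma s0 i; split=> //; first exact: measurableT_comp.
    by under eq_integral do rewrite normr_id.
  have -> : \sum_(i < d) sigma^-1 * C = sigma^-1 * (d%:R * C).
    by rewrite sumr_const card_ord -[LHS]mulr_natl mulrCA.
  move=> /Lq_leW; apply; rewrite [leRHS]mulrC.
  by rewrite ler_wpM2l ?invr_ge0 ?(ltW s0)// lerDl.
apply: (@squeeze_cvge _ _ _ _ (cst 0%E) _ (fun s : R => ((2 * (d%:R * C + 1)) * s^-1)%:E)).
- near=> s; rewrite Lnorm_ge0/=; apply: bnd; near: s; exact: nbhs_pinfty_gt.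
- exact: cvg_cst.
- apply/fine_cvgP; split; first by apply: nearW.
  rewrite /comp/= -[X in _ --> X](mulr0 (2 * (d%:R * C + 1))).
  by apply: cvgM; [exact: cvg_cst|by apply/gtr0_cvgV0; [exact: nbhs_pinfty_gt|exact: cvg_id]].
Unshelve. all: by end_near. Qed.

End LnormConvergence.

Section SmallNoiseLimit.
Context disp (Om : measurableType disp) (R : realType) (P : probability Om R) (d : nat).
Variables (a : 'I_d -> R) (L : 'M[R]_d) (nu : 'cV[R]_d) (h : R -> R) (X B : R -> Om -> R).
Hypotheses (P_complete : measure_is_complete P) (a_inj : injective a).
Hypotheses (XB : signal_and_noise P a L nu X B).
Notation hv := (hvec a h).
Notation A := (L^T).

Lemma resolvent_bound_mono s t K : s <= t -> resolvent_bound A t K -> resolvent_bound A s K.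
Proof.
move=> st [K0 HK]; split=> // l j r /andP[r0 rs].
have -> : s - r = t - (t - s + r) by ring.
by apply: HK; rewrite addr_ge0 ?subr_ge0//= -lerBrDl opprB addrC subrK.
Qed.

Lemma resolve_cst_mono s t K i : 0 <= K -> s <= t -> resolve_cst A s K i <= resolve_cst A t K i.
Proof.
move=> K0 st; rewrite lerD2l; apply: ler_sum => l _; apply: ler_wpM2l => //.
by apply: ler_sum => j _; exact: ler_wpM2r.
Qed.

(** Summed over the coordinates to be uniform in them. Neither the probability space nor the initial
    law occurs in it, so that it can be used under an invariant measure. *)
Definition deviation_cst m t K : R :=
  \sum_i resolve_cst A t K i * (expR (bdg_cst m t * t) * (2 * hmax a h)).

Lemma deviation_cst_ge0 m t K : 0 <= t -> 0 <= K -> 0 <= deviation_cst m t K.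
Proof.
move=> t0 K0; apply: sumr_ge0 => i _; rewrite mulr_ge0 ?resolve_cst_ge0//.
by rewrite mulr_ge0 ?expR_ge0// mulr_ge0// hmax_ge0.
Qed.

Variables (sigma : R) (pi : R -> Om -> 'cV[R]_d) (sigma0 : 0 < sigma).
Hypothesis wf : wonham_filter P a L nu h sigma X B pi.

Lemma Lq_le_filter m s t K i : (0 < m)%N -> 0 <= s <= t -> resolvent_bound A t K ->
  Lq_le P m.*2 (fun w => pi s w i 0 - marginal L nu s i 0) (sigma^-1 * deviation_cst m t K).
Proof.
move=> m0 /andP[s0 st] tK; have K0 := tK.1.
have := Lq_le_filter_deviation P_complete a_inj XB sigma0 wf i m0 s0 (resolvent_bound_mono st tK).
move=> /(Lq_leZ sigma^-1) H.
have E w : sigma^-1 * (sigma * (pi s w i 0 - marginal L nu s i 0)) = pi s w i 0 - marginal L nu s i 0.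
  by rewrite mulKf// gt_eqF.
under eq_fun do rewrite -E; apply: (Lq_leW H).
rewrite ger0_norm ?invr_ge0 ?(ltW sigma0)// ler_wpM2l ?invr_ge0 ?(ltW sigma0)//.
have t0 := le_trans s0 st; have h0 : 0 <= 2 * hmax a h by rewrite mulr_ge0// hmax_ge0.
rewrite /deviation_cst (bigD1 i)//=; apply: ler_wpDr.
  apply: sumr_ge0 => j _; rewrite mulr_ge0 ?resolve_cst_ge0//.
  by rewrite mulr_ge0 ?expR_ge0.
apply: ler_pM; [exact: resolve_cst_ge0|by rewrite mulr_ge0 ?expR_ge0|exact: resolve_cst_mono|].
by rewrite ler_wpM2r// bdg_cst_homo.
Qed.

Variable Z : R -> Om -> 'cV[R]_d.
Notation W := (innovation hv sigma (observation h sigma X B) pi).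
Hypothesis Z_sde : sde P 0 (fun t w => A *m Z t w)
  (fun t _ => covar (marginal L nu t) *m hv) W Z.

Let cZ l w : continuous (path_coord Z l ^~ w).
Proof.
by apply: (@continuous_ext0 _ (fun s => Z s w l 0)); apply: within_continuous_coord; case: Z_sde.
Qed.

Let mZ l s : measurable_fun setT (path_coord Z l s).
Proof. by have [mZ _ _] := Z_sde; apply: mZ; rewrite le_max lexx orbT. Qed.

Let Z_ito s j : 0 <= s ->
  exists2 I, is_ito_integral P (fun s w => (covar (marginal L nu s) *m hv) j 0) W s I &
    {ae P, forall w, I w = forcing0 A (path_coord Z) j s w}.
Proof.
move=> s0; have [I II EI] := sde_forcing Z_sde j s0; exists I => //.
by apply: filterS EI => w; rewrite forcing0E// => ->; rewrite mxE add0r.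
Qed.

Lemma linear_sde_gaussian : gaussian_process P Z.
Proof.
move=> n t u t0; exists 0.
have bW := innovation_filtered_bm P_complete a_inj XB sigma0 wf.
have W0 w : W 0 w = 0 by case: (innovation_continuous a_inj XB wf w).
apply: (bm_gaussian_normal bW W0).
have gZ s i : 0 <= s -> bm_gaussian P W (fun w => Z s w i 0).
  move=> s0.
  have E w : Z s w i 0 = resolve A (fun j s => forcing0 A (path_coord Z) j s w) i s.
    by rewrite -forcing0_resolve// /path_coord ext0E.
  under eq_fun do rewrite E.
  apply: (@bm_gaussian_resolve _ _ _ P _ A (forcing0 A (path_coord Z)) _ _ _ _ _ _ bW W0 s0).
  - by move=> j w; exact: continuous_forcing0.
  - by move=> j r; exact: measurable_forcing0.
  move=> j r /andP[r0 _]; have [I II EI] := Z_ito j r0.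
  apply: (bm_gaussian_ae bW _ _ EI); first exact: (bm_gaussian_ito bW r0 II).
  exact: measurable_forcing0.
apply: (@bm_gaussian_sum _ _ _ P _ W bW _ _ (fun k w => ((u k)^T *m Z (t k) w) 0 0)) => k.
under eq_fun do rewrite mxE.
apply: (@bm_gaussian_sum _ _ _ P _ W bW _ _ (fun i w => (u k)^T 0 i * Z (t k) w i 0)) => i.
by apply: (bm_gaussianZ bW); exact: gZ.
Qed.

(** Compares the filter with its own marginal flow; the factor 1 / sigma comes from
    [Lq_le_filter]. *)
Lemma Lq_le_filter_sde m t K i (Y0 : R) : (0 < m)%N -> 0 <= t -> resolvent_bound A t K ->
  0 <= Y0 -> (forall s j, 0 <= s <= t -> `|marginal L nu s j 0| <= Y0) ->
  Lq_le P m.*2 (fun w => sigma * (pi t w i 0 - marginal L nu t i 0) - Z t w i 0)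
    (resolve_cst A t K i * (expR (bdg_cst m t * t) *
      ((2 + Y0) * hmax a h * (d%:R * (sigma^-1 * deviation_cst m t K))))).
Proof.
move=> m0 t0 tK Y00 HY.
have E w : Z t w i 0 = resolve A (fun j s => forcing0 A (path_coord Z) j s w) i t.
  by rewrite -forcing0_resolve// /path_coord ext0E.
under eq_fun do rewrite E.
apply: (Lq_le_filter_compare P_complete a_inj XB sigma0 wf i (y := marginal L nu)) => //.
- by rewrite mulr_ge0 ?invr_ge0 ?(ltW sigma0)// deviation_cst_ge0// tK.1.
- by move=> s j st; exact: Lq_le_filter.
- by move=> j w; exact: continuous_forcing0.
- by move=> j s; exact: measurable_forcing0.
- by move=> s j /andP[s0 _]; exact: Z_ito.
Qed.

End SmallNoiseLimit.

(** * The Lyapunov equation *)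

Section Contraction.
Context {R : realType} {d : nat}.
Variable L : 'M[R]_d.
Hypotheses (L_intensity : intensity_matrix L) (L_ergodic : ergodic L).

Lemma mexp_row_sum t i : \sum_j mexp (t *: L) i j = 1.
Proof.
have dF (x : R) : is_derive x 1 (fun t => \sum_j mexp (t *: L) i j) 0.
  have : is_derive x 1 (fun t => \sum_j mexp (t *: L) i j) (\sum_j (L *m mexp (x *: L)) i j).
    by apply: is_derive_bigsum => j; exact: is_derive_mexp.
  rewrite mexp_comm [X in is_derive _ _ _ X](_ : _ = 0)//.
  under eq_bigr do rewrite mxE; rewrite exchange_big/= big1// => l _.
  by rewrite -mulr_sumr (L_intensity.2 l) mulr0.
rewrite (is_derive_eq0_cst dF t 0) mexp_0 (bigD1 i)//= big1 ?addr0; first by rewrite mxE eqxx.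
by move=> j ji; rewrite mxE eq_sym (negbTE ji).
Qed.

Lemma mexp_natS n : mexp (n.+1%:R *: L) = mexp L *m mexp (n%:R *: L).
Proof. by rewrite -{2}[L]scale1r -mexpD -natr1 addrC. Qed.

(** Ergodicity gives positivity at time 1 and products propagate it to integer times, which is why
    the flow is sampled at the integers. *)
Lemma mexp_nat_ge0 n i j : 0 <= mexp (n%:R *: L) i j.
Proof.
elim: n i j => [|n IH] i j; first by rewrite mexp_0 mxE.
by rewrite mexp_natS mxE sumr_ge0// => l _; rewrite mulr_ge0// ltW.
Qed.

Lemma mexp_nat_norm_le n (u : 'cV[R]_d) U i : (forall j, `|u j 0| <= U) ->
  `|(mexp (n%:R *: L) *m u) i 0| <= U.
Proof.
move=> uU; rewrite mxE (le_trans (ler_norm_sum _ _ _))//.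
apply: (@le_trans _ _ (\sum_j mexp (n%:R *: L) i j * U)).
  apply: ler_sum => j _; rewrite normrM (ger0_norm (mexp_nat_ge0 _ _ _)).
  by rewrite ler_wpM2l ?mexp_nat_ge0.
by rewrite -mulr_suml mexp_row_sum mul1r.
Qed.

Lemma mexp_trE t : mexp (t *: L^T) = (mexp (t *: L))^T.
Proof. by rewrite mexp_tr linearZ. Qed.

Lemma mexp_tr_sum t (x : 'cV[R]_d) : \sum_i (mexp (t *: L^T) *m x) i 0 = \sum_i x i 0.
Proof.
under eq_bigr do rewrite mxE; rewrite exchange_big/=; apply: eq_bigr => j _.
by rewrite -mulr_suml mexp_trE; under eq_bigr do rewrite mxE; rewrite mexp_row_sum mul1r.
Qed.

Hypothesis d_gt0 : (0 < d)%N.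

(** Doeblin's argument: subtracting the least entry [e] of exp L from all entries is invisible on
    zero-sum vectors, and leaves a nonnegative matrix with row sums 1 - d e. *)
Lemma ergodic_contraction : exists rho, 0 <= rho < 1 /\ forall n (x : 'cV[R]_d),
  \sum_i x i 0 = 0 ->
  \sum_i `|(mexp (n%:R *: L^T) *m x) i 0| <= rho ^+ n * \sum_i `|x i 0|.
Proof.
have [e e0 eL] : exists2 e : R, 0 < e & forall i j, e <= mexp L i j.
  exists (\big[Num.min/1]_(ij : 'I_d * 'I_d) mexp L ij.1 ij.2).
    by apply: lt_bigmin => // ij _; exact: L_ergodic.
  by move=> i j; exact: (@bigmin_le _ _ _ 1 (i, j) (fun ij : 'I_d * 'I_d => mexp L ij.1 ij.2)).
pose rho := 1 - d%:R * e.
have i0 : 'I_d by exact: Ordinal d_gt0.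
have row1 i : \sum_j mexp L i j = 1 by have := mexp_row_sum 1 i; rewrite scale1r.
have rowe i : \sum_j (mexp L i j - e) = rho.
  by rewrite sumrB row1 sumr_const card_ord -[e *+ _]mulr_natl.
have rho0 : 0 <= rho by rewrite -(rowe i0) sumr_ge0// => j _; rewrite subr_ge0.
have rho1 : rho < 1 by rewrite ltrBlDr ltrDl mulr_gt0// ltr0n.
exists rho; split; first by rewrite rho0.
have step (x : 'cV[R]_d) : \sum_i x i 0 = 0 ->
    \sum_i `|((mexp L)^T *m x) i 0| <= rho * \sum_i `|x i 0|.
  move=> x0.
  have E i : ((mexp L)^T *m x) i 0 = \sum_j (mexp L j i - e) * x j 0.
    under eq_bigr do rewrite mulrBl; rewrite sumrB -mulr_sumr x0 mulr0 subr0 mxE.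
    by apply: eq_bigr => j _; rewrite mxE.
  apply: (@le_trans _ _ (\sum_i \sum_j (mexp L j i - e) * `|x j 0|)).
    apply: ler_sum => i _; rewrite E (le_trans (ler_norm_sum _ _ _))//.
    by apply: ler_sum => j _; rewrite normrM ger0_norm// subr_ge0.
  rewrite exchange_big/= mulr_sumr; apply: ler_sum => j _.
  by rewrite -mulr_suml rowe.
elim=> [|n IH] x x0; first by rewrite mexp_0 expr0 mul1r mul1mx.
have -> : mexp (n.+1%:R *: L^T) = (mexp L)^T *m mexp (n%:R *: L^T).
  by rewrite -natr1 addrC mexpD scale1r mexp_tr.
rewrite -mulmxA; apply: (le_trans (step _ _)); first by rewrite mexp_tr_sum.
by rewrite exprS -mulrA ler_wpM2l// IH.
Qed.

End Contraction.

(** * Quadratic forms along the flow of the generator *)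

Section QuadraticForm.
Context {R : realType} {d : nat}.
Variable L : 'M[R]_d.

Definition quad (S : 'M[R]_d) (u : 'cV[R]_d) : R := (u^T *m S *m u) 0 0.

Lemma quadE (S : 'M[R]_d) (u : 'cV[R]_d) : quad S u = \sum_i u i 0 * \sum_j S i j * u j 0.
Proof.
rewrite /quad -mulmxA mxE; apply: eq_bigr => i _; rewrite mxE; congr (_ * _).
by rewrite mxE.
Qed.

Lemma quadD S x y :
  quad S (x + y) = quad S x + (x^T *m S *m y) 0 0 + (y^T *m S *m x) 0 0 + quad S y.
Proof.
have -> : quad S (x + y) = ((x^T + y^T) *m S *m (x + y)) 0 0.
  by congr ((_ *m _ *m _) 0 0); apply/matrixP => i j; rewrite !mxE.
have addE (M N : 'M[R]_1) : (M + N) 0 0 = M 0 0 + N 0 0 by rewrite mxE.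
by rewrite 2!mulmxDl !mulmxDr !addE /quad; ring.
Qed.

Definition flow (u : 'cV[R]_d) (t : R) := mexp (t *: L) *m u.

Lemma is_derive_flow (u : 'cV[R]_d) (t : R) i :
  is_derive t 1 (fun t : R => flow u t i 0) ((L *m flow u t) i 0).
Proof.
rewrite /flow mulmxA mxE.
have -> : (fun t : R => (mexp (t *: L) *m u) i 0) = fun t => \sum_j u j 0 * mexp (t *: L) i j.
  by apply/funext => s; rewrite mxE; apply: eq_bigr => j _; rewrite mulrC.
under eq_bigr do rewrite mulrC.
by apply: is_derive_bigsum => j; apply: is_derive_scale; exact: is_derive_mexp.
Qed.

Lemma is_derive_quad_flow (S : 'M[R]_d) (u : 'cV[R]_d) (t : R) :
  is_derive t 1 (fun t : R => quad S (flow u t)) (quad (L^T *m S + S *m L) (flow u t)).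
Proof.
have -> : (fun t => quad S (flow u t)) =
    fun t => \sum_i flow u t i 0 * \sum_j S i j * flow u t j 0.
  by apply/funext => s; rewrite quadE.
set y := flow u t.
have -> : quad (L^T *m S + S *m L) y =
    \sum_i (flow u t i 0 * (\sum_j S i j * (L *m y) j 0) + (\sum_j S i j * flow u t j 0) * (L *m y) i 0).
  rewrite -/y; clearbody y; rewrite /quad mulmxDr mulmxDl mxE addrC big_split/=; congr (_ + _).
    rewrite -!mulmxA mxE; apply: eq_bigr => i _; rewrite mxE; congr (_ * _).
    by rewrite mxE.
  have -> : y^T *m (L^T *m S) *m y = (L *m y)^T *m (S *m y) by rewrite trmx_mul !mulmxA.
  rewrite mxE; apply: eq_bigr => i _; rewrite mxE mulrC; congr (_ * _).
  by rewrite mxE.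
apply: is_derive_bigsum => i; apply: is_derive_mul; first exact: is_derive_flow.
by apply: is_derive_bigsum => j; apply: is_derive_scale; exact: is_derive_flow.
Qed.

Lemma quad_rank1 (g u : 'cV[R]_d) : quad (g *m g^T) u = ((g^T *m u) 0 0) ^+ 2.
Proof.
rewrite /quad mulmxA -mulmxA mxE big_ord1 expr2; congr (_ * _).
by rewrite -[u^T *m g]trmxK trmx_mul trmxK mxE.
Qed.

End QuadraticForm.

Lemma invariant_dim_gt0 (R : realType) (d : nat) (L : 'M[R]_d) (mu : 'cV[R]_d) :
  invariant_distribution L mu -> (0 < d)%N.
Proof.
move=> [[_ +] _]; case: d mu {L} => // mu.
by rewrite big_ord0 => /eqP; rewrite eq_sym oner_eq0.
Qed.

Section Lyapunov.
Context {R : realType} {d : nat}.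
Variables (L : 'M[R]_d) (hv mu : 'cV[R]_d).
Hypotheses (L_intensity : intensity_matrix L) (L_ergodic : ergodic L).
Hypothesis mu_inv : invariant_distribution L mu.

Let d_gt0 : (0 < d)%N.
Proof. exact: invariant_dim_gt0 mu_inv. Qed.

Let g := covar mu *m hv.

Lemma covar_tr (x : 'cV[R]_d) : (covar x)^T = covar x.
Proof. by rewrite /covar linearB/= tr_diag_mx trmx_mul trmxK. Qed.

Lemma lyapunov_rank1 : covar mu *m hv *m hv^T *m covar mu = g *m g^T.
Proof. by rewrite /g trmx_mul covar_tr mulmxA. Qed.

Lemma covar_hv_sum : \sum_i g i 0 = 0.
Proof.
have [[_ mu1] _] := mu_inv; rewrite /g; under eq_bigr do rewrite covar_mulE mulrBr.
rewrite sumrB -mulr_suml mu1 mul1r /mean.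
by apply/eqP; rewrite subr_eq0; apply/eqP; apply: eq_bigr => i _; rewrite mulrC.
Qed.

(** Only one of the two exponentials has to decay: the columns of [S] sum to 0, so exp (n L^T) S
    contracts, while exp (n L) u stays bounded by the entries of [u]. *)
Lemma quad_flow_decay : exists rho, 0 <= rho < 1 /\ forall S : 'M[R]_d,
  (forall j, \sum_i S i j = 0) -> forall u : 'cV[R]_d, exists2 K, 0 <= K &
  forall n, `|quad S (flow L u n%:R)| <= rho ^+ n * K.
Proof.
have [rho [rho01 H]] := ergodic_contraction L_intensity L_ergodic d_gt0.
exists rho; split=> // S S0 u.
pose U := \sum_i `|u i 0|; have uU j : `|u j 0| <= U by rewrite /U (bigD1 j)//= lerDl sumr_ge0.
have U0 : 0 <= U by exact: sumr_ge0.
exists (U * U * \sum_j \sum_i `|S i j|).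
  by rewrite !mulr_ge0//; apply: sumr_ge0 => j _; exact: sumr_ge0.
move=> n; have rn0 : 0 <= rho ^+ n by rewrite exprn_ge0//; case/andP: rho01.
set y := flow L u n%:R.
have yU j : `|y j 0| <= U by exact: mexp_nat_norm_le.
pose S' := mexp (n%:R *: L^T) *m S.
have E : quad S y = \sum_i \sum_j u i 0 * S' i j * y j 0.
  rewrite /quad {1}/y /flow trmx_mul -mexp_trE -[u^T *m _ *m S]mulmxA -/S' -mulmxA mxE.
  apply: eq_bigr => i _; rewrite mxE mxE mulr_sumr; apply: eq_bigr => j _; by rewrite mulrA.
have S'b : \sum_j \sum_i `|S' i j| <= rho ^+ n * \sum_j \sum_i `|S i j|.
  rewrite mulr_sumr; apply: ler_sum => j _.
  have cS i : (mexp (n%:R *: L^T) *m col j S) i 0 = S' i j.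
    by rewrite !mxE; apply: eq_bigr => k _; rewrite mxE.
  have := H n (col j S); under eq_bigr do rewrite mxE; move=> /(_ (S0 j)).
  under eq_bigr do rewrite cS; under [in leRHS]eq_bigr do rewrite mxE.
  exact.
rewrite E (le_trans (ler_norm_sum _ _ _))//.
apply: (@le_trans _ _ (\sum_i \sum_j U * U * `|S' i j|)).
  apply: ler_sum => i _; rewrite (le_trans (ler_norm_sum _ _ _))//; apply: ler_sum => j _.
  rewrite !normrM mulrAC; apply: ler_wpM2r => //; exact: ler_pM.
rewrite exchange_big/=; under eq_bigr do rewrite -mulr_sumr.
by rewrite -mulr_sumr mulrCA ler_wpM2l// mulr_ge0.
Qed.

(** A nonnegative form vanishing at the vector of ones is affine along that direction, hence
    constant; its slope is the row sum. This turns the scalar condition on [S] into zero row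
    sums. *)
Lemma nonneg_definite_kernel (S : 'M[R]_d) : nonneg_definite S -> \sum_i \sum_j S i j = 0 ->
  forall i, \sum_j S i j = 0.
Proof.
move=> [Ss S0] S1 i; pose one : 'cV[R]_d := const_mx 1; pose e : 'cV[R]_d := delta_mx i 0.
pose b := \sum_j S i j.
have q1 : quad S one = 0.
  rewrite quadE -[RHS]S1; apply: eq_bigr => k _; rewrite mxE mul1r.
  by apply: eq_bigr => j _; rewrite mxE mulr1.
have eS1 : (e^T *m S *m one) 0 0 = b.
  by rewrite trmx_delta -rowE mxE; apply: eq_bigr => j _; rewrite !mxE mulr1.
have Se1 : (one^T *m S *m e) 0 0 = b.
  have <- : ((e^T *m S *m one)^T) 0 0 = b by rewrite mxE.
  by rewrite !trmx_mul trmxK Ss mulmxA.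
have q (x : R) : 0 <= quad S e + 2 * x * b.
  have := S0 (e + x *: one).
  have trZ : (x *: one)^T = x *: one^T by apply/matrixP => k l; rewrite !mxE.
  have scE (M : 'M[R]_1) : (x *: M) 0 0 = x * M 0 0 by rewrite mxE.
  rewrite -/(quad _ _) quadD /quad trZ -!scalemxAl -!scalemxAr !scE eS1 Se1 -/(quad S one) q1.
  by rewrite !mulr0 addr0 -/(quad S e) (_ : 2 * x * b = x * b + x * b); [rewrite addrA|ring].
(* With a nonzero slope this choice makes the form equal to -1. *)
apply/eqP/negP => /negP b0; have := q (- (quad S e + 1) / (2 * b)).
have -> : 2 * (- (quad S e + 1) / (2 * b)) * b = - (quad S e + 1) by field.
by lra.
Qed.

(** Along the flow the quadratic form of [D] is constant and also tends to 0, so it vanishes, and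
    [D] with it by polarisation. *)
Lemma lyapunov_injective (D : 'M[R]_d) : D^T = D -> (forall i, \sum_j D i j = 0) ->
  L^T *m D + D *m L = 0 -> D = 0.
Proof.
move=> Ds D0 DE; have [rho [/andP[r0 r1] H]] := quad_flow_decay.
have D0' j : \sum_i D i j = 0 by rewrite -[RHS](D0 j); apply: eq_bigr => i _; rewrite -{1}Ds mxE.
have q0 u : quad D u = 0.
  have [K K0 HK] := H D D0' u.
  have dq (t : R) : is_derive t 1 (fun t => quad D (flow L u t)) 0.
    by have := is_derive_quad_flow L D u t; rewrite DE [X in is_derive _ _ _ X](_ : _ = 0)// /quad mulmx0 mul0mx mxE.
  have E n : quad D (flow L u n%:R) = quad D u.
    by rewrite (is_derive_eq0_cst dq _ 0) /flow mexp_0 mul1mx.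
  apply/eqP; rewrite -normr_le0.
  have cv : rho ^+ n * K @[n --> \oo] --> (0 * K : R).
    by apply: cvgM; [apply: cvg_expr; rewrite ger0_norm|exact: cvg_cst].
  by rewrite -[leRHS](mul0r K); apply: (limr_ge_cst cv) => n; rewrite -(E n).
apply/matrixP => i j; rewrite mxE.
pose e k : 'cV[R]_d := delta_mx k 0.
have qe k l : ((e k)^T *m D *m e l) 0 0 = D k l.
  by rewrite trmx_delta -rowE -colE !mxE.
have := q0 (e i + e j); have := q0 (e i); have := q0 (e j).
rewrite quadD => -> ->; rewrite !qe.
have -> : D j i = D i j by rewrite -{1}Ds mxE.
by rewrite add0r addr0 -mulr2n => /eqP; rewrite mulrn_eq0/= => /eqP.
Qed.

(** The symmetric matrices killing the vector of ones form a subspace stable under the Lyapunov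
    operator. An injective endomorphism of it is onto, and the right-hand side lies in it because
    the entries of [g] sum to 0. *)
Lemma lyapunov_surjective : exists S : 'M[R]_d, [/\ S^T = S, forall i, \sum_j S i j = 0 &
  0 = L^T *m S + S *m L + g *m g^T].
Proof.
pose one : 'cV[R]_d := const_mx 1.
pose f : 'End('M[R]_d) := linfun (mulmx L^T \+ mulmxr L).
pose s : 'End('M[R]_d) := linfun (idfun \- trmx).
pose r : 'Hom('M[R]_d, 'cV[R]_d) := linfun (mulmxr one).
pose E := (lker s :&: lker r)%VS.
have rowE (S : 'M[R]_d) : (S *m one = 0) <-> forall i, \sum_j S i j = 0.
  split=> [/matrixP H i|H].
    have := H i 0; rewrite !mxE => H0; rewrite -[RHS]H0.
    by apply: eq_bigr => j _; rewrite mxE mulr1.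
  by apply/matrixP => i j; rewrite !mxE -[RHS](H i); apply: eq_bigr => k _; rewrite mxE mulr1.
have memE (S : 'M[R]_d) : S \in E <-> S^T = S /\ S *m one = 0.
  rewrite memv_cap !memv_ker !lfunE/=; split.
    by move=> /andP[/eqP H /eqP ->]; split=> //; apply/eqP; rewrite eq_sym -subr_eq0 H.
  by move=> [-> ->]; rewrite subrr !eqxx.
have L1 : L *m one = 0 by apply/rowE => i; exact: L_intensity.2.
have fE : (f @: E <= E)%VS.
  apply/subvP => _ /memv_imgP[S /memE[Ss S1] ->]; apply/memE; rewrite lfunE/=; split.
    by rewrite linearD/= !trmx_mul trmxK Ss addrC.
  by rewrite mulmxDl -!mulmxA S1 L1 !mulmx0 addr0.
have kE : (E :&: lker f)%VS = 0%VS.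
  apply/eqP; rewrite -subv0; apply/subvP => S; rewrite memv_cap => /andP[/memE[Ss S1]].
  rewrite memv_ker lfunE/= => /eqP H; rewrite memv0; apply/eqP.
  by apply: lyapunov_injective => //; exact/rowE.
have fEE : (f @: E)%VS = E.
  apply/eqP; rewrite eqEdim fE/= -(limg_ker_dim f E) kE dimv0 add0n.
  exact: leqnn.
have gE : - (g *m g^T) \in E.
  apply/memE; rewrite linearN/= trmx_mul trmxK mulNmx; split=> //.
  rewrite -mulmxA (_ : g^T *m one = 0) ?mulmx0 ?oppr0//.
  apply/matrixP => i j; rewrite !mxE -[RHS]covar_hv_sum; apply: eq_bigr => k _.
  by rewrite (ord1 i) !mxE mulr1.
move: gE; rewrite -fEE => /memv_imgP[S /memE[Ss S1] gS].
exists S; split=> //; first exact/rowE.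
by move: gS; rewrite lfunE/= => <-; rewrite addNr.
Qed.

(** The form decreases along the flow, with derivative minus a square, towards the limit 0. *)
Lemma lyapunov_nonneg (S : 'M[R]_d) : S^T = S -> (forall i, \sum_j S i j = 0) ->
  0 = L^T *m S + S *m L + g *m g^T -> nonneg_definite S.
Proof.
move=> Ss S0 SE; split=> // u; rewrite -/(quad S u).
have [rho [/andP[r0 r1] H]] := quad_flow_decay.
have S0' j : \sum_i S i j = 0 by rewrite -[RHS](S0 j); apply: eq_bigr => i _; rewrite -{1}Ss mxE.
have [K K0 HK] := H S S0' u.
have SE' : L^T *m S + S *m L = - (g *m g^T) by apply/eqP; rewrite -addr_eq0 -SE.
have dq (t : R) : is_derive t 1 (fun t => - quad S (flow L u t)) (((g^T *m flow L u t) 0 0) ^+ 2).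
  have := is_derive_opp (is_derive_quad_flow L S u t); rewrite SE'.
  rewrite [X in is_derive _ _ _ X](_ : _ = ((g^T *m flow L u t) 0 0) ^+ 2)//.
  by rewrite -quad_rank1 /quad mulmxN mulNmx mxE opprK.
have E n : quad S (flow L u n%:R) <= quad S u.
  have := @is_derive_ge0_le _ (fun t => - quad S (flow L u t)) (fun t => ((g^T *m flow L u t) 0 0) ^+ 2) 0 n%:R.
  have -> : flow L u 0 = u by rewrite /flow mexp_0 mul1mx.
  rewrite lerN2; apply=> //.
  by move=> x _; exact: sqr_ge0.
have cv : - (rho ^+ n * K) @[n --> \oo] --> (- (0 * K) : R).
  by apply: cvgN; apply: cvgM; [apply: cvg_expr; rewrite ger0_norm|exact: cvg_cst].
rewrite -[leLHS]oppr0 -(mul0r K); apply: (limr_le_cst cv) => n.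
by apply: le_trans (E n); have := HK n; rewrite ler_norml => /andP[].
Qed.

Lemma lyapunov_exists_unique : exists! S : 'M[R]_d, lyapunov_solution L hv mu S.
Proof.
have [S [Ss S0 SE]] := lyapunov_surjective; exists S; split.
  split; [exact: lyapunov_nonneg|by rewrite big1// => i _|by rewrite lyapunov_rank1].
move=> T [TN T0 TE]; apply/eqP; rewrite -subr_eq0; apply/eqP; apply: lyapunov_injective.
- by rewrite linearB/= Ss TN.1.
- move=> i; under eq_bigr do rewrite !mxE; rewrite sumrB S0 (nonneg_definite_kernel TN T0).
  by rewrite subrr.
rewrite lyapunov_rank1 in TE.
rewrite mulmxBr mulmxBl addrACA -opprD; apply/eqP; rewrite subr_eq0; apply/eqP.
by apply: (addIr (g *m g^T)); rewrite -SE -TE.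
Qed.

End Lyapunov.

(** * Limits of the invariant measures *)

Section ProbabilityKernels.
Context dX dY (X : measurableType dX) (Y : measurableType dY) (R : realType).
Variable k : R.-pker X ~> Y.

Section Fiber.
Variable x : X.

(* [k x] is canonically a measure only; the copy carries the probability structure. *)
Definition ker_prob (A : set Y) : \bar R := k x A.

HB.instance Definition _ := Measure.copy ker_prob (k x).

HB.instance Definition _ := Measure_isProbability.Build _ _ _ ker_prob (prob_kernel x).

End Fiber.

Lemma measurable_Rintegral_kernel (f : Y -> R) B : 0 <= B -> measurable_fun setT f ->
  (forall y, `|f y| <= B) -> measurable_fun setT (fun x => 'Ex_(ker_prob x) f).
Proof.
move=> B0 mf fB.
(* Shifting by [B] makes the integrand nonnegative, as the measurability theorem for kernel
   integrals asks. *)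
have E x : 'Ex_(ker_prob x) f = fine (\int[k x]_y (f y + B)%:E)%E - B.
  have i1 : (ker_prob x).-integrable setT (EFin \o f) by exact: (@integrable_bounded _ _ _ (ker_prob x) f B).
  have ic : (ker_prob x).-integrable setT (EFin \o (fun=> B)) by apply: (@integrable_bounded _ _ _ (ker_prob x) _ B) => // y; rewrite ger0_norm.
  rewrite -[(fine _)]/('Ex_(ker_prob x) (fun y => f y + B)) RintegralD//.
  by rewrite (Rintegral_prob_cst (ker_prob x)) addrK.
under eq_fun do rewrite E.
apply: measurable_funB => //; apply: measurableT_comp => //.
apply: (@measurable_fun_integral_kernel _ _ X Y R (fun x => k x) _ (fun y => (f y + B)%:E)).
- by move=> U mU; exact: measurable_kernel.
- by move=> y; rewrite lee_fin -lerBlDr sub0r; have := fB y; rewrite ler_norml => /andP[].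
- by apply/measurable_EFinP; exact: measurable_funD.
Qed.

End ProbabilityKernels.

Section InvariantIntegral.
Context dT (T : measurableType dT) (R : realType) (M : probability T R).
Variables (Q : R.-pker T ~> T) (S : set T).
Hypotheses (mS : measurable S) (MS : M S = 1%E).
Hypothesis inv : forall A, measurable A -> (\int[M]_(x in S) Q x A = M A)%E.

Lemma ae_full_set : {ae M, forall x, S x}.
Proof.
exists (~` S); split=> //; first exact: measurableC.
by rewrite probability_setC// MS subee.
Qed.

Lemma ae_full_setW (D : T -> Prop) : (forall x, S x -> D x) -> {ae M, forall x, D x}.
Proof. by move=> SD; apply: filterS ae_full_set. Qed.

Lemma invariant_indic A : measurable A -> 'Ex_M (fun x => fine (Q x A)) = fine (M A).
Proof.
move=> mA; rewrite -(inv mA) /Rintegral; congr fine.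
have mQ : measurable_fun setT (fun x => Q x A) by exact: measurable_kernel.
rewrite [RHS]integral_mkcond; apply: ae_eq_integral => //.
- by apply/measurable_EFinP; apply: measurableT_comp.
- apply/(measurable_restrictT _ mS).
  exact: measurable_funTS.
apply: filterS ae_full_set => x Sx _.
rewrite patchE mem_set//= fineK//; exact: (fin_num_measure (ker_prob Q x)).
Qed.

(** Invariance is assumed on sets; level-set sums carry it to bounded functions, after an affine
    reduction to values in [0, 1]. *)
Lemma invariant_Rintegral (f : T -> R) B : 0 <= B -> measurable_fun setT f ->
  (forall y, `|f y| <= B) -> 'Ex_M f = 'Ex_M (fun x => 'Ex_(ker_prob Q x) f).
Proof.
move=> B0 mf fB.
wlog f01 : f B B0 mf fB / forall y, 0 <= f y <= 1.
  move=> H; pose g y := (f y + B) / (2 * B + 1).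
  have c0 : 0 < 2 * B + 1 by rewrite ltr_wpDl// mulr_ge0.
  have g01 y : 0 <= g y <= 1.
    have := fB y; rewrite ler_norml => /andP[a b]; apply/andP; split.
      by rewrite divr_ge0// ?(ltW c0)//; lra.
    by rewrite ler_pdivrMr//; lra.
  have mg : measurable_fun setT g by apply: measurable_funM => //; exact: measurable_funD.
  have g1 y : `|g y| <= 1 by have /andP[a b] := g01 y; rewrite ger0_norm.
  have fE y : f y = (2 * B + 1) * g y - B by rewrite /g; field; rewrite gt_eqF.
  have lin (P : probability T R) : 'Ex_P f = (2 * B + 1) * 'Ex_P g - B.
    have ig : P.-integrable setT (EFin \o g) by exact: (@integrable_bounded _ _ _ P g 1).
    rewrite [X in 'Ex_P X](_ : f = fun y => (2 * B + 1) * g y - B); last exact/funext.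
    rewrite RintegralB//.
    - by rewrite RintegralZl// Rintegral_prob_cst.
    - exact: (integrableZl measurableT _ ig).
    - exact: finite_measure_integrable_cst.
  rewrite lin (H g 1 ler01 mg g1 g01).
  have mQg := measurable_Rintegral_kernel Q ler01 mg g1.
  have Qg1 x : `|'Ex_(ker_prob Q x) g| <= 1.
    by apply: (@Rintegral_norm_bound _ _ _ (ker_prob Q x)) => //; exact: aeW.
  have iQg : M.-integrable setT (EFin \o (fun x => 'Ex_(ker_prob Q x) g)).
    exact: (@integrable_bounded _ _ _ M _ 1).
  have QE x : 'Ex_(ker_prob Q x) f = (2 * B + 1) * 'Ex_(ker_prob Q x) g - B := lin (ker_prob Q x).
  under [in RHS]eq_fun do rewrite QE.
  rewrite RintegralB//.
  - by rewrite RintegralZl// Rintegral_prob_cst.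
  - exact: (integrableZl measurableT _ iQg).
  - exact: finite_measure_integrable_cst.
have le_inv n : `|'Ex_M f - 'Ex_M (fun x => 'Ex_(ker_prob Q x) f)| <= 2 * n.+1%:R^-1.
  pose D (k : nat) := f @^-1` `[k.+1%:R / n.+1%:R, +oo[.
  have mD k : measurable (D k) by rewrite -[D k]setTI; apply: mf => //; exact: measurable_itv.
  pose F y : R := n.+1%:R^-1 * \sum_(k < n.+1) \1_(D k) y.
  have mF : measurable_fun setT F.
    by apply: measurable_funM => //; apply: measurable_sum => k; exact: measurable_indic.
  have Ff y : `|F y - f y| <= n.+1%:R^-1.
    have := @layer_approx R (n.+1%:R * f y) n.+1.
    have /andP[x0 x1] := f01 y.
    rewrite mulr_ge0//= ler_piMr// => /(_ isT).
    rewrite (eq_bigr (fun k : 'I_n.+1 => \1_(D k) y)); last first.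
      move=> k _; rewrite !indicE; congr (_%:R); congr nat_of_bool.
      by apply/idP/idP; rewrite !inE /D/= !in_itv/= !andbT ler_pdivrMr ?ltr0n// mulrC.
    have -> : F y - f y = n.+1%:R^-1 * (\sum_(k < n.+1) \1_(D k) y - n.+1%:R * f y).
      by rewrite mulrBr mulKf// pnatr_eq0.
    move=> h; rewrite normrM ger0_norm ?invr_ge0//; exact: ler_piMr.
  have FB y : `|F y| <= 1 + n.+1%:R^-1.
    rewrite -[F y](subrK (f y)) addrC (le_trans (ler_normD _ _))// lerD//.
    by have /andP[? ?] := f01 y; rewrite ger0_norm.
  have near (P : probability T R) : `|'Ex_P F - 'Ex_P f| <= n.+1%:R^-1.
    rewrite -RintegralB//; last 2 first.
    - exact: (@integrable_bounded _ _ _ P F (1 + n.+1%:R^-1)).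
    - exact: (@integrable_bounded _ _ _ P f B).
    by apply: Rintegral_norm_bound; [exact: measurable_funB|exact: aeW].
  have FE (P : probability T R) : 'Ex_P F = n.+1%:R^-1 * \sum_(k < n.+1) fine (P (D k)).
    have ii (k : 'I_n.+1) : P.-integrable setT (EFin \o (\1_(D k) : T -> R)) by exact: integrable_indic.
    rewrite RintegralZl//; last exact: (integrable_sumR _ ii).
    rewrite (Rintegral_sumR _ ii); congr (_ * _); apply: eq_bigr => k _.
    exact: Rintegral_indic_le1.
  have iQ A : measurable A -> M.-integrable setT (EFin \o (fun x => fine (Q x A))).
    move=> mA; apply: (@integrable_bounded _ _ _ M _ 1).
      by apply: measurableT_comp => //; exact: measurable_kernel.
    move=> x; rewrite ger0_norm ?fine_ge0//.
    rewrite -lee_fin fineK; first exact: (probability_le1 (ker_prob Q x) mA).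
    exact: (fin_num_measure (ker_prob Q x)).
  have EF : 'Ex_M F = 'Ex_M (fun x => 'Ex_(ker_prob Q x) F).
    have QE x : 'Ex_(ker_prob Q x) F = n.+1%:R^-1 * \sum_(k < n.+1) fine (Q x (D k)) := FE (ker_prob Q x).
    under [in RHS]eq_fun do rewrite QE.
    have ii (k : 'I_n.+1) : M.-integrable setT (EFin \o (fun x => fine (Q x (D k)))) := iQ _ (mD k).
    rewrite FE RintegralZl//; last exact: (@integrable_sumR _ _ _ M _ _ (fun (k : 'I_n.+1) x => fine (Q x (D k))) ii).
    rewrite (@Rintegral_sumR _ _ _ M _ _ (fun (k : 'I_n.+1) x => fine (Q x (D k))) ii); congr (_ * _); apply: eq_bigr => k _.
    by rewrite invariant_indic.
  have B1 : 0 <= 1 + n.+1%:R^-1 :> R by rewrite addr_ge0.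
  have mQF' := measurable_Rintegral_kernel Q B1 mF FB.
  have mQf := measurable_Rintegral_kernel Q B0 mf fB.
  have h1 := near M.
  have h2 : `|'Ex_M (fun x => 'Ex_(ker_prob Q x) F) - 'Ex_M (fun x => 'Ex_(ker_prob Q x) f)| <= n.+1%:R^-1.
    rewrite -RintegralB//; last 2 first.
    - apply: (@integrable_bounded _ _ _ M _ (1 + n.+1%:R^-1)) => // x.
      by apply: (@Rintegral_norm_bound _ _ _ (ker_prob Q x)) => //; exact: aeW.
    - apply: (@integrable_bounded _ _ _ M _ B) => // x.
      by apply: (@Rintegral_norm_bound _ _ _ (ker_prob Q x)) => //; exact: aeW.
    apply: Rintegral_norm_bound; first exact: measurable_funB.
    by apply: aeW => x; exact: near (ker_prob Q x).
  rewrite -EF in h2; have := ler_normB ('Ex_M F - 'Ex_M (fun x => 'Ex_(ker_prob Q x) f)) ('Ex_M F - 'Ex_M f).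
  have -> : 'Ex_M F - 'Ex_M (fun x => 'Ex_(ker_prob Q x) f) - ('Ex_M F - 'Ex_M f) = 'Ex_M f - 'Ex_M (fun x => 'Ex_(ker_prob Q x) f) by ring.
  by move=> /le_trans; apply; rewrite mulr_natl mulr2n; exact: lerD h2 h1.
apply/eqP; rewrite -subr_eq0 -normr_le0 -(mulr0 2).
have cv : 2 * n.+1%:R^-1 @[n --> \oo] --> (2 * 0 : R).
  by apply: cvgM; [exact: cvg_cst|exact: cvg_harmonic].
exact: (limr_ge_cst cv).
Qed.

Lemma invariant_norm_le (f g : T -> R) B c : 0 <= B -> measurable_fun setT f ->
  (forall y, `|f y| <= B) -> M.-integrable setT (EFin \o g) ->
  (forall x, S x -> `|'Ex_(ker_prob Q x) f - c| <= g x) -> `|'Ex_M f - c| <= 'Ex_M g.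
Proof.
move=> B0 mf fB ig H; rewrite (invariant_Rintegral B0 mf fB) -[c](Rintegral_prob_cst M).
have mQf := measurable_Rintegral_kernel Q B0 mf fB.
have iQ : M.-integrable setT (EFin \o (fun x => 'Ex_(ker_prob Q x) f)).
  apply: (@integrable_bounded _ _ _ M _ B) => // x.
  by apply: (@Rintegral_norm_bound _ _ _ (ker_prob Q x)) => //; exact: aeW.
have ic : M.-integrable setT (EFin \o (fun=> c)) by exact: finite_measure_integrable_cst.
rewrite -RintegralB//; apply: Rintegral_norm_le => //.
  exact: (integrableB measurableT iQ ic).
by apply: filterS ae_full_set => x; exact: H.
Qed.

End InvariantIntegral.

(** * Borel sets of column vectors *)

Section BorelColumns.
Context {R : realType} {d : nat}.

Lemma open_borel_measurable (O : set 'cV[R]_d) : open O -> measurable (O : set (borel_cV R d)).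
Proof. by move=> oO; exact: sub_sigma_algebra. Qed.

Lemma closed_borel_measurable (C : set 'cV[R]_d) : closed C -> measurable (C : set (borel_cV R d)).
Proof.
move=> cC; rewrite -[C]setCK; apply: measurableC; apply: open_borel_measurable.
exact: closed_openC.
Qed.

Lemma continuous_borel_measurable (f : borel_cV R d -> R) :
  continuous (f : 'cV[R]_d -> R) -> measurable_fun setT f.
Proof.
move=> /continuousP cf; apply: (measurability _ (RGenOpens.measurableE R)) => _ /= [_ [x [y ->]] <-]; rewrite setTI; apply: open_borel_measurable; apply: cf.
exact: interval_open.
Qed.

(** An open set is a countable union of rational boxes, whose preimages are finite intersections of
    coordinate conditions. *)
Lemma borel_measurable dO (Om : measurableType dO) (V : Om -> borel_cV R d) :
  (forall i, measurable_fun setT (fun w => (V w : 'cV[R]_d) i 0)) ->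
  measurable_fun setT V.
Proof.
move=> mV; apply: (@measurability _ _ _ _ setT V (@open 'cV[R]_d)) => //.
move=> _ [V0 oV0 <-]; rewrite setTI.
pose box (p : {ffun 'I_d -> rat} * nat) : set 'cV[R]_d :=
  [set x | forall i, `|x i 0 - ratr (p.1 i)| < p.2.+1%:R^-1].
pose good (p : {ffun 'I_d -> rat} * nat) := `[< box p `<=` V0 >].
have -> : V @^-1` V0 = \bigcup_p (if good p then V @^-1` box p else set0).
  apply/seteqP; split=> w /=; last first.
    by move=> [p _]; case: ifP => // /asboolP bO /bO.
  move=> VV; have /nbhs_ballP[e /= e0 eV] : nbhs (V w : 'cV[R]_d) V0 by exact: open_nbhs_nbhs.
  have [n ne] : exists n : nat, n.+1%:R^-1 < e / 2.
    have [k] := ltr_add_invr (divr_gt0 e0 (ltr0n _ 2)); rewrite add0r; by exists k.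
  have /choice[q Hq] : forall i, exists q : rat, `|(V w : 'cV[R]_d) i 0 - ratr q| < n.+1%:R^-1.
    move=> i; have lt1 : (V w : 'cV[R]_d) i 0 - n.+1%:R^-1 < (V w : 'cV[R]_d) i 0 + n.+1%:R^-1.
      by rewrite ltrBlDr -addrA ltrDl addr_gt0// invr_gt0 ltr0n.
    have [q] := rat_in_itvoo lt1; rewrite in_itv/= => /andP[q1 q2]; exists q.
    by rewrite ltr_distlC q1 q2.
  exists ([ffun i => q i], n) => //.
  have gd : good ([ffun i => q i], n).
    apply/asboolP => x bx; apply: eV; split=> // i j; rewrite (ord1 j) /ball/=.
    have := Hq i; have := bx i; rewrite /= ffunE => h1 h2.
    rewrite -(subrK (ratr (q i)) ((V w : 'cV[R]_d) i 0)) -addrA (le_lt_trans (ler_normD _ _))//.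
    rewrite [`|ratr _ - _|]distrC [ltRHS]splitr.
    by apply: ltrD; [exact: lt_trans h2 ne|exact: lt_trans h1 ne].
  by rewrite gd => i; rewrite /= ffunE.
apply: countable_bigcupT_measurable; first exact: countableP.
move=> p; case: ifP => _; last exact: measurable0.
have -> : V @^-1` box p = \bigcap_(i in [set: 'I_d]) [set w | `|(V w : 'cV[R]_d) i 0 - ratr (p.1 i)| < p.2.+1%:R^-1].
  by apply/seteqP; split=> [w h i _|w h i]; [exact: h|exact: h].
apply: fin_bigcap_measurable; first exact: finite_finset.
move=> i _; have mf : measurable_fun setT (fun w => `|(V w : 'cV[R]_d) i 0 - ratr (p.1 i)|).
  by apply: measurableT_comp => //; apply: measurable_funB.
rewrite (_ : [set w | _] = (fun w => `|(V w : 'cV[R]_d) i 0 - ratr (p.1 i)|) @^-1` `]-oo, p.2.+1%:R^-1[).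
  by rewrite -[X in measurable X]setTI; apply: mf => //; exact: measurable_itv.
by apply/seteqP; split=> w; rewrite /= in_itv.
Qed.

End BorelColumns.

(** * The Ornstein-Uhlenbeck reference and its characteristic function *)

Section GaussianReference.
Context dd (Om : measurableType dd) (R : realType) (P : probability Om R) (d : nat).
Variables (L : 'M[R]_d) (g th : 'cV[R]_d) (S : 'M[R]_d).
Hypothesis SE : 0 = L^T *m S + S *m L + g *m g^T.
Variables (F : R -> set (set Om)) (W : R -> Om -> R).
Hypotheses (bW : filtered_bm P F W) (W0 : forall w, W 0 w = 0).
Hypothesis cW : forall w, {within `[0, +oo[, continuous (fun t : R => W t w)}.
Notation A := (L^T).
Notation leb := (@lebesgue_measure R).

Let Wx t w := ext0 (fun s => W s w) t.

Let cWx w : continuous (Wx ^~ w).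
Proof. by apply: (@continuous_ext0 _ (fun t => W t w)). Qed.

Let mWx t : measurable_fun setT (Wx t).
Proof. by apply: (fbm_measurable_W bW); rewrite le_max lexx orbT. Qed.

(** The forcing of dN = A N dt + g dW started at 0, whose Gaussian law at time t has covariance S -
    exp (t L^T) S exp (t L). *)
Definition const_forcing (j : 'I_d) s w := g j 0 * Wx s w.

Lemma continuous_const_forcing j w : continuous (const_forcing j ^~ w).
Proof. by move=> s; apply: cvgM; [exact: cvg_cst|exact: cWx]. Qed.

Lemma measurable_const_forcing j s : measurable_fun setT (const_forcing j s).
Proof. exact: measurable_funM. Qed.

(** For [M = 1] this is the kernel of the Wiener integral giving the component of N along [th]; a
    derivative in [r] multiplies [M] by [A] on the right. *)
Let gam (M : 'M[R]_d) (r : R) := \sum_i th i 0 * (M *m flow A g r) i 0.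

Let is_derive_gam M (r : R) : is_derive r 1 (gam M) (gam (M *m A) r).
Proof.
apply: is_derive_bigsum => i; apply: is_derive_scale.
rewrite -mulmxA mxE.
have -> : (fun r => (M *m flow A g r) i 0) = fun r => \sum_l M i l * flow A g r l 0.
  by apply/funext => s; rewrite mxE.
by apply: is_derive_bigsum => l; apply: is_derive_scale; exact: is_derive_flow.
Qed.

Let cgam M : continuous (gam M).
Proof. by apply: is_derive_continuous => r; exact: is_derive_gam. Qed.

Let gam1E r : gam 1%:M r = (g^T *m flow L th r) 0 0.
Proof.
rewrite /gam mxE /flow.
transitivity (\sum_i \sum_j th i 0 * (mexp (r *: A) i j * g j 0)).
  by apply: eq_bigr => i _; rewrite mul1mx mxE mulr_sumr.
rewrite exchange_big/=; apply: eq_bigr => j _; rewrite mxE [RHS]mulrC mxE mulr_suml.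
by apply: eq_bigr => i _; rewrite mexp_trE mxE; ring.
Qed.

Let N t w := \sum_i th i 0 * resolve A (fun j s => const_forcing j s w) i t.

Let flow_mulE i r : (A *m flow A g r) i 0 = \sum_l A i l * \sum_j mexp (r *: A) l j * g j 0.
Proof. by rewrite mxE; apply: eq_bigr => l _; congr (_ * _); rewrite mxE. Qed.

Lemma resolve_stieltjes t w : 0 <= t -> N t w = gam 1%:M 0 * W t w +
  \int[leb]_(s in `[0, t]) (gam A (t - s) * Wx s w).
Proof.
move=> t0; rewrite /N /resolve.
have ci l j : continuous (fun s => mexp ((t - s) *: A) l j * const_forcing j s w).
  by move=> s; apply: cvgM; [exact: continuous_mexp_backward|exact: continuous_const_forcing].
have E i : \sum_l A i l * \sum_j \int[leb]_(s in `[0, t]) (mexp ((t - s) *: A) l j * const_forcing j s w) =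
    \int[leb]_(s in `[0, t]) ((A *m flow A g (t - s)) i 0 * Wx s w).
  transitivity (\int[leb]_(s in `[0, t]) \sum_l A i l * \sum_j (mexp ((t - s) *: A) l j * const_forcing j s w)).
    rewrite (@Rintegral_sum_continuous _ _ _ (fun l s => A i l * \sum_j (mexp ((t - s) *: A) l j * const_forcing j s w))); last first.
      by move=> l s; apply: cvgM; [exact: cvg_cst|apply: cvg_bigsum => j; exact: ci].
    apply: eq_bigr => l _; rewrite RintegralZl//; last first.
      by apply: integrable_continuous => s; apply: cvg_bigsum => j; exact: ci.
    congr (_ * _).
    by rewrite (@Rintegral_sum_continuous _ _ _ (fun j s => mexp ((t - s) *: A) l j * const_forcing j s w)).
  apply: eq_Rintegral => s _; rewrite flow_mulE mulr_suml; apply: eq_bigr => l _.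
  rewrite -mulrA; congr (_ * _); rewrite mulr_suml; apply: eq_bigr => j _.
  by rewrite /const_forcing mulrA.
under eq_bigr do rewrite E mulrDr.
rewrite big_split/=; congr (_ + _).
  rewrite /gam mulr_suml; apply: eq_bigr => i _.
  by rewrite mul1mx /flow mexp_0 mul1mx /const_forcing /Wx ext0E// mulrA.
have cf i : continuous (fun s => (A *m flow A g (t - s)) i 0 * Wx s w).
  move=> s; apply: cvgM; last exact: cWx.
  rewrite (_ : (fun s => (A *m flow A g (t - s)) i 0) = fun s => \sum_l A i l * \sum_j mexp ((t - s) *: A) l j * g j 0); last first.
    by apply/funext => z; exact: flow_mulE.
  rewrite flow_mulE.
  apply: cvg_bigsum => l; apply: cvgM; first exact: cvg_cst.
  apply: cvg_bigsum => j; apply: cvgM; last exact: cvg_cst.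
  exact: continuous_mexp_backward.
transitivity (\int[leb]_(s in `[0, t]) \sum_i th i 0 * ((A *m flow A g (t - s)) i 0 * Wx s w)).
  rewrite (@Rintegral_sum_continuous _ _ _ (fun i s => th i 0 * ((A *m flow A g (t - s)) i 0 * Wx s w))); last first.
    by move=> i s; apply: cvgM; [exact: cvg_cst|exact: cf].
  by apply: eq_bigr => i _; rewrite RintegralZl//; exact: integrable_continuous.
apply: eq_Rintegral => s _; rewrite /gam mulr_suml; apply: eq_bigr => i _.
by rewrite mulrA.
Qed.

Let part t n m w := \sum_(k < m) gam 1%:M (t - grid 0 t n k) * (W (grid 0 t n k.+1) w - W (grid 0 t n k) w).

Let part_cos t n m : 0 <= t -> (m <= n)%N ->
  adapted (F (grid 0 t n m)) (part t n m) /\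
  gaussian_cos P (part t n m) (\sum_(k < m) gam 1%:M (t - grid 0 t n k) ^+ 2 * (t / n%:R)).
Proof.
move=> t0; elim: m => [_|m IH mn].
  have -> : part t n 0 = fun=> 0 by apply/funext => w; rewrite /part big_ord0.
  rewrite big_ord0; split; first by apply: adapted_cst; rewrite grid0; exact: (fbm_sigma bW).
  split=> // u c; under eq_fun do rewrite mulr0 add0r.
  by rewrite Rintegral_prob_cst mulr0 mul0r oppr0 expR0 mulr1.
have [aS gS] := IH (ltnW mn).
have g0 k : (k <= n)%N -> 0 <= grid 0 t n k by move=> kn; have /andP[] := grid_itv t0 kn.
have gle : grid 0 t n m <= grid 0 t n m.+1 by exact: grid_le.
have E : part t n m.+1 = fun w => part t n m w + gam 1%:M (t - grid 0 t n m) * (W (grid 0 t n m.+1) w - W (grid 0 t n m) w).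
  by apply/funext => w; rewrite /part big_ord_recr.
have m0 := g0 _ (ltnW mn); have m10 := g0 _ mn.
split.
  have sa := fbm_sigma bW m10; rewrite E; apply: (adaptedD sa); first exact: (adapted_mono bW m0 gle).
  apply: (adaptedZ sa); apply: (adaptedB sa); first exact: (fbm_adapted bW).
  by apply: (adapted_mono bW m0 gle); exact: (fbm_adapted bW).
rewrite E big_ord_recr/=.
have := Rintegral_cos_indep bW (gam 1%:M (t - grid 0 t n m)) m0 gle aS gS.
by rewrite gridS subr0.
Qed.

(** The Lyapunov equation makes the squared kernel an exact derivative, so the variance needs no
    integration. *)
Lemma quad_flow_variance t : 0 <= t ->
  \int[leb]_(r in `[0, t]) (gam 1%:M r) ^+ 2 = quad S th - quad S (flow L th t).
Proof.
move=> t0.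
have SE' : L^T *m S + S *m L = - (g *m g^T) by apply/eqP; rewrite -addr_eq0 -SE.
have dq (x : R) : is_derive x 1 (fun t => - quad S (flow L th t)) (gam 1%:M x ^+ 2).
  have := is_derive_opp (is_derive_quad_flow L S th x); rewrite SE'.
  rewrite [X in is_derive _ _ _ X](_ : _ = gam 1%:M x ^+ 2)//.
  by rewrite gam1E -quad_rank1 /quad mulmxN mulNmx mxE opprK.
rewrite (is_derive_FTC t0 (fun x _ => dq x)); last first.
  by move=> x; apply: cvgM; exact: cgam.
have -> : flow L th 0 = th by rewrite /flow mexp_0 mul1mx.
by rewrite opprK addrC.
Qed.

Lemma resolve_cos t (c : R) : 0 <= t ->
  'Ex_P (fun w => cos (N t w + c)) =
  cos c * expR (- ((quad S th - quad S (flow L th t)) / 2)).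
Proof.
move=> t0; have mW s : 0 <= s -> measurable_fun setT (W s) by exact: (fbm_measurable_W bW).
have cvS w : part t n n w @[n --> \oo] --> N t w.
  rewrite resolve_stieltjes//.
  have := @stieltjes_sum_cvg _ (gam 1%:M) (gam A) (gam (A *m A)) (Wx ^~ w) t t0.
  have d1 (z : R) : is_derive z 1 (gam 1%:M) (gam A z) by have := is_derive_gam 1%:M z; rewrite mul1mx.
  move=> /(_ d1 (is_derive_gam A) (@cgam _) (@cWx w)).
  rewrite {1}/Wx ext0E// W0 => /(_ erefl); rewrite /Wx ext0E//.
  apply: cvg_trans; apply: near_eq_cvg; near=> n; rewrite /part; apply: eq_bigr => k _.
  have /andP[g0 _] := grid_itv t0 (ltnW (ltn_ord k)).
  by have /andP[g1 _] := grid_itv t0 (ltn_ord k); rewrite !ext0E.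
have mpart n : measurable_fun setT (part t n n).
  apply: measurable_sum => k; apply: measurable_funM => //; apply: measurable_funB; apply: mW.
    by have /andP[] := grid_itv t0 (ltn_ord k).
  by have /andP[] := grid_itv t0 (ltnW (ltn_ord k)).
have mN : measurable_fun setT (N t).
  by apply: (@measurable_fun_cvg _ _ _ _ (fun n => part t n n)) => // w _; exact: cvS.
have cE : 'Ex_P (fun w => cos (1 * part t n n w + c)) @[n --> \oo] --> 'Ex_P (fun w => cos (1 * N t w + c)).
  apply: (@Rintegral_cvg_bounded _ _ _ P _ _ 1).
  - by move=> n; exact: measurable_cos_affine.
  - exact: measurable_cos_affine.
  - by move=> n; apply: aeW => w; rewrite ler_norml cos_geN1 cos_le1.
  - apply: aeW => w.
    have cc : 1 * part t n n w + c @[n --> \oo] --> 1 * N t w + c.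
      by apply: cvgD; [apply: cvgM; [exact: cvg_cst|exact: cvS]|exact: cvg_cst].
    by apply: (cvg_comp _ _ cc); exact: continuous_cos.
have -> : 'Ex_P (fun w => cos (N t w + c)) = 'Ex_P (fun w => cos (1 * N t w + c)).
  by under [in RHS]eq_fun do rewrite mul1r.
apply: (cvg_unique _ cE) => //.
have -> : (fun n => 'Ex_P (fun w => cos (1 * part t n n w + c))) =
    fun n => cos c * expR (- (1 ^+ 2 * rsum (fun r => gam 1%:M r ^+ 2) 0 t n / 2)).
  apply/funext => n; have [_ [_ ->]] := part_cos t0 (leqnn n).
  suff -> : \sum_(k < n) gam 1%:M (t - grid 0 t n k) ^+ 2 * (t / n%:R) =
      rsum (fun r => gam 1%:M r ^+ 2) 0 t n by [].
  (* Reversing the order turns left-point sums in t - s into right-point sums in r = t - s. *)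
  rewrite /rsum subr0 mulr_sumr (reindex_inj rev_ord_inj)/=; apply: eq_bigr => k _.
  rewrite mulrC; have n0 : (0 < n)%N by apply: leq_ltn_trans (ltn_ord k).
  suff -> : t - grid 0 t n (n - k.+1) = grid 0 t n k.+1 by [].
  rewrite /grid !add0r subr0 natrB ?ltn_ord// mulrBl.
  have -> : n%:R * (t / n%:R) = t by rewrite mulrCA divff ?mulr1// pnatr_eq0 -lt0n.
  by rewrite opprB addrC subrK.
apply: cvgM; first exact: cvg_cst.
have cg2 : continuous (fun r => gam 1%:M r ^+ 2) by move=> r; apply: cvgM; exact: cgam.
have [K _ HK] := continuous_itv_bounded 0 t cg2.
have cr := rsum_cvg t0 (@continuous_right_cont _ (fun r => gam 1%:M r ^+ 2) 0 t cg2) HK.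
rewrite quad_flow_variance// in cr.
have cve : - (1 ^+ 2 * rsum (fun r => gam 1%:M r ^+ 2) 0 t n / 2) @[n --> \oo] -->
    - (1 ^+ 2 * (quad S th - quad S (flow L th t)) / 2).
  by apply: cvgN; apply: cvgM; [apply: cvgM; [exact: cvg_cst|exact: cr]|exact: cvg_cst].
have -> : quad S th - quad S (flow L th t) = 1 ^+ 2 * (quad S th - quad S (flow L th t)).
  by rewrite expr1n mul1r.
by apply: (cvg_comp _ _ cve); exact: continuous_expR.
Unshelve. all: by end_near. Qed.

End GaussianReference.

Lemma cos_shift_dist_le (R : realType) (x y c : R) : `|cos (x + c) - cos (y + c)| <= `|x - y|.
Proof.
rewrite -!sinDpihalf (le_trans (sin_dist_le _ _))//.
by rewrite (_ : _ - _ = x - y)//; ring.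
Qed.

Section SecondMoments.
Context dd (Om : measurableType dd) (R : realType) (P : probability Om R).

(** The arithmetic-geometric inequality replaces Cauchy-Schwarz; the slack [e] keeps the divisor
    positive when [b] is 0. *)
Lemma Rintegral_norm_Lq2 (U : Om -> R) b : Lq_le P 2 U b -> 'Ex_P (fun w => `|U w|) <= b.
Proof.
move=> Ub; have [mU b0 _] := Ub.
have i2 := integrable_Lq Ub; have E2 := Rintegral_Lq Ub.
have i1 : P.-integrable setT (EFin \o (fun w => `|U w|)).
  by have := integrable_Lq_le (isT : (1 <= 2)%N) Ub; under eq_fun do rewrite expr1.
apply/ler_addgt0Pr => e e0; have be : 0 < b + e by rewrite ltr_wpDl.
pose k := 2 * (b + e); have k0 : 0 < k by rewrite mulr_gt0.
have kE : k * ((b + e) / 2) = (b + e) ^+ 2 by rewrite /k; field.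
have ik : P.-integrable setT (EFin \o (fun w => k^-1 * `|U w| ^+ 2)) by exact: (integrableZl measurableT _ i2).
apply: (@le_trans _ _ ('Ex_P (fun w => (b + e) / 2 + k^-1 * `|U w| ^+ 2))).
  apply: Rintegral_le_ae => //.
    apply: (@integrableD _ _ _ P setT measurableT (fun=> ((b + e) / 2)%:E)
      (fun w => (k^-1 * `|U w| ^+ 2)%:E)) => //; exact: finite_measure_integrable_cst.
  apply: aeW => w; rewrite -(ler_pM2l k0) mulrDr mulVKf ?gt_eqF// kE /k.
  by have := sqr_ge0 (b + e - `|U w|); rewrite sqrrB mulr2n; lra.
rewrite RintegralD//; last exact: finite_measure_integrable_cst.
rewrite Rintegral_prob_cst RintegralZl//.
have c0 : 0 <= k^-1 by rewrite invr_ge0 ltW.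
apply: (le_trans (lerD (lexx _) (ler_wpM2l c0 E2))).
rewrite -(ler_pM2l k0) mulrDr mulVKf ?gt_eqF// kE.
have : b ^+ 2 <= (b + e) ^+ 2 by apply: lerXn2r; rewrite ?nnegrE ?(ltW be)// lerDl ltW.
by rewrite /k !expr2; lra.
Qed.

Lemma Lq_le_cst q c : 0 <= c -> Lq_le P q (fun=> c) c.
Proof. by move=> c0; apply: Lq_le_aebounded => //; apply: aeW => w; rewrite ger0_norm. Qed.

Lemma Lq_le_norm q (U : Om -> R) b : Lq_le P q U b -> Lq_le P q (fun w => `|U w|) b.
Proof.
move=> [mU b0 Ub]; split=> //; first exact: measurableT_comp.
by under eq_integral do rewrite normr_id.
Qed.

(** The sums telescope, so they equal the integral whatever the mesh. *)
Lemma ito_integral_cst (W : R -> Om -> R) t c : (forall w, W 0 w = 0) ->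
  measurable_fun setT (W t) ->
  is_ito_integral P (fun _ _ => c) W t (fun w => c * W t w).
Proof.
move=> W0 mW; split; first exact: measurable_funM.
move=> e e0; exists 1 => // n tau t0 tn _.
rewrite (_ : [set w | _] = set0) ?measure0 ?lte_fin//; apply/seteqP; split=> w //=.
rewrite -mulr_sumr -(big_mkord xpredT (fun k => W (tau k.+1) w - W (tau k) w)).
by rewrite telescope_sumr// tn t0 W0 subr0 subrr normr0 ltNge ltW.
Qed.

End SecondMoments.

Section InvariantMarginal.
Context {R : realType} {d : nat}.
Variables (L : 'M[R]_d) (mu : 'cV[R]_d).
Hypothesis mu_inv : invariant_distribution L mu.

Lemma marginal_invariant t : marginal L mu t = mu.
Proof.
have A0 s : L^T *m marginal L mu s = 0.
  by rewrite /marginal mulmxA mexp_comm -mulmxA mu_inv.2 mulmx0.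
apply/matrixP => i j; rewrite (ord1 j).
have dq (x : R) : is_derive x 1 (fun t => marginal L mu t i 0) 0.
  by have := is_derive_marginal L mu i x; rewrite A0 mxE.
by rewrite (is_derive_eq0_cst dq t 0) /marginal mexp_0 mul1mx.
Qed.

Definition dist1 (x : 'cV[R]_d) : R := \sum_i `|x i 0 - mu i 0|.

Lemma dist1_ge0 x : 0 <= dist1 x. Proof. exact: sumr_ge0. Qed.

Lemma marginal_sub nu t : marginal L nu t - mu = mexp (t *: L^T) *m (nu - mu).
Proof. by rewrite mulmxBr -/(marginal L mu t) marginal_invariant. Qed.

Lemma marginal_dist_le nu s t K j : 0 <= s <= t -> resolvent_bound L^T t K ->
  `|marginal L nu s j 0 - mu j 0| <= K * dist1 nu.
Proof.
move=> /andP[s0 st] [K0 HK].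
have -> : marginal L nu s j 0 - mu j 0 = (marginal L nu s - mu) j 0 by rewrite !mxE.
rewrite marginal_sub mxE (le_trans (ler_norm_sum _ _ _))// mulr_sumr.
apply: ler_sum => k _; rewrite normrM [(nu - mu) k 0]mxE [(- mu) k 0]mxE; apply: ler_wpM2r => //.
have -> : s = t - (t - s) by rewrite opprB addrC subrK.
by apply: HK; rewrite subr_ge0 st/= gerBl.
Qed.

End InvariantMarginal.

(** * One run of the filter from an arbitrary initial law *)

Section InvariantStep.
Context disp (Om : measurableType disp) (R : realType) (P : probability Om R) (d : nat).
Variables (a : 'I_d -> R) (L : 'M[R]_d) (nu mu : 'cV[R]_d) (h : R -> R)
  (X B : R -> Om -> R) (sigma : R) (pi : R -> Om -> 'cV[R]_d).
Hypotheses (P_complete : measure_is_complete P) (a_inj : injective a).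
Hypotheses (XB : signal_and_noise P a L nu X B) (sigma0 : 0 < sigma).
Hypothesis wf : wonham_filter P a L nu h sigma X B pi.
Hypothesis mu_inv : invariant_distribution L mu.
Hypothesis nu_simplex : simplex nu.
Variable rho : R.
Hypothesis contraction : forall n (x : 'cV[R]_d), \sum_i x i 0 = 0 ->
  \sum_i `|(mexp (n%:R *: L^T) *m x) i 0| <= rho ^+ n * \sum_i `|x i 0|.
Notation A := (L^T).
Notation hv := (hvec a h).
Notation W := (innovation hv sigma (observation h sigma X B) pi).

Lemma marginal_contraction n : dist1 mu (marginal L nu n%:R) <= rho ^+ n * dist1 mu nu.
Proof.
have [_ nu1] := nu_simplex; have [[_ mu1] _] := mu_inv.
have subE (x y : 'cV[R]_d) i : (x - y) i 0 = x i 0 - y i 0 by rewrite !mxE.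
have s0 : \sum_i (nu - mu) i 0 = 0.
  by under eq_bigr do rewrite subE; rewrite sumrB nu1 mu1 subrr.
have := contraction n s0; rewrite -marginal_sub// /dist1.
by under eq_bigr do rewrite subE; under [in X in _ <= X -> _]eq_bigr do rewrite subE.
Qed.

(** Fluctuation of order 1 / sigma around the marginal flow, plus the contracted distance of the
    initial law. *)
Lemma Lq_le_step m n K : (0 < m)%N -> 0 <= rho -> resolvent_bound A n%:R K ->
  Lq_le P m.*2 (fun w => dist1 mu (pi n%:R w))
    (sigma^-1 * (d%:R * deviation_cst a L h m n%:R K) + rho ^+ n * dist1 mu nu).
Proof.
move=> m0 r0 nK; have q0 : (0 < m.*2)%N by rewrite double_gt0.
have mpi i : measurable_fun setT (fun w => pi n%:R w i 0).
  exact: (measurable_filter P_complete a_inj XB sigma0 wf).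
have b1 : Lq_le P m.*2 (fun w => \sum_i `|pi n%:R w i 0 - marginal L nu n%:R i 0|)
    (sigma^-1 * (d%:R * deviation_cst a L h m n%:R K)).
  have : Lq_le P m.*2 (fun w => \sum_i `|pi n%:R w i 0 - marginal L nu n%:R i 0|)
      (\sum_(i < d) (sigma^-1 * deviation_cst a L h m n%:R K)).
    apply: (@Lq_le_sum _ _ _ P _ _ _ (fun i w => `|pi n%:R w i 0 - marginal L nu n%:R i 0|) (fun=> _)) => // i.
    apply: Lq_le_norm; apply: (Lq_le_filter P_complete a_inj XB sigma0 wf) => //.
    by rewrite lexx andbT.
  by rewrite sumr_const card_ord -[_ *+ d]mulr_natl mulrCA.
have b2 := Lq_le_cst P m.*2 (mulr_ge0 (exprn_ge0 n r0) (dist1_ge0 mu nu)).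
apply: Lq_le_dominated (Lq_leD q0 b1 b2).
  by apply: measurable_sum => i; apply: measurableT_comp => //; exact: measurable_funB.
apply: aeW => w; rewrite ger0_norm ?dist1_ge0//.
apply: (@le_trans _ _ (\sum_i `|pi n%:R w i 0 - marginal L nu n%:R i 0| + dist1 mu (marginal L nu n%:R))).
  rewrite -big_split/=; apply: ler_sum => i _.
  by rewrite -[pi n%:R w i 0 - mu i 0](subrKA (marginal L nu n%:R i 0)) ler_normD.
by rewrite lerD2l marginal_contraction.
Qed.

Definition step_cst (th : 'cV[R]_d) (n : nat) K : R := \sum_i `|th i 0| *
  (resolve_cst A n%:R K i * (expR (bdg_cst 1 n%:R * n%:R) * ((2 + 1) * hmax a h * d%:R))).

(* The first term bounds the error of replacing the filter by the Gaussian
   solution of the linear equation, the second one the memory of [nu]. *)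
Lemma step_cos (S : 'M[R]_d) (th : 'cV[R]_d) (c : R) n K :
  0 = L^T *m S + S *m L + (covar mu *m hv) *m (covar mu *m hv)^T ->
  0 <= rho -> resolvent_bound A n%:R K ->
  `|'Ex_P (fun w => cos (dotc th (sigma *: (pi n%:R w - mu)) + c)) -
    cos c * expR (- ((quad S th - quad S (flow L th n%:R)) / 2))| <=
  step_cst th n K * (sigma^-1 * deviation_cst a L h 1 n%:R K + K * dist1 mu nu) +
  (\sum_i `|th i 0|) * (sigma * (rho ^+ n * dist1 mu nu)).
Proof.
move=> SE r0 nK; have n0 : 0 <= n%:R :> R by [].
have bW := innovation_filtered_bm P_complete a_inj XB sigma0 wf.
have W0 w : W 0 w = 0 by case: (innovation_continuous a_inj XB wf w).
have cW w : {within `[0, +oo[, continuous (fun t : R => W t w)}.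
  by case: (innovation_continuous a_inj XB wf w).
set g := covar mu *m hv in SE *.
pose J := const_forcing g W; pose Nn i w := resolve A (fun j s => J j s w) i n%:R.
pose N w := \sum_i th i 0 * Nn i w.
have EN : 'Ex_P (fun w => cos (N w + c)) = cos c * expR (- ((quad S th - quad S (flow L th n%:R)) / 2)).
  exact: (resolve_cos th SE bW W0 cW c n0).
rewrite -EN.
have mpi i : measurable_fun setT (fun w => pi n%:R w i 0).
  exact: (measurable_filter P_complete a_inj XB sigma0 wf).
pose b := sigma^-1 * deviation_cst a L h 1 n%:R K + K * dist1 mu nu.
have b0 : 0 <= b.
  by rewrite addr_ge0 ?mulr_ge0 ?invr_ge0 ?(ltW sigma0) ?deviation_cst_ge0 ?dist1_ge0// nK.1.
have cmp i : Lq_le P 2 (fun w => sigma * (pi n%:R w i 0 - marginal L nu n%:R i 0) - Nn i w)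
    (resolve_cst A n%:R K i * (expR (bdg_cst 1 n%:R * n%:R) * ((2 + 1) * hmax a h * (d%:R * b)))).
  (* The noise coefficient is frozen at [mu], so the law of the reference does not depend on [nu];
     [Y0 = 1] because [mu] is a probability vector. *)
  apply: (@Lq_le_filter_compare _ _ _ P d a L nu h X B sigma pi P_complete a_inj XB sigma0 wf
    (fun=> mu) J 1 n%:R K i 1 b) => //.
  - move=> s j _; have [[mu0 mu1] _] := mu_inv; rewrite ger0_norm// -mu1 (bigD1 j)//= lerDl.
    exact: sumr_ge0.
  - move=> s j /andP[s0 sn].
    have e1 := Lq_le_filter P_complete a_inj XB sigma0 wf j (isT : (0 < 1)%N) (introT andP (conj s0 sn)) nK.
    have e2 : Lq_le P 1.*2 (fun=> marginal L nu s j 0 - mu j 0) (K * dist1 mu nu).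
      apply: Lq_le_aebounded => //; first by rewrite mulr_ge0 ?dist1_ge0// nK.1.
      by apply: aeW => w; apply: (@marginal_dist_le _ _ L mu mu_inv nu s n%:R K j) => //; rewrite s0.
    have := Lq_leD (isT : (0 < 1.*2)%N) e1 e2.
    by under eq_fun do rewrite subrKA.
  - by move=> j w; exact: continuous_const_forcing.
  - by move=> j s; exact: (measurable_const_forcing g bW).
  - move=> s j /andP[s0 _]; exists (fun w => g j 0 * W s w).
      by apply: ito_integral_cst => //; exact: (fbm_measurable_W bW).
    by apply: aeW => w; rewrite /J /const_forcing ext0E.
have mNn i : measurable_fun setT (Nn i).
  have [mm _ _] := cmp i.
  rewrite (_ : Nn i = fun w => sigma * (pi n%:R w i 0 - marginal L nu n%:R i 0) -
      (sigma * (pi n%:R w i 0 - marginal L nu n%:R i 0) - Nn i w)).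
    by apply: measurable_funB => //; apply: measurable_funM => //; exact: measurable_funB.
  by apply/funext => w; rewrite subKr.
have mN : measurable_fun setT N by apply: measurable_sum => i; exact: measurable_funM.
pose x w := dotc th (sigma *: (pi n%:R w - mu)).
have xE w : x w = \sum_i th i 0 * (sigma * (pi n%:R w i 0 - mu i 0)).
  by rewrite /x dotcE; apply: eq_bigr => i _; rewrite !mxE.
have mx : measurable_fun setT x.
  rewrite (_ : x = fun w => \sum_i th i 0 * (sigma * (pi n%:R w i 0 - mu i 0))); last exact/funext.
  by apply: measurable_sum => i; do 2 apply: measurable_funM => //; exact: measurable_funB.
have icos (y : Om -> R) : measurable_fun setT y -> P.-integrable setT (EFin \o (fun w => cos (y w + c))).
  by move=> my; have := integrable_cos_affine P 1 c my; under eq_fun do rewrite mul1r.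
rewrite -RintegralB//; [|exact: icos|exact: icos].
pose e i w := sigma * (pi n%:R w i 0 - marginal L nu n%:R i 0) - Nn i w.
have ie i : P.-integrable setT (EFin \o (fun w => `|th i 0| * `|e i w|)).
  have ie1 : P.-integrable setT (EFin \o (fun w => `|e i w|)).
    by have := integrable_Lq_le (isT : (1 <= 2)%N) (cmp i); under eq_fun do rewrite expr1.
  exact: (integrableZl measurableT _ ie1).
have isum := integrable_sumR (index_enum 'I_d) ie.
pose k := (\sum_i `|th i 0|) * (sigma * (rho ^+ n * dist1 mu nu)).
have ik : P.-integrable setT (EFin \o (fun=> k)) by exact: finite_measure_integrable_cst.
apply: (@le_trans _ _ ('Ex_P (fun w => \sum_i `|th i 0| * `|e i w| + k))).
  apply: Rintegral_norm_le.
  - exact: (integrableB measurableT (icos _ mx) (icos _ mN)).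
  - exact: (integrableD measurableT isum ik).
  apply: aeW => w; rewrite (le_trans (cos_shift_dist_le (x w) (N w) c))//.
  rewrite xE /N -sumrB.
  have -> : \sum_i (th i 0 * (sigma * (pi n%:R w i 0 - mu i 0)) - th i 0 * Nn i w) =
      \sum_i th i 0 * e i w + \sum_i th i 0 * (sigma * (marginal L nu n%:R i 0 - mu i 0)).
    by rewrite -big_split/=; apply: eq_bigr => i _; rewrite /e; ring.
  rewrite (le_trans (ler_normD _ _))// lerD//.
    by rewrite (le_trans (ler_norm_sum _ _ _))//; apply: ler_sum => i _; rewrite normrM.
  rewrite /k mulr_suml (le_trans (ler_norm_sum _ _ _))//; apply: ler_sum => i _.
  rewrite !normrM (gtr0_norm sigma0) ler_wpM2l// ler_wpM2l ?(ltW sigma0)//.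
  apply: le_trans (marginal_contraction n); rewrite /dist1 (bigD1 i)//= lerDl.
  exact: sumr_ge0.
rewrite RintegralD// Rintegral_prob_cst -/b lerD// (Rintegral_sumR _ ie) /step_cst mulr_suml.
apply: ler_sum => i _; rewrite RintegralZl//; last first.
  by have := integrable_Lq_le (isT : (1 <= 2)%N) (cmp i); under eq_fun do rewrite expr1.
rewrite -[leRHS]mulrA ler_wpM2l//; apply: (le_trans (Rintegral_norm_Lq2 (cmp i))).
by rewrite -!mulrA.
Qed.

End InvariantStep.

Lemma continuous_bigsum (R : realType) (T : topologicalType) (I : Type) (r : seq I)
    (f : I -> T -> R) :
  (forall i, continuous (f i)) -> continuous (fun x => \sum_(i <- r) f i x).
Proof. by move=> cf x; apply: cvg_bigsum => i; exact: cf. Qed.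

Lemma continuous_coord_comp (R : realType) d (g : R -> R) (i : 'I_d) : continuous g ->
  continuous (fun x : 'cV[R]_d => g (x i 0)).
Proof.
move=> cg x; apply: (@continuous_comp _ _ _ (fun x : 'cV[R]_d => x i 0) g); last exact: cg.
exact: coord_continuous.
Qed.

(** * Moments and characteristic functions of an invariant measure *)

Section InvariantLimit.
Context {R : realType} {d : nat}.
Variables (a : 'I_d -> R) (L : 'M[R]_d) (h : R -> R) (mu : 'cV[R]_d) (S : 'M[R]_d).
Hypotheses (a_inj : injective a) (L_intensity : intensity_matrix L) (L_ergodic : ergodic L).
Hypothesis mu_inv : invariant_distribution L mu.
Notation A := (L^T).
Notation hv := (hvec a h).

Let d_gt0 : (0 < d)%N.
Proof. exact: invariant_dim_gt0 mu_inv. Qed.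

Lemma simplex_entry (x : 'cV[R]_d) i : simplex x -> 0 <= x i 0 <= 1.
Proof.
move=> [x0 x1]; rewrite x0/= -x1 (bigD1 i)//= lerDl; exact: sumr_ge0.
Qed.

Lemma dist1_simplex x : simplex x -> dist1 mu x <= d%:R.
Proof.
move=> xS; rewrite /dist1 -[d in leRHS]card_ord -sumr_const; apply: ler_sum => i _.
have [mS _] := mu_inv; have /andP[a0 a1] := simplex_entry i xS; have /andP[b0 b1] := simplex_entry i mS.
by rewrite ler_norml; apply/andP; split; lra.
Qed.

Lemma continuous_dist1 : continuous (dist1 mu).
Proof.
apply: (@continuous_bigsum _ _ _ _ (fun i (x : 'cV[R]_d) => `|x i 0 - mu i 0|)) => i.
apply: (@continuous_coord_comp _ _ (fun r => `|r - mu i 0|)) => r.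
by apply: cvg_norm; apply: cvgB; [exact: cvg_id|exact: cvg_cst].
Qed.

Lemma measurable_dist1 : measurable_fun setT (dist1 mu : borel_cV R d -> R).
Proof. exact: (continuous_borel_measurable continuous_dist1). Qed.

Lemma measurable_simplex : measurable (simplex : set (borel_cV R d)).
Proof.
apply: closed_borel_measurable.
rewrite (_ : simplex = \bigcap_(i in [set: 'I_d]) ((fun x : 'cV[R]_d => x i 0) @^-1` [set r | 0 <= r]) `&`
   ((fun x : 'cV[R]_d => \sum_i x i 0) @^-1` [set 1])); last first.
  apply/seteqP; split=> x [H1 H2]; split=> //; first by move=> i _; exact: H1.
  by move=> i; exact: (H1 i I).
apply: closedI.
  apply: closed_bigI => i _; apply: closed_comp; last exact: closed_ge.
  by move=> x _; exact: coord_continuous.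
apply: closed_comp; last exact: closed_eq.
by move=> x _; apply: (@continuous_bigsum _ _ _ _ (fun i (x : 'cV[R]_d) => x i 0)) => i; exact: coord_continuous.
Qed.

Section OneNoiseLevel.
Variables (sigma : R) (M : probability (borel_cV R d) R).
Hypotheses (sigma0 : 0 < sigma) (M_inv : invariant_measure a L h sigma M).
Variable rho : R.
Hypotheses (rho0 : 0 <= rho) (rho1 : rho < 1).
Hypothesis contraction : forall n (x : 'cV[R]_d), \sum_i x i 0 = 0 ->
  \sum_i `|(mexp (n%:R *: L^T) *m x) i 0| <= rho ^+ n * \sum_i `|x i 0|.

Lemma ae_simplexW (D : 'cV[R]_d -> Prop) : (forall x, simplex x -> D x) -> {ae M, forall x, D x}.
Proof. by have [MS _] := M_inv; exact: (ae_full_setW measurable_simplex MS). Qed.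

(** A bound valid for every filter, on any space and from any point of the simplex, becomes a bound
    under [M] by conditioning on the starting point. *)
Lemma invariant_transfer n (f g : borel_cV R d -> R) (B c : R) : 0 <= B ->
  measurable_fun setT f -> (forall y, `|f y| <= B) ->
  M.-integrable setT (EFin \o g) ->
  (forall eta, simplex eta -> forall (disp : measure_display) (Om : measurableType disp)
     (P : probability Om R) (X Bm : R -> Om -> R) (pi : R -> Om -> 'cV[R]_d),
     measure_is_complete P -> signal_and_noise P a L eta X Bm ->
     wonham_filter P a L eta h sigma X Bm pi ->
     `|'Ex_P (fun w => f (pi n%:R w)) - c| <= g eta) ->
  `|'Ex_M f - c| <= 'Ex_M g.
Proof.
move=> B0 mf fB ig H; have [MS [Q [Qtr Qinv]]] := M_inv.
have n0 : 0 <= n%:R :> R by [].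
apply: (@invariant_norm_le _ _ R M (Q n%:R) simplex measurable_simplex MS _ f g B) => //.
  by move=> D mD; exact: Qinv.
move=> eta eS; have [disp [Om [P [X [Bm [pi [Pc XB wf law]]]]]]] := Qtr eta eS.
have mpi : measurable_fun setT (pi n%:R : Om -> borel_cV R d).
  apply: borel_measurable => i.
  exact: (measurable_filter Pc a_inj XB sigma0 wf).
have -> : 'Ex_(ker_prob (Q n%:R) eta) f = 'Ex_P (fun w => f (pi n%:R w)).
  rewrite /Rintegral; congr fine; apply/esym.
  apply: (@integral_law _ _ Om (borel_cV R d) R P (ker_prob (Q n%:R) eta) (pi n%:R) mpi _ (EFin \o f)).
  - by move=> C mC; exact: law.
  - exact/measurable_EFinP.
  - apply: (@integrable_bounded _ _ _ P (fun w => f (pi n%:R w)) B) => //.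
    exact: (measurableT_comp mf mpi).
exact: (H eta eS disp Om P X Bm pi).
Qed.

(** Running the filter for time 1 leaves [M] unchanged while contracting the distance to [mu], up to
    the noise of order 1 / sigma. *)
Lemma invariant_moment_step m K b : (0 < m)%N -> resolvent_bound A 1%:R K ->
  Lq_le M m.*2 (dist1 mu) b ->
  Lq_le M m.*2 (dist1 mu) (sigma^-1 * (d%:R * deviation_cst a L h m 1%:R K) + rho * b).
Proof.
move=> m0 K1 Mb; set D := d%:R * _; have [_ b0 _] := Mb.
have D0 : 0 <= D by rewrite mulr_ge0// deviation_cst_ge0// K1.1.
have sD0 : 0 <= sigma^-1 * D by rewrite mulr_ge0// invr_ge0 ltW.
have q0 : (0 < m.*2)%N by rewrite double_gt0.
(* Test functions must be bounded everywhere; on the simplex, which has full measure, the truncation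
   has no effect. *)
pose u (x : borel_cV R d) := Num.min (dist1 mu x) d%:R.
have u0 x : 0 <= u x by rewrite le_min dist1_ge0/=.
have ud x : u x <= d%:R by rewrite ge_min lexx orbT.
have mu_ : measurable_fun setT u by apply: measurable_minr => //; exact: measurable_dist1.
have mum : measurable_fun setT (fun x => u x ^+ m.*2) by exact: measurable_funX.
have umB x : `|u x ^+ m.*2| <= d%:R ^+ m.*2.
  by rewrite ger0_norm ?exprn_ge0// lerXn2r ?nnegrE.
pose v x := sigma^-1 * D + rho * dist1 mu x.
have v0 x : 0 <= v x by rewrite addr_ge0// mulr_ge0// dist1_ge0.
have Mv : Lq_le M m.*2 v (sigma^-1 * D + rho * b).
  apply: Lq_leD => //; first exact: Lq_le_cst.
  by have := Lq_leZ rho Mb; rewrite (ger0_norm rho0).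
have iv : M.-integrable setT (EFin \o (fun x => v x ^+ m.*2)).
  by have := integrable_Lq Mv; under eq_fun do rewrite ger0_norm//.
have Ev : 'Ex_M (fun x => v x ^+ m.*2) <= (sigma^-1 * D + rho * b) ^+ m.*2.
  by have := Rintegral_Lq Mv; under eq_fun do rewrite ger0_norm//.
have H : `|'Ex_M (fun x => u x ^+ m.*2) - 0| <= 'Ex_M (fun x => v x ^+ m.*2).
  apply: (@invariant_transfer 1 _ _ (d%:R ^+ m.*2)) => //.
  move=> eta eS disp Om P X Bm pi Pc XB wf; rewrite subr0.
  have st := Lq_le_step Pc a_inj XB sigma0 wf mu_inv eS contraction m0 rho0 K1.
  rewrite expr1 -/D in st; have Est := Rintegral_Lq st; have ist := integrable_Lq st.
  have mpi : measurable_fun setT (pi 1%:R : Om -> borel_cV R d).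
    by apply: borel_measurable => i; exact: (measurable_filter Pc a_inj XB sigma0 wf).
  apply: le_trans Est; apply: Rintegral_norm_le => //.
    apply: (@integrable_bounded _ _ _ P (fun w => u (pi 1%:R w) ^+ m.*2) (d%:R ^+ m.*2)) => //.
    exact: (measurableT_comp mum mpi).
  apply: aeW => w; rewrite ger0_norm ?exprn_ge0// lerXn2r ?nnegrE//.
  by rewrite ge_min ler_norm.
have umM : Lq_le M m.*2 u (sigma^-1 * D + rho * b).
  apply: Lq_le_Rintegral => //; first by rewrite addr_ge0// mulr_ge0.
    by under eq_fun do rewrite ger0_norm//; exact: (@integrable_bounded _ _ _ M _ (d%:R ^+ m.*2)).
  under eq_fun do rewrite ger0_norm//; apply: le_trans Ev; apply: le_trans H.
  by rewrite subr0 ler_norm.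
apply: Lq_le_ae umM; first exact: measurable_dist1.
apply: ae_simplexW => x xS; rewrite /u.
by have := dist1_simplex xS; rewrite minEle => ->.
Qed.

Lemma invariant_moment m K : (0 < m)%N -> resolvent_bound A 1%:R K ->
  Lq_le M m.*2 (dist1 mu) (sigma^-1 * (d%:R * deviation_cst a L h m 1%:R K / (1 - rho))).
Proof.
move=> m0 K1; set D := d%:R * _.
have D0 : 0 <= D by rewrite mulr_ge0// deviation_cst_ge0// K1.1.
have r1 : 0 < 1 - rho by rewrite subr_gt0.
set b := sigma^-1 * (D / (1 - rho)).
have b0 : 0 <= b by rewrite mulr_ge0 ?invr_ge0 ?(ltW sigma0)// divr_ge0// ltW.
(* [b] is the fixed point of the one-step bound, and the iteration starts from the diameter bound
   [d]. *)
have it j : Lq_le M m.*2 (dist1 mu) (rho ^+ j * d%:R + b).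
  elim: j => [|j IH].
    apply: Lq_le_aebounded; [exact: measurable_dist1|by rewrite addr_ge0// mulr_ge0 ?exprn_ge0|].
    apply: ae_simplexW => x xS; rewrite expr0 mul1r ger0_norm ?dist1_ge0//.
    by apply: ler_wpDr => //; exact: dist1_simplex.
  have := invariant_moment_step m0 K1 IH; rewrite -/D.
  have -> : sigma^-1 * D + rho * (rho ^+ j * d%:R + b) = rho ^+ j.+1 * d%:R + b.
    by rewrite /b exprS; field; rewrite !gt_eqF.
  by [].
apply: Lq_le_Rintegral; [exact: measurable_dist1|by []|exact: integrable_Lq (it 0%N)|].
have cv : (rho ^+ j * d%:R + b) ^+ m.*2 @[j --> \oo] --> (0 * d%:R + b) ^+ m.*2.
  apply: (@continuous_cvg _ _ _ _ _ _ (fun x : R => x ^+ m.*2)); first exact: exprn_continuous.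
  apply: cvgD; last exact: cvg_cst.
  by apply: cvgM; [apply: cvg_expr; rewrite ger0_norm|exact: cvg_cst].
rewrite -[b in leRHS]add0r -(mul0r (d%:R : R)); apply: (limr_ge_cst cv) => j.
exact: Rintegral_Lq (it j).
Qed.

Lemma invariant_cos (SE : 0 = L^T *m S + S *m L + (covar mu *m hv) *m (covar mu *m hv)^T)
    (th : 'cV[R]_d) (c : R) n K K1 C :
  resolvent_bound A n%:R K -> resolvent_bound A 1%:R K1 ->
  C = d%:R * deviation_cst a L h 1 1%:R K1 / (1 - rho) ->
  `|'Ex_M (fun x => cos (dotc th (sigma *: ((x : 'cV[R]_d) - mu)) + c)) -
    cos c * expR (- ((quad S th - quad S (flow L th n%:R)) / 2))| <=
  sigma^-1 * (step_cst a L h th n K * (deviation_cst a L h 1 n%:R K + K * C)) +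
  (\sum_i `|th i 0|) * (rho ^+ n * C).
Proof.
move=> nK K1b CE.
have M2 : Lq_le M 2 (dist1 mu) (sigma^-1 * C).
  by rewrite CE; exact: (invariant_moment (isT : (0 < 1)%N) K1b).
have E1 : 'Ex_M (dist1 mu) <= sigma^-1 * C.
  by have := Rintegral_norm_Lq2 M2; under eq_fun do rewrite ger0_norm ?dist1_ge0//.
have i1 : M.-integrable setT (EFin \o dist1 mu).
  have := integrable_Lq_le (isT : (1 <= 2)%N) M2.
  by under eq_fun do rewrite expr1 ger0_norm ?dist1_ge0//.
pose al := step_cst a L h th n K; pose be := \sum_i `|th i 0|.
have K0 : 0 <= K := nK.1.
have al0 : 0 <= al.
  apply: sumr_ge0 => i _; rewrite !mulr_ge0 ?expR_ge0 ?resolve_cst_ge0 ?hmax_ge0//.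
have be0 : 0 <= be by exact: sumr_ge0.
pose k1 := al * (sigma^-1 * deviation_cst a L h 1 n%:R K).
(* The factor [sigma] is compensated by the first moment of [dist1 mu], which is of order 1 /
   sigma. *)
pose k2 := al * K + be * (sigma * rho ^+ n).
have k20 : 0 <= k2 by rewrite addr_ge0 ?mulr_ge0 ?exprn_ge0 ?(ltW sigma0).
have ig : M.-integrable setT (EFin \o (fun x => k1 + k2 * dist1 mu x)).
  apply: (@integrableD _ _ _ M setT measurableT (fun=> k1%:E) (fun x => (k2 * dist1 mu x)%:E)).
    exact: finite_measure_integrable_cst.
  exact: (integrableZl measurableT _ i1).
have cf : continuous (fun x : 'cV[R]_d => cos (dotc th (sigma *: (x - mu)) + c)).
  have cl : continuous (fun x : 'cV[R]_d => dotc th (sigma *: (x - mu)) + c).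
    rewrite (_ : (fun x : 'cV[R]_d => _) = fun x : 'cV[R]_d =>
        \sum_i th i 0 * (sigma * (x i 0 - mu i 0)) + c); last first.
      by apply/funext => y; rewrite dotcE; congr (_ + _); apply: eq_bigr => i _; rewrite !mxE.
    have cs : continuous (fun x : 'cV[R]_d => \sum_i th i 0 * (sigma * (x i 0 - mu i 0))).
      apply: (@continuous_bigsum _ _ _ _ (fun i (x : 'cV[R]_d) => th i 0 * (sigma * (x i 0 - mu i 0)))) => i.
      apply: (@continuous_coord_comp _ _ (fun r => th i 0 * (sigma * (r - mu i 0)))) => r.
      do 2 (apply: cvgM; first exact: cvg_cst).
      by apply: cvgB; [exact: cvg_id|exact: cvg_cst].
    move=> x; apply: (@continuous_comp _ _ _ (fun x : 'cV[R]_d => \sum_i th i 0 * (sigma * (x i 0 - mu i 0))) (fun r => r + c)); first exact: cs.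
    by apply: cvgD; [exact: cvg_id|exact: cvg_cst].
  move=> x; apply: (@continuous_comp _ _ _ (fun x : 'cV[R]_d => dotc th (sigma *: (x - mu)) + c) cos); first exact: cl.
  exact: continuous_cos.
apply: (@le_trans _ _ ('Ex_M (fun x => k1 + k2 * dist1 mu x))).
  apply: (@invariant_transfer n _ _ 1) => //.
  - exact: (continuous_borel_measurable cf).
  - by move=> y; rewrite ler_norml cos_geN1 cos_le1.
  move=> eta eS disp Om P X Bm pi Pc XB wf.
  apply: (le_trans (step_cos Pc a_inj XB sigma0 wf mu_inv eS contraction th c SE rho0 nK)).
  by rewrite /k1 /k2 -/al -/be le_eqVlt; apply/orP; left; apply/eqP; ring.
rewrite RintegralD//; [|exact: finite_measure_integrable_cst|exact: (integrableZl measurableT _ i1)].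
rewrite Rintegral_prob_cst RintegralZl//.
apply: (le_trans (lerD (lexx _) (ler_wpM2l k20 E1))).
rewrite /k1 /k2 -/al -/be le_eqVlt; apply/orP; left; apply/eqP; field.
by rewrite gt_eqF.
Qed.

End OneNoiseLevel.

End InvariantLimit.

Section TrigPolyRegular.
Context {R : realType} {d : nat}.

Lemma continuous_lin (T : topologicalType) (f g : T -> R) (x y : R) :
  continuous f -> continuous g -> continuous (fun z => x * f z + y * g z).
Proof.
move=> cf cg z; apply: cvgD; apply: cvgM; (try exact: cvg_cst); [exact: cf|exact: cg].
Qed.

Lemma continuous_dotc (u : 'cV[R]_d) : continuous (dotc u).
Proof.
rewrite (_ : dotc u = fun x => \sum_i u i 0 * x i 0); last by apply/funext => x; exact: dotcE.
apply: (@continuous_bigsum _ _ _ _ (fun i (x : 'cV[R]_d) => u i 0 * x i 0)) => i.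
apply: (@continuous_coord_comp _ _ (fun r => u i 0 * r)) => r.
by apply: cvgM; [exact: cvg_cst|exact: cvg_id].
Qed.

Lemma trigpoly_regular (p : 'cV[R]_d -> R) : trigpoly p ->
  continuous p /\ exists2 B : R, 0 <= B & forall x, `|p x| <= B.
Proof.
elim=> [u c|x f y g _ [cf [Bf Bf0 fB]] _ [cg [Bg Bg0 gB]]].
  split; last by exists 1 => // x; rewrite ler_norml cos_geN1 cos_le1.
  move=> x; apply: (@continuous_comp _ _ _ (dotc u) (fun r => cos (r + c))); first exact: continuous_dotc.
  have := @continuous_cos_affine R 1 c (dotc u x).
  by rewrite (_ : (fun t => cos (1 * t + c)) = fun t => cos (t + c))//; apply/funext => t; rewrite mul1r.
split; first exact: continuous_lin.
exists (`|x| * Bf + `|y| * Bg) => [|z]; first by rewrite addr_ge0 ?mulr_ge0.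
by rewrite (le_trans (ler_normD _ _))// !normrM lerD// ler_wpM2l.
Qed.

Lemma continuous_affine_mx (s : R) (m : 'cV[R]_d) : continuous (fun x : 'cV[R]_d => s *: (x - m)).
Proof.
move=> x; apply: (@continuous_comp _ _ _ (fun x : 'cV[R]_d => x - m) (fun y => s *: y)).
  by apply: (@continuousB R 'cV[R]_d 'cV[R]_d id (cst m) x); [exact: cvg_id|exact: cst_continuous].
exact: scaler_continuous.
Qed.

Definition norm1 (x : 'cV[R]_d) : R := \sum_i `|x i 0|.

Lemma norm1_ge0 x : 0 <= norm1 x. Proof. exact: sumr_ge0. Qed.

(** The exponent and the constant [C] are fixed before [e]: one moment bound then controls the
    approximation error for all [e]. *)
Lemma polynomial_growth_approx (F : 'cV[R]_d -> R) : continuous F -> polynomial_growth F ->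
  exists2 m, (0 < m)%N & exists2 C : R, 0 <= C & forall e : R, 0 < e ->
    exists p, trigpoly p /\ forall x, `|F x - p x| <= e + e * (C * norm1 x ^+ m.*2).
Proof.
move=> cF [C [k FC]].
have C0 : 0 <= C.
  have := FC 0; rewrite normr0 => h; have := le_trans (normr_ge0 _) h.
  by rewrite pmulr_lge0// ltr_pwDl// exprn_ge0.
exists k.+1 => //; exists (4 * C); first by rewrite mulr_ge0.
(* Outside the ball |x| exceeds 1 / e, so raising the power by one gains the factor [e]; K >= 1
   makes powers of |x| dominate the constants. *)
move=> e e0; pose K := 1 + e^-1; have K1 : 1 <= K by rewrite lerDl invr_ge0 ltW.
have K0 : 0 < K by rewrite (lt_le_trans ltr01).
have fB x : `|x| <= K -> `|F x| <= C * (1 + K ^+ k).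
  move=> xK; apply: (le_trans (FC x)); rewrite ler_wpM2l// lerD2l lerXn2r ?nnegrE//.
  exact: ltW.
have [p [tp pB ph]] := trig_approx cF K0 fB e0.
exists p; split=> // x; have N0 := norm1_ge0 x.
have T0 : 0 <= e * (4 * C * norm1 x ^+ k.+1.*2) 
  by apply: mulr_ge0; [exact: ltW|apply: mulr_ge0; [rewrite mulr_ge0|rewrite exprn_ge0]].
have [xK|Kx] := leP `|x| K; first by rewrite (le_trans (ph x xK))// lerDl.
have x1 : 1 <= `|x| by rewrite (le_trans K1)// ltW.
apply: (@le_trans _ _ (4 * C * `|x| ^+ k)).
  have xk : 1 <= `|x| ^+ k by exact: exprn_ege1.
  have Kk : K ^+ k <= `|x| ^+ k by rewrite lerXn2r ?nnegrE ?(ltW K0)// ltW.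
  have h1 := FC x; have h2 := pB x.
  have h3 : C * 1 <= C * `|x| ^+ k by rewrite ler_wpM2l.
  have h4 : C * K ^+ k <= C * `|x| ^+ k by rewrite ler_wpM2l.
  have := ler_normB (F x) (p x); rewrite !mulrDr in h1 h2; lra.
apply: ler_wpDl; first exact: ltW.
rewrite mulrCA ler_wpM2l ?mulr_ge0//.
apply: (@le_trans _ _ (e * `|x| ^+ k.+1)).
  rewrite exprS mulrA ler_peMl ?exprn_ge0// -(mulfV (lt0r_neq0 e0)) ler_pM2l//.
  by rewrite (le_trans _ (ltW Kx))// lerDr.
rewrite ler_wpM2l ?(ltW e0)//; apply: (@le_trans _ _ (`|x| ^+ k.+1.*2)).
  by rewrite ler_weXn2l// -addnn leq_addr.
by rewrite lerXn2r ?nnegrE// mxnorm_le_sum.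
Qed.

Lemma Rintegral_growth dd (Om : measurableType dd) (P : probability Om R)
    (F p : 'cV[R]_d -> R) (V : Om -> 'cV[R]_d) (e C b B : R) m :
  (0 < m)%N -> 0 <= e -> 0 <= C -> 0 <= B ->
  measurable_fun setT (fun w => F (V w)) -> measurable_fun setT (fun w => p (V w)) ->
  (forall x, `|p x| <= B) -> (forall x, `|F x - p x| <= e + e * (C * norm1 x ^+ m.*2)) ->
  Lq_le P m.*2 (fun w => norm1 (V w)) b ->
  P.-integrable setT (EFin \o (fun w => F (V w))) /\
  `|'Ex_P (fun w => F (V w)) - 'Ex_P (fun w => p (V w))| <= e + e * (C * b ^+ m.*2).
Proof.
move=> m0 e0 C0 B0 mF mp pB Fp Vb.
have NE : (fun w => `|norm1 (V w)| ^+ m.*2) = fun w => norm1 (V w) ^+ m.*2.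
  by apply/funext => w; rewrite ger0_norm// norm1_ge0.
have iN := integrable_Lq Vb; have EN := Rintegral_Lq Vb; rewrite NE in iN EN.
have ip : P.-integrable setT (EFin \o (fun w => p (V w))) by exact: (@integrable_bounded _ _ _ P _ B).
have iCN : P.-integrable setT (EFin \o (fun w => C * norm1 (V w) ^+ m.*2)) by exact: (integrableZl measurableT _ iN).
have ieN : P.-integrable setT (EFin \o (fun w => e * (C * norm1 (V w) ^+ m.*2))) by exact: (integrableZl measurableT _ iCN).
have ibd : P.-integrable setT (EFin \o (fun w => e + e * (C * norm1 (V w) ^+ m.*2))).
  apply: (@integrableD _ _ _ P setT measurableT (fun=> e%:E) (fun w => (e * (C * norm1 (V w) ^+ m.*2))%:E)) => //.
  exact: finite_measure_integrable_cst.
have iD : P.-integrable setT (EFin \o (fun w => F (V w) - p (V w))).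
  apply: integrable_dominated ibd; first exact: measurable_funB.
  exact: aeW.
have iF : P.-integrable setT (EFin \o (fun w => F (V w))).
  have := @integrableD _ _ _ P setT measurableT _ _ iD ip.
  congr (P.-integrable _ _); apply/funext => w /=; rewrite -EFinD; congr EFin; exact: subrK.
split=> //; rewrite -RintegralB//.
apply: (le_trans (Rintegral_norm_le iD ibd _)); first exact: aeW.
rewrite RintegralD//; last exact: finite_measure_integrable_cst.
rewrite Rintegral_prob_cst RintegralZl// RintegralZl// lerD2l ler_wpM2l// ler_wpM2l//.
Qed.

End TrigPolyRegular.

Section GaussianVector.
Context dd (Om : measurableType dd) (R : realType) (P : probability Om R) (d : nat).
Variables (G : Om -> 'cV[R]_d) (S : 'M[R]_d).
Hypothesis gaussG : centered_gaussian_vector P G S.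

Lemma gaussian_vector_coord i : exists v, normal_law P (fun w => G w i 0) 0 v.
Proof.
have := gaussG (delta_mx i 0); set v := (X in normal_law _ _ _ X) => N; exists v.
have E w : ((delta_mx i 0 : 'cV[R]_d)^T *m G w) 0 0 = G w i 0.
  rewrite mxE (bigD1 i)//= big1 => [|j ji]; rewrite !mxE !eqxx ?mul1r ?addr0//.
  by rewrite (negPf ji) mul0r.
by rewrite (funext E) in N.
Qed.

Lemma normal_law_Lq (U : Om -> R) v m : (0 < m)%N -> normal_law P U 0 v ->
  exists b, Lq_le P m.*2 U b.
Proof.
move=> m0 UN; have [v0 mU PU] := UN; have [vE|vn0] := eqVneq v 0.
  exists 0; apply: Lq_le_aebounded => //.
  exists (U @^-1` (~` [set 0])); split.
  - by rewrite -[X in measurable X]setTI; apply: mU => //; apply: measurableC.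
  - rewrite PU ?vE ?eqxx; last exact: measurableC.
    by rewrite diracE memNset//= => /(_ erefl).
  - by move=> w /= /negP; rewrite normr_le0 => /eqP.
have vp : 0 < v by rewrite lt_neqAle eq_sym vn0.
have E : (fun w => `|U w| ^+ m.*2) = fun w => U w ^+ m.*2.
  by apply/funext => w; rewrite norm_even_exprn.
have i1 := normal_law_integrable_exp m.*2 vp UN.
pose M := 'Ex_P (fun w => U w ^+ m.*2).
have M0 : 0 <= M by apply: Rintegral_ge0 => w _; rewrite -norm_even_exprn exprn_ge0.
exists (1 + M); apply: Lq_le_Rintegral; rewrite ?E ?addr_ge0//.
rewrite (@le_trans _ _ (1 + M))//; first by rewrite lerDr.
by rewrite -[leLHS]expr1 ler_weXn2l ?lerDl// double_gt0.
Qed.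

Lemma gaussian_vector_Lq m : (0 < m)%N -> exists b, Lq_le P m.*2 (fun w => norm1 (G w)) b.
Proof.
move=> m0; have H i : exists b, Lq_le P m.*2 (fun w => G w i 0) b.
  by have [v] := gaussian_vector_coord i; exact: normal_law_Lq.
have [b Hb] := choice H; exists (\sum_i b i).
apply: (@Lq_le_sum _ _ _ P _ _ _ (fun i w => `|G w i 0|) b); first by rewrite double_gt0.
by move=> i; exact: Lq_le_norm.
Qed.

Lemma gaussian_vector_measurable (f : 'cV[R]_d -> R) : continuous f ->
  measurable_fun setT (fun w => f (G w)).
Proof.
move=> cf; have mG : measurable_fun setT (G : Om -> borel_cV R d).
  by apply: borel_measurable => i; have [v []] := gaussian_vector_coord i.
exact: (measurableT_comp (continuous_borel_measurable cf) mG).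
Qed.

Lemma gaussian_vector_cos th c :
  'Ex_P (fun w => cos (dotc th (G w) + c)) = cos c * expR (- (quad S th / 2)).
Proof.
have := normal_law_cos 1 c (gaussG th); rewrite expr1n mul1r => <-.
by congr Rintegral; apply/funext => w; rewrite mul1r.
Qed.

End GaussianVector.

(** * Convergence of the scaled invariant measures *)

Section InvariantGaussianLimit.
Context {R : realType} {d : nat}.
Variables (a : 'I_d -> R) (L : 'M[R]_d) (h : R -> R) (mu : 'cV[R]_d) (S : 'M[R]_d).
Hypotheses (a_inj : injective a) (L_intensity : intensity_matrix L) (L_ergodic : ergodic L).
Hypothesis mu_inv : invariant_distribution L mu.
Hypothesis S_sol : lyapunov_solution L (hvec a h) mu S.
Variable M : R -> probability (borel_cV R d) R.
Hypothesis M_inv : forall sigma, 0 < sigma -> invariant_measure a L h sigma (M sigma).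
Notation hv := (hvec a h).

Let scaled (sigma : R) (x : borel_cV R d) : 'cV[R]_d := sigma *: ((x : 'cV[R]_d) - mu).

Let SE : 0 = L^T *m S + S *m L + (covar mu *m hv) *m (covar mu *m hv)^T.
Proof. by have [_ _] := S_sol; rewrite lyapunov_rank1. Qed.

Let S0 j : \sum_i S i j = 0.
Proof.
have [SN Ssum _] := S_sol; have [Ss _] := SN.
rewrite -[RHS](nonneg_definite_kernel SN Ssum j).
by apply: eq_bigr => i _; rewrite -{1}Ss mxE.
Qed.

Let contr : exists rho, 0 <= rho < 1 /\ forall n (x : 'cV[R]_d), \sum_i x i 0 = 0 ->
  \sum_i `|(mexp (n%:R *: L^T) *m x) i 0| <= rho ^+ n * \sum_i `|x i 0|.
Proof. exact: (ergodic_contraction L_intensity L_ergodic (invariant_dim_gt0 mu_inv)). Qed.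

Lemma cvg_inv_pinfty (c : R) : sigma^-1 * c @[sigma --> +oo] --> (0 : R).
Proof.
rewrite -[X in _ --> X](mul0r c); apply: cvgM; last exact: cvg_cst.
by apply/gtr0_cvgV0; [exact: nbhs_pinfty_gt|exact: cvg_id].
Qed.

Lemma invariant_cos_cvg (th : 'cV[R]_d) (c : R) :
  'Ex_(M sigma) (fun x => cos (dotc th (scaled sigma x) + c)) @[sigma --> +oo] -->
  cos c * expR (- (quad S th / 2)).
Proof.
have [rho [/andP[r0 r1] Hc]] := contr.
have [K1 nK1] := exists_resolvent_bound L^T 1%:R.
pose C := d%:R * deviation_cst a L h 1 1%:R K1 / (1 - rho).
pose q n := cos c * expR (- ((quad S th - quad S (flow L th n%:R)) / 2)).
have cv1 : (\sum_i `|th i 0|) * (rho ^+ n * C) @[n --> \oo] --> (0 : R).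
  rewrite -[X in _ --> X](mulr0 (\sum_i `|th i 0|)) -[X in _ * X](mul0r C).
  apply: cvgM; first exact: cvg_cst.
  by apply: cvgM; [apply: cvg_expr; rewrite ger0_norm|exact: cvg_cst].
have cv2 : q n @[n --> \oo] --> cos c * expR (- (quad S th / 2)).
  have [rho' [/andP[r0' r1'] Hq]] := quad_flow_decay L_intensity L_ergodic mu_inv.
  have [K' K'0 HK'] := Hq S S0 th.
  have cq : quad S (flow L th n%:R) @[n --> \oo] --> (0 : R).
    apply: (@squeeze_cvgr _ _ _ _ (fun n => - (rho' ^+ n * K')) (fun n => rho' ^+ n * K')).
    - by apply: nearW => n; have := HK' n; rewrite ler_norml.
    - rewrite -[X in _ --> X]oppr0 -(mul0r K'); apply: cvgN.
      by apply: cvgM; [apply: cvg_expr; rewrite ger0_norm|exact: cvg_cst].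
    - rewrite -(mul0r K').
      by apply: cvgM; [apply: cvg_expr; rewrite ger0_norm|exact: cvg_cst].
  apply: cvgM; first exact: cvg_cst.
  have ce : - ((quad S th - quad S (flow L th n%:R)) / 2) @[n --> \oo] --> - ((quad S th - 0) / 2).
    by apply: cvgN; apply: cvgM; [apply: cvgB; [exact: cvg_cst|exact: cq]|exact: cvg_cst].
  rewrite subr0 in ce.
  by apply: (cvg_comp _ _ ce); exact: continuous_expR.
apply/cvgrPdist_le => e e0.
have e3 : 0 < e / 3 by rewrite divr_gt0.
have [n [n1 n2]] : exists n, `|(\sum_i `|th i 0|) * (rho ^+ n * C)| <= e / 3 /\
    `|cos c * expR (- (quad S th / 2)) - q n| <= e / 3.
  have /cvgrPdist_le/(_ _ e3) h1 := cv1; have /cvgrPdist_le/(_ _ e3) h2 := cv2.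
  have [N _ HN] := filterI h1 h2; exists N; have [a1 a2] := HN N (leqnn N).
  by split=> //; move: a1; rewrite sub0r normrN.
(* The constants grow with [n], so [n] is chosen first and [sigma] afterwards. *)
have [K nK] := exists_resolvent_bound L^T n%:R.
have /cvgrPdist_le/(_ _ e3) h3 := cvg_inv_pinfty (step_cst a L h th n K * (deviation_cst a L h 1 n%:R K + K * C)).
near=> sigma.
have s0 : 0 < sigma by near: sigma; exact: nbhs_pinfty_gt.
have := invariant_cos a_inj mu_inv s0 (M_inv s0) r0 r1 Hc SE th c nK nK1 (erefl C).
have : `|0 - sigma^-1 * (step_cst a L h th n K * (deviation_cst a L h 1 n%:R K + K * C))| <= e / 3.
  by near: sigma; exact: h3.
rewrite sub0r normrN => h4; rewrite -/(q n) => h5.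
set E := 'Ex_(M sigma) _ in h5 *; set l := cos c * _ in n2 *.
have := ler_norm (sigma^-1 * (step_cst a L h th n K * (deviation_cst a L h 1 n%:R K + K * C))).
have := ler_norm ((\sum_i `|th i 0|) * (rho ^+ n * C)).
have := ler_distD (q n) l E; rewrite [`|q n - E|]distrC; move: h4 h5 n1 n2; lra.
Unshelve. all: by end_near. Qed.

Lemma measurable_scaled (f : 'cV[R]_d -> R) sigma : continuous f ->
  measurable_fun setT (fun x => f (scaled sigma x)).
Proof.
move=> cf; apply: (@continuous_borel_measurable _ _ (fun x => f (scaled sigma x))).
have cs : continuous (fun x : 'cV[R]_d => f (sigma *: (x - mu))).
  move=> x; apply: (@continuous_comp _ _ _ (fun x : 'cV[R]_d => sigma *: (x - mu)) f x); last exact: cf.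
  exact: continuous_affine_mx.
exact: cs.
Qed.

Context dd (Om : measurableType dd) (P : probability Om R) (G : Om -> 'cV[R]_d).
Hypothesis gaussG : centered_gaussian_vector P G S.

Lemma invariant_trigpoly_cvg p : trigpoly p ->
  'Ex_(M sigma) (fun x => p (scaled sigma x)) @[sigma --> +oo] --> 'Ex_P (fun w => p (G w)).
Proof.
elim=> [u c|x f y g tf IHf tg IHg].
  by rewrite (gaussian_vector_cos gaussG); exact: invariant_cos_cvg.
have [cf [Bf Bf0 fB]] := trigpoly_regular tf; have [cg [Bg Bg0 gB]] := trigpoly_regular tg.
have lin d' (O' : measurableType d') (P' : probability O' R) (V : O' -> 'cV[R]_d) :
    measurable_fun setT (fun w => f (V w)) -> measurable_fun setT (fun w => g (V w)) ->
    'Ex_P' (fun w => x * f (V w) + y * g (V w)) =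
    x * 'Ex_P' (fun w => f (V w)) + y * 'Ex_P' (fun w => g (V w)).
  move=> mf mg.
  have i1 : P'.-integrable setT (EFin \o (fun w => f (V w))) by exact: (@integrable_bounded _ _ _ P' _ Bf).
  have i2 : P'.-integrable setT (EFin \o (fun w => g (V w))) by exact: (@integrable_bounded _ _ _ P' _ Bg).
  rewrite RintegralD//; [|exact: (integrableZl measurableT _ i1)|exact: (integrableZl measurableT _ i2)].
  by rewrite !RintegralZl.
rewrite (lin _ _ P G (gaussian_vector_measurable gaussG cf) (gaussian_vector_measurable gaussG cg)).
have E sigma : 'Ex_(M sigma) (fun z => x * f (scaled sigma z) + y * g (scaled sigma z)) =
    x * 'Ex_(M sigma) (fun z => f (scaled sigma z)) + y * 'Ex_(M sigma) (fun z => g (scaled sigma z)).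
  by apply: (lin _ _ (M sigma) (scaled sigma)); exact: measurable_scaled.
rewrite (_ : (fun sigma => _) = fun sigma => x * 'Ex_(M sigma) (fun z => f (scaled sigma z)) +
    y * 'Ex_(M sigma) (fun z => g (scaled sigma z))); last exact/funext.
by apply: cvgD; apply: cvgM => //; exact: cvg_cst.
Qed.

Lemma invariant_gaussian_cvg (F : 'cV[R]_d -> R) : continuous F -> polynomial_growth F ->
  (\int[M sigma]_(eta in simplex) (F (scaled sigma eta))%:E)%E @[sigma --> +oo] -->
  'E_P[F \o G]%E.
Proof.
move=> cF gF; have [m m0 [C C0 HC]] := polynomial_growth_approx cF gF.
have [rho [/andP[r0 r1] Hc]] := contr.
have [K1 nK1] := exists_resolvent_bound L^T 1%:R.
pose b1 := d%:R * deviation_cst a L h m 1%:R K1 / (1 - rho).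
have Mb sigma : 0 < sigma -> Lq_le (M sigma) m.*2 (fun x => norm1 (scaled sigma x)) b1.
  move=> s0; have := invariant_moment a_inj mu_inv s0 (M_inv s0) r0 r1 Hc m0 nK1.
  move=> /(Lq_leZ sigma); rewrite (gtr0_norm s0) mulVKf ?gt_eqF//.
  rewrite (_ : (fun w => sigma * dist1 mu w) = fun x => norm1 (scaled sigma x))//.
  apply/funext => x; rewrite /dist1 /norm1 mulr_sumr; apply: eq_bigr => i _.
  by rewrite !mxE normrM (gtr0_norm s0).
have [b2 Gb] := gaussian_vector_Lq gaussG m0.
have H sigma e p B : 0 < sigma -> 0 < e -> trigpoly p -> 0 <= B -> (forall x, `|p x| <= B) ->
    (forall x, `|F x - p x| <= e + e * (C * norm1 x ^+ m.*2)) ->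
    (M sigma).-integrable setT (EFin \o (fun w => F (scaled sigma w))) /\
    `|'Ex_(M sigma) (fun w => F (scaled sigma w)) - 'Ex_(M sigma) (fun w => p (scaled sigma w))| <= e + e * (C * b1 ^+ m.*2).
  move=> s0 e0 tp B0 pB Fp; have [cp _] := trigpoly_regular tp.
  exact: (@Rintegral_growth R d _ _ (M sigma) F p (scaled sigma) e C b1 B m m0 (ltW e0) C0 B0
    (measurable_scaled sigma cF) (measurable_scaled sigma cp) pB Fp (Mb sigma s0)).
have HG e p B : 0 < e -> trigpoly p -> 0 <= B -> (forall x, `|p x| <= B) ->
    (forall x, `|F x - p x| <= e + e * (C * norm1 x ^+ m.*2)) ->
    P.-integrable setT (EFin \o (fun w => F (G w))) /\
    `|'Ex_P (fun w => F (G w)) - 'Ex_P (fun w => p (G w))| <= e + e * (C * b2 ^+ m.*2).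
  move=> e0 tp B0 pB Fp; have [cp _] := trigpoly_regular tp.
  exact: (@Rintegral_growth R d _ _ P F p G e C b2 B m m0 (ltW e0) C0 B0
    (gaussian_vector_measurable gaussG cF) (gaussian_vector_measurable gaussG cp) pB Fp Gb).
have [p1 [tp1 Fp1]] := HC 1 ltr01; have [_ [B1 B10 p1B]] := trigpoly_regular tp1.
have [iFG _] := HG 1 p1 B1 ltr01 tp1 B10 p1B Fp1.
have cvR : 'Ex_(M sigma) (fun x => F (scaled sigma x)) @[sigma --> +oo] --> 'Ex_P (fun w => F (G w)).
  apply/cvgrPdist_le => e e0.
  have [_ b10 _] := Mb 1 ltr01; have [_ b20 _] := Gb.
  (* Replacing [F] by [p] under both laws costs [e' * k = e / 2]; the convergence for [p] takes the
     other half. *)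
  pose k := 2 + C * b1 ^+ m.*2 + C * b2 ^+ m.*2.
  have k1 : 0 <= C * b1 ^+ m.*2 by rewrite mulr_ge0 ?exprn_ge0.
  have k2 : 0 <= C * b2 ^+ m.*2 by rewrite mulr_ge0 ?exprn_ge0.
  have k0 : 0 < k by rewrite /k; lra.
  pose e' := e / (2 * k); have e'0 : 0 < e' by rewrite divr_gt0// mulr_gt0.
  have e'k : e' * k = e / 2 by rewrite /e'; field; rewrite gt_eqF.
  have [p [tp Fp]] := HC e' e'0; have [_ [B B0 pB]] := trigpoly_regular tp.
  have [_ hG] := HG e' p B e'0 tp B0 pB Fp.
  have e2 : 0 < e / 2 by rewrite divr_gt0.
  have /cvgrPdist_le/(_ _ e2) hp := invariant_trigpoly_cvg tp.
  near=> sigma; have s0 : 0 < sigma by near: sigma; exact: nbhs_pinfty_gt.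
  have [_ hM] := H sigma e' p B s0 e'0 tp B0 pB Fp.
  have hps : `|'Ex_P (fun w => p (G w)) - 'Ex_(M sigma) (fun x => p (scaled sigma x))| <= e / 2.
    by near: sigma; exact: hp.
  move: hG hM hps.
  set x1 := 'Ex_P (fun w => F (G w)); set x2 := 'Ex_P (fun w => p (G w)).
  set y1 := 'Ex_(M sigma) (fun x => F (scaled sigma x)); set y2 := 'Ex_(M sigma) (fun x => p (scaled sigma x)).
  move=> hG hM hps.
  have := ler_distD x2 x1 y1; have := ler_distD y2 x2 y1; rewrite [`|y2 - y1|]distrC.
  by move: e'k; rewrite /k !mulrDr; lra.
rewrite unlock /= Rintegral_probE//.
(* The simplex has full measure, so the integral over it is the full expectation. *)
apply: (@cvg_trans _ (('Ex_(M sigma) (fun x => F (scaled sigma x)))%:E @[sigma --> +oo])).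
  apply: near_eq_cvg; near=> sigma; have s0 : 0 < sigma by near: sigma; exact: nbhs_pinfty_gt.
  have [iF _] := H sigma 1 p1 B1 s0 ltr01 tp1 B10 p1B Fp1.
  have mF := measurable_scaled sigma cF.
  rewrite -Rintegral_probE// [RHS]integral_mkcond; apply: ae_eq_integral => //.
  - exact/measurable_EFinP.
  - apply/(measurable_restrictT _ measurable_simplex); apply: measurable_funTS.
    exact/measurable_EFinP.
  apply: (ae_simplexW (M_inv s0)) => x xS _.
  by rewrite patchE mem_set.
apply/fine_cvgP; split; first exact: nearW.
exact: cvR.
Unshelve. all: by end_near. Qed.

End InvariantGaussianLimit.

Lemma col_scaleE (R : realType) d (c : R) (x : 'cV[R]_d) i : (c *: x) i 0 = c * x i 0.
Proof. by rewrite mxE. Qed.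

Lemma col_subE (R : realType) d (x y : 'cV[R]_d) i : (x - y) i 0 = x i 0 - y i 0.
Proof. by rewrite !mxE. Qed.

Section FilterLimits.
Context dd (Om : measurableType dd) (R : realType) (P : probability Om R).
Context {d : nat} {a : 'I_d -> R} {L : 'M[R]_d} {nu : 'cV[R]_d} {h : R -> R} {X B : R -> Om -> R}.
Hypotheses (P_complete : measure_is_complete P) (a_inj : injective a).
Hypothesis XB : signal_and_noise P a L nu X B.
Variable pi : R -> R -> Om -> 'cV[R]_d.
Hypothesis pi_filter : forall sigma, 0 < sigma -> wonham_filter P a L nu h sigma X B (pi sigma).

Lemma Lnorm_filter_cvg0 (p t : R) : 1 <= p -> 0 <= t ->
  Lnorm P p%:E (fun w => (`|pi sigma t w - marginal L nu t|)%:E) @[sigma --> +oo] --> 0%E.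
Proof.
move=> p1 t0; apply: (Lnorm_cvg0 p1) => m m0.
have [K HK] := exists_resolvent_bound L^T t; have [K0 _] := HK.
exists (deviation_cst a L h m t K); first exact: deviation_cst_ge0.
move=> sigma s0 i.
have -> : (fun w => (pi sigma t w - marginal L nu t) i 0) =
    fun w => pi sigma t w i 0 - marginal L nu t i 0.
  by apply/funext => w; exact: col_subE.
by apply: (Lq_le_filter P_complete a_inj XB s0 (pi_filter s0)) => //; rewrite t0 lexx.
Qed.

Lemma Lnorm_filter_sde_cvg0 (Z : R -> R -> Om -> 'cV[R]_d) (p t : R) :
  (forall sigma, 0 < sigma -> sde P 0 (fun t w => L^T *m Z sigma t w)
     (fun t _ => covar (marginal L nu t) *m hvec a h)
     (innovation (hvec a h) sigma (observation h sigma X B) (pi sigma)) (Z sigma)) ->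
  1 <= p -> 0 <= t ->
  Lnorm P p%:E (fun w => (`|sigma *: (pi sigma t w - marginal L nu t) - Z sigma t w|)%:E)
    @[sigma --> +oo] --> 0%E.
Proof.
move=> Z_sde p1 t0; apply: (Lnorm_cvg0 p1) => m m0.
have [K HK] := exists_resolvent_bound L^T t.
(* The marginal flow is bounded on [0, t] by continuity, which supplies the [Y0] of the
   comparison. *)
have Yb j : exists b, 0 <= b /\ forall s, 0 <= s <= t -> `|marginal L nu s j 0| <= b.
  have [b b0 Hb] := @continuous_itv_bounded R (fun s => marginal L nu s j 0) 0 t (@continuous_marginal R d L nu j).
  by exists b.
have [b Hb] := choice Yb; pose Y0 := \sum_j b j.
have Y00 : 0 <= Y0 by apply: sumr_ge0 => j _; have [] := Hb j.
have HY s j : 0 <= s <= t -> `|marginal L nu s j 0| <= Y0.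
  have [_ Hj] := Hb j; move=> /Hj /le_trans; apply; rewrite /Y0 (bigD1 j)//= lerDl.
  by apply: sumr_ge0 => k _; have [] := Hb k.
pose c := expR (bdg_cst m t * t) * ((2 + Y0) * hmax a h * (d%:R * deviation_cst a L h m t K)).
exists (\sum_i `|resolve_cst L^T t K i * c|); first exact: sumr_ge0.
move=> sigma s0 i.
have -> : (fun w => (sigma *: (pi sigma t w - marginal L nu t) - Z sigma t w) i 0) =
    fun w => sigma * (pi sigma t w i 0 - marginal L nu t i 0) - Z sigma t w i 0.
  by apply/funext => w; rewrite col_subE -(col_subE (pi sigma t w)) col_scaleE.
apply: (Lq_leW (Lq_le_filter_sde P_complete a_inj XB s0 (pi_filter s0) (Z_sde _ s0) i m0 t0 HK Y00 HY)).
have reorder (r e y H n s D : R) : r * (e * (y * H * (n * (s * D)))) = s * (r * (e * (y * H * (n * D)))).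
  by ring.
rewrite reorder -/c.
rewrite ler_wpM2l ?invr_ge0 ?(ltW s0)// (bigD1 i)//= (le_trans (ler_norm _))// lerDl.
exact: sumr_ge0.
Qed.

End FilterLimits.

Theorem theorem2p6 (R : realType) (d : nat)
    (disp : measure_display) (Om : measurableType disp) (P : probability Om R)
    (P_complete : measure_is_complete P)
    (a : 'I_d -> R) (a_inj : injective a)
    (L : 'M[R]_d) (L_intensity : intensity_matrix L)
    (nu : 'cV[R]_d) (nu_distr : simplex nu)
    (h : R -> R)
    (X B : R -> Om -> R) (XB : signal_and_noise P a L nu X B)
    (pi : R -> R -> Om -> 'cV[R]_d)
    (pi_filter : forall sigma : R, 0 < sigma ->
       wonham_filter P a L nu h sigma X B (pi sigma))
    (Bbar : R -> R -> Om -> R)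
    (Bbar_def : forall sigma : R, Bbar sigma =
       innovation (hvec a h) sigma (observation h sigma X B) (pi sigma))
    (Z : R -> R -> Om -> 'cV[R]_d)
    (Z_sde : forall sigma : R, 0 < sigma ->
       sde P 0 (fun t w => L^T *m Z sigma t w)
         (fun t _ => covar (marginal L nu t) *m hvec a h)
         (Bbar sigma) (Z sigma)) :
  [/\ forall sigma : R, 0 < sigma ->
        brownian_motion P (Bbar sigma) /\ gaussian_process P (Z sigma),
      forall p t : R, 1 <= p -> 0 <= t ->
        Lnorm P p%:E
          (fun w => (`| pi sigma t w - marginal L nu t |)%:E)
          @[sigma --> +oo] --> 0%E,
      forall p t : R, 1 <= p -> 0 <= t ->
        Lnorm P p%:E
          (fun w => (`| sigma *: (pi sigma t w - marginal L nu t)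
                        - Z sigma t w |)%:E)
          @[sigma --> +oo] --> 0%E &
      forall mu : 'cV[R]_d, ergodic L -> invariant_distribution L mu ->
        (exists! S : 'M[R]_d, lyapunov_solution L (hvec a h) mu S) /\
        forall (S : 'M[R]_d) (M : R -> probability (borel_cV R d) R)
          (F : 'cV[R]_d -> R) (G : Om -> 'cV[R]_d),
          lyapunov_solution L (hvec a h) mu S ->
          (forall sigma : R, 0 < sigma ->
             unique_invariant_measure a L h sigma (M sigma)) ->
          continuous F -> polynomial_growth F ->
          centered_gaussian_vector P G S ->
          (\int[M sigma]_(eta in simplex)
             (F (sigma *: ((eta : 'cV[R]_d) - mu)))%:E)%E
          @[sigma --> +oo] --> 'E_P[F \o G]%E].
Proof.
split.
- move=> sigma s0; split.
    by rewrite Bbar_def; exact: (innovation_brownian_motion P_complete a_inj XB s0 (pi_filter _ s0)).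
  have := Z_sde _ s0; rewrite Bbar_def => sdeZ.
  exact: (linear_sde_gaussian P_complete a_inj XB s0 (pi_filter _ s0) sdeZ).
- by move=> p t; exact: (Lnorm_filter_cvg0 P_complete a_inj XB pi_filter).
- move=> p t; apply: (Lnorm_filter_sde_cvg0 P_complete a_inj XB pi_filter) => sigma s0.
  by have := Z_sde _ s0; rewrite Bbar_def.
- move=> mu L_ergodic mu_inv; split; first exact: lyapunov_exists_unique.
  move=> S M F G S_sol M_uniq cF gF gaussG.
  apply: (invariant_gaussian_cvg a_inj L_intensity L_ergodic mu_inv S_sol _ gaussG cF gF).
  by move=> sigma s0; have [] := M_uniq _ s0.
Qed.
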